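(* Let $f:\mathbb{R}^2\to\mathbb{R}$, $F$, $\mu$ and $M$ be as described in the context, and let $T>0$. Assume that the spectral measure $\mu$ of $f$ satisfies $$\int_{\mathbb{R}^2}\frac{1}{1+|\xi|^{2/3}}\,d\mu(\xi)<+\infty.$$ Then the stochastic partial differential equation $$\begin{cases}\left(\partial_t^2-2\partial_t\partial_{x_1}-x_1^2\partial_{x_2}^2\right)u(t,x_1,x_2)=\dot F(t,x_1,x_2), & t>0,\ (x_1,x_2)\in\mathbb{R}^2,\\ u(0,x_1,x_2)=0, & (x_1,x_2)\in\mathbb{R}^2,\\ \partial_t u(0,x_1,x_2)=0, & (x_1,x_2)\in\mathbb{R}^2,\end{cases}$$ admits a random field solution $\{u(t,x)\}_{t\in[0,T],\,x\in\mathbb{R}^2}$ (in the sense defined in the context) with representation $$u(t,x_1,x_2)=\int_0^t\int_{\mathbb{R}^2}\Gamma(t-s,x_1,y_1,x_2-y_2)\,M(ds,dy_1,dy_2),$$ where $$\Gamma(t,x_1,y_1,x_2)=\frac{\sqrt3}{2\pi}\,\frac{1}{\sqrt{(y_1^3-x_1^3)(2t+x_1-y_1)-3x_2^2}}$$ if $t>0$, $y_1>x_1$ and $(y_1^3-x_1^3)(2t+x_1-y_1)-3x_2^2>0$, and $\Gamma(t,x_1,y_1,x_2)=0$ otherwise.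
   Context: **Noise.** The function $f:\mathbb{R}^2\to\mathbb{R}$ is continuous on $\mathbb{R}^2\setminus\{0\}$ and satisfies $f(-x)=f(x)$ for all $x$. On a complete probability space $(\Omega,\mathcal{A},\mathbb{P})$ there is given a Gaussian family $\{F(\varphi)\}_{\varphi\in C_0^\infty(\mathbb{R}^3)}$ with mean zero and covariance $$\mathbb{E}[F(\varphi)F(\psi)]=\int_0^{+\infty}\int_{\mathbb{R}^2}\int_{\mathbb{R}^2}\varphi(t,x)f(x-y)\psi(t,y)\,dy\,dx\,dt,\qquad \varphi,\psi\in C_0^\infty(\mathbb{R}^3).$$ Formally $F(\varphi)=\int_{\mathbb{R}^3}\varphi(t,x_1,x_2)\dot F(t,x_1,x_2)\,dt\,dx_1\,dx_2$. **Spectral measure.** With $\mathcal{F}\eta(\xi):=\int_{\mathbb{R}^2}e^{-i\xi\cdot x}\eta(x)\,dx$, the spectral measure of $f$ is a non-negative tempered measure $\mu$ on $\mathbb{R}^2$ such that $\int_{\mathbb{R}^2}f(x)\eta(x)\,dx=\int_{\mathbb{R}^2}\mathcal{F}\eta(\xi)\,d\mu(\xi)$ for all Schwartz functions $\eta$ on $\mathbb{R}^2$. Consequently $$\mathbb{E}[F(\varphi)F(\psi)]=\int_0^{+\infty}\int_{\mathbb{R}^2}\mathcal{F}\varphi(t,\xi)\overline{\mathcal{F}\psi(t,\xi)}\,d\mu(\xi)\,dt,$$ where $\mathcal{F}$ acts on the space variables. **Martingale measure.** By $\mathbb{L}^2(\Omega)$-continuity, $F$ is extended (approximating by test functions) to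 indicator functions of bounded Borel subsets $A$ of $[0,+\infty[\times\mathbb{R}^2$, $F(A):=F(\mathbf{1}_A)$, and one sets $M_t(B):=F([0,t]\times B)$ for $t\ge0$ and $B$ a bounded Borel subset of $\mathbb{R}^2$. With respect to the filtration generated by $M$ and augmented with the $\mathbb{P}$-null sets, $M$ is a worthy martingale measure (in the sense of Walsh) and $F(\varphi)=\int_0^{+\infty}\int_{\mathbb{R}^2}\varphi(t,x)M(dt,dx)$. The stochastic integral of deterministic integrands satisfies the isometry $$\mathbb{E}\left[\left|\int_0^{+\infty}\int_{\mathbb{R}^2}\varphi(t,x)M(dt,dx)\right|^2\right]=\int_0^{+\infty}\int_{\mathbb{R}^2}|\mathcal{F}\varphi(t,\xi)|^2\,d\mu(\xi)\,dt,$$ which determines the class of admissible deterministic integrands: the stochastic integral is called well defined if the right-hand side is finite. **Random field solution.** Let $\Gamma(t,x_1,y_1,x_2)$ denote the fundamental solution of $\partial_t^2-2\partial_t\partial_{x_1}-x_1^2\partial_{x_2}^2$, i.e. for each fixed parameter $y_1\in\mathbb{R}$ it solves, in the sense of distributions in $(t,x_1,x_2)$ and with $\Gamma=0$ for $t\le 0$, $(\partial_t^2-2\partial_t\partial_{x_1}-x_1^2\partial_{x_2}^2)\Gamma(t,x_1,y_1,x_2)=\delta_{(0,y_1,0)}(t,x_1,x_2)$, the Dirac delta at $(0,y_1,0)$. The family $$u(t,x_1,x_2):=\int_0^t\int_{\mathbb{R}^2}\Gamma(t-s,x_1,y_1,x_2-y_2)\,M(ds,dy_1,dy_2)$$ is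 called a random field solution of the Cauchy problem if, for all $(t,x_1,x_2)$, this is a well defined stochastic integral, that is, $$\int_0^t\int_{\mathbb{R}^2}\left|\mathcal{F}\Gamma(t-s,x_1,\cdot,x_2-\cdot)(\xi)\right|^2d\mu(\xi)\,ds<+\infty$$ (Fourier transform of $(y_1,y_2)\mapsto\Gamma(t-s,x_1,y_1,x_2-y_2)$), and the map $(t,x_1,x_2)\mapsto u(t,x_1,x_2)$ is measurable, so that $u$ is a real-valued measurable stochastic process (each $u(t,x_1,x_2)$ being defined up to $\mathbb{P}$-null sets, measurability is understood for a suitable version). *)

(* Defs.v *)
From HB Require Import structures.
From mathcomp Require Import all_boot all_order all_algebra.
From mathcomp Require Import all_classical all_reals all_analysis.
From mathcomp Require Import complex.

Set Implicit Arguments.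
Unset Strict Implicit.
Unset Printing Implicit Defensive.

Import Order.TTheory GRing.Theory Num.Theory.
Import numFieldNormedType.Exports.

Local Open Scope classical_set_scope.
Local Open Scope complex_scope.
Local Open Scope ring_scope.

(* [measurableTypeR R] is convertible to [R] and is the measurable type on
   which [lebesgue_measure] lives.  Points of R^3 are written (t, (x1, x2)). *)
Notation plane R := (measurableTypeR R * measurableTypeR R)%type.
Notation spacetime R := (measurableTypeR R * plane R)%type.

Definition leb2 (R : realType) : set (plane R) -> \bar R :=
  (@lebesgue_measure R \x @lebesgue_measure R)%E.

Arguments leb2 : clear implicits.

HB.instance Definition _ (R : realType) := Measure.on (leb2 R).

(* The library's canonical sigma-finite structure on a product measure only
   applies to products of subprobabilities. *)
Fact leb2_sigma_finite (R : realType) : sigma_finite setT (leb2 R).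
Proof.
have /sigma_finiteP[F [TF ndF Foo]] := sigma_finiteT (@lebesgue_measure R).
exists (fun n => F n `*` F n).
  rewrite -setXTT TF predeqE => -[x y]; split.
    move=> [/= [n _ Fnx] [k _ Fky]]; exists (maxn n k) => //; split.
    - by move: x Fnx; exact/subsetPset/ndF/leq_maxl.
    - by move: y Fky; exact/subsetPset/ndF/leq_maxr.
  by move=> [n _ []/= ? ?]; split; exists n.
move=> k; have [mF Fkoo] := Foo k; split; first exact: measurableX.
by rewrite /leb2 product_measure1E// lte_mul_pinfty// ge0_fin_numE.
Qed.

HB.instance Definition _ (R : realType) :=
  Measure_isSigmaFinite.Build _ _ _ (leb2 R) (leb2_sigma_finite R).

Definition leb3 (R : realType) : set (spacetime R) -> \bar R :=
  (@lebesgue_measure R \x leb2 R)%E.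

Arguments leb3 : clear implicits.

HB.instance Definition _ (R : realType) := Measure.on (leb3 R).

Definition enorm (R : realType) (x : plane R) : R :=
  Num.sqrt (x.1 ^+ 2 + x.2 ^+ 2).

Section SmoothFunctions.
Context {R : realType} {V : normedModType R}.

Definition iter_derive (vs : seq V) (f : V -> R) : V -> R :=
  foldr (fun v g => 'D_v g) f vs.

Definition smooth (f : V -> R) : Prop :=
  forall vs : seq V, continuous (iter_derive vs f) /\
    forall v x : V, derivable (iter_derive vs f) x v.

Definition test_function (f : V -> R) : Prop :=
  smooth f /\ compact (closure [set x | f x != 0]).

Definition schwartz (f : V -> R) : Prop :=
  smooth f /\ forall (vs : seq V) (k : nat), exists C : R,
    forall x : V, (1 + `|x|) ^+ k * `|iter_derive vs f x| <= C.

Definition cschwartz (f : V -> R[i]) : Prop :=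
  schwartz (fun x => complex.Re (f x)) /\ schwartz (fun x => complex.Im (f x)).

End SmoothFunctions.

Section ComplexIntegral.
Context {d : measure_display} {T : measurableType d} {R : realType}.
Variable m : {measure set T -> \bar R}.

Definition cintegrable (g : T -> R[i]) : Prop :=
  m.-integrable setT (EFin \o (fun x => complex.Re (g x))) /\
  m.-integrable setT (EFin \o (fun x => complex.Im (g x))).

Definition cintegral (g : T -> R[i]) : R[i] :=
  (\int[m]_x complex.Re (g x)) +i* (\int[m]_x complex.Im (g x)).

End ComplexIntegral.

Definition cis (R : realType) (a : R) : R[i] := cos a +i* sin a.

Definition fourier (R : realType) (g : plane R -> R[i]) (xi : plane R) : R[i] :=
  cintegral (leb2 R) (fun x => cis (- (xi.1 * x.1 + xi.2 * x.2)) * g x).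

Definition tempered_measure (R : realType)
    (mu : {measure set (plane R) -> \bar R}) : Prop :=
  exists k : nat, (\int[mu]_xi ((1 + enorm xi ^+ 2) ^- k)%:E < +oo)%E.

Definition spectral_measure (R : realType) (f : plane R -> R)
    (mu : {measure set (plane R) -> \bar R}) : Prop :=
  tempered_measure mu /\
  forall eta : plane R -> R[i], cschwartz eta ->
    cintegrable (leb2 R) (fun x => (f x)%:C * eta x) /\
    cintegral (leb2 R) (fun x => (f x)%:C * eta x) = cintegral mu (fourier eta).

(* \int_D \int |F g(s, .)(xi)|^2 mu(dxi) ds, with F acting on the space
   variables only *)
Definition noise_norm2 (R : realType) (mu : {measure set (plane R) -> \bar R})
    (D : set R) (g : spacetime R -> R) : \bar R :=
  (\int[lebesgue_measure]_(s in D) \int[mu]_xi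
     ((ComplexField.Normc.normc (fourier (fun y => (g (s, y))%:C) xi)) ^+ 2)%:E)%E.

Section Noise.
Context {d : measure_display} {Omega : measurableType d} {R : realType}.
Variable P : probability Omega R.

(* The Dirac case is separate because the library's [normal_prob m 0] is not a
   point mass. *)
Definition gaussian (X : Omega -> R) : Prop :=
  exists m s : R, forall A : set (measurableTypeR R), measurable A ->
    P (X @^-1` A) = if s == 0 then \d_m A else normal_prob m s A.

Definition gaussian_family {I : Type} (dom : set I) (F : I -> {RV P >-> R}) :=
  forall (n : nat) (phi : 'I_n -> I) (a : 'I_n -> R), (forall i, dom (phi i)) ->
    gaussian (fun w => \sum_(i < n) a i * F (phi i) w).

Definition noise (f : plane R -> R)
    (F : (spacetime R -> R) -> {RV P >-> R}) : Prop :=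
  [/\ gaussian_family [set phi : spacetime R -> R | test_function phi] F,
      forall phi : spacetime R -> R, test_function phi ->
        ('E_P[F phi])%E = 0%E
    & forall phi psi : spacetime R -> R, test_function phi -> test_function psi ->
      ('E_P[fun w => (F phi w * F psi w)%R])%E =
      (\int[lebesgue_measure]_(t in `[0, +oo[) \int[leb2 R]_x \int[leb2 R]_y
         (phi (t, x) * f (x - y) * psi (t, y)))%:E].

(* FA A plays the role of F(1_A); the values of FA on other sets are
   irrelevant.  By the covariance formula, E[F(phi)^2] is
   [noise_norm2 mu `[0, +oo[ phi] for test functions, so FA A is determined
   up to null sets. *)
Definition indicator_extension (mu : {measure set (plane R) -> \bar R})
    (F : (spacetime R -> R) -> {RV P >-> R})
    (FA : set (spacetime R) -> {RV P >-> R}) : Prop :=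
  forall A : set (spacetime R), measurable A -> bounded_set A ->
    A `<=` `[0, +oo[ `*` setT ->
    exists phi : nat -> spacetime R -> R,
      [/\ forall n, test_function (phi n),
          noise_norm2 mu `[0, +oo[ (fun p => phi n p - \1_A p)
            @[n --> \oo] --> 0%E
        & ('E_P[fun w => ((F (phi n) w - FA A w) ^+ 2)%R])%E @[n --> \oo] --> 0%E].

Definition martingale_measure (FA : set (spacetime R) -> {RV P >-> R})
    (t : R) (B : set (plane R)) : {RV P >-> R} :=
  FA (`[0, t] `*` B).

End Noise.

(* The elementary integrand c 1_{]a, b]}(s) 1_B(y) on the time interval [0, t] *)
Record step (R : realType) (t : R) := Step {
  coef : R;
  lo : R;
  hi : R;
  base : set (plane R);
  step_lo : 0 <= lo;
  step_lohi : lo <= hi;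
  step_hi : hi <= t;
  step_measurable : measurable base;
  step_bounded : bounded_set base }.

Section StochasticIntegral.
Context {d : measure_display} {Omega : measurableType d} {R : realType}.
Variables (P : probability Omega R) (mu : {measure set (plane R) -> \bar R}).
Variable M : R -> set (plane R) -> {RV P >-> R}.

Definition step_fun (t : R) (e : seq (step t)) (p : spacetime R) : R :=
  \sum_(c <- e) coef c * \1_(`]lo c, hi c] `*` base c) p.

Definition step_integral (t : R) (e : seq (step t)) (w : Omega) : R :=
  \sum_(c <- e) coef c * (M (hi c) (base c) w - M (lo c) (base c) w).

Definition well_defined_integrand (t : R) (g : spacetime R -> R) : Prop :=
  [/\ measurable_fun (`[0, t] `*` setT) g,
      forall s, 0 <= s <= t ->
        (leb2 R).-integrable setT (EFin \o (fun y => g (s, y)))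
    & (noise_norm2 mu `[0%R, t] g < +oo)%E].

(* Y is (a version of) \int_0^t \int g(s, y) M(ds, dy) *)
Definition stochastic_integral (t : R) (g : spacetime R -> R)
    (Y : Omega -> R) : Prop :=
  measurable_fun setT Y /\
  exists e : nat -> seq (step t),
    noise_norm2 mu `[0, t] (fun p => step_fun (e n) p - g p)
      @[n --> \oo] --> 0%E /\
    ('E_P[fun w => ((step_integral (e n) w - Y w) ^+ 2)%R])%E @[n --> \oo] --> 0%E.

End StochasticIntegral.

Section CauchyProblem.
Context {R : realType}.

Definition wave_op (phi : spacetime R -> R) (p : spacetime R) : R :=
  let dt : spacetime R := (1, (0, 0)) in
  let dx1 : spacetime R := (0, (1, 0)) in
  let dx2 : spacetime R := (0, (0, 1)) in
  'D_dt ('D_dt phi) p - 2 * 'D_dt ('D_dx1 phi) p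
    - p.2.1 ^+ 2 * 'D_dx2 ('D_dx2 phi) p.

(* [wave_op] is its own formal adjoint: each of its terms is of even order and
   x1^2 does not depend on x2.  So  L Gamma = delta_(0, y1, 0)  is tested
   against [wave_op phi]. *)
Definition fundamental_solution (Gamma : R -> R -> R -> R -> R) : Prop :=
  forall y1 : R,
    let G := fun p : spacetime R => Gamma p.1 p.2.1 y1 p.2.2 in
    [/\ forall p, p.1 <= 0 -> G p = 0,
        forall K : set (spacetime R), compact K ->
          (leb3 R).-integrable K (EFin \o G)
      & forall phi : spacetime R -> R, test_function phi ->
          \int[leb3 R]_p (G p * wave_op phi p) = phi (0, (y1, 0))].

Definition shifted_kernel (Gamma : R -> R -> R -> R -> R) (t : R) (x : plane R)
    (p : spacetime R) : R :=
  Gamma (t - p.1) x.1 p.2.1 (x.2 - p.2.2).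

Definition random_field_solution {d : measure_display} {Omega : measurableType d}
    (P : probability Omega R) (mu : {measure set (plane R) -> \bar R})
    (M : R -> set (plane R) -> {RV P >-> R}) (T : R)
    (Gamma : R -> R -> R -> R -> R) (u : R -> plane R -> Omega -> R) : Prop :=
  [/\ fundamental_solution Gamma,
      forall (t : R) (x : plane R), 0 <= t <= T ->
        well_defined_integrand mu t (shifted_kernel Gamma t x) /\
        stochastic_integral mu M t (shifted_kernel Gamma t x) (u t x)
    & measurable_fun ((`[0, T] `*` setT) `*` setT : set (spacetime R * Omega))
        (fun q => u q.1.1 q.1.2 q.2)].

Definition Gamma_explicit (t x1 y1 x2 : R) : R :=
  let q := (y1 ^+ 3 - x1 ^+ 3) * (2 * t + x1 - y1) - 3 * x2 ^+ 2 in
  if [&& 0 < t, x1 < y1 & 0 < q]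
  then Num.sqrt 3 / (2 * pi) * (1 / Num.sqrt q) else 0.

End CauchyProblem.

(* Main.v *)
(* The fundamental solution is supported where A > 0 and B > 0, with
   A = (y1^3 - x1^3)/3 and B = 2t + x1 - y1; in the variable x2 = sqrt(A B) u it
   is the arcsine weight 1/(2 pi sqrt(A B (1 - u^2))).  In the coordinates
   (x1, B, u) the tested operator becomes a sum of an x1-derivative, a
   B-derivative and a u-derivative, and only the first contributes, through its
   boundary value at x1 = y1.  For the noise, the same substitution writes
   |F Gamma|^2 as squares of real oscillatory integrals; integrating by parts in
   u and in y1 bounds them by C / (1 + |xi|^(2/3)), which is the hypothesis on mu.
   Testing the spectral identity with Gaussians bounds the noise norm of bounded
   compactly supported integrands by their L^2 norm, so step functions with
   rational data are dense; choosing for every (t, x) the least sufficiently close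
   rational step function in an enumeration makes the integral jointly measurable. *)
From HB Require Import structures.
Require Import Defs.
From mathcomp Require Import all_boot all_order all_algebra.
From mathcomp Require Import all_classical all_reals all_analysis.
From mathcomp Require Import complex.
From mathcomp Require Import measurable_realfun.
From mathcomp Require Import ring lra.
Import Order.TTheory GRing.Theory Num.Theory.
Import numFieldNormedType.Exports.
Local Open Scope classical_set_scope.
Local Open Scope ring_scope.
Set Implicit Arguments.
Unset Strict Implicit.
Unset Printing Implicit Defensive.

(** The exponent 2/3 balances two decay rates. For I one of the real oscillatory integrals, the
    endpoint singularities of the arcsine weight give I^2 <= C / |xi2|, and the y1-integration gives
    I^2 <= C (1 + |xi2|)^2 / xi1^2. With P = |xi|^(2/3), the first bound is C / P when |xi2| is at
    least of order P, and the second is C P^2 / P^3 otherwise. The operator degenerates at x1 = 0,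
    so the lower bounds on A are polynomial inequalities valid for every x1. The kernel is singular
    on the boundary of its support: integrations by parts are done on a truncated kernel, with
    bounds free of the truncation, and dominated convergence reaches the full kernel. On the noise
    side mu may have infinite mass, so Fubini is applied after a Gaussian damping of mu; what
    survives its removal is an inequality between second moments and noise norms, which suffices for
    Cauchy sequences. Noise norms occur squared, as extended reals, so the triangle inequality takes
    the form |a + b|^2 <= 2 |a|^2 + 2 |b|^2. *)

Notation intg m f := (integrable m setT (EFin \o f)).

(** * Real-valued integrals: domination, dominated convergence, Fatou *)

Section RealIntegral.
Context d (T : measurableType d) (R : realType) (m : {measure set T -> \bar R}).
Implicit Types f g : T -> R.

Lemma intg_measurable f : intg m f -> measurable_fun setT f.
Proof. by move/measurable_int/measurable_EFinP. Qed.

Lemma intg_ext f g : f =1 g -> intg m f -> intg m g.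
Proof. by move=> /funext ->. Qed.

Lemma Rint_ext f g : f =1 g -> \int[m]_x f x = \int[m]_x g x.
Proof. by move=> /funext ->. Qed.

Lemma intg_le f g : measurable_fun setT f -> intg m g ->
  (forall x, `|f x| <= g x) -> intg m f.
Proof.
move=> mf ig fg; apply: le_integrable ig => //; first exact/measurable_EFinP.
by move=> x _ /=; rewrite lee_fin (le_trans (fg x))// ler_norm.
Qed.

Lemma intgP f : measurable_fun setT f ->
  (\int[m]_x (`|f x|)%:E < +oo)%E -> intg m f.
Proof. by move=> mf foo; apply/integrableP; split => //; exact/measurable_EFinP. Qed.

Lemma intg_lty f : intg m f -> (\int[m]_x (`|f x|)%:E < +oo)%E.
Proof. by move=> /integrableP[]. Qed.

Lemma intgN f : intg m f -> intg m (fun x => - f x).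
Proof. by move/integrableN; apply: eq_integrable. Qed.

Lemma intgD f g : intg m f -> intg m g -> intg m (fun x => f x + g x).
Proof. by move=> fi gi; have := integrableD measurableT fi gi; apply: eq_integrable. Qed.

Lemma intgB f g : intg m f -> intg m g -> intg m (fun x => f x - g x).
Proof. by move=> fi gi; exact/intgD/intgN. Qed.

Lemma intgZl (c : R) f : intg m f -> intg m (fun x => c * f x).
Proof. by move=> fi; have := integrableZl measurableT c fi; apply: eq_integrable. Qed.

Lemma intg_norm f : intg m f -> intg m (fun x => `|f x|).
Proof. by move=> fi; exact: integrable_norm. Qed.

Lemma intg0 : intg m (fun=> 0).
Proof. exact: integrable0. Qed.

Lemma intg_bounded f g : intg m f -> measurable_fun setT g ->
  (exists C, forall x, `|g x| <= C) -> intg m (fun x => f x * g x).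
Proof.
move=> fi mg [C gC]; apply: (@intg_le _ (fun x => C * `|f x|)).
- by apply: measurable_funM => //; exact: intg_measurable fi.
- exact/intgZl/intg_norm.
- by move=> x; rewrite normrM mulrC ler_wpM2r.
Qed.

Lemma Rint_intgE f : intg m f -> (\int[m]_x f x)%:E = (\int[m]_x (f x)%:E)%E.
Proof. by move=> fi; rewrite /Rintegral fineK//; exact: integrable_fin_num fi. Qed.

Lemma Rint_ge0E f : intg m f -> (forall x, 0 <= f x) ->
  (\int[m]_x (`|f x|)%:E)%E = (\int[m]_x f x)%:E.
Proof.
move=> fi f0; rewrite Rint_intgE//; apply: eq_integral => x _.
by rewrite ger0_norm.
Qed.

Lemma le_Rint f g : intg m f -> intg m g -> (forall x, f x <= g x) ->
  \int[m]_x f x <= \int[m]_x g x.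
Proof. by move=> fi gi fg; exact: le_Rintegral. Qed.

Lemma normr_Rint_le f g : intg m g -> measurable_fun setT f ->
  (forall x, `|f x| <= g x) -> `|\int[m]_x f x| <= \int[m]_x g x.
Proof.
move=> ig mf fg; have fi := intg_le mf ig fg.
by apply: (le_trans (le_normr_Rintegral measurableT fi)); apply: le_Rint => //; exact: intg_norm.
Qed.

(** Both integrands on the right are nonnegative, so a change of variables known for nonnegative
    functions carries over to signed ones. *)
Lemma Rint_norm_split f : intg m f ->
  \int[m]_x f x = \int[m]_x (`|f x| + f x) - \int[m]_x `|f x|.
Proof.
move=> fi; have ni := intg_norm fi.
rewrite -RintegralB//; last exact: intgD.
by apply: eq_Rintegral => x _; rewrite addrAC subrr add0r.
Qed.

Lemma Rint0 : \int[m]_x (0 : R) = 0.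
Proof. by rewrite /Rintegral integral0. Qed.

Lemma dct_Rint (f_ : nat -> T -> R) f g :
  (forall n, measurable_fun setT (f_ n)) ->
  (forall x, f_ n x @[n --> \oo] --> f x) -> intg m g ->
  (forall n x, `|f_ n x| <= g x) ->
  intg m f /\ \int[m]_x f_ n x @[n --> \oo] --> \int[m]_x f x.
Proof.
move=> mf_ ff ig fg.
have mf : measurable_fun setT f by exact: (measurable_fun_cvg mf_ (fun x _ => ff x)).
have fi : intg m f.
  apply: (intg_le mf ig) => x.
  have h : `|f_ n x| @[n --> \oo] --> `|f x| by apply: cvg_norm; exact: ff.
  rewrite -(cvg_lim _ h)//; apply: limr_le; first by apply/cvg_ex; exists `|f x|.
  exact: nearW.
split => //.
apply: fine_cvg; rewrite Rint_intgE//.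
apply: (@dominated_cvg _ _ _ m setT measurableT (fun n => EFin \o f_ n) (EFin \o f) (EFin \o g)) => //=.
- by move=> n; exact/measurable_EFinP.
- by move=> x _; apply: cvg_EFin; [exact: nearW|exact: ff].
- by move=> n x _; rewrite lee_fin.
Qed.

(** Serves where the integrability of the limit is itself the question. *)
Lemma fatou_le (f_ : nat -> T -> R) f (C : \bar R) :
  (forall n, measurable_fun setT (f_ n)) -> (forall n x, 0 <= f_ n x) ->
  (forall x, f_ n x @[n --> \oo] --> f x) ->
  (forall n, \int[m]_x (f_ n x)%:E <= C)%E -> (\int[m]_x (f x)%:E <= C)%E.
Proof.
move=> mf_ f0 ff fC.
rewrite (_ : (\int[m]_x (f x)%:E)%E = (\int[m]_x limn_einf (fun n => (f_ n x)%:E))%E); last first.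
  apply: eq_integral => x _.
  have h : (f_ n x)%:E @[n --> \oo] --> (f x)%:E by apply: cvg_EFin; [exact: nearW|exact: ff].
  by rewrite is_cvg_limn_einfE; [apply/esym/cvg_lim|apply/cvg_ex; exists (f x)%:E].
apply: le_trans (fatou _ measurableT _ _) _ => //.
- by move=> n; exact/measurable_EFinP.
- by move=> n x _; rewrite lee_fin.
rewrite limn_einf_lim; apply: lime_le; first exact: is_cvg_einfs.
by apply: nearW => n; apply: le_trans (fC n); apply: ereal_inf_lbound; exists n => /=.
Qed.

End RealIntegral.

Lemma ae_eq_integrable d (T : measurableType d) (R : realType)
    (m : {measure set T -> \bar R}) (f g : T -> \bar R) :
  measurable_fun setT g -> ae_eq m setT f g -> m.-integrable setT f ->
  m.-integrable setT g.
Proof.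
move=> mg fg /integrableP[mf foo]; apply/integrableP; split => //.
rewrite (_ : (\int[m]_x _)%E = (\int[m]_x `|f x|)%E)//.
apply: ge0_ae_eq_integral => //; [exact: measurableT_comp|exact: measurableT_comp|].
by apply: filterS fg => x + _ => ->.
Qed.

(** * Fubini and Tonelli for real-valued integrals *)

Section RealFubini.
Context d1 d2 (T1 : measurableType d1) (T2 : measurableType d2) (R : realType).
Variables (m1 : {sigma_finite_measure set T1 -> \bar R})
  (m2 : {sigma_finite_measure set T2 -> \bar R}).

Lemma measurable_slice1 d3 (T3 : measurableType d3) (f : T1 * T2 -> T3) :
  measurable_fun setT f -> forall x, measurable_fun setT (fun y => f (x, y)).
Proof. by move=> mf x; exact: measurableT_comp. Qed.

Lemma measurable_slice2 d3 (T3 : measurableType d3) (f : T1 * T2 -> T3) :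
  measurable_fun setT f -> forall y, measurable_fun setT (fun x => f (x, y)).
Proof. by move=> mf y; exact: measurableT_comp. Qed.

Lemma measurable_ge0_int (f : T1 * T2 -> R) : measurable_fun setT f ->
  (forall z, 0 <= f z) ->
  measurable_fun setT (fun x => (\int[m2]_y (f (x, y))%:E)%E).
Proof.
move=> mf f0; apply: (measurable_fun_fubini_tonelli_F (EFin \o f)).
  exact/measurable_EFinP.
by move=> z; rewrite lee_fin.
Qed.

(** No integrability is assumed: [fine] sends infinite slice integrals to 0, and this keeps the
    slice integral measurable. *)
Lemma measurable_Rint (f : T1 * T2 -> R) : measurable_fun setT f ->
  measurable_fun setT (fun x => \int[m2]_y f (x, y)).
Proof.
move=> mf; apply: measurableT_comp; first exact: fine_measurable.
rewrite (_ : (fun x => _) = (fun x => \int[m2]_y ((f^\+ (x, y))%:E) - \int[m2]_y ((f^\- (x, y))%:E))%E).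
  apply: emeasurable_funB; apply: measurable_ge0_int.
  - exact: measurable_funrpos.
  - by move=> z; exact: funrpos_ge0.
  - exact: measurable_funrneg.
  - by move=> z; exact: funrneg_ge0.
apply/funext => x; rewrite integralE; congr (_ - _)%E; apply: eq_integral => y _.
  by rewrite !unlock/= EFin_max.
by rewrite !unlock/= EFin_max.
Qed.

(** The real slice integrals agree with the extended ones except on the null set where a slice fails
    to be integrable. *)
Lemma Rfubini1 (f : T1 * T2 -> R) : intg (m1 \x m2)%E f ->
  intg m1 (fun x => \int[m2]_y f (x, y)) /\
  \int[m1]_x \int[m2]_y f (x, y) = fine (\int[m1 \x m2]_z (f z)%:E)%E.
Proof.
move=> fi; have mf := intg_measurable fi.
have h := integrable_fubini_F fi.
have e : ae_eq m1 setT (fubini_F m2 (EFin \o f)) (EFin \o (fun x => \int[m2]_y f (x, y))).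
  by apply: filterS (ae_integrable1 fi) => x fx _; rewrite /fubini_F /= Rint_intgE.
have mR : measurable_fun setT (EFin \o (fun x => \int[m2]_y f (x, y))).
  exact/measurable_EFinP/measurable_Rint.
split; first by apply: ae_eq_integrable mR e h.
rewrite /Rintegral -(integral12_prod_meas1 fi); congr fine; apply/esym.
by apply: ae_eq_integral e => //; exact: measurable_int h.
Qed.

Lemma Rint_prod_crit (f : T1 * T2 -> R) (g : T1 -> R) : measurable_fun setT f ->
  (forall x, intg m2 (fun y => f (x, y))) -> intg m1 g ->
  (forall x, \int[m2]_y `|f (x, y)| <= g x) -> intg (m1 \x m2)%E f.
Proof.
move=> mf fi gi fg; apply/integrable12ltyP; first exact/measurable_EFinP.
apply: le_lt_trans (intg_lty gi); apply: ge0_le_integral => //=.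
- by move=> x _; exact: integral_ge0.
- by apply: (@measurable_ge0_int (fun z => `|f z|)) => //; exact: measurableT_comp.
- by do 2 apply: measurableT_comp => //; exact: intg_measurable gi.
- move=> x _; rewrite -Rint_intgE; last exact: intg_norm.
  by rewrite lee_fin (le_trans (fg x))// ler_norm.
Qed.

Lemma intg_prod (f : T1 -> R) (g : T2 -> R) : intg m1 f -> intg m2 g ->
  intg (m1 \x m2)%E (fun z => f z.1 * g z.2).
Proof.
move=> fi gi; apply: (@Rint_prod_crit _ (fun x => `|f x| * \int[m2]_y `|g y|)).
- apply: measurable_funM.
    exact: (measurableT_comp (intg_measurable fi) measurable_fst).
  exact: (measurableT_comp (intg_measurable gi) measurable_snd).
- by move=> x; exact: (intgZl (f x) gi).
- by apply: (intg_ext _ (intgZl (\int[m2]_y `|g y|) (intg_norm fi))) => x /=; rewrite mulrC.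
- move=> x /=; rewrite -RintegralZl//; last exact: intg_norm.
  by under eq_Rintegral do rewrite normrM.
Qed.

End RealFubini.

Section RealFubini2.
Context d1 d2 (T1 : measurableType d1) (T2 : measurableType d2) (R : realType).
Variables (m1 : {sigma_finite_measure set T1 -> \bar R})
  (m2 : {sigma_finite_measure set T2 -> \bar R}).

Lemma prod_swap_int (f : T1 * T2 -> R) :
  intg (m1 \x m2)%E f -> intg (m2 \x m1)%E (fun z => f (z.2, z.1)).
Proof.
move=> fi; have mf := intg_measurable fi.
apply/integrable12ltyP => /=.
  apply/measurable_EFinP; apply: (measurableT_comp mf).
  exact: measurable_fun_pair.
have mfE : measurable_fun setT (EFin \o f) by exact/measurable_EFinP.
by have /(integrable21ltyP m1 m2 mfE) := fi.
Qed.

Lemma Rfubini2 (f : T1 * T2 -> R) : intg (m1 \x m2)%E f ->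
  intg m2 (fun y => \int[m1]_x f (x, y)) /\
  \int[m2]_y \int[m1]_x f (x, y) = \int[m1]_x \int[m2]_y f (x, y).
Proof.
move=> fi; have [h1 e1] := Rfubini1 fi.
have [h2 e2] := Rfubini1 (prod_swap_int fi); split => //.
rewrite e1 e2 -(integral12_prod_meas1 fi) -(integral12_prod_meas1 (prod_swap_int fi)).
by rewrite /fubini_F /= (Fubini fi).
Qed.

End RealFubini2.

(** * Affine changes of variables on the line *)

Section Affine.
Variable R : realType.
Local Notation leb := (@lebesgue_measure R).

Lemma measurable_affine (a b : R) :
  measurable_fun [set: measurableTypeR R] (fun x : measurableTypeR R => a * x + b : measurableTypeR R).
Proof. by apply: measurable_funD => //; exact: measurable_funM. Qed.

(** The pushforward of Lebesgue measure under x -> a x + b, scaled by |a|, agrees with Lebesgue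
    measure on the half-open intervals, and these determine it. *)
Lemma lebesgue_affine (a b : R) (A : set (measurableTypeR R)) : a != 0 -> measurable A ->
  leb A = (`|a|%:E * leb ((fun x => a * x + b)%R @^-1` A))%E.
Proof.
move=> a0 mA.
have ma := measurable_affine a b.
pose push := pushforward leb (fun x : measurableTypeR R => a * x + b : measurableTypeR R).
pose m' := mscale (NngNum (normr_ge0 a)) push.
suff : leb A = m' ma A by [].
apply: lebesgue_measure_unique => //= _ [[c d]] _ <-.
rewrite /m' /mscale /= /push /pushforward /=.
(* The first branch is a < 0: the map reverses the order, so the preimage of ]c, d] is open on the
   right instead of on the left, with the same length. *)
have [a_gt0|a_lt0|/eqP] := ltgtP a 0; last by rewrite (negbTE a0).
  rewrite (_ : _ @^-1` _ = `[(d - b) / a, (c - b) / a[%classic); last first.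
    apply/seteqP; split => x /=; rewrite !in_itv/=.
      by rewrite ler_ndivrMr// ltr_ndivlMr//; lra.
    by rewrite ler_ndivrMr// ltr_ndivlMr//; lra.
  rewrite !lebesgue_measure_itv /= !lte_fin ltr_ndivrMr// divfK ?lt_eqF// ltrD2r.
  case: ifPn => cd; last by rewrite mule0.
  by rewrite -!EFinD -EFinM ltr0_norm//; congr EFin; field; rewrite lt_eqF.
rewrite (_ : _ @^-1` _ = `](c - b) / a, (d - b) / a]%classic); last first.
  apply/seteqP; split => x /=; rewrite !in_itv/=.
    by rewrite ler_pdivlMr// ltr_pdivrMr//; lra.
  by rewrite ler_pdivlMr// ltr_pdivrMr//; lra.
rewrite !lebesgue_measure_itv /= !lte_fin ltr_pdivrMr// divfK ?gt_eqF// ltrD2r.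
case: ifPn => cd; last by rewrite mule0.
by rewrite -!EFinD -EFinM gtr0_norm//; congr EFin; field; rewrite gt_eqF.
Qed.

Lemma ge0_integral_affine (a b : R) (h : R -> \bar R) : a != 0 ->
  measurable_fun setT h -> (forall x, 0 <= h x)%E ->
  (\int[leb]_y h y = `|a|%:E * \int[leb]_x h (a * x + b)%R)%E.
Proof.
move=> a0 mh h0; have ma := measurable_affine a b.
pose push := pushforward leb (fun x : measurableTypeR R => a * x + b : measurableTypeR R).
pose m' := mscale (NngNum (normr_ge0 a)) push.
rewrite (@eq_measure_integral _ _ _ _ (m' ma)); last first.
  by move=> A mA _; exact: lebesgue_affine.
rewrite ge0_integral_mscale//=.
by congr (_ * _)%E; rewrite /push ge0_integral_pushforward//=.
Qed.

Lemma intg_affine (a b : R) (h : R -> R) : a != 0 -> intg leb h ->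
  intg leb (fun x => h (a * x + b)).
Proof.
move=> a0 hi; have mh := intg_measurable hi.
apply: intgP; first exact: (measurableT_comp mh (measurable_affine a b)).
have := intg_lty hi; rewrite (@ge0_integral_affine a b (fun x => `|h x|%:E))//; last first.
  by do 2 apply: measurableT_comp => //.
by rewrite !ltey; apply: contra => /eqP ->; rewrite gt0_muley// lte_fin normr_gt0.
Qed.

Let Rint_affine_ge0 (a b : R) (h : R -> R) : a != 0 -> intg leb h -> (forall x, 0 <= h x) ->
  \int[leb]_y h y = `|a| * \int[leb]_x h (a * x + b).
Proof.
move=> a0 hi h0; have mh := intg_measurable hi.
have hi' := intg_affine b a0 hi.
apply: EFin_inj; rewrite EFinM !Rint_intgE//.
by apply: (@ge0_integral_affine a b (EFin \o h)) => //; exact/measurable_EFinP.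
Qed.

Lemma Rint_affine (a b : R) (h : R -> R) : a != 0 -> intg leb h ->
  \int[leb]_y h y = `|a| * \int[leb]_x h (a * x + b).
Proof.
move=> a0 hi; have hi' := intg_affine b a0 hi.
have ni := intg_norm hi; have ni' := intg_norm hi'.
rewrite (Rint_norm_split hi) (Rint_norm_split hi') mulrBr.
rewrite (@Rint_affine_ge0 a b (fun x => `|h x| + h x))//; [|exact: intgD|].
  by rewrite (@Rint_affine_ge0 a b (fun x => `|h x|)).
by move=> x; rewrite -lerBlDr sub0r -normrN ler_norm.
Qed.

End Affine.

(** * Joint measurability of Carathéodory functions *)

Section Caratheodory.
Context (R : realType) d (Y : measurableType d).

(** Rounding the first variable down to a multiple of 1/(n+1) leaves countably many strips, on each
    of which only the measurable second variable remains; continuity in the first variable gives the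
    pointwise limit. *)
Lemma measurable_caratheodory (f : measurableTypeR R * Y -> R) :
  (forall y, continuous (fun x : R => f (x, y))) ->
  (forall x, measurable_fun setT (fun y => f (x, y))) ->
  measurable_fun setT f.
Proof.
move=> cf mf.
pose rd n (x : R) : R := (Num.floor (n.+1%:R * x))%:~R / n.+1%:R.
apply: (@measurable_fun_cvg _ _ _ _ (fun n z => f (rd n z.1, z.2))) => [n|z _].
  move=> _ B mB; rewrite setTI.
  rewrite [X in measurable X](_ : _ = \bigcup_(i : int)
     ([set x : measurableTypeR R | Num.floor (n.+1%:R * x) = i] `*`
      [set y | B (f (i%:~R / n.+1%:R, y))])); last first.
    apply/seteqP; split => [[x y]/= Bf|[x y] [i _ [/= <-]]//].
    by exists (Num.floor (n.+1%:R * x)).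
  apply: countable_bigcupT_measurable; first exact: countableP.
  move=> i; apply: measurableX; last by rewrite -[X in measurable X]setTI; exact: mf.
  rewrite [X in measurable X](_ : _ = `[i%:~R / n.+1%:R, (i + 1)%:~R / n.+1%:R[%classic).
    exact: measurable_itv.
  apply/seteqP; split => x /=; rewrite in_itv/= ler_pdivrMr// ltr_pdivlMr// mulrC.
    by move=> <-; exact: floor_itv.
  exact: floor_def.
case: z => x y /=; apply: (@cvg_comp _ _ _ (rd ^~ x) (fun x => f (x, y)) _ (nbhs x)); last exact: cf.
have e n : `|x - rd n x| <= n.+1%:R^-1.
  have /andP[h1 h2] := floor_itv (n.+1%:R * x).
  rewrite /rd ger0_norm; last by rewrite subr_ge0 ler_pdivrMr// [x * _]mulrC.
  rewrite -(ler_pM2r (_ : 0 < n.+1%:R))// mulrBl divfK// mulVf// lerBlDl.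
  by rewrite [x * _]mulrC (le_trans (ltW h2))// intrD.
apply/cvgrPdist_le => eps eps0.
have := @cvg_harmonic R; move=> /cvgrPdist_le/(_ _ eps0); apply: filterS => n /=.
by rewrite sub0r normrN ger0_norm// => h; exact: le_trans (e n) h.
Qed.
End Caratheodory.

(** * Continuous functions and affine maps on the plane *)

Section Plane.
Variable R : realType.
Local Notation leb := (@lebesgue_measure R).

Lemma continuous_slices (V W Z : topologicalType) (f : V * W -> Z) : continuous f ->
  (forall y, continuous (fun x => f (x, y))) /\ (forall x, continuous (fun y => f (x, y))).
Proof.
move=> cf; split => [y x|x y].
  apply: (@continuous_comp _ _ _ (fun x => (x, y)) f); last exact: cf.
  by apply: cvg_pair => //; exact: cvg_cst.
apply: (@continuous_comp _ _ _ (fun y => (x, y)) f); last exact: cf.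
by apply: cvg_pair => //; exact: cvg_cst.
Qed.

(** Bridges the product topology and the product sigma-algebra, one variable at a time. *)
Lemma measurable_continuous_plane (f : plane R -> R) : continuous f -> measurable_fun setT f.
Proof.
move=> /(@continuous_slices R R R)[c1 c2]; apply: measurable_caratheodory => // x.
exact: continuous_measurable_fun.
Qed.

Lemma measurable_continuous_spacetime (f : spacetime R -> R) : continuous f -> measurable_fun setT f.
Proof.
move=> /(@continuous_slices R (R * R)%type R)[c1 c2]; apply: measurable_caratheodory => // x.
exact: measurable_continuous_plane.
Qed.

Lemma Rint_leb2 (f : plane R -> R) : intg (leb2 R) f ->
  \int[leb2 R]_z f z = \int[leb]_x \int[leb]_y f (x, y).
Proof. by move=> fi; have [_ ->] := Rfubini1 fi. Qed.

Lemma measurable_plane_affine (a b1 b2 : R) :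
  measurable_fun [set: plane R] (fun v : plane R => (a * v.1 + b1, a * v.2 + b2) : plane R).
Proof.
apply: measurable_fun_pair; apply: measurable_funD => //; apply: measurable_funM => //.
Qed.

Lemma ge0_plane_affine (a b1 b2 : R) (h : plane R -> R) : a != 0 ->
  measurable_fun setT h -> (forall z, 0 <= h z) ->
  (\int[leb2 R]_z (h z)%:E = (a ^+ 2)%:E * \int[leb2 R]_v (h (a * v.1 + b1, a * v.2 + b2)%R)%:E)%E.
Proof.
move=> a0 mh h0.
have mh' : measurable_fun setT (EFin \o h) by exact/measurable_EFinP.
pose h1 (z : plane R) := h (z.1, a * z.2 + b2).
have mh1 : measurable_fun setT h1.
  apply: (measurableT_comp mh); apply: measurable_fun_pair => //.
  by apply: measurable_funD => //; exact: measurable_funM.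
have mh2 : measurable_fun setT (fun v : plane R => h (a * v.1 + b1, a * v.2 + b2)).
  exact: (measurableT_comp mh (measurable_plane_affine a b1 b2)).
rewrite /leb2 (fubini_tonelli1 (EFin \o h))//.
have mEh2 : measurable_fun setT (fun v : plane R => (h (a * v.1 + b1, a * v.2 + b2))%:E).
  exact/measurable_EFinP.
rewrite (fubini_tonelli1 (fun v : plane R => (h (a * v.1 + b1, a * v.2 + b2)%R)%:E))//; last by move=> v; rewrite lee_fin.
rewrite /fubini_F /=.
pose g (x : measurableTypeR R) := (\int[leb]_y (h1 (x, y))%:E)%E.
have mg : measurable_fun setT g by apply: measurable_ge0_int => // z; exact: h0.
have g0 x : (0 <= g x)%E by apply: integral_ge0 => y _; rewrite lee_fin; exact: h0.
transitivity (\int[leb]_x (`|a|%:E * g x))%E.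
  apply: eq_integral => x _; apply: (ge0_integral_affine b2 a0 (h := fun y => (h (x, y))%:E)).
    exact: measurable_slice1 mh' x.
  by move=> y; rewrite lee_fin.
rewrite (ge0_integralZl _ measurableT mg (fun x _ => g0 x)); last by rewrite lee_fin.
rewrite (ge0_integral_affine b1 a0 mg g0).
by rewrite muleA -EFinM -normrM -expr2 ger0_norm// sqr_ge0.
Qed.

Lemma intg_plane_affine (a b1 b2 : R) (h : plane R -> R) : a != 0 -> intg (leb2 R) h ->
  intg (leb2 R) (fun v => h (a * v.1 + b1, a * v.2 + b2)).
Proof.
move=> a0 hi; have mh := intg_measurable hi.
apply: intgP; first exact: (measurableT_comp mh (measurable_plane_affine a b1 b2)).
have := intg_lty hi; rewrite (@ge0_plane_affine a b1 b2 (fun x => `|h x|))//; last first.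
  exact: measurableT_comp.
by rewrite !ltey; apply: contra => /eqP ->; rewrite gt0_muley// lte_fin exprn_even_gt0.
Qed.

Let Rint_plane_ge0 (a b1 b2 : R) (h : plane R -> R) : a != 0 -> intg (leb2 R) h ->
  (forall x, 0 <= h x) ->
  \int[leb2 R]_z h z = a ^+ 2 * \int[leb2 R]_v h (a * v.1 + b1, a * v.2 + b2).
Proof.
move=> a0 hi h0; have hi' := intg_plane_affine b1 b2 a0 hi.
apply: EFin_inj; rewrite EFinM !Rint_intgE//.
by apply: ge0_plane_affine => //; exact: intg_measurable hi.
Qed.

Lemma Rint_plane_affine (a b1 b2 : R) (h : plane R -> R) : a != 0 -> intg (leb2 R) h ->
  \int[leb2 R]_z h z = a ^+ 2 * \int[leb2 R]_v h (a * v.1 + b1, a * v.2 + b2).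
Proof.
move=> a0 hi; have hi' := intg_plane_affine b1 b2 a0 hi.
have ni := intg_norm hi; have ni' := intg_norm hi'.
rewrite (Rint_norm_split hi) (Rint_norm_split hi') mulrBr.
rewrite (@Rint_plane_ge0 a b1 b2 (fun x => `|h x| + h x))//; [|exact: intgD|].
  by rewrite (@Rint_plane_ge0 a b1 b2 (fun x => `|h x|)).
by move=> x; rewrite -lerBlDr sub0r -normrN ler_norm.
Qed.

End Plane.

(** * The fundamental theorem of calculus for improper integrals *)

Section FTC.
Variable R : realType.
Local Notation leb := (@lebesgue_measure R).
Implicit Types (f F : R -> R) (a b : R).

(** The indicator of ]a, b[ as a real factor: every integral stays over the whole line and a
    truncation is a product. *)
Definition oo a b (x : R) : R := (a < x < b)%R%:R.

Lemma oo_ge0 a b x : 0 <= oo a b x. Proof. by rewrite /oo ler0n. Qed.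

Lemma oo_le1 a b x : oo a b x <= 1. Proof. by rewrite /oo lern1 leq_b1. Qed.

Lemma normr_oo a b x : `|oo a b x| = oo a b x.
Proof. by rewrite ger0_norm// oo_ge0. Qed.

Lemma ooE a b : oo a b = \1_(`]a, b[%classic) :> (R -> R).
Proof. by apply/funext => x; rewrite indicE/= /oo mem_setE in_itv. Qed.

Lemma measurable_oo a b : measurable_fun [set: measurableTypeR R] (oo a b).
Proof. by rewrite ooE; exact: measurable_indic. Qed.

Lemma mul_ooE f a b : (fun x => f x * oo a b x) = f \_ `]a, b[%classic.
Proof. by apply/funext => x; rewrite ooE patchE indicE; case: ifPn; rewrite ?mulr1 ?mulr0. Qed.

Lemma Rint_oo f a b : \int[leb]_x (f x * oo a b x) = \int[leb]_(x in `]a, b[) f x.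
Proof. by rewrite [RHS]Rintegral_mkcond -mul_ooE. Qed.

Lemma intg_oo f a b : intg leb (fun x => f x * oo a b x) <-> leb.-integrable `]a, b[ (EFin \o f).
Proof. by rewrite mul_ooE -restrict_EFin; apply: iff_sym; exact: integrable_mkcond. Qed.

Lemma measurable_mul_oo f a b : (forall x, a < x < b -> {for x, continuous f}) ->
  measurable_fun [set: measurableTypeR R] (fun x => f x * oo a b x).
Proof.
move=> cf; rewrite mul_ooE; apply: (measurable_restrictT f (measurable_itv `]a, b[)).1.
apply: open_continuous_measurable_fun => //.
by move=> x; rewrite inE/= in_itv/= => /cf.
Qed.

Lemma intg_oo_const a b (c : R) : intg leb (fun x => c * oo a b x).
Proof. by rewrite ooE; exact/intgZl/integrable_indic_itv. Qed.

Lemma intg_oo1 a b : intg leb (oo a b).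
Proof. by rewrite ooE; exact/integrable_indic_itv. Qed.

Lemma Rint_cc f F a b : a < b -> (forall x, a <= x <= b -> {for x, continuous f}) ->
  (forall x, a <= x <= b -> is_derive x 1 F (f x)) ->
  (\int[leb]_(x in `[a, b]) (f x)%:E = (F b - F a)%:E)%E.
Proof.
move=> ab cf dF; have cF x : a <= x <= b -> {for x, continuous F}.
  by move=> /dF h; apply/differentiable_continuous/derivable1_diffP/ex_derive.
rewrite EFinB; apply: continuous_FTC2 => //.
- apply: continuous_in_subspaceT => x; rewrite inE/= in_itv/=; exact: cf.
- split.
  + by move=> x; rewrite in_itv/= => /andP[ax xb]; apply: ex_derive; apply: dF; rewrite !ltW.
  + by apply: cvg_at_right_filter; apply: cF; rewrite lexx ltW.
  + by apply: cvg_at_left_filter; apply: cF; rewrite lexx ltW.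
- move=> x; rewrite in_itv/= => /andP[ax xb]; rewrite derive1E.
  by apply: derive_val; apply: dF; rewrite !ltW.
Qed.

Section improper.
Variables (a b : R) (f F : R -> R) (la lb : R).
Hypotheses (ab : a < b) (dF : forall x, a < x < b -> is_derive x 1 F (f x))
  (cf : forall x, a < x < b -> {for x, continuous f})
  (Fa : F x @[x --> a^'+] --> la) (Fb : F x @[x --> b^'-] --> lb).

(** Starting at n+3 keeps the two margins at most (b - a)/3, so that [an n < bn n] for every n. *)
Let an (n : nat) := a + (b - a) / n.+3%:R.
Let bn (n : nat) := b - (b - a) / n.+3%:R.

Let h0 n : 0 < (b - a) / n.+3%:R.
Proof. by rewrite divr_gt0// subr_gt0. Qed.

Let anbn n : [/\ a < an n, an n < bn n & bn n < b].
Proof.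
have := h0 n; have : (b - a) / n.+3%:R <= (b - a) / 3%:R.
  by rewrite ler_pM2l ?subr_gt0// lef_pV2 ?posrE// ler_nat.
by rewrite /an /bn; move: ((b - a) / n.+3%:R) => q ? ?; split; lra.
Qed.

Let hcvg : (b - a) / n.+3%:R @[n --> \oo] --> 0.
Proof.
rewrite -[0](mulr0 (b - a)); apply: cvgM; first exact: cvg_cst.
have := @cvg_harmonic R; rewrite -(cvg_shiftn 2) /=.
by under eq_fun do rewrite addn2.
Qed.

Let cvg_an : an n @[n --> \oo] --> a.
Proof. by rewrite -[a in X in _ --> X]addr0; apply: cvgD => //; exact: cvg_cst. Qed.

Let cvg_bn : bn n @[n --> \oo] --> b.
Proof. by rewrite -[b in X in _ --> X]subr0; apply: cvgB => //; exact: cvg_cst. Qed.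

Let cvg_Fn : F (bn n) - F (an n) @[n --> \oo] --> lb - la.
Proof.
apply: cvgB.
  by move/cvg_at_leftP : Fb; apply; split => // n; have [] := anbn n.
by move/cvg_at_rightP : Fa; apply; split => // n; have [] := anbn n.
Qed.

Let in_oo n x : an n <= x <= bn n -> a < x < b.
Proof. by have [h1 h2 h3] := anbn n; move=> /andP[/(lt_le_trans h1) -> /le_lt_trans ->]. Qed.

Let f_ n x := f x * ((an n <= x <= bn n)%R)%:R.

Let f_E n : f_ n = f \_ `[an n, bn n].
Proof.
apply/funext => x; rewrite /f_ patchE mem_setE in_itv/=.
by case: ifPn; rewrite ?mulr1 ?mulr0.
Qed.

Let Rf_ n : (\int[leb]_x (f_ n x)%:E = (F (bn n) - F (an n))%:E)%E.
Proof.
have [h1 h2 h3] := anbn n.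
rewrite -(Rint_cc h2 (fun x h => cf (in_oo h)) (fun x h => dF (in_oo h))).
by rewrite f_E [RHS]integral_mkcond restrict_EFin.
Qed.

Let mf_ n : measurable_fun [set: measurableTypeR R] (f_ n).
Proof.
have [h1 h2 h3] := anbn n.
rewrite f_E; apply: (measurable_restrictT f (measurable_itv `[an n, bn n])).1.
apply: subspace_continuous_measurable_fun => //.
by apply: continuous_in_subspaceT => x; rewrite inE/= in_itv/= => /in_oo; exact: cf.
Qed.

Let f_cvg x : f_ n x @[n --> \oo] --> f x * oo a b x.
Proof.
have [/andP[ax xb]|nx] := boolP (a < x < b); last first.
  rewrite (_ : (fun _ => _) = fun=> 0); last first.
    apply/funext => n; rewrite /f_; case: (boolP (an n <= x <= bn n)); rewrite ?mulr0//.
    by move/in_oo; rewrite (negbTE nx).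
  by rewrite /oo (negbTE nx) mulr0; exact: cvg_cst.
apply: cvg_near_cst.
have : \forall n \near \oo, an n < x by apply: cvgr_lt ax.
have : \forall n \near \oo, x < bn n by apply: cvgr_gt xb.
apply: filterS2 => n xn nx; rewrite /f_ /oo ax xb.
by rewrite !ltW.
Qed.

Let f_le n x : `|f_ n x| <= `|f x * oo a b x|.
Proof.
rewrite /f_; case: (boolP (an n <= x <= bn n)) => [h|_]; last by rewrite mulr0 normr0.
by rewrite /oo (in_oo h).
Qed.

(** f may blow up at both ends and F needs only one-sided limits there: the classical theorem on
    [an, bn], then dominated convergence with |f| as majorant. *)
Lemma FTC_oo : intg leb (fun x => f x * oo a b x) ->
  \int[leb]_x (f x * oo a b x) = lb - la.
Proof.
move=> fi; have [_ h] := dct_Rint (m := leb) mf_ f_cvg (intg_norm fi) f_le.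
apply: cvg_unique h _ => //.
rewrite /= (_ : (fun n => _) = (fun n => F (bn n) - F (an n)))//.
by apply/funext => n; rewrite /Rintegral; exact: (congr1 fine (Rf_ n)).
Qed.

(** For f >= 0 the integrals over [an, bn] are increments of F, which converge and hence are
    bounded; Fatou concludes. *)
Lemma intg_FTC_oo : (forall x, a < x < b -> 0 <= f x) -> intg leb (fun x => f x * oo a b x).
Proof.
move=> f0; have mf := measurable_mul_oo cf; apply: intgP => //.
have /cvg_seq_bounded[M [_ /(_ (M + 1))]] := cvgP _ cvg_Fn.
rewrite ltrDl ltr01 => /(_ isT) FM.
apply: le_lt_trans (ltry (M + 1)).
apply: (@fatou_le _ _ _ leb (fun n x => `|f_ n x|)).
- by move=> n; exact: measurableT_comp.
- by [].
- by move=> x; apply: cvg_norm; exact: f_cvg.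
- move=> n; rewrite (_ : (\int[_]_x _)%E = (\int[leb]_x (f_ n x)%:E)%E).
    by rewrite Rf_ lee_fin (le_trans (ler_norm _))// FM.
  apply: eq_integral => x _; rewrite ger0_norm// /f_.
  by case: (boolP (an n <= x <= bn n)) => [/in_oo/f0|]; rewrite ?mulr1 ?mulr0.
Qed.

End improper.
End FTC.

(** * Syntax-directed differentiation *)

Section DeriveKit.
Variable R : realType.
Implicit Types (f g : R -> R) (x a b c : R).

(* An alias of [is_derive _ 1] that typeclass resolution does not see: it
   keeps the derivatives in the syntactic form produced by the lemmas below. *)
Definition isder x f a : Prop := is_derive x 1 f a.

Lemma isd_id x : isder x (fun y : R => y) 1.
Proof. exact: is_derive_id. Qed.

Lemma isd_cst c x : isder x (fun _ : R => c) 0.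
Proof. exact: is_derive_cst. Qed.

Lemma isdN f x a : isder x f a -> isder x (fun y => - f y) (- a).
Proof. by move=> h; apply: is_deriveN. Qed.

Lemma isdD f g x a b : isder x f a -> isder x g b ->
  isder x (fun y => f y + g y) (a + b).
Proof. by move=> h k; apply: is_deriveD. Qed.

Lemma isdM f g x a b : isder x f a -> isder x g b ->
  isder x (fun y => f y * g y) (a * g x + f x * b).
Proof.
move=> h k; apply: (is_derive_eq (is_deriveM h k)).
by rewrite addrC /GRing.scale /= mulrC.
Qed.

Lemma isd_comp f g x a b : isder (g x) f a -> isder x g b ->
  isder x (fun y => f (g y)) (a * b).
Proof. by move=> h k; exact: is_derive1_comp. Qed.

Lemma isdX f n x a : isder x f a -> isder x (fun y => f y ^+ n.+1) (n.+1%:R * f x ^+ n * a).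
Proof.
move=> h; elim: n => [|n ih]; first by apply: (is_derive_eq h); rewrite expr0 !mul1r.
rewrite (_ : (fun y => _) = (fun y => f y * f y ^+ n.+1)).
  by apply: (is_derive_eq (isdM h ih)); rewrite exprS -[in RHS]natr1; ring.
by apply/funext => y; rewrite exprS.
Qed.

Lemma isd_sqrt g x b : 0 < g x -> isder x g b ->
  isder x (fun y => Num.sqrt (g y)) (b / (2 * Num.sqrt (g x))).
Proof.
move=> g0 h; apply: (is_derive_eq (isd_comp (is_derive1_sqrt g0) h)).
by rewrite mulrC.
Qed.

Lemma isdV g x b : g x != 0 -> isder x g b ->
  isder x (fun y => (g y)^-1) (- b / g x ^+ 2).
Proof.
move=> g0 h; apply: (is_derive_eq (is_deriveV g0 h)).
by rewrite /GRing.scale /= mulrC mulrN mulNr.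
Qed.

Lemma isd_cos g x b : isder x g b -> isder x (fun y => cos (g y)) (- sin (g x) * b).
Proof. by move=> h; apply: (isd_comp (is_derive_cos (g x)) h). Qed.

Lemma isd_sin g x b : isder x g b -> isder x (fun y => sin (g y)) (cos (g x) * b).
Proof. by move=> h; apply: (isd_comp (is_derive_sin (g x)) h). Qed.

Lemma isd_cont f x a : isder x f a -> {for x, continuous f}.
Proof. by move=> [h _]; apply/differentiable_continuous/derivable1_diffP. Qed.

Lemma isd_eq f x a b : isder x f a -> a = b -> isder x f b.
Proof. by move=> h <-. Qed.

End DeriveKit.

Ltac isd1 := match goal with
  | |- isder _ _ _ => eassumption
  | |- isder _ (fun _ => ?c) _ => apply: isd_cst
  | |- isder _ (fun y => y) _ => apply: isd_id
  | |- isder _ (fun y => - @?f y) _ => apply: (@isdN _ f)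
  | |- isder _ (fun y => @?f y + @?g y) _ => apply: (@isdD _ f g)
  | |- isder _ (fun y => @?f y * @?g y) _ => apply: (@isdM _ f g)
  | |- isder _ (fun y => (@?f y) ^+ _) _ => apply: (@isdX _ f)
  | |- isder _ (fun y => Num.sqrt (@?f y)) _ => apply: (@isd_sqrt _ f)
  | |- isder _ (fun y => (@?f y)^-1) _ => apply: (@isdV _ f)
  | |- isder _ (fun y => cos (@?f y)) _ => apply: (@isd_cos _ f)
  | |- isder _ (fun y => sin (@?f y)) _ => apply: (@isd_sin _ f)
  end.
Ltac isd := repeat isd1.
Ltac isd_tac := apply: isd_eq; [by isd | cbv beta].

(** * The arcsine weight *)

Section Weight.
Variable R : realType.
Local Notation leb := (@lebesgue_measure R).

(** The conventions sqrt(x) = 0 for x <= 0 and 0^-1 = 0 make the weight vanish outside ]-1, 1[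
    without an explicit indicator. *)
Definition warc (u : R) : R := (Num.sqrt (1 - u ^+ 2))^-1.

Lemma warc_ge0 (u : R) : 0 <= warc u. Proof. by rewrite invr_ge0 sqrtr_ge0. Qed.

Lemma warc_out (u : R) : ~~ (-1 < u < 1) -> warc u = 0.
Proof.
move=> h; rewrite /warc ler0_sqrtr ?invr0// subr_le0.
move: h; rewrite -ltr_norml -leNgt => h.
by rewrite -real_normK ?num_real// exprn_ege1.
Qed.

Lemma sqr_lt1 (u : R) : -1 < u < 1 -> 0 < 1 - u ^+ 2.
Proof.
by rewrite -ltr_norml => h; rewrite subr_gt0 -real_normK ?num_real// expr_lt1.
Qed.

Lemma isd_warc (u : R) : -1 < u < 1 -> is_derive u 1 warc (u * warc u ^+ 3).
Proof.
move=> hu; have h := sqr_lt1 hu; have s0 : Num.sqrt (1 - u ^+ 2) != 0 by rewrite gt_eqF// sqrtr_gt0.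
rewrite -/(isder _ _ _) /warc; isd_tac.
by field.
Qed.

(** Since w' = u w^3 is dominated by w^3, this primitive of w^3 bounds the total variation of w in
    closed form. *)
Lemma isd_uwarc (u : R) : -1 < u < 1 -> is_derive u 1 (fun u => u * warc u) (warc u ^+ 3).
Proof.
move=> hu; have h := sqr_lt1 hu; have s0 : Num.sqrt (1 - u ^+ 2) != 0 by rewrite gt_eqF// sqrtr_gt0.
apply: (is_derive_eq (isdM (isd_id u) (isd_warc hu))).
rewrite {1}(_ : warc u = (1 - u ^+ 2) * warc u ^+ 3); first by ring.
by rewrite /warc -[X in X * _]sqr_sqrtr ?ltW//; field.
Qed.

Lemma asin_mono (x y : R) : -1 <= x -> x < y -> y <= 1 -> asin x < asin y.
Proof.
move=> h1 h2 h3; have hx : -1 <= x <= 1 by lra.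
have hy : -1 <= y <= 1 by lra.
rewrite ltNge; apply/negP => h.
have [/andP[ax bx] ex] := asin_def hx; have [/andP[ay by_] ey] := asin_def hy.
have := h2; rewrite -ex -ey; apply/negP; rewrite -leNgt.
have [->//|ne] := eqVneq (asin y) (asin x).
by apply/ltW; rewrite ltr_sin ?in_itv/= ?ax ?ay ?bx ?by_// lt_neqAle ne h.
Qed.

Lemma asin_lim1 : asin x @[x --> (1 : R)^'-] --> (pi / 2 : R).
Proof.
have p0 := @pi_gt0 R.
apply/cvgrPdist_lt => e e0.
(* The cap pi / 4 keeps y in the range where [asin] inverts [sin]. *)
pose y : R := pi / 2 - Num.min (e / 2) (pi / 4).
have m0 : 0 < Num.min (e / 2) (pi / 4) by rewrite lt_min; apply/andP; split; lra.
have m1 : Num.min (e / 2) (pi / 4) <= e / 2 by rewrite ge_min lexx.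
have m2 : Num.min (e / 2) (pi / 4) <= pi / 4 by rewrite ge_min lexx orbT.
have siny : sin y < 1.
  rewrite -(@sin_pihalf R) ltr_sin ?in_itv/= /y; lra.
near=> x.
have x1 : x < 1 by near: x; exact: nbhs_left_lt.
have xs : sin y < x by near: x; apply: nbhs_left_gt.
have s1 : -1 <= sin y by exact: sin_geN1.
have hx : -1 <= x <= 1 by lra.
have h : y < asin x.
  rewrite -[y]sinK; last by rewrite in_itv/= /y; lra.
  apply: asin_mono => //; lra.
have h2 := asin_lepi2 hx.
by rewrite ger0_norm; rewrite /y in h; lra.
Unshelve. all: by end_near. Qed.

Lemma asinN' (x : R) : -1 <= x <= 1 -> asin (- x) = - asin x.
Proof.
move=> hx; have [/andP[a b] e] := asin_def hx.
by rewrite -{1}e -sinN sinK// in_itv/=; lra.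
Qed.

Lemma asin_limN1 : asin x @[x --> (-1 : R)^'+] --> (- (pi / 2) : R).
Proof.
apply/cvg_at_rightNP; rewrite opprK.
have h : - asin x @[x --> (1 : R)^'-] --> (- (pi / 2) : R) by apply: cvgN; exact: asin_lim1.
apply: cvg_trans h; apply: near_eq_cvg; near=> x.
rewrite /= asinN'//; have : x < 1 by near: x; exact: nbhs_left_lt.
have : 0 < x by near: x; exact: nbhs_left_gt.
by move=> /ltW h0 /ltW h1; rewrite h1 (le_trans _ h0)// lerN10.
Unshelve. all: by end_near. Qed.

Lemma cont_warc (u : R) : -1 < u < 1 -> {for u, continuous warc}.
Proof. by move=> /isd_warc; exact: isd_cont. Qed.

Lemma warc_ooE (u : R) : warc u * oo (-1) 1 u = warc u.
Proof. by rewrite /oo; case: (boolP (-1 < u < 1)) => [|/warc_out ->]; rewrite ?mulr1 ?mulr0. Qed.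

Lemma intg_warc : intg leb warc.
Proof.
apply: (@intg_ext _ _ _ leb _ _ warc_ooE).
apply: (intg_FTC_oo _ (@is_derive1_asin R) cont_warc asin_limN1 asin_lim1); first lra.
by move=> x _; exact: warc_ge0.
Qed.

Lemma Rint_warc : \int[leb]_u warc u = pi.
Proof.
rewrite -(Rint_ext leb warc_ooE) (FTC_oo _ (@is_derive1_asin R) cont_warc asin_limN1 asin_lim1).
- lra.
- lra.
- by apply: intg_ext intg_warc => x; rewrite warc_ooE.
Qed.

End Weight.

(** * One-dimensional oscillatory integrals *)

Section Oscillation.
Variable R : realType.
Local Notation leb := (@lebesgue_measure R).
Implicit Types (f F : R -> R) (a b : R).

Lemma cont_norm_le a b x : a < x < b -> a <= x <= b.
Proof. by move=> /andP[? ?]; rewrite !ltW. Qed.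

Lemma intg_cont_cc f a b : (forall x, a <= x <= b -> {for x, continuous f}) ->
  intg leb (fun x => f x * oo a b x).
Proof.
move=> cf; apply: (intg_oo f a b).2.
apply: (@integrableS _ _ _ leb `[a, b]%classic) => //.
  exact: subset_itv_oo_cc.
apply: continuous_compact_integrable; first exact: segment_compact.
by apply: continuous_in_subspaceT => x; rewrite inE/= in_itv/=; exact: cf.
Qed.

Lemma FTC_cc f F a b : a < b -> (forall x, a <= x <= b -> isder x F (f x)) ->
  (forall x, a <= x <= b -> {for x, continuous f}) ->
  \int[leb]_x (f x * oo a b x) = F b - F a.
Proof.
move=> ab dF cf; apply: FTC_oo => //; last exact: intg_cont_cc.
- by move=> x /cont_norm_le; exact: dF.
- by move=> x /cont_norm_le; exact: cf.
- by apply: cvg_at_right_filter; apply: (isd_cont (dF a _)); rewrite lexx ltW.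
- by apply: cvg_at_left_filter; apply: (isd_cont (dF b _)); rewrite lexx ltW.
Qed.

Lemma norm_cos_le1 (x : R) : `|cos x| <= 1.
Proof. by rewrite ler_norml cos_geN1 cos_le1. Qed.

Lemma norm_sin_le1 (x : R) : `|sin x| <= 1.
Proof. by rewrite ler_norml sin_geN1 sin_le1. Qed.

Lemma contM f g (x : R) : {for x, continuous f} -> {for x, continuous g} ->
  {for x, continuous (fun y => f y * g y)}.
Proof. by move=> cf cg; exact: continuousM. Qed.

Lemma contD f g (x : R) : {for x, continuous f} -> {for x, continuous g} ->
  {for x, continuous (fun y => f y + g y)}.
Proof. by move=> cf cg; exact: continuousD. Qed.

Lemma cont_cst (c x : R) : {for x, continuous (fun _ : R => c)}.
Proof. exact: cst_continuous. Qed.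

Lemma osc_parts a b (xi s c : R) (r r' v v' : R -> R) : a < b -> xi != 0 ->
  (forall y, a <= y <= b -> isder y r (r' y)) ->
  (forall y, a <= y <= b -> {for y, continuous r'}) ->
  (forall y, a <= y <= b -> isder y v (v' y)) ->
  (forall y, a <= y <= b -> {for y, continuous v'}) ->
  (forall y, a <= y <= b -> `|r' y| <= v' y) ->
  `|\int[leb]_y (cos (xi * y + s * r y + c) * oo a b y)| <= (2 + `|s| * (v b - v a)) / `|xi|.
Proof.
move=> ab xi0 dr cr' dv cv' rv.
pose p y := xi * y + s * r y + c.
have dp y : a <= y <= b -> isder y p (xi + s * r' y).
  by move=> /dr h; rewrite /p; isd_tac; ring.
have cp y : a <= y <= b -> {for y, continuous (fun y => cos (p y))}.
  by move=> /dp h; apply: isd_cont (isd_cos h).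
have I1 := intg_cont_cc cp.
have I2 : intg leb (fun y => cos (p y) * r' y * oo a b y).
  by apply: (@intg_cont_cc (fun y => cos (p y) * r' y)) => y h; apply: contM; [exact: cp|exact: cr'].
have e : \int[leb]_y (xi * (cos (p y) * oo a b y) + s * (cos (p y) * r' y * oo a b y)) =
    sin (p b) - sin (p a).
  rewrite -(@FTC_cc (fun y => cos (p y) * (xi + s * r' y)) (fun y => sin (p y)))//.
  - by apply: eq_Rintegral => y _; ring.
  - by move=> y /dp h; apply: isd_sin.
  - move=> y h; apply: contM; first exact: cp.
    by apply: contD; [exact: cont_cst|apply: contM; [exact: cont_cst|exact: cr']].
rewrite RintegralD// in e; [|exact: intgZl|exact: intgZl].
rewrite RintegralZl// RintegralZl// in e.
have bnd : `|\int[leb]_y (cos (p y) * r' y * oo a b y)| <= v b - v a.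
  rewrite -(FTC_cc ab dv cv'); apply: normr_Rint_le.
  - exact: intg_cont_cc.
  - exact: intg_measurable I2.
  - move=> y; rewrite !normrM normr_oo /oo.
    case: (boolP (a < y < b)) => [/cont_norm_le h|]; last by rewrite !mulr0.
    rewrite !mulr1 -[leRHS]mul1r ler_pM//; first exact: norm_cos_le1.
    exact: rv.
rewrite ler_pdivlMr ?normr_gt0// mulrC -normrM.
have -> : xi * \int[leb]_y (cos (p y) * oo a b y) =
   sin (p b) - sin (p a) - s * \int[leb]_y (cos (p y) * r' y * oo a b y) by rewrite -e addrK.
apply: (le_trans (ler_normB _ _)); apply: lerD.
  apply: (le_trans (ler_normB _ _)).
  by have := norm_sin_le1 (p b); have := norm_sin_le1 (p a); lra.
by rewrite normrM ler_wpM2l.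
Qed.

Lemma warc_le (m : R) : 0 <= m < 1 -> warc m <= (Num.sqrt (1 - m))^-1.
Proof.
move=> /andP[m0 m1]; rewrite /warc lef_pV2 ?posrE ?sqrtr_gt0; [|nra|lra].
by rewrite ler_sqrt; [nra|nra].
Qed.

(** One integration by parts away from the endpoints: the boundary terms and the integral of |w'|
    are each at most 2 w(m), and w(m) <= (1 - m)^(-1/2). *)
Lemma osc_warc_core (z c m : R) : z != 0 -> 0 < m < 1 ->
  `|\int[leb]_u (cos (z * u + c) * warc u * oo (- m) m u)| <= 4 / (`|z| * Num.sqrt (1 - m)).
Proof.
move=> z0 /andP[m0 m1]; have mm : - m < m by lra.
have in1 u : - m <= u <= m -> -1 < u < 1 by lra.
have dp u : isder u (fun u => z * u + c) z by isd_tac; ring.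
have cp u : {for u, continuous (fun u => cos (z * u + c))} by exact: isd_cont (isd_cos (dp u)).
have sp u : {for u, continuous (fun u => sin (z * u + c))} by exact: isd_cont (isd_sin (dp u)).
have cw3 u : -1 < u < 1 -> {for u, continuous (fun u => warc u ^+ 3)}.
  by move=> h; exact: isd_cont (isdX 2 (isd_warc h)).
pose I1 := \int[leb]_u (cos (z * u + c) * warc u * oo (- m) m u).
have i1 : intg leb (fun u => cos (z * u + c) * warc u * oo (- m) m u).
  by apply: (@intg_cont_cc (fun u => cos (z * u + c) * warc u)) => u /in1 h; apply: contM => //; exact: cont_warc.
have i2 : intg leb (fun u => sin (z * u + c) * (u * warc u ^+ 3) * oo (- m) m u).
  apply: (@intg_cont_cc (fun u => sin (z * u + c) * (u * warc u ^+ 3))) => u /in1 h.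
  apply: contM => //; apply: contM; last exact: cw3.
  exact: isd_cont (isd_id u).
have e : z * I1 = sin (z * m + c) * warc m - sin (z * - m + c) * warc (- m)
   - \int[leb]_u (sin (z * u + c) * (u * warc u ^+ 3) * oo (- m) m u).
  rewrite -(@FTC_cc (fun u => z * (cos (z * u + c) * warc u) + sin (z * u + c) * (u * warc u ^+ 3))
    (fun u => sin (z * u + c) * warc u))//.
  - rewrite -RintegralZl// -RintegralB//.
      by apply: eq_Rintegral => u _; ring.
    apply: (@intg_cont_cc (fun u => z * (cos (z * u + c) * warc u) + sin (z * u + c) * (u * warc u ^+ 3))) => u /in1 h.
    apply: contD; apply: contM => //; first exact: cont_cst.
      by apply: contM => //; exact: cont_warc.
    by apply: contM; [exact: isd_cont (isd_id u)|exact: cw3].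
  - move=> u /in1 h; apply: isd_eq (isdM (isd_sin (dp u)) (isd_warc h)) _; ring.
  - move=> u /in1 h; apply: contD; apply: contM => //; first exact: cont_cst.
      by apply: contM => //; exact: cont_warc.
    by apply: contM; [exact: isd_cont (isd_id u)|exact: cw3].
have wN : warc (- m) = warc m by rewrite /warc sqrrN.
have wm : warc m <= (Num.sqrt (1 - m))^-1 by apply: warc_le; lra.
have w0 := warc_ge0 m.
have bnd : `|\int[leb]_u (sin (z * u + c) * (u * warc u ^+ 3) * oo (- m) m u)| <= 2 * warc m.
  have h : \int[leb]_u (warc u ^+ 3 * oo (- m) m u) = m * warc m - (- m) * warc (- m).
    apply: (@FTC_cc (fun u => warc u ^+ 3) (fun u => u * warc u)) => // u /in1 ?; [exact: isd_uwarc|exact: cw3].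
  apply: (@le_trans _ _ (\int[leb]_u (warc u ^+ 3 * oo (- m) m u))).
    apply: normr_Rint_le.
    - by apply: (@intg_cont_cc (fun u => warc u ^+ 3)) => u /in1; exact: cw3.
    - exact: intg_measurable i2.
    - move=> u; rewrite !normrM normr_oo /oo.
      case: (boolP (- m < u < m)) => [/cont_norm_le/in1 h1|]; last by rewrite !mulr0.
      rewrite /= !mulr1 (ger0_norm (warc_ge0 u)) -[warc u * (warc u * warc u)]/(warc u ^+ 3) mulrA.
      rewrite ler_piMl ?exprn_ge0 ?warc_ge0//.
      by rewrite mulr_ile1 ?norm_sin_le1// ltW// ltr_norml.
  rewrite h wN; nra.
rewrite -/I1 invfM mulrCA mulrC -ler_pdivrMr ?invr_gt0 ?normr_gt0// invrK mulrC -normrM e wN.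
apply: (le_trans (ler_normB _ _)).
apply: (@le_trans _ _ (2 * warc m + 2 * warc m)); last lra.
apply: lerD => //; apply: (le_trans (ler_normB _ _)).
rewrite !normrM (ger0_norm w0).
have := norm_sin_le1 (z * m + c); have := norm_sin_le1 (z * - m + c); nra.
Qed.

(** On [m, v] the weight is at most (1 - u)^(-1/2), whose primitive is -2 sqrt(1 - u). *)
Lemma asin_tail (m v : R) : 0 <= m -> m < v -> v < 1 ->
  asin v - asin m <= 2 * Num.sqrt (1 - m).
Proof.
move=> m0 mv v1.
have in1 u : m <= u <= v -> -1 < u < 1 by move=> /andP[? ?]; apply/andP; split; lra.
have dS u : m <= u <= v -> isder u (fun u => - (2 * Num.sqrt (1 - u))) (Num.sqrt (1 - u))^-1.
  move=> h; have u1 : 0 < 1 - u by lra.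
  have s0 : Num.sqrt (1 - u) != 0 by rewrite gt_eqF// sqrtr_gt0.
  by isd_tac; field.
have cS u : m <= u <= v -> {for u, continuous (fun u : R => (Num.sqrt (1 - u))^-1)}.
  move=> h; have u1 : 0 < 1 - u by lra.
  have s0 : Num.sqrt (1 - u) != 0 by rewrite gt_eqF// sqrtr_gt0.
  by apply: isd_cont; isd.
have e1 := FTC_cc mv (fun u h => is_derive1_asin (in1 u h)) (fun u h => cont_warc (in1 u h)).
have e2 := FTC_cc mv dS cS.
have : asin v - asin m <= - (2 * Num.sqrt (1 - v)) - - (2 * Num.sqrt (1 - m)).
  rewrite -e1 -e2; apply: le_Rint.
  - by apply: intg_cont_cc => u /in1; exact: cont_warc.
  - exact: intg_cont_cc.
  - move=> u; rewrite /oo; case: (boolP (m < u < v)) => [h|]; last by rewrite !mulr0.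
    by rewrite !mulr1; apply: warc_le; lra.
have := sqrtr_ge0 (1 - v); lra.
Qed.

Lemma pi_le4 : pi <= 4 :> R.
Proof. by have /andP[_] := pihalf_02 R; lra. Qed.

Lemma intg_osc_warc (z c m : R) : intg leb (fun u => cos (z * u + c) * warc u * oo (- m) m u).
Proof.
apply: (@intg_ext _ _ _ leb (fun u => warc u * (cos (z * u + c) * oo (- m) m u))).
  by move=> u; ring.
apply: intg_bounded; first exact: intg_warc.
  apply: measurable_funM; last exact: measurable_oo.
  apply: measurableT_comp => //; first by apply: continuous_measurable_fun; exact: continuous_cos.
  exact: measurable_affine.
exists 1 => u; rewrite normrM normr_oo mulr_ile1 ?oo_ge0 ?oo_le1//.
exact: norm_cos_le1.
Qed.

Lemma osc_warc_trivial (z c m : R) :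
  `|\int[leb]_u (cos (z * u + c) * warc u * oo (- m) m u)| <= pi.
Proof.
rewrite -(@Rint_warc R); apply: normr_Rint_le; first exact: intg_warc.
  exact: intg_measurable (intg_osc_warc z c m).
move=> u; rewrite !normrM normr_oo (ger0_norm (warc_ge0 u)) -mulrA mulrCA ler_piMr ?warc_ge0//.
by rewrite mulr_ile1 ?oo_ge0 ?oo_le1// norm_cos_le1.
Qed.

(** Cutting at m = 1 - 1/|z| balances the two estimates: the core gives 4 |z|^(-1/2) by
    [osc_warc_core], and the mass 2 (asin v - asin m) of the two ends is again at most 4 |z|^(-1/2).
    For |z| <= 2 the trivial bound pi <= 4 is already below the claim. *)
Lemma osc_warc (z c v : R) : z != 0 -> 0 < v < 1 ->
  `|\int[leb]_u (cos (z * u + c) * warc u * oo (- v) v u)| <= 8 / Num.sqrt `|z|.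
Proof.
move=> z0 /andP[v0 v1].
have zp : 0 < `|z| by rewrite normr_gt0.
set s := Num.sqrt `|z|; have sp : 0 < s by rewrite sqrtr_gt0.
have ss : s ^+ 2 = `|z| by rewrite sqr_sqrtr// ltW.
have [z2|z2] := leP `|z| 2.
  apply: (le_trans (osc_warc_trivial z c v)); apply: (le_trans pi_le4).
  by rewrite ler_pdivlMr//; nra.
have iz : 0 < `|z|^-1 < 2^-1 by rewrite invr_gt0 zp ltf_pV2 ?posrE.
have sz : Num.sqrt `|z|^-1 = s^-1 by rewrite sqrtrV// ltW.
have e4 : 4 / (`|z| * s^-1) = 4 / s by rewrite -ss; field; rewrite gt_eqF.
have h4 : 4 / s <= 8 / s by rewrite ler_pM2r ?invr_gt0//; lra.
have [vm|vm] := leP v (1 - `|z|^-1).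
  apply: (le_trans (@osc_warc_core z c v z0 _)); first by rewrite v0 v1.
  apply: le_trans h4; rewrite -e4 ler_pM2l// lef_pV2 ?posrE ?mulr_gt0 ?sqrtr_gt0 ?invr_gt0//; last lra.
  by rewrite ler_pM2l// -sz ler_sqrt; lra.
pose m := 1 - `|z|^-1.
have m01 : 0 < m < 1 by rewrite /m; lra.
have i1 := intg_osc_warc z c v; have i2 := intg_osc_warc z c m.
have -> : \int[leb]_u (cos (z * u + c) * warc u * oo (- v) v u) =
   \int[leb]_u (cos (z * u + c) * warc u * oo (- m) m u) +
   \int[leb]_u (cos (z * u + c) * warc u * oo (- v) v u - cos (z * u + c) * warc u * oo (- m) m u).
  by rewrite RintegralB// addrC subrK.
apply: (le_trans (ler_normD _ _)).
have -> : 8 / s = 4 / s + 4 / s by field; rewrite gt_eqF.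
apply: lerD.
  by apply: (le_trans (@osc_warc_core z c m z0 m01)); rewrite /m subKr sz e4.
have wi x : 0 < x -> x < 1 -> intg leb (fun u => warc u * oo (- x) x u) /\
    \int[leb]_u (warc u * oo (- x) x u) = 2 * asin x.
  move=> x0 x1; have xx : - x < x by lra.
  have in1 u : - x <= u <= x -> -1 < u < 1 by lra.
  split; first by apply: intg_cont_cc => u /in1; exact: cont_warc.
  rewrite (FTC_cc xx (fun u h => is_derive1_asin (in1 u h)) (fun u h => cont_warc (in1 u h))).
  by rewrite asinN'; lra.
have [j1 f1] := wi v v0 v1; have [j2 f2] := wi m (proj1 (andP m01)) (proj2 (andP m01)).
apply: (@le_trans _ _ (\int[leb]_u (warc u * oo (- v) v u - warc u * oo (- m) m u))).
  apply: normr_Rint_le; [exact: intgB|exact: intg_measurable (intgB i1 i2)|move=> u].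
  have k0 : 0 <= oo (- v) v u - oo (- m) m u.
    rewrite /oo subr_ge0 ler_nat.
    by case: (boolP (- m < u < m)) => // /andP[h1 h2]; rewrite /m in h1 h2 vm *; rewrite (_ : - v < u < v)//; lra.
  rewrite -[leRHS]mulrBr -[X in `|X|]mulrBr -mulrA normrM [X in _ * X]ger0_norm ?mulr_ge0 ?warc_ge0//.
  by rewrite ler_piMl ?norm_cos_le1// mulr_ge0 ?warc_ge0.
rewrite RintegralB// f1 f2.
have := @asin_tail m v; rewrite {4}/m subKr sz => h.
have : asin v - asin m <= 2 / s by apply: h; rewrite /m; lra.
have -> : 4 / s = 2 * (2 / s) by field; rewrite gt_eqF.
by move=> ?; rewrite -mulrBr ler_pM2l.
Qed.

End Oscillation.

(** * The light-cone radius of the kernel and its estimates *)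

Section KernelBounds.
Variable R : realType.
Local Notation leb := (@lebesgue_measure R).

(* With A and B the two light-cone coordinates relative to (x1, y1), the kernel
   is the fundamental solution 1/(2 pi sqrt(A B - x2^2)) of the wave equation in
   2+1 dimensions; r is its radius in the variable x2. *)
Definition kA (x1 y : R) : R := (y ^+ 3 - x1 ^+ 3) / 3.
Definition kB (tau x1 y : R) : R := 2 * tau + x1 - y.
Definition kr (tau x1 y : R) : R := Num.sqrt (kA x1 y * kB tau x1 y).

(** The difference of the two sides is (y - x1) (y + x1)^2 / 4, so the bound holds for every x1,
    with equality at y = - x1. The cube is the vanishing order of A at the degenerate point x1 =
    0. *)
Lemma kA_ge (x1 y : R) : x1 <= y -> (y - x1) ^+ 3 / 12 <= kA x1 y.
Proof.
move=> h; rewrite /kA -subr_ge0.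
have -> : (y ^+ 3 - x1 ^+ 3) / 3 - (y - x1) ^+ 3 / 12 = (y - x1) * (y + x1) ^+ 2 / 4 by field.
by rewrite divr_ge0// mulr_ge0 ?sqr_ge0// subr_ge0.
Qed.

Lemma kA_gt0 (x1 y : R) : x1 < y -> 0 < kA x1 y.
Proof.
move=> h; apply: lt_le_trans (kA_ge (ltW h)).
by rewrite divr_gt0// exprn_gt0// subr_gt0.
Qed.

Lemma kA_le (x1 y z : R) : y <= z -> kA x1 y <= kA x1 z.
Proof.
move=> h; rewrite /kA ler_pM2r// lerD2r -subr_ge0.
have -> : z ^+ 3 - y ^+ 3 = (z - y) * ((2 * z + y) ^+ 2 + 3 * y ^+ 2) / 4 by field.
rewrite divr_ge0// mulr_ge0 ?subr_ge0//.
by have := sqr_ge0 (2 * z + y); have := sqr_ge0 y; lra.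
Qed.

Section fixed.
Variables (tau x1 : R).
Hypothesis tau0 : 0 < tau.
Let A := kA x1.
Let B := kB tau x1.
Let r := kr tau x1.
Let Amax := A (x1 + 2 * tau).

Lemma kAB_gt0 y : x1 < y < x1 + 2 * tau -> 0 < A y /\ 0 < B y.
Proof. by move=> h; split; [apply: kA_gt0; lra|rewrite /B /kB; lra]. Qed.

Lemma kr_gt0 y : x1 < y < x1 + 2 * tau -> 0 < r y.
Proof. by move=> /kAB_gt0[h1 h2]; rewrite /r /kr sqrtr_gt0 mulr_gt0. Qed.

Let dA y : isder y A (y ^+ 2).
Proof. by rewrite /A /kA; isd_tac; field. Qed.

Let dB y : isder y B (- 1).
Proof. by rewrite /B /kB; isd_tac; ring. Qed.

Let rE y : x1 < y < x1 + 2 * tau -> r y = Num.sqrt (A y) * Num.sqrt (B y).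
Proof. by move=> /kAB_gt0[h1 h2]; rewrite /r /kr sqrtrM// ltW. Qed.

Definition kr' (y : R) := (y ^+ 2 * B y - A y) / (2 * r y).

Lemma isd_kr y : x1 < y < x1 + 2 * tau -> isder y r (kr' y).
Proof.
move=> h; have [h1 h2] := kAB_gt0 h; have r0 := kr_gt0 h.
have hAB : 0 < A y * B y by exact: mulr_gt0.
have dAB : isder y (fun y => A y * B y) (y ^+ 2 * B y - A y).
  by apply: isd_eq (isdM (dA y) (dB y)) _; ring.
exact: (@isd_sqrt _ (fun y => A y * B y) _ _ hAB dAB).
Qed.

(** An increasing function whose derivative dominates the derivative of r = sqrt(A) sqrt(B): in the
    product rule sqrt(B) is replaced by its bound sqrt(2 tau), sqrt(A) by its bound sqrt(Amax), and
    the minus sign makes both terms increase. *)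
Let v (y : R) := Num.sqrt (2 * tau) * Num.sqrt (A y) - Num.sqrt Amax * Num.sqrt (B y).
Let v' (y : R) := Num.sqrt (2 * tau) * (y ^+ 2 / (2 * Num.sqrt (A y)))
  + Num.sqrt Amax / (2 * Num.sqrt (B y)).

(** An instance of [osc_parts] in which the increment of v is at most 2 sqrt(2 tau) sqrt(Amax),
    whatever a and b; the singularities at the two ends of the support therefore cost nothing. *)
Lemma osc_space (a b xi s c : R) : x1 < a -> a < b -> b < x1 + 2 * tau -> xi != 0 ->
  `|\int[leb]_y (cos (xi * y + s * r y + c) * oo a b y)| <=
  (2 + `|s| * (2 * Num.sqrt (2 * tau) * Num.sqrt Amax)) / `|xi|.
Proof.
move=> xa ab bx xi0.
have inI y : a <= y <= b -> x1 < y < x1 + 2 * tau by lra.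
have dv y : a <= y <= b -> isder y v (v' y).
  move=> /inI h; have [h1 h2] := kAB_gt0 h.
  have dA' := dA y; have dB' := dB y.
  rewrite /v /v'; isd_tac; field.
  by rewrite !gt_eqF ?sqrtr_gt0.
have sA y : x1 < y < x1 + 2 * tau -> Num.sqrt (A y) != 0 /\ Num.sqrt (B y) != 0.
  by move=> /kAB_gt0[h1 h2]; rewrite !gt_eqF ?sqrtr_gt0.
have cv y : a <= y <= b -> {for y, continuous v'}.
  move=> /inI h; have [h1 h2] := kAB_gt0 h; have [s1 s2] := sA _ h.
  have dA' := dA y; have dB' := dB y.
  apply: isd_cont; rewrite /v'; isd => //; by cbv beta; rewrite mulf_neq0.
have cr y : a <= y <= b -> {for y, continuous kr'}.
  move=> /inI h; have dA' := dA y; have dB' := dB y; have dr' := isd_kr h.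
  apply: isd_cont; rewrite /kr'; isd.
  by cbv beta; rewrite mulf_neq0// gt_eqF// kr_gt0.
apply: (le_trans (@osc_parts _ a b xi s c r kr' v v' ab xi0 _ _ _ _ _)) => //.
- by move=> y /inI; exact: isd_kr.
- move=> y /inI h; have [h1 h2] := kAB_gt0 h; have [s1 s2] := sA _ h.
  have pA : 0 < Num.sqrt (A y) by rewrite sqrtr_gt0.
  have pB : 0 < Num.sqrt (B y) by rewrite sqrtr_gt0.
  have eA : Num.sqrt (A y) ^+ 2 = A y by rewrite sqr_sqrtr// ltW.
  have eB : Num.sqrt (B y) ^+ 2 = B y by rewrite sqr_sqrtr// ltW.
  have -> : kr' y = Num.sqrt (B y) * (y ^+ 2 / (2 * Num.sqrt (A y))) - Num.sqrt (A y) / (2 * Num.sqrt (B y)).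
    by rewrite /kr' rE// -{1}eA -{1}eB; field; rewrite s1 s2.
  have lA : Num.sqrt (A y) <= Num.sqrt Amax by apply: ler_wsqrtr; apply: kA_le; lra.
  have lB : Num.sqrt (B y) <= Num.sqrt (2 * tau) by apply: ler_wsqrtr; rewrite /B /kB; lra.
  apply: (le_trans (ler_normB _ _)); apply: lerD.
    have k0 : 0 <= y ^+ 2 / (2 * Num.sqrt (A y)).
      by apply: divr_ge0; [exact: sqr_ge0|apply: ltW; rewrite mulr_gt0].
    by rewrite ger0_norm; [rewrite ler_wpM2r|apply: mulr_ge0 => //; exact: ltW].
  have k0 : 0 <= (2 * Num.sqrt (B y))^-1 by rewrite invr_ge0 mulr_ge0// ltW.
  by rewrite ger0_norm; [rewrite ler_wpM2r|apply: mulr_ge0 => //; exact: ltW].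
rewrite ler_pM2r ?invr_gt0 ?normr_gt0// lerD2l ler_wpM2l// /v.
have h1 : Num.sqrt (A b) <= Num.sqrt Amax by apply: ler_wsqrtr; apply: kA_le; lra.
have h2 : Num.sqrt (B a) <= Num.sqrt (2 * tau) by apply: ler_wsqrtr; rewrite /B /kB; lra.
have := sqrtr_ge0 (A a); have := sqrtr_ge0 (B b); have := sqrtr_ge0 (2 * tau); have := sqrtr_ge0 Amax.
by have := sqrtr_ge0 (B a); have := sqrtr_ge0 (A b); nra.
Qed.

Let q4 (x : R) := Num.sqrt (Num.sqrt x).

Let q4_gt0 (x : R) : 0 < x -> 0 < q4 x.
Proof. by move=> h; rewrite /q4 !sqrtr_gt0. Qed.

Let q4X (x : R) : 0 <= x -> q4 x ^+ 4 = x.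
Proof. by move=> h; rewrite (exprM _ 2 2) /q4 !sqr_sqrtr// sqrtr_ge0. Qed.

Let q4_le x y : x <= y -> q4 x <= q4 y.
Proof. by move=> h; rewrite /q4; do 2 apply: ler_wsqrtr. Qed.

Let q4_2 : q4 (2 * tau) <= 2 * q4 tau.
Proof.
rewrite -(@ler_pXn2r _ 4)// ?nnegrE ?mulr_ge0 ?sqrtr_ge0//.
have e1 : q4 (2 * tau) ^+ 4 = 2 * tau by apply: q4X; rewrite mulr_ge0// ltW.
have e2 : q4 tau ^+ 4 = tau by apply: q4X; exact: ltW.
have -> : (2 * q4 tau) ^+ 4 = 16 * q4 tau ^+ 4 by ring.
by rewrite e1 e2; have := tau0; lra.
Qed.

Let dq4 (g : R -> R) (x b : R) : 0 < g x -> isder x g b -> isder x (fun y : R => q4 (g y)) (b / (4 * q4 (g x) ^+ 3)).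
Proof.
move=> h dg; have s0 : 0 < Num.sqrt (g x) by rewrite sqrtr_gt0.
have ds := isd_sqrt h dg.
apply: (isd_eq (@isd_sqrt _ (fun y => Num.sqrt (g y)) _ _ s0 ds)).
have e : Num.sqrt (g x) = q4 (g x) ^+ 2 by rewrite /q4 sqr_sqrtr// ltW.
have n0 : q4 (g x) != 0 by rewrite gt_eqF// q4_gt0.
by rewrite -/(q4 (g x)) e; field.
Qed.

(** With D and E the fourth roots of y - x1 and B, r^(-1/2) = (A B)^(-1/4) is at most 2 / (D^3 E).
    Since D^4 + E^4 = 2 tau, one of D, E is at least de = tau^(1/4), which separates the product
    into w. Its primitive W changes by at most 2 (8 + 32/3) < 38, as D and E stay below 2 de. The
    bound is free of tau because the integral is scale invariant. *)
Lemma int_kr_quarter (a b : R) : x1 < a -> a < b -> b < x1 + 2 * tau ->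
  intg leb (fun y => (Num.sqrt (r y))^-1 * oo a b y) /\
  \int[leb]_y ((Num.sqrt (r y))^-1 * oo a b y) <= 38.
Proof.
move=> xa ab bx.
have t0 := tau0.
have inI y : a <= y <= b -> x1 < y < x1 + 2 * tau by lra.
pose de := q4 tau; have de0 : 0 < de by exact: q4_gt0.
pose D y := q4 (y - x1); pose E y := q4 (B y).
have D0 y : x1 < y < x1 + 2 * tau -> 0 < D y by move=> h; apply: q4_gt0; lra.
have E0 y : x1 < y < x1 + 2 * tau -> 0 < E y by move=> /kAB_gt0[_ ?]; exact: q4_gt0.
pose W y := 2 * (4 * D y / de - 4 / 3 * E y ^+ 3 / de ^+ 3).
pose w y := 2 * ((D y ^+ 3 * de)^-1 + (de ^+ 3 * E y)^-1).
have dD y : x1 < y < x1 + 2 * tau -> isder y D (1 / (4 * D y ^+ 3)).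
  by move=> h; apply: (@dq4 (fun y => y - x1)); [lra|isd_tac; ring].
have dE y : x1 < y < x1 + 2 * tau -> isder y E (- 1 / (4 * E y ^+ 3)).
  by move=> /kAB_gt0[_ ?]; apply: dq4.
have dW y : a <= y <= b -> isder y W (w y).
  move=> /inI h; have h1 := dD _ h; have h2 := dE _ h.
  have n1 := D0 _ h; have n2 := E0 _ h.
  rewrite /W /w; isd_tac; field.
  by rewrite !gt_eqF.
have cw y : a <= y <= b -> {for y, continuous w}.
  move=> /inI h; have h1 := dD _ h; have h2 := dE _ h.
  have n1 := D0 _ h; have n2 := E0 _ h.
  by apply: isd_cont; rewrite /w; isd; cbv beta; rewrite mulf_neq0 ?expf_neq0 ?gt_eqF.
have iw : intg leb (fun y => w y * oo a b y) by exact: intg_cont_cc.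
have cr y : a <= y <= b -> {for y, continuous (fun y => (Num.sqrt (r y))^-1)}.
  move=> /inI h; have dr' := isd_kr h; have r0 := kr_gt0 h.
  by apply: isd_cont; isd => //; cbv beta; rewrite gt_eqF// sqrtr_gt0.
have ir := intg_cont_cc cr.
split => //.
apply: (@le_trans _ _ (\int[leb]_y (w y * oo a b y))).
  apply: le_Rint => // y; rewrite /oo; case: (boolP (a < y < b)) => [h|]; last by rewrite !mulr0.
  have {}h := inI _ (cont_norm_le h).
  have r0 := kr_gt0 h; have n1 := D0 _ h; have n2 := E0 _ h; have [A0 B0] := kAB_gt0 h.
  rewrite !mulr1.
  have DE0 : 0 < D y ^+ 3 * E y by rewrite mulr_gt0// exprn_gt0.
  (* Fourth powers are compared; the constant 12 of [kA_ge] is relaxed to 16 = 2^4. *)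
  have l1 : D y ^+ 3 * E y / 2 <= Num.sqrt (r y).
    rewrite -(@ler_pXn2r _ 4)// ?nnegrE ?sqrtr_ge0//; last by rewrite divr_ge0// ltW.
    rewrite (exprM _ 2 2 : Num.sqrt (r y) ^+ 4 = _) sqr_sqrtr ?(ltW r0)//.
    rewrite /r /kr sqr_sqrtr; last by rewrite mulr_ge0// ltW.
    apply: (@le_trans _ _ ((y - x1) ^+ 3 / 12 * B y)); last by rewrite ler_wpM2r ?(ltW B0)//; apply: kA_ge; lra.
    have -> : (D y ^+ 3 * E y / 2) ^+ 4 = (D y ^+ 4) ^+ 3 * E y ^+ 4 / 16 by field.
    rewrite /D /E !q4X; [|exact: ltW|lra].
    have : 0 <= (y - x1) ^+ 3 * B y by rewrite mulr_ge0 ?exprn_ge0//; [lra|exact: ltW].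
    lra.
  apply: (@le_trans _ _ (2 * (D y ^+ 3 * E y)^-1)).
    have -> : 2 * (D y ^+ 3 * E y)^-1 = (D y ^+ 3 * E y / 2)^-1 by rewrite invf_div.
    have sr : 0 < Num.sqrt (r y) by rewrite sqrtr_gt0.
    by rewrite lef_pV2// posrE divr_gt0.
  rewrite /w ler_pM2l//.
  have [h1|h1] := leP tau (B y).
    have : de <= E y by exact: q4_le.
    move=> h2; rewrite -[leLHS]addr0; apply: lerD; last by rewrite invr_ge0 mulr_ge0 ?exprn_ge0// ltW.
    by rewrite lef_pV2 ?posrE ?mulr_gt0 ?exprn_gt0// ler_pM2l// exprn_gt0.
  have h2 : de <= D y by apply: q4_le; move: h1; rewrite /B /kB; lra.
  rewrite -[leLHS]add0r; apply: lerD; first by rewrite invr_ge0 mulr_ge0 ?exprn_ge0// ltW.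
  rewrite lef_pV2 ?posrE ?mulr_gt0 ?exprn_gt0// ler_pM2r//.
  by rewrite ler_pXn2r// nnegrE ltW.
rewrite (FTC_cc ab dW cw) /W.
have hb : a <= b <= b by lra.
have ha : a <= a <= b by lra.
have Db : D b / de <= 2.
  by rewrite ler_pdivrMr//; apply: le_trans q4_2; apply: q4_le; lra.
have Ea : E a / de <= 2.
  by rewrite ler_pdivrMr//; apply: le_trans q4_2; apply: q4_le; rewrite /B /kB; lra.
have Da0 : 0 <= D a / de by rewrite divr_ge0// ltW// D0// inI.
have Ea0 : 0 <= E a / de by rewrite divr_ge0// ltW// E0// inI.
have Eb0 : 0 <= E b / de by rewrite divr_ge0// ltW// E0// inI.
have Ea3 : (E a / de) ^+ 3 <= 2 ^+ 3 by rewrite ler_pXn2r// nnegrE.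
have Eb3 : 0 <= (E b / de) ^+ 3 by rewrite exprn_ge0.
move: Ea3 Eb3; rewrite !expr_div_n -!mulrA => Ea3 Eb3.
by rewrite !mulrA in Ea3 Eb3 *; rewrite -!mulrA; lra.
Qed.

End fixed.
End KernelBounds.

(** * Syntax-directed measurability *)

(** A head symbol on which [meas1] can match the shape of the function. *)
Definition mfun d (T : measurableType d) (R : realType) (f : T -> R) : Prop :=
  measurable_fun [set: T] f.

Section MeasurabilityKit.
Context d (T : measurableType d) (R : realType).
Implicit Types f g : T -> R.

Lemma mfunE f : mfun f -> measurable_fun [set: T] f. Proof. by []. Qed.

Lemma mfunI f : measurable_fun [set: T] f -> mfun f. Proof. by []. Qed.

Lemma mf_cst (c : R) : mfun (fun _ : T => c). Proof. exact: measurable_cst. Qed.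

Lemma mfD f g : mfun f -> mfun g -> mfun (fun x => f x + g x).
Proof. exact: measurable_funD. Qed.

Lemma mfN f : mfun f -> mfun (fun x => - f x).
Proof. exact: measurable_funN. Qed.

Lemma mfM f g : mfun f -> mfun g -> mfun (fun x => f x * g x).
Proof. exact: measurable_funM. Qed.

Lemma mfX f n : mfun f -> mfun (fun x => f x ^+ n).
Proof. exact: measurable_funX. Qed.

Lemma mf_comp (h : R -> R) f : measurable_fun [set: R] h -> mfun f -> mfun (fun x => h (f x)).
Proof. by move=> mh mf; exact: measurableT_comp mh mf. Qed.

Lemma mf_compR (h : measurableTypeR R -> R) f : mfun h -> mfun f -> mfun (fun x => h (f x)).
Proof. by move=> mh mf; exact: measurableT_comp mh mf. Qed.

Lemma mf_norm f : mfun f -> mfun (fun x => `|f x|).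
Proof. by apply: mf_comp; apply: continuous_measurable_fun; exact: norm_continuous. Qed.

Lemma mf_sqrt f : mfun f -> mfun (fun x => Num.sqrt (f x)).
Proof. by apply: mf_comp; apply: continuous_measurable_fun; exact: sqrt_continuous. Qed.

Lemma mf_cos f : mfun f -> mfun (fun x => cos (f x)).
Proof. by apply: mf_comp; apply: continuous_measurable_fun; exact: continuous_cos. Qed.

Lemma mf_sin f : mfun f -> mfun (fun x => sin (f x)).
Proof. by apply: mf_comp; apply: continuous_measurable_fun; exact: continuous_sin. Qed.

Lemma mf_exp f : mfun f -> mfun (fun x => expR (f x)).
Proof. by apply: mf_comp; exact: measurable_expR. Qed.

(** Inversion jumps at 0, where its value is 0; the continuous functions y / (y^2 + 1/(n+1)) of y
    have the right limit there as well. *)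
Lemma mfV f : mfun f -> mfun (fun x => (f x)^-1).
Proof.
move=> mf; apply: (@measurable_fun_cvg _ _ _ _ (fun n x => f x / (f x ^+ 2 + n.+1%:R^-1))).
  move=> n; apply: mfM => //.
  pose h (y : R) := (y ^+ 2 + n.+1%:R^-1)^-1.
  have ch : continuous h.
    move=> y; have p : y ^+ 2 + n.+1%:R^-1 != 0 by rewrite gt_eqF// ltr_wpDl ?sqr_ge0// invr_gt0.
    apply: (@isd_cont _ _ _ (- (2 * y) / (y ^+ 2 + n.+1%:R^-1) ^+ 2)).
    by apply: (@isdV _ (fun y : R => y ^+ 2 + n.+1%:R^-1)) => //; isd_tac; ring.
  by apply: (mf_comp (h := h)) => //; exact: continuous_measurable_fun.
move=> x _; have [->|fx] := eqVneq (f x) 0.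
  by under eq_fun do rewrite mul0r; rewrite invr0; exact: cvg_cst.
have -> : (f x)^-1 = f x / (f x ^+ 2 + 0) by rewrite addr0 expr2 invfM mulVKf.
apply: cvgM; first exact: cvg_cst.
apply: cvgV; first by rewrite addr0 expf_neq0.
by apply: cvgD; [exact: cvg_cst|exact: cvg_harmonic].
Qed.

Lemma mf_if (b : T -> bool) f g : measurable_fun [set: T] b -> mfun f -> mfun g ->
  mfun (fun x => if b x then f x else g x).
Proof. exact: measurable_fun_ifT. Qed.

Lemma mb_and (b c : T -> bool) : measurable_fun [set: T] b -> measurable_fun [set: T] c ->
  measurable_fun [set: T] (fun x => b x && c x).
Proof. exact: measurable_and. Qed.

Lemma mb_lt f g : mfun f -> mfun g -> measurable_fun [set: T] (fun x => f x < g x).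
Proof. exact: measurable_fun_ltr. Qed.

Lemma mf_oo f g h : mfun f -> mfun g -> mfun h -> mfun (fun x => oo (f x) (g x) (h x)).
Proof.
move=> mf mg mh; rewrite (_ : (fun x => _) = (fun x => if (f x < h x) && (h x < g x) then 1 else 0)).
  by apply: mf_if; [apply: mb_and; exact: mb_lt|exact: mf_cst|exact: mf_cst].
by apply/funext => x; rewrite /oo; case: ifP.
Qed.

Lemma mf_warc f : mfun f -> mfun (fun x => warc (f x)).
Proof.
move=> mf; rewrite /warc; apply: mfV; apply: mf_sqrt; apply: mfD; first exact: mf_cst.
by apply: mfN; exact: mfX.
Qed.

Lemma mf_fst d2 (T2 : measurableType d2) (f : T -> measurableTypeR R * T2) :
  measurable_fun setT f -> mfun (fun x => (f x).1).
Proof. by move=> mf; exact: measurableT_comp measurable_fst mf. Qed.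

Lemma mf_snd d2 (T2 : measurableType d2) (f : T -> T2 * measurableTypeR R) :
  measurable_fun setT f -> mfun (fun x => (f x).2).
Proof. by move=> mf; exact: measurableT_comp measurable_snd mf. Qed.

End MeasurabilityKit.

Lemma mf_id (R : realType) : mfun (fun x : measurableTypeR R => x : R).
Proof. exact: measurable_id. Qed.

Lemma mm_fst d d1 d2 (T : measurableType d) (T1 : measurableType d1) (T2 : measurableType d2)
  (f : T -> T1 * T2) : measurable_fun setT f -> measurable_fun setT (fun x => (f x).1).
Proof. by move=> mf; exact: measurableT_comp measurable_fst mf. Qed.

Lemma mm_snd d d1 d2 (T : measurableType d) (T1 : measurableType d1) (T2 : measurableType d2)
  (f : T -> T1 * T2) : measurable_fun setT f -> measurable_fun setT (fun x => (f x).2).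
Proof. by move=> mf; exact: measurableT_comp measurable_snd mf. Qed.

Lemma mm_pair d d1 d2 (T : measurableType d) (T1 : measurableType d1) (T2 : measurableType d2)
  (f : T -> T1) (g : T -> T2) : measurable_fun setT f -> measurable_fun setT g ->
  measurable_fun setT (fun x => (f x, g x)).
Proof. exact: measurable_fun_pair. Qed.

Lemma mm_pairR d d2 (T : measurableType d) (R : realType) (T2 : measurableType d2)
  (f : T -> R) (g : T -> T2) : mfun f -> measurable_fun setT g ->
  measurable_fun setT (fun x => (f x : measurableTypeR R, g x)).
Proof. by move=> mf mg; apply: measurable_fun_pair. Qed.

Lemma mm_pairRR d (T : measurableType d) (R : realType)
  (f : T -> R) (g : T -> R) : mfun f -> mfun g ->
  measurable_fun setT (fun x => (f x : measurableTypeR R, g x : measurableTypeR R)).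
Proof. by move=> mf mg; apply: measurable_fun_pair. Qed.

Ltac meas1 := match goal with
  | |- mfun _ => eassumption
  | |- mfun (fun _ => ?c) => apply: mf_cst
  | |- mfun (fun x => x) => exact: measurable_id
  | |- mfun (fun x => - @?f x) => apply: (@mfN _ _ _ f)
  | |- mfun (fun x => @?f x + @?g x) => apply: (@mfD _ _ _ f g)
  | |- mfun (fun x => @?f x * @?g x) => apply: (@mfM _ _ _ f g)
  | |- mfun (fun x => (@?f x) ^+ _) => apply: (@mfX _ _ _ f)
  | |- mfun (fun x => (@?f x)^-1) => apply: (@mfV _ _ _ f)
  | |- mfun (fun x => `|@?f x|) => apply: (@mf_norm _ _ _ f)
  | |- mfun (fun x => Num.sqrt (@?f x)) => apply: (@mf_sqrt _ _ _ f)
  | |- mfun (fun x => cos (@?f x)) => apply: (@mf_cos _ _ _ f)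
  | |- mfun (fun x => sin (@?f x)) => apply: (@mf_sin _ _ _ f)
  | |- mfun (fun x => expR (@?f x)) => apply: (@mf_exp _ _ _ f)
  | |- mfun (fun x => warc (@?f x)) => apply: (@mf_warc _ _ _ f)
  | |- mfun (fun x => oo (@?f x) (@?g x) (@?h x)) => apply: (@mf_oo _ _ _ f g h)
  | |- mfun (fun x => fst (@?f x)) => apply: (@mf_fst _ _ _ _ _ f)
  | |- mfun (fun x => snd (@?f x)) => apply: (@mf_snd _ _ _ _ _ f)
  | |- measurable_fun _ (fun x => @?b x && @?c x) => apply: (@mb_and _ _ b c)
  | |- measurable_fun _ (fun x => @?f x < @?g x) => apply: (@mb_lt _ _ _ f g)
  | |- measurable_fun _ (fun x => x) => exact: measurable_id
  | |- measurable_fun _ (fun x => fst (@?f x)) => apply: (@mm_fst _ _ _ _ _ _ f)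
  | |- measurable_fun _ (fun x => snd (@?f x)) => apply: (@mm_snd _ _ _ _ _ _ f)
  | |- measurable_fun _ (fun x => (@?f x, @?g x)) =>
      first [apply: (@mm_pairRR _ _ _ f g) | apply: (@mm_pairR _ _ _ _ _ f g) | apply: (@mm_pair _ _ _ _ _ _ f g)]
  | |- mfun fst => exact: measurable_fst
  | |- mfun snd => exact: measurable_snd
  | |- measurable_fun _ fst => exact: measurable_fst
  | |- measurable_fun _ snd => exact: measurable_snd
  | |- mfun _ => apply: mf_if
  end.
Ltac meas := repeat (cbv beta; meas1).

(** * Two-dimensional oscillatory integrals of the kernel *)

Section KernelOscillation.
Variable R : realType.
Local Notation leb := (@lebesgue_measure R).

Lemma Rint_oo1 (a b : R) : a < b -> \int[leb]_y oo a b y = b - a.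
Proof.
move=> ab; rewrite -(@FTC_cc _ (fun=> 1) (fun y => y) _ _ ab).
- by apply: eq_Rintegral => y _; rewrite mul1r.
- by move=> y _; exact: isd_id.
- by move=> y _; exact: cst_continuous.
Qed.

(** The point z is (y1, u) with u the rescaled transverse variable: the Jacobian kr has cancelled
    the factor kr^-1 of the kernel, so only the arcsine weight, the phase and the truncations
    remain. *)
Definition oscJ (tau x1 a b v xi1 xi2 c : R) (z : plane R) : R :=
  oo a b z.1 * (cos (xi1 * z.1 + xi2 * kr tau x1 z.1 * z.2 + c) * warc z.2 * oo (- v) v z.2).

Section fixed.
Variables (tau x1 a b v : R).
Hypotheses (tau0 : 0 < tau) (xa : x1 < a) (ab : a < b) (bx : b < x1 + 2 * tau).
Hypothesis (v01 : 0 < v < 1).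
Let r := kr tau x1.

Lemma mf_kr d (T : measurableType d) (t x y : T -> R) : mfun t -> mfun x -> mfun y ->
  mfun (fun z => kr (t z) (x z) (y z)).
Proof. by move=> mt mx my; rewrite /kr /kA /kB; meas. Qed.

Lemma measurable_kr : mfun (fun y : measurableTypeR R => r y).
Proof. by apply: mf_kr; meas. Qed.

Local Notation J := (oscJ tau x1 a b v).

Let mJ xi1 xi2 c : measurable_fun setT (J xi1 xi2 c).
Proof.
apply: mfunE; rewrite /oscJ; meas.
by apply: mf_kr; meas.
Qed.

Lemma intg_oscJ xi1 xi2 c : intg (leb2 R) (J xi1 xi2 c).
Proof.
apply: (intg_le (mJ _ _ _) (intg_prod (intg_oo1 a b) (intg_warc R))) => z.
rewrite /oscJ normrM normr_oo ler_wpM2l ?oo_ge0//.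
rewrite !normrM normr_oo (ger0_norm (warc_ge0 _)) -mulrA mulrCA ler_piMr ?warc_ge0//.
by rewrite mulr_ile1 ?oo_ge0 ?oo_le1// norm_cos_le1.
Qed.

Let JE xi1 xi2 c : \int[leb2 R]_z J xi1 xi2 c z = \int[leb]_y (oo a b y *
   \int[leb]_u (cos ((xi2 * r y) * u + (xi1 * y + c)) * warc u * oo (- v) v u)).
Proof.
rewrite (Rint_leb2 (intg_oscJ xi1 xi2 c)); apply: eq_Rintegral => y _; rewrite -RintegralZl//; last exact: intg_osc_warc.
by apply: eq_Rintegral => u _; rewrite /oscJ /r /=; congr (_ * (cos _ * _ * _)); ring.
Qed.

Lemma kernel_bound0 xi1 xi2 c : `|\int[leb2 R]_z J xi1 xi2 c z| <= 2 * tau * pi.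
Proof.
rewrite JE; apply: (@le_trans _ _ (\int[leb]_y (pi * oo a b y))).
  apply: normr_Rint_le; first exact: intg_oo_const.
    rewrite (_ : (fun y => _) = (fun y => \int[leb]_u J xi1 xi2 c (y, u))).
      exact: intg_measurable (proj1 (Rfubini1 (intg_oscJ xi1 xi2 c))).
    apply/funext => y; rewrite -RintegralZl//; last exact: intg_osc_warc.
    by apply: eq_Rintegral => u _; rewrite /oscJ /r /=; congr (_ * (cos _ * _ * _)); ring.
  move=> y; rewrite normrM normr_oo mulrC ler_wpM2r ?oo_ge0//; exact: osc_warc_trivial.
rewrite RintegralZl//; last exact: intg_oo1.
rewrite mulrC ler_wpM2r ?pi_ge0//.
rewrite Rint_oo1//.
by have := xa; have := bx; lra.
Qed.

(** The inner integral in u has frequency xi2 r(y), hence size at most 8 (|xi2| r(y))^(-1/2); the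
    integral of r^(-1/2) is at most 38, and 304 = 8 * 38. *)
Lemma kernel_bound2 xi1 xi2 c : xi2 != 0 -> `|\int[leb2 R]_z J xi1 xi2 c z| <= 304 / Num.sqrt `|xi2|.
Proof.
move=> xi20; rewrite JE.
have [ir rle] := int_kr_quarter tau0 xa ab bx.
have s0 : 0 < Num.sqrt `|xi2| by rewrite sqrtr_gt0 normr_gt0.
apply: (@le_trans _ _ (\int[leb]_y (8 / Num.sqrt `|xi2| * ((Num.sqrt (r y))^-1 * oo a b y)))).
  apply: normr_Rint_le; first exact: intgZl.
    rewrite (_ : (fun y => _) = (fun y => \int[leb]_u J xi1 xi2 c (y, u))).
      exact: intg_measurable (proj1 (Rfubini1 (intg_oscJ xi1 xi2 c))).
    apply/funext => y; rewrite -RintegralZl//; last exact: intg_osc_warc.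
    by apply: eq_Rintegral => u _; rewrite /oscJ /r /=; congr (_ * (cos _ * _ * _)); ring.
  move=> y; rewrite normrM normr_oo mulrA [leRHS]mulrC [oo a b y]/oo.
  case: (boolP (a < y < b)) => [h|]; last by rewrite !mul0r.
  have h' : x1 < y < x1 + 2 * tau by have := xa; have := bx; lra.
  have r0 : 0 < r y by exact: kr_gt0.
  have n0 : xi2 * r y != 0 by rewrite mulf_neq0// gt_eqF.
  rewrite mul1r [leRHS]mul1r; apply: (le_trans (osc_warc _ n0 v01)).
  by rewrite normrM (gtr0_norm r0) sqrtrM// invfM mulrA.
rewrite RintegralZl//.
have -> : 304 / Num.sqrt `|xi2| = 8 / Num.sqrt `|xi2| * 38 by field; rewrite gt_eqF.
by rewrite ler_wpM2l// divr_ge0// ltW.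
Qed.

(** Here y1 is integrated first, u being fixed: [osc_space] applies with s = xi2 u and |u| < 1, and
    the remaining weight has mass at most pi. *)
Lemma kernel_bound1 xi1 xi2 c : xi1 != 0 -> `|\int[leb2 R]_z J xi1 xi2 c z| <=
   pi * ((2 + `|xi2| * (2 * Num.sqrt (2 * tau) * Num.sqrt (kA x1 (x1 + 2 * tau)))) / `|xi1|).
Proof.
move=> xi10; set V := 2 * _ * _.
have V0 : 0 <= V by rewrite !mulr_ge0 ?sqrtr_ge0.
rewrite (Rint_leb2 (intg_oscJ xi1 xi2 c)) -(proj2 (Rfubini2 (intg_oscJ xi1 xi2 c))).
set C := (2 + _) / _.
have C0 : 0 <= C by rewrite divr_ge0// addr_ge0// mulr_ge0.
rewrite -Rint_warc mulrC -RintegralZl//; last exact: intg_warc.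
apply: normr_Rint_le; first exact/intgZl/intg_warc.
  exact: intg_measurable (proj1 (Rfubini2 (intg_oscJ xi1 xi2 c))).
move=> u; rewrite mulrC.
have -> : \int[leb]_y J xi1 xi2 c (y, u) = (warc u * oo (- v) v u) *
   \int[leb]_y (cos (xi1 * y + (xi2 * u) * r y + c) * oo a b y).
  rewrite -RintegralZl//; first by apply: eq_Rintegral => y _; rewrite /oscJ /r /=;
    rewrite (_ : xi1 * y + xi2 * r y * u + c = xi1 * y + xi2 * u * r y + c); ring.
  apply: (@intg_le _ _ _ leb _ (oo a b)) (intg_oo1 a b) _.
    by apply: mfunE; rewrite /r; meas; apply: mf_kr; meas.
  by move=> y; rewrite normrM normr_oo ler_piMl ?oo_ge0// norm_cos_le1.
rewrite normrM; have [h|h] := boolP (-1 < u < 1); last first.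
  by rewrite (warc_out h) mul0r normr0 !mul0r.
apply: ler_pM => //.
  by rewrite normrM normr_oo (ger0_norm (warc_ge0 _)) ler_piMr ?warc_ge0// oo_le1.
have h2 := @osc_space R tau x1 a b xi1 (xi2 * u) c xa ab bx xi10.
apply: (le_trans h2).
rewrite /C ler_pM2r ?invr_gt0 ?normr_gt0// lerD2l ler_wpM2r// normrM ler_piMr//.
by rewrite ltW// ltr_norml.
Qed.

End fixed.
End KernelOscillation.

(** * The explicit kernel, its truncation and its slices *)

Section Kernel.
Variable R : realType.
Local Notation leb := (@lebesgue_measure R).
Implicit Types t x y v u : R.

Lemma GammaE t x1 y v : Gamma_explicit t x1 y v =
  if [&& 0 < t, x1 < y & 0 < kA x1 y * kB t x1 y - v ^+ 2]
  then (2 * pi * Num.sqrt (kA x1 y * kB t x1 y - v ^+ 2))^-1 else 0.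
Proof.
rewrite /Gamma_explicit.
have -> : (y ^+ 3 - x1 ^+ 3) * (2 * t + x1 - y) - 3 * v ^+ 2 =
    3 * (kA x1 y * kB t x1 y - v ^+ 2) by rewrite /kA /kB; field.
rewrite pmulr_rgt0//; case: ifP => // /and3P[_ _ q0].
rewrite sqrtrM//; have p0 : pi != 0 :> R by rewrite gt_eqF// pi_gt0.
have s3 : Num.sqrt 3 != 0 :> R by rewrite gt_eqF// sqrtr_gt0.
have : Num.sqrt (kA x1 y * kB t x1 y - v ^+ 2) != 0 by rewrite gt_eqF// sqrtr_gt0.
move: (Num.sqrt (_ - _)) (Num.sqrt 3) (pi : R) s3 p0 => s s3 p h3 hp h.
by field; rewrite h hp h3.
Qed.

Lemma Gamma_ge0 t x1 y v : 0 <= Gamma_explicit t x1 y v.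
Proof.
rewrite GammaE; case: ifP => // _; rewrite invr_ge0 mulr_ge0 ?sqrtr_ge0//.
by rewrite mulr_ge0// pi_ge0.
Qed.

Lemma Gamma_out t x1 y v : ~~ (x1 < y < x1 + 2 * t) -> Gamma_explicit t x1 y v = 0.
Proof.
move=> h; rewrite GammaE; case: ifP => // /and3P[t0 xy q0]; case/negP: h.
rewrite xy /=; have A0 := kA_gt0 xy.
have : 0 < kA x1 y * kB t x1 y by have := sqr_ge0 v; lra.
by rewrite pmulr_rgt0// /kB => ?; lra.
Qed.

Lemma Gamma_out_v t x1 y v : ~~ (- kr t x1 y < v < kr t x1 y) -> Gamma_explicit t x1 y v = 0.
Proof.
move=> h; rewrite GammaE; case: ifP => // /and3P[t0 xy q0]; case/negP: h.
rewrite -ltr_norml -sqrtr_sqr /kr ltr_sqrt; last by have := sqr_ge0 v; lra.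
by rewrite subr_gt0 in q0.
Qed.

Lemma Gamma_scaled t x1 y u : x1 < y < x1 + 2 * t ->
  Gamma_explicit t x1 y (kr t x1 y * u) = (2 * pi * kr t x1 y)^-1 * warc u.
Proof.
move=> h; have t0 : 0 < t by lra.
have [A0 B0] := kAB_gt0 h; have r0 := kr_gt0 h.
have rr : kr t x1 y ^+ 2 = kA x1 y * kB t x1 y by rewrite sqr_sqrtr// mulr_ge0// ltW.
rewrite GammaE -rr exprMn.
have -> : kr t x1 y ^+ 2 - kr t x1 y ^+ 2 * u ^+ 2 = kr t x1 y ^+ 2 * (1 - u ^+ 2) by ring.
rewrite t0 (proj1 (andP h)) /= pmulr_rgt0 ?exprn_gt0// subr_gt0.
case: ifPn => [u1|]; last first.
  by rewrite -leNgt => u1; rewrite /warc ler0_sqrtr ?invr0 ?mulr0// subr_le0.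
rewrite sqrtrM ?sqr_ge0// sqrtr_sqr (gtr0_norm r0) /warc mulrA.
by rewrite -invfM.
Qed.

Lemma mf_Gamma d (T : measurableType d) (a b c e : T -> R) : mfun a -> mfun b -> mfun c -> mfun e ->
  mfun (fun z => Gamma_explicit (a z) (b z) (c z) (e z)).
Proof. by move=> ma mb mc me; rewrite /Gamma_explicit; meas. Qed.

(** The kernel kept at distance dl from both ends of its support in y1 and within the fraction nu of
    its radius in x2. The parameters 0 and 1 give back the whole kernel, see [gtr01]. *)
Definition gtr (dl nu t : R) (x : plane R) (y : plane R) : R :=
  Gamma_explicit t x.1 y.1 (x.2 - y.2) * oo (x.1 + dl) (x.1 + 2 * t - dl) y.1
  * oo (- (nu * kr t x.1 y.1)) (nu * kr t x.1 y.1) (x.2 - y.2).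

Lemma mf_gtr d (T : measurableType d) (dl nu t : T -> R) (x y : T -> plane R) :
  mfun dl -> mfun nu -> mfun t -> measurable_fun setT x -> measurable_fun setT y ->
  mfun (fun z => gtr (dl z) (nu z) (t z) (x z) (y z)).
Proof.
move=> md mn mt mx my.
have x1 := mf_fst mx; have x2 := mf_snd mx; have y1 := mf_fst my; have y2 := mf_snd my.
by rewrite /gtr; meas; first [apply: mf_Gamma; meas | apply: mf_kr; meas].
Qed.

Lemma gtr_ge0 dl nu t (x y : plane R) : 0 <= gtr dl nu t x y.
Proof. by rewrite /gtr !mulr_ge0 ?Gamma_ge0 ?oo_ge0. Qed.

Lemma gtr_le dl nu t (x y : plane R) : gtr dl nu t x y <= Gamma_explicit t x.1 y.1 (x.2 - y.2).
Proof.
rewrite /gtr -mulrA ler_piMr ?Gamma_ge0//.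
by rewrite mulr_ile1 ?oo_ge0 ?oo_le1.
Qed.

Lemma gtr01 t (x y : plane R) : gtr 0 1 t x y = Gamma_explicit t x.1 y.1 (x.2 - y.2).
Proof.
rewrite /gtr addr0 subr0 !mul1r.
have [h1|h1] := boolP (x.1 < y.1 < x.1 + 2 * t); last by rewrite Gamma_out// !mul0r.
have [h2|h2] := boolP (- kr t x.1 y.1 < x.2 - y.2 < kr t x.1 y.1); last by rewrite Gamma_out_v// !mul0r.
by rewrite /oo h1 h2 !mulr1.
Qed.

(** The substitution y2 = x2 - kr u turns the slice into the arcsine weight; outside the support in
    y1 both sides are 0. *)
Lemma kernel_slice dl nu t (x : plane R) (y1 : R) (h : R -> R) : 0 <= dl -> 0 < nu -> nu <= 1 ->
  measurable_fun [set: measurableTypeR R] h -> (exists C, forall y, `|h y| <= C) ->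
  intg leb (fun y2 => h y2 * gtr dl nu t x (y1, y2)) /\
  \int[leb]_y2 (h y2 * gtr dl nu t x (y1, y2)) =
  (2 * pi)^-1 * (oo (x.1 + dl) (x.1 + 2 * t - dl) y1 *
    \int[leb]_u (h (x.2 - kr t x.1 y1 * u) * (warc u * oo (- nu) nu u))).
Proof.
move=> dl0 nu0 nu1 mh [C hC].
have [i0|i0] := boolP (x.1 + dl < y1 < x.1 + 2 * t - dl); last first.
  have e : (fun y2 => h y2 * gtr dl nu t x (y1, y2)) = fun=> 0.
    by apply/funext => y2; rewrite /gtr /= [oo (_ + dl) _ _]/oo (negbTE i0) mulr0 mul0r mulr0.
  by rewrite e [oo _ _ _]/oo (negbTE i0) mul0r mulr0 Rint0; split => //; exact: intg0.
have [ir p0] : x.1 < y1 < x.1 + 2 * t /\ 0 < pi :> R by split; [lra|exact: pi_gt0].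
set r := kr t x.1 y1; have r0 : 0 < r by exact: kr_gt0.
pose F u := (2 * pi * r)^-1 * (h (x.2 - r * u) * (warc u * oo (- nu) nu u)).
have iF0 : intg leb (fun u => h (x.2 - r * u) * (warc u * oo (- nu) nu u)).
  apply: (@intg_ext _ _ _ leb (fun u => warc u * (h (x.2 - r * u) * oo (- nu) nu u))).
    by move=> u; ring.
  apply: intg_bounded; first exact: intg_warc.
    apply: mfunE; meas; apply: (mf_compR (h := h)) => //; meas.
  exists C => u; rewrite normrM normr_oo -[C]mulr1.
  by rewrite ler_pM ?oo_ge0 ?oo_le1.
have iF : intg leb F by exact: intgZl.
have e y2 : h y2 * gtr dl nu t x (y1, y2) = F (- r^-1 * y2 + x.2 / r).
  have u0 : r * (- r^-1 * y2 + x.2 / r) = x.2 - y2 by field; rewrite gt_eqF.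
  rewrite /F /gtr /= [oo (_ + dl) _ _]/oo i0 mulr1 -/r -u0 /r Gamma_scaled// -/r u0 subKr.
  have -> : oo (- (nu * r)) (nu * r) (x.2 - y2) = oo (- nu) nu (- r^-1 * y2 + x.2 / r).
    by rewrite /oo -u0 [r * _]mulrC -mulNr !ltr_pM2r.
  by ring.
have a0 : - r^-1 != 0 by rewrite oppr_eq0 invr_eq0 gt_eqF.
rewrite [oo _ _ _]/oo i0 mul1r; split.
  by apply: intg_ext (intg_affine (x.2 / r) a0 iF) => y2; rewrite e.
rewrite (Rint_ext leb e); have := Rint_affine (x.2 / r) a0 iF.
rewrite RintegralZl// normrN normfV (gtr0_norm r0) => h1.
set I := \int[leb]_u F _ in h1 *; set I0 := \int[leb]_u _ in h1 *.
have -> : I = r * ((2 * pi * r)^-1 * I0) by rewrite h1 mulVKf// gt_eqF.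
have rn : r != 0 by rewrite gt_eqF.
have : pi != 0 :> R by rewrite gt_eqF.
by move: (pi : R) => p pn; field; rewrite rn pn.
Qed.

End Kernel.

(** * The Fourier transform of a real function through its real and imaginary parts *)

Section FourierReal.
Variable R : realType.
Implicit Types (g : plane R -> R) (xi : plane R).

(** [fc] and [fs] are the real and imaginary parts of the transform and [fourier2] is its squared
    modulus; complex numbers disappear from here on. *)
Definition fc g xi : R := \int[leb2 R]_y (cos (xi.1 * y.1 + xi.2 * y.2) * g y).
Definition fs g xi : R := \int[leb2 R]_y (sin (- (xi.1 * y.1 + xi.2 * y.2)) * g y).
Definition fourier2 g xi : R := fc g xi ^+ 2 + fs g xi ^+ 2.

Lemma normc_fourier g xi :
  ComplexField.Normc.normc (fourier (fun y => (g y)%:C%C) xi) ^+ 2 = fourier2 g xi.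
Proof.
rewrite /fourier /cintegral /= sqr_sqrtr ?addr_ge0 ?sqr_ge0//.
congr (_ ^+ 2 + _ ^+ 2); apply: eq_Rintegral => y _.
  by rewrite /cis /= cosN mulr0 subr0.
by rewrite /cis /= mulr0 add0r.
Qed.

Lemma intg_phase (h : R -> R) (c : R) g xi : continuous h -> (forall x, `|h x| <= 1) ->
  intg (leb2 R) g ->
  intg (leb2 R) (fun y => h (xi.1 * y.1 + xi.2 * y.2 + c) * g y).
Proof.
move=> ch h1 ig; apply: (@intg_ext _ _ _ (leb2 R) (fun y => g y * h (xi.1 * y.1 + xi.2 * y.2 + c))).
  by move=> y; rewrite mulrC.
apply: intg_bounded => //.
  by apply: mfunE; apply: (mf_comp (h := h)); [exact: continuous_measurable_fun|meas].
by exists 1.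
Qed.

Lemma intg_fc g xi : intg (leb2 R) g ->
  intg (leb2 R) (fun y => cos (xi.1 * y.1 + xi.2 * y.2) * g y).
Proof.
move=> ig; have := @intg_phase cos 0 g xi (@continuous_cos R) (@norm_cos_le1 R) ig.
by apply: intg_ext => y; rewrite addr0.
Qed.

Lemma intg_fs g xi : intg (leb2 R) g ->
  intg (leb2 R) (fun y => sin (- (xi.1 * y.1 + xi.2 * y.2)) * g y).
Proof.
move=> ig; have := @intg_phase sin 0 g (- xi) (@continuous_sin R) (@norm_sin_le1 R) ig.
by apply: intg_ext => y; rewrite addr0 /= !mulNr opprD.
Qed.

Lemma fourier2_ge0 g xi : 0 <= fourier2 g xi.
Proof. by rewrite addr_ge0 ?sqr_ge0. Qed.

Lemma fcD g h xi : intg (leb2 R) g -> intg (leb2 R) h ->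
  fc (fun y => g y + h y) xi = fc g xi + fc h xi.
Proof.
move=> ig ih; rewrite /fc -RintegralD//; [|exact: intg_fc|exact: intg_fc].
by apply: eq_Rintegral => y _; rewrite mulrDr.
Qed.

Lemma fsD g h xi : intg (leb2 R) g -> intg (leb2 R) h ->
  fs (fun y => g y + h y) xi = fs g xi + fs h xi.
Proof.
move=> ig ih; rewrite /fs -RintegralD//; [|exact: intg_fs|exact: intg_fs].
by apply: eq_Rintegral => y _; rewrite mulrDr.
Qed.

Lemma fourier2D_le g h xi : intg (leb2 R) g -> intg (leb2 R) h ->
  fourier2 (fun y => g y + h y) xi <= 2 * fourier2 g xi + 2 * fourier2 h xi.
Proof.
move=> ig ih; rewrite /fourier2 fcD// fsD//.
move: (fc g xi) (fc h xi) (fs g xi) (fs h xi) => a b c e.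
have := sqr_ge0 (a - b); have := sqr_ge0 (c - e); nra.
Qed.

Lemma fourier2N g xi : intg (leb2 R) g -> fourier2 (fun y => - g y) xi = fourier2 g xi.
Proof.
move=> ig; rewrite /fourier2.
have -> : fc (fun y => - g y) xi = - fc g xi.
  rewrite /fc -mulN1r -RintegralZl//; last exact: intg_fc.
  by apply: eq_Rintegral => y _; ring.
have -> : fs (fun y => - g y) xi = - fs g xi.
  rewrite /fs -mulN1r -RintegralZl//; last exact: intg_fs.
  by apply: eq_Rintegral => y _; ring.
by rewrite !sqrrN.
Qed.

Lemma fourier2_le1 g xi : intg (leb2 R) g ->
  fourier2 g xi <= 2 * (\int[leb2 R]_y `|g y|) ^+ 2.
Proof.
move=> ig; have I0 : 0 <= \int[leb2 R]_y `|g y| by exact: Rintegral_ge0.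
have h1 : `|fc g xi| <= \int[leb2 R]_y `|g y|.
  apply: normr_Rint_le; [exact: intg_norm|exact: intg_measurable (intg_fc xi ig)|].
  by move=> y; rewrite normrM ler_piMl// norm_cos_le1.
have h2 : `|fs g xi| <= \int[leb2 R]_y `|g y|.
  apply: normr_Rint_le; [exact: intg_norm|exact: intg_measurable (intg_fs xi ig)|].
  by move=> y; rewrite normrM ler_piMl// norm_sin_le1.
rewrite /fourier2 -[fc g xi ^+ 2]real_normK ?num_real// -[fs g xi ^+ 2]real_normK ?num_real//.
by rewrite mulr_natl mulr2n lerD// ler_pXn2r// nnegrE.
Qed.

Lemma mf_fourier2 d (T : measurableType d) (g : T * plane R -> R) :
  mfun g -> mfun (fun z : T * plane R => fourier2 (fun y => g (z.1, y)) z.2).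
Proof.
move=> mg.
have h1 (h : R -> R) (s : R) : continuous h ->
    mfun (fun z : T * plane R => \int[leb2 R]_y (h (s * (z.2.1 * y.1 + z.2.2 * y.2)) * g (z.1, y))).
  move=> ch; apply: (@measurable_Rint _ _ _ _ _ (leb2 R)
    (fun w : (T * plane R) * plane R => h (s * (w.1.2.1 * w.2.1 + w.1.2.2 * w.2.2)) * g (w.1.1, w.2))).
  apply: mfunE; apply: mfM.
    by apply: (mf_comp (h := h)); [exact: continuous_measurable_fun|meas].
  by apply: (measurableT_comp mg); meas.
have m1 := h1 cos 1 (@continuous_cos R); have m2 := h1 sin (-1) (@continuous_sin R).
rewrite (_ : (fun z => _) = (fun z : T * plane R =>
  (\int[leb2 R]_y (cos (1 * (z.2.1 * y.1 + z.2.2 * y.2)) * g (z.1, y))) ^+ 2 +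
  (\int[leb2 R]_y (sin (-1 * (z.2.1 * y.1 + z.2.2 * y.2)) * g (z.1, y))) ^+ 2)).
  by meas.
apply/funext => z; rewrite /fourier2 /fc /fs.
by congr (_ ^+ 2 + _ ^+ 2); apply: eq_Rintegral => y _; rewrite ?mul1r ?mulN1r.
Qed.

Lemma fourier2_cvg (g_ : nat -> plane R -> R) g (G : plane R -> R) xi :
  (forall n, mfun (g_ n)) -> (forall y, g_ n y @[n --> \oo] --> g y) ->
  intg (leb2 R) G -> (forall n y, `|g_ n y| <= G y) ->
  fourier2 (g_ n) xi @[n --> \oo] --> fourier2 g xi.
Proof.
move=> mg gg iG gG.
have h (h : R -> R) (c : R) : continuous h -> (forall x, `|h x| <= 1) ->
  \int[leb2 R]_y (h (c * (xi.1 * y.1 + xi.2 * y.2)) * g_ n y) @[n --> \oo] -->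
  \int[leb2 R]_y (h (c * (xi.1 * y.1 + xi.2 * y.2)) * g y).
  move=> ch h1; apply: (proj2 (dct_Rint (m := leb2 R) _ _ iG _)).
  - move=> n; apply: mfunE; apply: mfM => //.
    by apply: (mf_comp (h := h)); [exact: continuous_measurable_fun|meas].
  - by move=> y; apply: cvgM; [exact: cvg_cst|exact: gg].
  - by move=> n y; rewrite normrM -[leRHS]mul1r ler_pM.
have m1 := h cos 1 (@continuous_cos R) (@norm_cos_le1 R).
have m2 := h sin (-1) (@continuous_sin R) (@norm_sin_le1 R).
have e f : fourier2 f xi = (\int[leb2 R]_y (cos (1 * (xi.1 * y.1 + xi.2 * y.2)) * f y)) ^+ 2
   + (\int[leb2 R]_y (sin (-1 * (xi.1 * y.1 + xi.2 * y.2)) * f y)) ^+ 2.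
  rewrite /fourier2 /fc /fs.
  by congr (_ ^+ 2 + _ ^+ 2); apply: eq_Rintegral => y _; rewrite ?mul1r ?mulN1r.
rewrite e; under eq_fun do rewrite e.
by rewrite /=; apply: cvgD; rewrite expr2; under eq_fun do rewrite expr2; apply: cvgM.
Qed.

End FourierReal.

(** * Decay of the Fourier transform of the kernel *)

Section KernelFourier.
Variable R : realType.
Local Notation leb := (@lebesgue_measure R).

Lemma Rint_slice_le1 dl nu t (x : plane R) (y1 : R) : 0 <= dl -> 0 < nu -> nu <= 1 ->
  intg leb (fun y2 => gtr dl nu t x (y1, y2)) /\
  \int[leb]_y2 gtr dl nu t x (y1, y2) <= oo (x.1 + dl) (x.1 + 2 * t - dl) y1.
Proof.
move=> dl0 nu0 nu1.
have b1 : exists C : R, forall _ : R, `|1 : R| <= C by exists 1 => y; rewrite normr1.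
have [i e] := @kernel_slice R dl nu t x y1 (fun=> 1) dl0 nu0 nu1 (measurable_cst _) b1.
have e1 y : 1 * gtr dl nu t x (y1, y) = gtr dl nu t x (y1, y) by rewrite mul1r.
split; first exact: intg_ext e1 i.
rewrite -(Rint_ext leb e1) e.
have p0 := @pi_gt0 R.
rewrite mulrC -mulrA ler_piMr ?oo_ge0// ler_pdivrMr ?mulr_gt0// mul1r.
have : \int[leb]_u (1 * (warc u * oo (- nu) nu u)) <= \int[leb]_u warc u.
  apply: le_Rint; last by move=> u; rewrite mul1r ler_piMr ?warc_ge0 ?oo_le1.
    apply: (@intg_ext _ _ _ leb (fun u => warc u * oo (- nu) nu u)); first by move=> u; rewrite mul1r.
    apply: intg_bounded; [exact: intg_warc|exact: measurable_oo|].
    by exists 1 => u; rewrite normr_oo oo_le1.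
  exact: intg_warc.
by rewrite Rint_warc; lra.
Qed.

Lemma measurable_gtr dl nu t (x : plane R) : mfun (gtr dl nu t x).
Proof. by apply: (@mf_gtr R _ _ (fun=> dl) (fun=> nu) (fun=> t) (fun=> x) id); meas. Qed.

Lemma intg_gtr dl nu t (x : plane R) : 0 <= dl -> 0 < nu -> nu <= 1 ->
  intg (leb2 R) (gtr dl nu t x).
Proof.
move=> dl0 nu0 nu1.
apply: (@Rint_prod_crit _ _ _ _ R leb leb _ (oo (x.1 + dl) (x.1 + 2 * t - dl))).
- exact: measurable_gtr.
- by move=> y1; have [] := @Rint_slice_le1 dl nu t x y1 dl0 nu0 nu1.
- exact: intg_oo1.
- move=> y1; have [_] := @Rint_slice_le1 dl nu t x y1 dl0 nu0 nu1; apply: le_trans.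
  by under eq_Rintegral do rewrite ger0_norm ?gtr_ge0//.
Qed.

(** The offset c handles both parts of the transform at once: c = 0 gives [fc], and c = pi / 2 gives
    [fs], since cos(p + pi / 2) = sin(- p). *)
Lemma gtr_osc dl nu t (x : plane R) (xi : plane R) (c : R) : 0 <= dl -> 0 < nu -> nu <= 1 ->
  \int[leb2 R]_y (cos (xi.1 * y.1 + xi.2 * y.2 + c) * gtr dl nu t x y) =
  (2 * pi)^-1 * \int[leb2 R]_z
    oscJ t x.1 (x.1 + dl) (x.1 + 2 * t - dl) nu xi.1 (- xi.2) (c + xi.2 * x.2) z.
Proof.
move=> dl0 nu0 nu1.
have iJ := intg_oscJ t x.1 (x.1 + dl) (x.1 + 2 * t - dl) nu xi.1 (- xi.2) (c + xi.2 * x.2).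
rewrite Rint_leb2; last first.
  apply: (@intg_phase _ cos); [exact: continuous_cos|exact: norm_cos_le1|exact: intg_gtr].
rewrite (Rint_leb2 iJ) -RintegralZl//; last exact: (proj1 (Rfubini1 iJ)).
apply: eq_Rintegral => y1 _ /=.
pose h (y2 : R) := cos (xi.1 * y1 + xi.2 * y2 + c).
have mh : measurable_fun [set: measurableTypeR R] h by apply: mfunE; rewrite /h; meas.
have bh : exists C, forall y, `|h y| <= C by exists 1 => y; exact: norm_cos_le1.
rewrite (proj2 (@kernel_slice R dl nu t x y1 h dl0 nu0 nu1 mh bh)).
congr (_ * _).
rewrite -RintegralZl//; last first.
  apply: (@intg_ext _ _ _ leb (fun u => warc u * (cos (xi.1 * y1 + xi.2 * (x.2 - kr t x.1 y1 * u) + c) * oo (- nu) nu u))).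
    by move=> u; rewrite /h; ring.
  apply: intg_bounded; [exact: intg_warc|by apply: mfunE; meas|].
  by exists 1 => u; rewrite normrM normr_oo mulr_ile1 ?oo_ge0 ?oo_le1// norm_cos_le1.
apply: eq_Rintegral => u _; rewrite /oscJ /h /= -!mulrA; congr (_ * (cos _ * _)).
by ring.
Qed.

(** The variation bound of [osc_space] at the final time T, which dominates those at earlier
    times. *)
Definition VT (T x1 : R) : R := 2 * Num.sqrt (2 * T) * Num.sqrt (kA x1 (x1 + 2 * T)).

Lemma le_sqr (a b : R) : 0 <= a -> a <= b -> a ^+ 2 <= b ^+ 2.
Proof. by move=> a0 ab; rewrite !expr2 ler_pM. Qed.

(** The right-hand sides are free of dl, nu and t, which is what allows the truncation to be removed
    afterwards. If the truncated interval is empty, I = 0. *)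
Lemma gtr_osc_bounds dl nu t T (x : plane R) (xi : plane R) (c : R) : 0 < dl -> 0 < nu < 1 -> t <= T ->
  let I := \int[leb2 R]_y (cos (xi.1 * y.1 + xi.2 * y.2 + c) * gtr dl nu t x y) in
  [/\ I ^+ 2 <= T ^+ 2, I ^+ 2 * `|xi.2| <= 304 ^+ 2 &
      I ^+ 2 * xi.1 ^+ 2 <= (2 + `|xi.2| * VT T x.1) ^+ 2].
Proof.
move=> dl0 nu01 tT I; have /andP[nu0 nu1] := nu01.
have p0 := @pi_gt0 R; have p2 : 2 < 2 * pi :> R by have := @pi_ge2 R; lra.
have [ab|ab] := ltP (x.1 + dl) (x.1 + 2 * t - dl); last first.
  have -> : I = 0.
    rewrite /I -(@Rint0 _ _ R (leb2 R)); apply: eq_Rintegral => y _.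
    have -> : gtr dl nu t x y = 0; last by rewrite mulr0.
    rewrite /gtr [oo (_ + dl) _ _]/oo; case: (boolP (_ < _ < _)) => [|_]; last by rewrite mulr0 mul0r.
    by move=> /andP[h1 h2]; have := lt_trans h1 h2; rewrite ltNge ab.
  by rewrite expr0n/= !mul0r; split; rewrite ?sqr_ge0.
have t0 : 0 < t by lra.
have T0 : 0 < T by exact: lt_le_trans t0 tT.
have xa : x.1 < x.1 + dl by lra.
have bx : x.1 + 2 * t - dl < x.1 + 2 * t by lra.
have IE := @gtr_osc dl nu t x xi c (ltW dl0) nu0 (ltW nu1).
pose J := \int[leb2 R]_z
    oscJ t x.1 (x.1 + dl) (x.1 + 2 * t - dl) nu xi.1 (- xi.2) (c + xi.2 * x.2) z.
rewrite -/J -/I in IE.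
have IJ : `|I| * (2 * pi) = `|J|.
  rewrite IE normrM mulrC mulrA ger0_norm; last by rewrite invr_ge0 ltW// mulr_gt0.
  by rewrite mulfV ?mul1r// gt_eqF// mulr_gt0.
have I2 : I ^+ 2 = `|I| ^+ 2 by rewrite real_normK ?num_real.
have aI : 0 <= `|I| by [].
split.
- have b0 := @kernel_bound0 R t x.1 _ _ nu xa ab bx xi.1 (- xi.2) (c + xi.2 * x.2).
  rewrite I2; apply: le_sqr => //; apply: le_trans tT.
  rewrite -/J -IJ in b0; rewrite -(ler_pM2r (_ : 0 < 2 * pi)) ?mulr_gt0//.
  by apply: (le_trans b0); rewrite le_eqVlt; apply/orP; left; apply/eqP; ring.
- have [->|x0] := eqVneq xi.2 0; first by rewrite normr0 mulr0 sqr_ge0.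
  have x0' : - xi.2 != 0 by rewrite oppr_eq0.
  have b2 := @kernel_bound2 R t x.1 _ _ nu t0 xa ab bx nu01 xi.1 (- xi.2) (c + xi.2 * x.2) x0'.
  rewrite -/J -IJ normrN ler_pdivlMr ?sqrtr_gt0 ?normr_gt0// in b2.
  rewrite I2 -[`|xi.2|]sqr_sqrtr// -exprMn.
  apply: le_sqr; first by rewrite mulr_ge0 ?sqrtr_ge0.
  apply: le_trans b2; rewrite ler_wpM2r ?sqrtr_ge0// ler_peMr//; lra.
- have [->|x0] := eqVneq xi.1 0; first by rewrite expr0n/= mulr0 sqr_ge0.
  have b1 := @kernel_bound1 R t x.1 _ _ nu xa ab bx xi.1 (- xi.2) (c + xi.2 * x.2) x0.
  have V0 : 0 <= VT T x.1 by rewrite /VT !mulr_ge0 ?sqrtr_ge0.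
  have VV : 2 * Num.sqrt (2 * t) * Num.sqrt (kA x.1 (x.1 + 2 * t)) <= VT T x.1.
    rewrite /VT -!mulrA ler_pM2l// ler_pM ?sqrtr_ge0//; first by apply: ler_wsqrtr; lra.
    by apply: ler_wsqrtr; apply: kA_le; lra.
  rewrite -/J -IJ normrN [leRHS]mulrA ler_pdivlMr ?normr_gt0// in b1.
  rewrite I2 -[xi.1 ^+ 2]real_normK ?num_real// -exprMn; apply: le_sqr; first by rewrite mulr_ge0.
  rewrite -(ler_pM2l p0).
  have h1 : pi * (`|I| * `|xi.1|) <= `|I| * (2 * pi) * `|xi.1|.
    rewrite [leRHS](_ : _ = 2 * (pi * (`|I| * `|xi.1|))); last by ring.
    by rewrite ler_peMl ?mulr_ge0 ?(ltW p0)//; lra.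
  apply: (le_trans h1); apply: (le_trans b1); rewrite ler_pM2l// lerD2l ler_wpM2l//.
Qed.

(** P stands for |xi|^(2/3). If P <= 2 |b|, the bound on I2 |b| suffices; if P <= 1, the trivial one
    does. Otherwise b^2 <= P^2 / 4 <= P^3 / 4, so a^2 >= 3/4 P^3, while (2 + |b| V)^2 <= (8 + V^2 /
    2) P^2; dividing, I2 P <= 4/3 (8 + V^2 / 2) <= 11 + V^2. *)
Lemma decay_combine (I2 P a b V T : R) : 0 <= I2 -> 0 <= P -> P ^+ 3 = a ^+ 2 + b ^+ 2 -> 0 <= V ->
  I2 <= T ^+ 2 -> I2 * `|b| <= 304 ^+ 2 -> I2 * a ^+ 2 <= (2 + `|b| * V) ^+ 2 ->
  I2 * (1 + P) <= 2 * T ^+ 2 + 2 * 304 ^+ 2 + 11 + V ^+ 2.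
Proof.
move=> I0 P0 e V0 h0 h2 h1.
rewrite -(real_normK (num_real b)) in e.
have b0 := normr_ge0 b; move: (`|b|) b0 e h2 h1 => B b0 e h2 h1.
have V2 := sqr_ge0 V; have T2 := sqr_ge0 T.
suff : I2 * P <= T ^+ 2 + 2 * 304 ^+ 2 + 11 + V ^+ 2 by rewrite mulrDr mulr1; lra.
have [Pb|Pb] := leP P (2 * B).
  have : I2 * P <= I2 * (2 * B) by rewrite ler_wpM2l.
  by rewrite mulrCA; lra.
have [P1|P1] := leP P 1.
  have : I2 * P <= I2 * 1 by rewrite ler_wpM2l.
  by rewrite mulr1; lra.
have B2 : B ^+ 2 <= P ^+ 2 / 4 by nra.
have P23 : P ^+ 2 <= P ^+ 3 by rewrite [P ^+ 3]exprS ler_peMl ?sqr_ge0// ltW.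
have a2 : 3 / 4 * P ^+ 3 <= a ^+ 2 by lra.
have hV : (2 + B * V) ^+ 2 <= (8 + V ^+ 2 / 2) * P ^+ 2.
  have : (2 + B * V) ^+ 2 <= 8 + 2 * (B ^+ 2 * V ^+ 2) by have := sqr_ge0 (2 - B * V); nra.
  have : B ^+ 2 * V ^+ 2 <= P ^+ 2 / 4 * V ^+ 2 by rewrite ler_wpM2r.
  have : 1 <= P ^+ 2 by rewrite exprn_ege1// ltW.
  nra.
have h3 : I2 * (3 / 4 * P ^+ 3) <= (8 + V ^+ 2 / 2) * P ^+ 2.
  by apply: le_trans hV; apply: le_trans h1; rewrite ler_wpM2l.
have PP : 0 < P ^+ 2 by rewrite exprn_gt0//; lra.
have : 3 / 4 * (I2 * P) <= 8 + V ^+ 2 / 2.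
  by rewrite -(ler_pM2r PP); apply: le_trans h3; rewrite le_eqVlt; apply/orP; left; apply/eqP; ring.
lra.
Qed.

(** The outer factor 2 adds the real and the imaginary part. *)
Definition kdecay (T x1 : R) : R := 2 * (2 * T ^+ 2 + 2 * 304 ^+ 2 + 11 + VT T x1 ^+ 2).

Lemma kdecay_ge0 T x1 : 0 <= kdecay T x1.
Proof. by have := sqr_ge0 T; have := sqr_ge0 (VT T x1); rewrite /kdecay; lra. Qed.

Lemma enorm23 (xi : plane R) : (enorm xi `^ (2 / 3)) ^+ 3 = xi.1 ^+ 2 + xi.2 ^+ 2.
Proof.
rewrite -powR_mulrn ?powR_ge0// -powRrM.
have -> : 2 / 3 * 3%:R = 2%:R :> R by field.
by rewrite powR_mulrn ?sqrtr_ge0// sqr_sqrtr// addr_ge0 ?sqr_ge0.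
Qed.

Lemma fourier2_gtr_le dl nu t T (x xi : plane R) : 0 < dl -> 0 < nu < 1 -> t <= T ->
  fourier2 (gtr dl nu t x) xi <= kdecay T x.1 / (1 + enorm xi `^ (2 / 3)).
Proof.
move=> dl0 nu01 tT.
have P0 : 0 <= enorm xi `^ (2 / 3) by exact: powR_ge0.
have V0 : 0 <= VT T x.1 by rewrite /VT !mulr_ge0 ?sqrtr_ge0.
rewrite ler_pdivlMr; last by rewrite ltr_wpDr.
have [a1 a2 a3] := gtr_osc_bounds x xi 0 dl0 nu01 tT.
have [b1 b2 b3] := gtr_osc_bounds x xi (pi / 2) dl0 nu01 tT.
have h1 := decay_combine (sqr_ge0 _) P0 (enorm23 xi) V0 a1 a2 a3.
have h2 := decay_combine (sqr_ge0 _) P0 (enorm23 xi) V0 b1 b2 b3.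
rewrite (_ : kdecay T x.1 = (2 * T ^+ 2 + 2 * 304 ^+ 2 + 11 + VT T x.1 ^+ 2) +
  (2 * T ^+ 2 + 2 * 304 ^+ 2 + 11 + VT T x.1 ^+ 2)); last by rewrite /kdecay; ring.
rewrite /fourier2 mulrDl; apply: lerD.
  by apply: le_trans h1; rewrite /fc; under [in leRHS]eq_Rintegral do rewrite addr0.
apply: le_trans h2; rewrite /fs le_eqVlt; apply/orP; left; apply/eqP.
by congr (_ ^+ 2 * _); apply: eq_Rintegral => y _; rewrite sinN cosDpihalf.
Qed.

End KernelFourier.

(** * The squared noise norm *)

Lemma ge0_integral_le2D d (T : measurableType d) (R : realType) (m : {measure set T -> \bar R})
    (D : set T) (f g h : T -> \bar R) : measurable D ->
  measurable_fun setT f -> measurable_fun setT g -> measurable_fun setT h ->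
  (forall x, 0 <= f x)%E -> (forall x, 0 <= g x)%E -> (forall x, 0 <= h x)%E ->
  (forall x, f x <= 2%:E * g x + 2%:E * h x)%E ->
  (\int[m]_(x in D) f x <= 2%:E * \int[m]_(x in D) g x + 2%:E * \int[m]_(x in D) h x)%E.
Proof.
move=> mD mf mg mh f0 g0 h0 fgh.
have mgD : measurable_fun D g by exact: measurable_funTS.
have mhD : measurable_fun D h by exact: measurable_funTS.
rewrite -ge0_integralZl// -ge0_integralZl// -ge0_integralD//; first last.
- exact: measurable_funeM.
- by move=> s _; rewrite mule_ge0.
- exact: measurable_funeM.
- by move=> s _; rewrite mule_ge0.
apply: ge0_le_integral => //.
- exact: measurable_funTS.
- by apply: emeasurable_funD; exact: measurable_funeM.
Qed.

Section NoiseNorm.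
Variable R : realType.
Local Notation leb := (@lebesgue_measure R).
Variable mu : {sigma_finite_measure set (plane R) -> \bar R}.
Implicit Types (g h : spacetime R -> R) (D E : set (measurableTypeR R)).

(** Integrable slices make the Fourier integrals additive; joint measurability makes [fnorm2 g]
    measurable in time. *)
Definition good_integrand g := mfun g /\ forall s, intg (leb2 R) (fun y => g (s, y)).

Definition fnorm2 g (s : measurableTypeR R) : \bar R :=
  (\int[mu]_xi (fourier2 (fun y => g (s, y)) xi)%:E)%E.

Lemma noise_norm2E D g : noise_norm2 mu D g = (\int[leb]_(s in D) fnorm2 g s)%E.
Proof.
rewrite /noise_norm2; apply: eq_integral => s _; apply: eq_integral => xi _.
by rewrite normc_fourier.
Qed.

Lemma fnorm2_ge0 g s : (0 <= fnorm2 g s)%E.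
Proof. by apply: integral_ge0 => xi _; rewrite lee_fin fourier2_ge0. Qed.

Lemma noise_norm2_ge0 D g : (0 <= noise_norm2 mu D g)%E.
Proof. by rewrite noise_norm2E; apply: integral_ge0 => s _; exact: fnorm2_ge0. Qed.

Lemma mf_slice_fourier2 g : mfun g -> mfun (fun z : spacetime R => fourier2 (fun y => g (z.1, y)) z.2).
Proof. exact: mf_fourier2. Qed.

Lemma measurable_fnorm2 g : mfun g -> measurable_fun [set: measurableTypeR R] (fnorm2 g).
Proof.
move=> mg; apply: (@measurable_ge0_int _ _ _ _ _ mu
  (fun z : spacetime R => fourier2 (fun y => g (z.1, y)) z.2)).
- exact: mf_slice_fourier2.
- by move=> z; exact: fourier2_ge0.
Qed.

Lemma good_slice g s : good_integrand g -> mfun (fourier2 (fun y => g (s, y))).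
Proof. by move=> [mg _]; exact: (measurable_slice1 (mf_slice_fourier2 mg) s). Qed.

Lemma good_intg g s : good_integrand g -> intg (leb2 R) (fun y => g (s, y)).
Proof. by case. Qed.

Lemma goodD g h : good_integrand g -> good_integrand h -> good_integrand (fun p => g p + h p).
Proof. by move=> [mg ig] [mh ih]; split=> [|s]; [exact: mfD|exact: intgD]. Qed.

Lemma goodN g : good_integrand g -> good_integrand (fun p => - g p).
Proof. by move=> [mg ig]; split=> [|s]; [exact: mfN|exact: intgN]. Qed.

Lemma goodB g h : good_integrand g -> good_integrand h -> good_integrand (fun p => g p - h p).
Proof. by move=> gg gh; apply: goodD => //; exact: goodN. Qed.

Lemma goodZ c g : good_integrand g -> good_integrand (fun p => c * g p).
Proof. by move=> [mg ig]; split=> [|s]; [apply: mfM => //; exact: mf_cst|exact: intgZl]. Qed.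

Lemma good0 : good_integrand (fun=> 0).
Proof. by split; [exact: mf_cst|move=> s; exact: intg0]. Qed.

Lemma good_sum (I : Type) (r : seq I) (F : I -> spacetime R -> R) :
  (forall i, good_integrand (F i)) -> good_integrand (fun p => \sum_(i <- r) F i p).
Proof.
move=> gF; elim: r => [|i r ih].
  by under eq_fun do rewrite big_nil; exact: good0.
by under eq_fun do rewrite big_cons; exact: goodD.
Qed.

Lemma noise_norm2D D g h : measurable D -> good_integrand g -> good_integrand h ->
  (noise_norm2 mu D (fun p => (g p + h p)%R) <= 2%:E * noise_norm2 mu D g + 2%:E * noise_norm2 mu D h)%E.
Proof.
move=> mD gg gh; rewrite !noise_norm2E; apply: ge0_integral_le2D => //.
- by apply: measurable_fnorm2; exact: (goodD gg gh).1.
- exact: measurable_fnorm2 gg.1.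
- exact: measurable_fnorm2 gh.1.
- by move=> s; exact: fnorm2_ge0.
- by move=> s; exact: fnorm2_ge0.
- by move=> s; exact: fnorm2_ge0.
move=> s; apply: ge0_integral_le2D => //.
- by apply/measurable_EFinP; exact: good_slice s (goodD gg gh).
- by apply/measurable_EFinP; exact: good_slice s gg.
- by apply/measurable_EFinP; exact: good_slice s gh.
- by move=> xi; rewrite lee_fin fourier2_ge0.
- by move=> xi; rewrite lee_fin fourier2_ge0.
- by move=> xi; rewrite lee_fin fourier2_ge0.
by move=> xi; rewrite -!EFinM -EFinD lee_fin; apply: fourier2D_le; exact: good_intg.
Qed.

Lemma noise_norm2N D g : good_integrand g ->
  noise_norm2 mu D (fun p => - g p) = noise_norm2 mu D g.
Proof.
move=> gg; rewrite !noise_norm2E; apply: eq_integral => s _; apply: eq_integral => xi _.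
by rewrite fourier2N//; exact: good_intg.
Qed.

Lemma fourier2_0 xi : fourier2 (fun=> 0 : R) xi = 0.
Proof.
rewrite /fourier2 /fc /fs; under eq_Rintegral do rewrite mulr0.
under [X in _ + X ^+ 2]eq_Rintegral do rewrite mulr0.
by rewrite Rint0 expr0n addr0.
Qed.

Lemma noise_norm2_supp D E g : measurable D -> measurable E -> D `<=` E -> mfun g ->
  (forall s y, E s -> ~ D s -> g (s, y) = 0) -> noise_norm2 mu E g = noise_norm2 mu D g.
Proof.
move=> mD mE DE mg g0; rewrite !noise_norm2E -(setDKU DE).
rewrite ge0_integral_setU//; first last.
- by apply/disj_setPLR => x [].
- by move=> s _; exact: fnorm2_ge0.
- by apply: measurable_funTS; exact: measurable_fnorm2.
- exact: measurableD.
rewrite [X in (X + _)%E]integral0_eq ?add0e// => s [Es Ds].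
rewrite /fnorm2 integral0_eq// => xi _.
rewrite (_ : (fun y => g (s, y)) = fun=> 0) ?fourier2_0//.
by apply/funext => y; rewrite g0.
Qed.

End NoiseNorm.

(** * Finiteness of the noise norm of the kernel, and removal of the truncation *)

Section KernelNoise.
Variable R : realType.
Local Notation leb := (@lebesgue_measure R).
Variable mu : {sigma_finite_measure set (plane R) -> \bar R}.
Hypothesis mu_int : (\int[mu]_xi (1 / (1 + enorm xi `^ (2 / 3)))%:E < +oo)%E.

Definition gtrk dl nu t (x : plane R) (p : spacetime R) : R := gtr dl nu (t - p.1) x p.2.

Lemma shifted_kernelE t (x : plane R) : shifted_kernel Gamma_explicit t x = gtrk 0 1 t x.
Proof. by apply/funext => p; rewrite /shifted_kernel /gtrk gtr01. Qed.

Lemma mf_gtrk dl nu t (x : plane R) : mfun (gtrk dl nu t x).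
Proof.
by rewrite /gtrk; apply: (@mf_gtr R _ _ (fun=> dl) (fun=> nu) (fun p : spacetime R => t - p.1) (fun=> x) snd); meas.
Qed.

Lemma good_gtrk dl nu t (x : plane R) : 0 <= dl -> 0 < nu -> nu <= 1 ->
  good_integrand (gtrk dl nu t x).
Proof. by move=> h1 h2 h3; split; [exact: mf_gtrk|move=> s; exact: (intg_gtr (t - s) x h1 h2 h3)]. Qed.

(** The shift by 2 places [nun n = 1 - dln n] strictly between 0 and 1 from n = 0 on. *)
Definition dln (n : nat) : R := n.+2%:R^-1.
Definition nun (n : nat) : R := 1 - dln n.

Lemma dln_gt0 n : 0 < dln n. Proof. by rewrite invr_gt0. Qed.

Lemma nun_01 n : 0 < nun n < 1.
Proof.
have h := dln_gt0 n.
have : dln n < 1 by rewrite invf_lt1// ltr1n.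
rewrite /nun; lra.
Qed.

Lemma cvg_dln : dln n @[n --> \oo] --> (0 : R).
Proof.
have := @cvg_harmonic R; rewrite -(cvg_shiftn 1) /=.
by under eq_fun do rewrite addn1.
Qed.

(** The support of the kernel is open, so at a given point the cutoffs are inactive from some n on
    and the sequence is eventually constant. *)
Lemma gtr_cvg t (x y : plane R) : gtr (dln n) (nun n) t x y @[n --> \oo] --> gtr 0 1 t x y.
Proof.
rewrite gtr01 /gtr.
have [h1|h1] := boolP (x.1 < y.1 < x.1 + 2 * t); last first.
  by rewrite Gamma_out//; under eq_fun do rewrite !mul0r; exact: cvg_cst.
set r := kr t x.1 y.1.
have [h2|h2] := boolP (- r < x.2 - y.2 < r); last first.
  by rewrite Gamma_out_v//; under eq_fun do rewrite !mul0r; exact: cvg_cst.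
apply: cvg_near_cst.
have r0 : 0 < r by lra.
have d1 : \forall n \near \oo, dln n < y.1 - x.1 by apply: cvgr_lt cvg_dln _ _; rewrite subr_gt0; lra.
have d2 : \forall n \near \oo, dln n < x.1 + 2 * t - y.1 by apply: cvgr_lt cvg_dln _ _; rewrite subr_gt0; lra.
have d3 : \forall n \near \oo, dln n < 1 - `|x.2 - y.2| / r.
  by apply: cvgr_lt cvg_dln _ _; rewrite subr_gt0 ltr_pdivrMr// mul1r ltr_norml.
near=> n.
have e1 : dln n < y.1 - x.1 by near: n.
have e2 : dln n < x.1 + 2 * t - y.1 by near: n.
have e3 : dln n < 1 - `|x.2 - y.2| / r by near: n.
have e4 : - (nun n * r) < x.2 - y.2 < nun n * r.
  by rewrite -ltr_norml -ltr_pdivrMr// /nun; lra.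
have e5 : x.1 + dln n < y.1 < x.1 + 2 * t - dln n by lra.
by rewrite /oo e4 e5 !mulr1.
Unshelve. all: by end_near. Qed.

Lemma intg_wmu : intg mu (fun xi => 1 / (1 + enorm xi `^ (2 / 3))).
Proof.
apply: intgP.
  apply: mfunE; apply: mfM; first exact: mf_cst.
  apply: mfV; apply: mfD; first exact: mf_cst.
  apply: (@mf_comp _ _ _ (fun z : R => z `^ (2 / 3))); first exact: measurable_powR.
  by rewrite /enorm; meas.
apply: le_lt_trans mu_int; rewrite le_eqVlt; apply/orP; left; apply/eqP.
by apply: eq_integral => xi _; rewrite ger0_norm// divr_ge0// addr_ge0// powR_ge0.
Qed.

Lemma fourier2_gtr01_le (t T : R) (x xi : plane R) : t <= T ->
  fourier2 (gtr 0 1 t x) xi <= kdecay T x.1 / (1 + enorm xi `^ (2 / 3)).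
Proof.
move=> tT.
have h : fourier2 (gtr (dln n) (nun n) t x) xi @[n --> \oo] --> fourier2 (gtr 0 1 t x) xi.
  apply: (@fourier2_cvg _ _ _ (gtr 0 1 t x)).
  - by move=> n; exact: measurable_gtr.
  - by move=> y; exact: gtr_cvg.
  - by apply: intg_gtr.
  - by move=> n y; rewrite ger0_norm ?gtr_ge0// gtr01 gtr_le.
rewrite -(cvg_lim _ h)//; apply: limr_le; first by apply/cvg_ex; eexists; exact: h.
by apply: nearW => n; apply: fourier2_gtr_le => //; [exact: dln_gt0|exact: nun_01].
Qed.

Lemma fnorm2_gtrk_le (t T : R) (x : plane R) (s : R) : 0 <= s -> t <= T ->
  (fnorm2 mu (gtrk 0 1 t x) s <= (kdecay T x.1 * \int[mu]_xi (1 / (1 + enorm xi `^ (2 / 3))))%:E)%E.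
Proof.
move=> s0 tT; have iw := intg_wmu.
have tsT : t - s <= T by rewrite (le_trans _ tT)// gerBl.
rewrite -RintegralZl// Rint_intgE; last exact: intgZl.
apply: ge0_le_integral => //.
- by move=> xi _; rewrite lee_fin fourier2_ge0.
- by apply/measurable_EFinP; apply: good_slice; exact: good_gtrk.
- by apply/measurable_EFinP; exact: intg_measurable (intgZl _ iw).
move=> xi _; rewrite lee_fin; apply: (le_trans (fourier2_gtr01_le x xi tsT)).
by rewrite [1 / _]mul1r.
Qed.

Lemma noise_norm2_gtrk_lty t (x : plane R) : (noise_norm2 mu `[0%R, t] (gtrk 0 1 t x) < +oo)%E.
Proof.
rewrite noise_norm2E; set C := kdecay t x.1 * \int[mu]_xi (1 / (1 + enorm xi `^ (2 / 3))).
apply: (@le_lt_trans _ _ (\int[leb]_(s in `[0%R, t]) C%:E)%E).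
  apply: ge0_le_integral => //.
  - by move=> s _; exact: fnorm2_ge0.
  - by apply: measurable_funTS; apply: measurable_fnorm2; exact: mf_gtrk.
  by move=> s; rewrite /= in_itv/= => /andP[s0 _]; exact: fnorm2_gtrk_le.
rewrite integral_cst//= lebesgue_measure_itv/=.
by case: ifP => _; rewrite ?mule0// -EFinB -EFinM ltry.
Qed.

(** Dominated convergence at three levels: in space under twice the kernel, in frequency under C /
    (1 + |xi|^(2/3)), in time under a constant. *)
Lemma noise_norm2_gtrk_cvg t (x : plane R) :
  noise_norm2 mu `[0%R, t] (fun p => gtrk (dln n) (nun n) t x p - gtrk 0 1 t x p)
    @[n --> \oo] --> 0%E.
Proof.
(* 4 = 2 + 2, from the two terms of [fourier2D_le]. *)
pose C := 4 * kdecay t x.1; have C0 : 0 <= C by rewrite mulr_ge0// kdecay_ge0.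
have iw := intg_wmu.
pose W := \int[mu]_xi (1 / (1 + enorm xi `^ (2 / 3))).
have gg n : good_integrand (fun p => gtrk (dln n) (nun n) t x p - gtrk 0 1 t x p).
  have /andP[n0 n1] := nun_01 n.
  by apply: goodB; apply: good_gtrk => //; [exact: ltW (dln_gt0 n)|exact: ltW].
have bnd n (s : R) xi : 0 <= s -> fourier2 (fun y => gtrk (dln n) (nun n) t x (s, y) - gtrk 0 1 t x (s, y)) xi
    <= C * (1 / (1 + enorm xi `^ (2 / 3))).
  move=> s0; have /andP[n0 n1] := nun_01 n.
  have tst : t - s <= t by rewrite gerBl.
  have i1 : intg (leb2 R) (gtr (dln n) (nun n) (t - s) x).
    by apply: intg_gtr => //; [exact: ltW (dln_gt0 n)|exact: ltW].
  have i2 : intg (leb2 R) (gtr 0 1 (t - s) x) by exact: intg_gtr.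
  apply: (le_trans (fourier2D_le xi i1 (intgN i2))); rewrite fourier2N//.
  have h1 : fourier2 (gtr (dln n) (nun n) (t - s) x) xi <= kdecay t x.1 / (1 + enorm xi `^ (2 / 3)).
    by apply: fourier2_gtr_le; [exact: dln_gt0|exact: nun_01|].
  have h2 : fourier2 (gtr 0 1 (t - s) x) xi <= kdecay t x.1 / (1 + enorm xi `^ (2 / 3)).
    exact: fourier2_gtr01_le.
  rewrite /C [1 / _]mul1r -mulrA.
  move: h1 h2; move: (fourier2 _ _) (fourier2 _ _) (_ / _) => a b c h1 h2.
  by lra.
have inner (s : R) : 0 <= s ->
    fnorm2 mu (fun p => gtrk (dln n) (nun n) t x p - gtrk 0 1 t x p) s @[n --> \oo] --> 0%E.
  move=> s0.
  pose q n (xi : plane R) := fourier2 (fun y => gtrk (dln n) (nun n) t x (s, y) - gtrk 0 1 t x (s, y)) xi.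
  have mq n : measurable_fun setT (q n) by exact: good_slice s (gg n).
  have q_cvg xi : q n xi @[n --> \oo] --> (0 : R).
    rewrite -[0 : R](fourier2_0 xi).
    apply: (@fourier2_cvg _ _ _ (fun y => 2 * gtr 0 1 (t - s) x y)).
    + by move=> n; exact: intg_measurable (good_intg s (gg n)).
    + move=> y; have h : gtr (dln n) (nun n) (t - s) x y - gtr 0 1 (t - s) x y @[n --> \oo] -->
        gtr 0 1 (t - s) x y - gtr 0 1 (t - s) x y by apply: cvgB; [exact: gtr_cvg|exact: cvg_cst].
      by rewrite subrr in h.
    + by apply: intgZl; exact: intg_gtr.
    + move=> n y; apply: (le_trans (ler_normB _ _)).
      rewrite /gtrk /= !ger0_norm ?gtr_ge0// [gtr 0 1 _ _ _]gtr01.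
      by have := gtr_le (dln n) (nun n) (t - s) x y; lra.
  have q_le n xi : `|q n xi| <= C * (1 / (1 + enorm xi `^ (2 / 3))).
    by rewrite ger0_norm ?fourier2_ge0//; exact: bnd.
  have [_] := dct_Rint mq q_cvg (intgZl C iw) q_le.
  rewrite Rint0 => h.
  rewrite (_ : (fun n => _) = (fun n => (\int[mu]_xi q n xi)%:E)).
    by apply: cvg_EFin; [exact: nearW|exact: h].
  by apply/funext => n; rewrite Rint_intgE//; exact: (intg_le (mq n) (intgZl C iw) (q_le n)).
under eq_fun do rewrite noise_norm2E.
rewrite -[0%E](@integral0 _ _ R leb `[0%R, t]).
apply: (@dominated_cvg _ _ _ leb `[0%R, t]%classic _ (fun n => fnorm2 mu (fun p => gtrk (dln n) (nun n) t x p - gtrk 0 1 t x p))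
  (cst 0%E) (fun=> (C * W)%:E)) => //.
- by move=> n; apply: measurable_funTS; apply: measurable_fnorm2; exact: (gg n).1.
- by move=> s; rewrite /= in_itv/= => /andP[s0 _]; exact: inner.
- apply: (@measurable_bounded_integrable _ _ _ leb (cst (C * W))) => //.
  + rewrite /= lebesgue_measure_itv/=; case: ifP => _ //; by rewrite -EFinB ltry.
  + exact: bounded_cst.
- move=> n s; rewrite /= in_itv/= => /andP[s0 _].
  rewrite gee0_abs ?fnorm2_ge0//; rewrite /W -RintegralZl// Rint_intgE; last exact: intgZl.
  apply: ge0_le_integral => //.
  + by move=> xi _; rewrite lee_fin fourier2_ge0.
  + by apply/measurable_EFinP; exact: good_slice s (gg n).
  + by apply/measurable_EFinP; exact: intg_measurable (intgZl _ iw).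
  + by move=> xi _; rewrite lee_fin; exact: bnd.
Qed.

End KernelNoise.

(** * Fourier transforms of Gaussians on the line *)

Section GaussFourier.
Variable R : realType.
Local Notation leb := (@lebesgue_measure R).
Local Notation gs := (@gauss_fun R).

Lemma Rint_gauss : \int[leb]_x gs x = Num.sqrt pi.
Proof. by rewrite /Rintegral integralT_gauss. Qed.

Lemma intg_gauss_half : intg leb (fun x : R => expR (- (x ^+ 2 / 2))).
Proof.
have s2 : Num.sqrt 2^-1 != 0 :> R by rewrite gt_eqF// sqrtr_gt0 invr_gt0.
apply: intg_ext (intg_affine 0 s2 (@integrableT_gauss R)) => x.
by rewrite /gauss_fun addr0 exprMn sqr_sqrtr ?invr_ge0// mulrC.
Qed.

Lemma mul_gauss_le (x : R) : `|x| * gs x <= expR (- (x ^+ 2 / 2)).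
Proof.
have -> : gs x = expR (- (x ^+ 2 / 2)) * expR (- (x ^+ 2 / 2)).
  by rewrite -expRD /gauss_fun; congr expR; field.
rewrite mulrA ler_piMl ?expR_ge0// -(ler_pM2r (expR_gt0 (x ^+ 2 / 2))) mul1r -mulrA.
rewrite -expRD addNr expR0 mulr1; apply: le_trans (expR_ge1Dx _).
rewrite -[x ^+ 2]real_normK ?num_real//; have := sqr_ge0 (`|x| - 1); nra.
Qed.

Lemma isd_gauss x : isder x gs (- (2 * x) * gs x).
Proof.
have d : isder x (fun x : R => - x ^+ 2) (- (2 * x)) by isd_tac; ring.
by apply: isd_eq (isd_comp (is_derive_expR _) d) _; rewrite mulrC.
Qed.

Lemma intg_trig_gauss (h : R -> R) (b : R) : continuous h -> (forall x, `|h x| <= 1) ->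
  intg leb (fun x => h (b * x) * gs x).
Proof.
move=> ch h1; apply: (@intg_ext _ _ _ leb (fun x => gs x * h (b * x))); first by move=> x; rewrite mulrC.
apply: intg_bounded; first exact: integrableT_gauss.
  apply: mfunE; apply: (@mf_comp _ _ _ h (fun x => b * x)); first exact: continuous_measurable_fun.
  by meas.
by exists 1.
Qed.

Lemma mf_gauss : mfun (fun x : measurableTypeR R => gs x).
Proof. by rewrite /gauss_fun; meas. Qed.

(** The integrand is the derivative of sin(b x) exp(- x^2) / 2, which vanishes at infinity. *)
Lemma gauss_parts (b : R) :
  \int[leb]_x (b / 2 * (cos (b * x) * gs x) - x * sin (b * x) * gs x) = 0.
Proof.
pose F x := sin (b * x) * gs x / 2.
pose f x := b / 2 * (cos (b * x) * gs x) - x * sin (b * x) * gs x.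
have db x : isder x (fun x => b * x) b by isd_tac; ring.
have dF x : isder x F (f x).
  by apply: isd_eq (isdM (isdM (isd_sin (db x)) (isd_gauss x)) (isd_cst 2^-1 x)) _; rewrite /f; field.
have cg x : {for x, continuous gs} by exact: isd_cont (isd_gauss x).
have cf x : {for x, continuous f}.
  apply: (@contD _ _ (fun x => - (x * sin (b * x) * gs x))).
    apply: contM; first exact: cst_continuous.
    by apply: contM => //; exact: isd_cont (isd_cos (db x)).
  apply: continuousN; apply: contM => //; apply: contM; first exact: isd_cont (isd_id x).
  exact: isd_cont (isd_sin (db x)).
pose G (x : R) := `|b / 2| * gs x + expR (- (x ^+ 2 / 2)).
have iG : intg leb G.
  apply: intgD; last exact: intg_gauss_half.
  by apply: intgZl; exact: integrableT_gauss.
pose f_ (n : nat) x := f x * oo (- n.+1%:R) n.+1%:R x.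
have mf : mfun (fun x : measurableTypeR R => f x).
  by apply: continuous_measurable_fun => x; exact: cf.
have mf_ n : measurable_fun [set: measurableTypeR R] (f_ n).
  by apply: mfM => //; exact: measurable_oo.
have fG x : `|f x| <= G x.
  apply: (le_trans (ler_normB _ _)); apply: lerD.
    rewrite normrM ler_wpM2l// normrM (ger0_norm (gauss_fun_ge0 x)).
    by rewrite ler_piMl ?gauss_fun_ge0// norm_cos_le1.
  apply: le_trans (mul_gauss_le x).
  rewrite !normrM (ger0_norm (gauss_fun_ge0 x)) ler_wpM2r ?gauss_fun_ge0//.
  by rewrite ler_piMr// norm_sin_le1.
have f_G n x : `|f_ n x| <= G x.
  by apply: le_trans (fG x); rewrite normrM normr_oo ler_piMr// oo_le1.
have f_f x : f_ n x @[n --> \oo] --> f x.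
  apply: cvg_near_cst; near=> n.
  have : `|x| < n.+1%:R.
    apply: (@lt_le_trans _ _ n%:R); last by rewrite ler_nat.
    by near: n; exact: nbhs_infty_gtr.
  by rewrite ltr_norml /f_ /oo => ->; rewrite mulr1.
have [_ h] := dct_Rint mf_ f_f iG f_G.
have e n : \int[leb]_x f_ n x = F n.+1%:R - F (- n.+1%:R).
  apply: FTC_cc => //; have : 0 < n.+1%:R :> R by []; lra.
have FN x : F (- x) = - F x.
  by rewrite /F mulrN sinN /gauss_fun sqrrN; ring.
have h0 : F n.+1%:R - F (- n.+1%:R) @[n --> \oo] --> (0 : R).
  have g0 n : gs n.+1%:R <= n.+1%:R^-1.
    rewrite /gauss_fun expRN lef_pV2 ?posrE ?expR_gt0//.
    apply: le_trans (expR_ge1Dx _); rewrite -natrX -natr1 [leLHS]addrC lerD2l ler_nat.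
    by rewrite (leq_trans (leqnSn n))// leq_pmulr.
  apply: (@squeeze_cvgr _ _ _ _ (fun n => - n.+1%:R^-1) (fun n => n.+1%:R^-1)).
  - apply: nearW => n; rewrite -ler_norml FN opprK; apply: le_trans (g0 n).
    have -> : F n.+1%:R + F n.+1%:R = sin (b * n.+1%:R) * gs n.+1%:R by rewrite /F; field.
    by rewrite normrM (ger0_norm (gauss_fun_ge0 _)) ler_piMl ?gauss_fun_ge0// norm_sin_le1.
  - by rewrite -oppr0; apply: cvgN; exact: cvg_harmonic.
  - exact: cvg_harmonic.
have {}h : F n.+1%:R - F (- n.+1%:R) @[n --> \oo] --> \int[leb]_x f x.
  by rewrite (_ : (fun n => _) = (fun n => \int[leb]_x f_ n x))//; apply/funext => n; rewrite e.
exact: (cvg_unique _ h h0).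
Unshelve. all: by end_near. Qed.

Let phi (b : R) : R := \int[leb]_x (cos (b * x) * gs x).

(** Differentiation under the integral sign gives minus the integral of x sin(b x) exp(- x^2), and
    [gauss_parts] turns this into a linear differential equation. *)
Let dphi b : isder b phi (- (b / 2) * phi b).
Proof.
have in1 : `]b - 1, b + 1[%classic b by rewrite /= in_itv/=; lra.
have ci x : `]b - 1, b + 1[%classic x -> leb.-integrable setT (EFin \o (fun y => cos (x * y) * gs y)).
  by move=> _; apply: (@intg_trig_gauss cos); [exact: continuous_cos|exact: norm_cos_le1].
have d1 (x y : R) : isder x (fun x => cos (x * y) * gs y) (- (y * sin (x * y) * gs y)).
  have dxy : isder x (fun x => x * y) y by isd_tac; ring.
  by apply: isd_eq (isdM (isd_cos dxy) (isd_cst (gs y) x)) _; ring.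
have di x y : `]b - 1, b + 1[%classic x -> [set: R] y -> derivable (fun x : R => cos (x * y) * gs y) x 1.
  by move=> _ _; have [] := d1 x y.
have pe x y : partial1of2 (fun x y : R => cos (x * y) * gs y) x y = - (y * sin (x * y) * gs y).
  by rewrite partial1of2E; apply: derive_val; exact: d1.
have pub x y : `]b - 1, b + 1[%classic x -> [set: R] y ->
    `|partial1of2 (fun x y : R => cos (x * y) * gs y) x y| <= expR (- (y ^+ 2 / 2)).
  move=> _ _; rewrite pe normrN; apply: le_trans (mul_gauss_le y).
  rewrite !normrM (ger0_norm (gauss_fun_ge0 y)) ler_wpM2r ?gauss_fun_ge0//.
  by rewrite ler_piMr// norm_sin_le1.
have E0 y : 0 <= expR (- (y ^+ 2 / 2)) :> R by exact: expR_ge0.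
have h1 := @derivable_under_integral R _ _ leb (fun x y : R => cos (x * y) * gs y) setT measurableT
  b _ _ in1 ci di _ E0 intg_gauss_half pub.
have h2 := @differentiation_under_integral R _ _ leb (fun x y : R => cos (x * y) * gs y) setT measurableT
  b _ _ in1 ci di _ E0 intg_gauss_half pub.
have i1 : intg leb (fun y => b / 2 * (cos (b * y) * gs y)) by apply: intgZl; exact: ci in1.
have i2 : intg leb (fun y => y * sin (b * y) * gs y).
  apply: (intg_le _ intg_gauss_half) => [|y].
    by apply: mfunE; apply: mfM; [meas|exact: mf_gauss].
  by have := pub b y in1 I; rewrite pe normrN.
have h3 : \int[leb]_y (b / 2 * (cos (b * y) * gs y)) = \int[leb]_y (y * sin (b * y) * gs y).
  by apply/eqP; rewrite -subr_eq0 -RintegralB// gauss_parts.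
split; first exact: h1.
rewrite -derive1E h2 /=.
rewrite (_ : \int[leb]_y _ = \int[leb]_y (-1 * (y * sin (b * y) * gs y))).
  rewrite RintegralZl// -h3 RintegralZl//; last exact: ci in1.
  by rewrite /phi mulN1r mulNr.
by apply: eq_Rintegral => y _; rewrite pe mulN1r.
Qed.

(** By the equation of [dphi], phi(b) exp(b^2 / 4) is constant; at b = 0 it is the Gaussian
    integral. *)
Lemma gauss_cos (b : R) : \int[leb]_x (cos (b * x) * gs x) = Num.sqrt pi * expR (- (b ^+ 2 / 4)).
Proof.
have d0 x : isder x (fun b => phi b * expR (b ^+ 2 / 4)) 0.
  have dx : isder x (fun b : R => b ^+ 2 / 4) (x / 2) by isd_tac; field.
  by apply: isd_eq (isdM (dphi x) (isd_comp (is_derive_expR _) dx)) _; field.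
have := is_derive_0_is_cst b 0 d0.
rewrite expr0n/= mul0r expR0 mulr1 expRN.
rewrite (_ : phi 0 = Num.sqrt pi); last first.
  rewrite /phi -Rint_gauss; apply: eq_Rintegral => x _.
  by rewrite mul0r cos0 mul1r.
by move=> <-; rewrite mulfK// gt_eqF// expR_gt0.
Qed.

Lemma gauss_sin (b : R) : \int[leb]_x (sin (b * x) * gs x) = 0.
Proof.
have i1 : intg leb (fun x => sin (b * x) * gs x).
  by apply: (@intg_trig_gauss sin); [exact: continuous_sin|exact: norm_sin_le1].
have := Rint_affine 0 (_ : -1 != 0) i1; rewrite oppr_eq0 oner_eq0 => /(_ isT).
set I := \int[leb]_y (_ * gs y) => e.
have : I = -1 * I.
  rewrite {1}e normrN normr1 mul1r -RintegralZl//; apply: eq_Rintegral => x _.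
  by rewrite addr0 mulN1r mulrN sinN /gauss_fun sqrrN mulNr mulN1r.
lra.
Qed.

Lemma intg_gauss_phase (b a : R) : intg leb (fun x => cos (b * x + a) * gs x).
Proof.
apply: (@intg_ext _ _ _ leb (fun x => cos a * (cos (b * x) * gs x) - sin a * (sin (b * x) * gs x))).
  by move=> x; rewrite cosD; ring.
apply: intgB; apply: intgZl; apply: intg_trig_gauss.
- exact: continuous_cos.
- exact: norm_cos_le1.
- exact: continuous_sin.
- exact: norm_sin_le1.
Qed.

Lemma gauss_phase (b a : R) :
  \int[leb]_x (cos (b * x + a) * gs x) = cos a * (Num.sqrt pi * expR (- (b ^+ 2 / 4))).
Proof.
have i1 := intg_trig_gauss b (@continuous_cos R) (@norm_cos_le1 R).
have i2 := intg_trig_gauss b (@continuous_sin R) (@norm_sin_le1 R).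
rewrite -gauss_cos -RintegralZl// -[RHS]subr0 -[X in _ - X](mulr0 (sin a)) -(gauss_sin b) -RintegralZl//.
rewrite -RintegralB//; [|exact: intgZl|exact: intgZl].
by apply: eq_Rintegral => x _; rewrite cosD; ring.
Qed.

End GaussFourier.

(** * Gaussians on the plane *)

Section Gauss2.
Variable R : realType.
Local Notation leb := (@lebesgue_measure R).
Local Notation gs := (@gauss_fun R).

(* The Gaussian centred at a, of width dl and integral pi * dl^2. *)
Definition gauss2 (dl : R) (a z : plane R) : R := gs ((z.1 - a.1) / dl) * gs ((z.2 - a.2) / dl).

Definition gauss2_std (v : plane R) : R := gs v.1 * gs v.2.

Lemma gauss2_std_ge0 v : 0 <= gauss2_std v.
Proof. by rewrite mulr_ge0// gauss_fun_ge0. Qed.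

Lemma mf_gauss2_std : mfun gauss2_std.
Proof. by rewrite /gauss2_std /gauss_fun; meas. Qed.

Lemma gauss2_shift dl a v : dl != 0 ->
  gauss2 dl a (dl * v.1 + a.1, dl * v.2 + a.2) = gauss2_std v.
Proof. by move=> d0; rewrite /gauss2 /gauss2_std /= !addrK ![dl * _]mulrC !mulfK. Qed.

Lemma intg_gauss2_std : intg (leb2 R) gauss2_std.
Proof. by apply: intg_prod; exact: integrableT_gauss. Qed.

Lemma intg_gauss2 dl a : dl != 0 -> intg (leb2 R) (gauss2 dl a).
Proof.
move=> d0; have di0 : dl^-1 != 0 by rewrite invr_eq0.
apply: intg_ext (intg_plane_affine (- a.1 / dl) (- a.2 / dl) di0 intg_gauss2_std) => z.
by rewrite /gauss2_std /gauss2 /= !mulrBl !(mulrC dl^-1) !mulNr.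
Qed.

Lemma intg_gauss2_phase (b1 b2 c : R) :
  intg (leb2 R) (fun v => cos (b1 * v.1 + b2 * v.2 + c) * gauss2_std v).
Proof.
exact: (@intg_phase _ cos c gauss2_std (b1, b2) (@continuous_cos R) (@norm_cos_le1 R) intg_gauss2_std).
Qed.

Lemma gauss2_phase (b1 b2 c : R) :
  \int[leb2 R]_v (cos (b1 * v.1 + b2 * v.2 + c) * gauss2_std v) =
  cos c * (pi * expR (- ((b1 ^+ 2 + b2 ^+ 2) / 4))).
Proof.
rewrite Rint_leb2; last exact: intg_gauss2_phase.
have e1 (x : R) : \int[leb]_y (cos (b1 * x + b2 * y + c) * gauss2_std (x, y)) =
    (Num.sqrt pi * expR (- (b2 ^+ 2 / 4))) * (cos (b1 * x + c) * gs x).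
  rewrite mulrA [X in X * gs x]mulrC -gauss_phase [RHS]mulrC -RintegralZl//; last exact: intg_gauss_phase.
  by apply: eq_Rintegral => y _; rewrite /gauss2_std/= mulrCA [b1 * x + _]addrC -addrA.
under eq_Rintegral do rewrite e1.
rewrite RintegralZl//; last exact: intg_gauss_phase.
rewrite gauss_phase.
have -> : expR (- ((b1 ^+ 2 + b2 ^+ 2) / 4)) = expR (- (b1 ^+ 2 / 4)) * expR (- (b2 ^+ 2 / 4)) :> R.
  by rewrite -expRD; congr expR; field.
have p0 : Num.sqrt pi * Num.sqrt pi = pi :> R by rewrite -expr2 sqr_sqrtr// pi_ge0.
by rewrite -[X in cos c * (X * _)]p0; move: (Num.sqrt pi) => s; ring.
Qed.

Lemma Rint_gauss2_std : \int[leb2 R]_v gauss2_std v = pi.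
Proof.
have := gauss2_phase 0 0 0; rewrite cos0 expr0n/= addr0 mul0r oppr0 expR0 mul1r mulr1 => <-.
by apply: Rint_ext => v; rewrite !mul0r !addr0 cos0 mul1r.
Qed.

Lemma fc_gauss2 dl a xi : dl != 0 -> fc (gauss2 dl a) xi =
  pi * dl ^+ 2 * (cos (xi.1 * a.1 + xi.2 * a.2) * expR (- (dl ^+ 2 * (xi.1 ^+ 2 + xi.2 ^+ 2) / 4))).
Proof.
move=> d0; rewrite /fc (@Rint_plane_affine _ dl a.1 a.2)//; last exact: intg_fc (intg_gauss2 a d0).
rewrite (_ : \int[_]_v _ = \int[leb2 R]_v (cos ((dl * xi.1) * v.1 + (dl * xi.2) * v.2 +
  (xi.1 * a.1 + xi.2 * a.2)) * gauss2_std v)).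
  rewrite gauss2_phase !exprMn -mulrDr; move: (pi : R) (expR _) (cos _) => p e k; ring.
by apply: Rint_ext => v; rewrite gauss2_shift//=; congr (cos _ * _); ring.
Qed.

End Gauss2.

(** * Gaussians are Schwartz functions *)

Section LineDerivative.
Variables (R : realType) (V : normedModType R).

(** Reduces directional derivatives to derivatives on the line, where the one-variable rules
    apply. *)
Lemma is_derive_line (f : V -> R) (z v : V) (d : R) :
  isder 0 (fun h : R => f (h *: v + z)) d <-> is_derive z v f d.
Proof.
rewrite /isder; have e : (fun h : R => h^-1 *: (((fun h : R => f (h *: v + z)) \o shift 0) (h *: 1) -
    f (0 *: v + z))) = (fun h : R => h^-1 *: ((f \o shift z) (h *: v) - f z)).
  by apply/funext => h /=; rewrite scale0r add0r addr0 /GRing.scale/= mulr1.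
split; move=> [h1 h2]; split.
- by move: h1; rewrite /derivable e.
- by move: h2; rewrite /derive e.
- by move: h1; rewrite /derivable e.
- by move: h2; rewrite /derive e.
Qed.

End LineDerivative.

Section GaussSchwartz.
Variable R : realType.
Variables (q : R) (a : plane R).
Hypothesis q0 : 0 < q.

(** Polynomials as a class closed under directional derivatives, with polynomial growth: every
    iterated derivative of a Gaussian is one of them times the same Gaussian. *)
Inductive polyfun : (plane R -> R) -> Prop :=
| pf_cst c : polyfun (fun=> c)
| pf_fst : polyfun (fun z => z.1)
| pf_snd : polyfun (fun z => z.2)
| pfD f g : polyfun f -> polyfun g -> polyfun (fun z => f z + g z)
| pfM f g : polyfun f -> polyfun g -> polyfun (fun z => f z * g z).

Lemma polyfun_cont f : polyfun f -> continuous f.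
Proof.
elim=> [c|||{}f g _ cf _ cg|{}f g _ cf _ cg] z.
- exact: cst_continuous.
- exact: cvg_fst.
- exact: cvg_snd.
- by apply: cvgD; [exact: cf|exact: cg].
- by apply: cvgM; [exact: cf|exact: cg].
Qed.

Lemma polyfun_derive f (v : plane R) : polyfun f ->
  exists2 g, polyfun g & forall z, is_derive z v f (g z).
Proof.
elim=> [c|||{}f g pf [f' pf' df] pg [g' pg' dg]|{}f g pf [f' pf' df] pg [g' pg' dg]].
- exists (fun=> 0); first exact: pf_cst.
  by move=> z; exact: is_derive_cst.
- exists (fun=> v.1); first exact: pf_cst.
  move=> z; apply/is_derive_line; have : isder (0 : R) (fun h : R => h * v.1 + z.1) v.1 by isd_tac; ring.
  by [].
- exists (fun=> v.2); first exact: pf_cst.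
  move=> z; apply/is_derive_line; have : isder (0 : R) (fun h : R => h * v.2 + z.2) v.2 by isd_tac; ring.
  by [].
- exists (fun z => f' z + g' z); first exact: pfD.
  by move=> z; exact: is_deriveD.
- exists (fun z => f' z * g z + f z * g' z); first by apply: pfD; exact: pfM.
  move=> z; apply/is_derive_line; have := isdM ((is_derive_line _ _ _ _).2 (df z)) ((is_derive_line _ _ _ _).2 (dg z)).
  by rewrite scale0r add0r.
Qed.

Lemma polyfun_growth f : polyfun f ->
  exists C n, 0 <= C /\ forall z, `|f z| <= C * (1 + `|z|) ^+ n.
Proof.
have n0 (z : plane R) : 0 <= 1 + `|z| by rewrite addr_ge0.
have n1 (z : plane R) : 1 <= 1 + `|z| by rewrite lerDl.
elim=> [c|||{}f g _ [C [n [C0 h]]] _ [D [m [D0 k]]]|{}f g _ [C [n [C0 h]]] _ [D [m [D0 k]]]].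
- by exists `|c|, 0; split => // z; rewrite expr0 mulr1.
- exists 1, 1; split => // z; rewrite expr1 mul1r; apply: (@le_trans _ _ `|z|); last by rewrite lerDr.
  by rewrite prod_normE le_max lexx.
- exists 1, 1; split => // z; rewrite expr1 mul1r; apply: (@le_trans _ _ `|z|); last by rewrite lerDr.
  by rewrite prod_normE le_max lexx orbT.
- exists (C + D), (n + m)%N; split; first exact: addr_ge0.
  move=> z; apply: (le_trans (ler_normD _ _)); rewrite mulrDl; apply: lerD.
    apply: (le_trans (h z)); rewrite ler_wpM2l// exprD ler_peMr ?exprn_ge0//.
    exact: exprn_ege1.
  apply: (le_trans (k z)); rewrite ler_wpM2l// exprD ler_peMl ?exprn_ge0//.
  exact: exprn_ege1.
- exists (C * D), (n + m)%N; split; first exact: mulr_ge0.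
  by move=> z; rewrite normrM exprD mulrACA ler_pM.
Qed.

Let E (z : plane R) : R := expR (- (q * ((z.1 - a.1) ^+ 2 + (z.2 - a.2) ^+ 2))).

Let dE (v : plane R) : exists2 l, polyfun l & forall z, is_derive z v E (l z * E z).
Proof.
pose l z := - (2 * q) * ((z.1 + - a.1) * v.1 + (z.2 + - a.2) * v.2).
exists l.
  apply: pfM; first exact: pf_cst.
  by apply: pfD; apply: pfM; try exact: pf_cst; apply: pfD; try exact: pf_cst; [exact: pf_fst|exact: pf_snd].
move=> z; apply/is_derive_line; rewrite /E /=.
pose p (h : R) := - (q * ((h *: v.1 + z.1 - a.1) ^+ 2 + (h *: v.2 + z.2 - a.2) ^+ 2)).
have dp : isder 0 p (l z).
  rewrite /p; have : isder (0 : R) (fun h : R => - (q * ((h * v.1 + z.1 - a.1) ^+ 2 + (h * v.2 + z.2 - a.2) ^+ 2))) (l z).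
    by isd_tac; rewrite /l; ring.
  by [].
apply: isd_eq (isd_comp (is_derive_expR _) dp) _.
by rewrite mulrC /p !scale0r !add0r.
Qed.

Let cE : continuous E.
Proof.
move=> z; apply: (@continuous_comp _ _ _ (fun z : plane R => - (q * ((z.1 - a.1) ^+ 2 + (z.2 - a.2) ^+ 2))) expR);
  last exact: continuous_expR.
apply: cvgN; apply: cvgM; first exact: cvg_cst.
by apply: cvgD; apply: cvgM; apply: cvgB; try exact: cvg_cst; by [exact: cvg_fst|exact: cvg_snd].
Qed.

(** (1 + |z|)^N is at most exp(N |z|) <= exp(N |a| + N |z - a|), and completing the square gives N r
    - q r^2 <= N^2 / (4 q). The norm is the maximum norm, which lies below the Euclidean one in the
    exponent. *)
Let E_bound N : exists C, forall z, (1 + `|z|) ^+ N * E z <= C.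
Proof.
exists (expR (N%:R * `|a| + N%:R ^+ 2 / (4 * q))) => z.
have n0 : 0 <= 1 + `|z| by rewrite addr_ge0.
have h1 : (1 + `|z|) ^+ N <= expR (N%:R * (`|a| + `|z - a|)).
  rewrite mulrC expRM_natr lerXn2r ?nnegrE ?expR_ge0//; apply: le_trans (expR_ge1Dx _).
  by rewrite lerD2l -lerBlDl; apply: le_trans (lerB_dist _ _) _.
have h2 : q * `|z - a| ^+ 2 <= q * ((z.1 - a.1) ^+ 2 + (z.2 - a.2) ^+ 2).
  rewrite ler_pM2l// prod_normE /Order.max/=; case: ifP => _.
    by rewrite real_normK ?num_real// lerDr sqr_ge0.
  by rewrite real_normK ?num_real// lerDl sqr_ge0.
apply: (le_trans (ler_wpM2r (expR_ge0 _) h1)); rewrite -expRD ler_expR.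
rewrite mulrDr -addrA lerD2l; apply: le_trans (lerB (lexx _) h2) _.
have q4 : 0 < 4 * q by rewrite mulr_gt0.
rewrite ler_pdivlMr//; have := sqr_ge0 (2 * q * `|z - a| - N%:R).
move: (`|z - a|) (N%:R : R) => r n h.
have -> : (n * r - q * r ^+ 2) * (4 * q) = n ^+ 2 - (2 * q * r - n) ^+ 2 by ring.
by rewrite lerBlDr lerDl.
Qed.

Lemma schwartz_poly_gauss p : polyfun p -> schwartz (fun z => p z * E z).
Proof.
have it (vs : seq (plane R)) f : polyfun f ->
    exists2 g, polyfun g & iter_derive vs (fun z => f z * E z) = (fun z => g z * E z).
  move=> pf; elim: vs => [|v vs [g pg /= ->]]; first by exists f.
  have [g' pg' dg] := polyfun_derive v pg; have [l pl dl] := dE v.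
  exists (fun z => g' z + g z * l z); first by apply: pfD => //; exact: pfM.
  apply/funext => z; apply: derive_val.
  apply/is_derive_line; have := isdM ((is_derive_line _ _ _ _).2 (dg z)) ((is_derive_line _ _ _ _).2 (dl z)).
  by rewrite scale0r add0r => h; apply: isd_eq h _; ring.
move=> pp; split=> [vs|vs k].
  have [g pg ->] := it vs _ pp; split.
    by move=> z; apply: cvgM; [exact: polyfun_cont|exact: cE].
  move=> v z; have [g' pg' dg] := polyfun_derive v pg; have [l pl dl] := dE v.
  have := isdM ((is_derive_line _ _ _ _).2 (dg z)) ((is_derive_line _ _ _ _).2 (dl z)).
  by move=> /(is_derive_line (fun z => g z * E z)) [].
have [g /polyfun_growth[C [n [C0 gC]]] ->] := it vs _ pp.
have [D hD] := E_bound (k + n); exists (C * D) => z.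
have n0 : 0 <= 1 + `|z| by rewrite addr_ge0.
rewrite normrM (ger0_norm (expR_ge0 _)) mulrA.
apply: (@le_trans _ _ (C * ((1 + `|z|) ^+ (k + n) * E z))); last by rewrite ler_wpM2l.
rewrite mulrA ler_wpM2r ?expR_ge0// exprD mulrCA ler_wpM2l ?exprn_ge0//.
Qed.

End GaussSchwartz.

Lemma schwartz_gauss2 (R : realType) (dl : R) (a : plane R) : dl != 0 -> schwartz (gauss2 dl a).
Proof.
move=> d0; have q0 : 0 < (dl ^+ 2)^-1 by rewrite invr_gt0 exprn_even_gt0.
have := schwartz_poly_gauss a q0 (pf_cst 1).
rewrite (_ : (fun z => _) = gauss2 dl a)//; apply/funext => z.
by rewrite mul1r /gauss2 /gauss_fun -expRD; congr expR; field.
Qed.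

Lemma cschwartz_real (R : realType) (g : plane R -> R) : schwartz g -> cschwartz (fun z => (g z)%:C%C).
Proof.
move=> sg; split => //=; split=> [vs|vs k].
  suff -> : iter_derive vs (fun=> 0 : R) = (fun=> 0) :> (plane R -> R).
    by split=> [z|v z]; [exact: cst_continuous|exact: derivable_cst].
  by elim: vs => //= v vs ->; apply/funext => z; exact: derive_cst.
exists 0 => z; suff -> : iter_derive vs (fun=> 0 : R) = (fun=> 0) :> (plane R -> R).
  by rewrite normr0 mulr0.
by elim: vs => //= v vs ->; apply/funext => y; exact: derive_cst.
Qed.

(** * Gaussian weights and the spectral identity tested on Gaussians *)

Section GaussWeight.
Variable R : realType.

Definition gsq (c : R) (z : plane R) : R := expR (- (c * (z.1 ^+ 2 + z.2 ^+ 2))).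

Lemma gsq_ge0 c z : 0 <= gsq c z. Proof. exact: expR_ge0. Qed.

Lemma mf_gsq c : mfun (gsq c). Proof. by rewrite /gsq; meas. Qed.

Lemma gsqE c : 0 < c -> gsq c = gauss2 (Num.sqrt c)^-1 0.
Proof.
move=> c0; apply/funext => z; rewrite /gsq /gauss2 /gauss_fun /= invrK -expRD; congr expR.
by rewrite !subr0 !exprMn sqr_sqrtr ?ltW// -opprD -mulrDl mulrC.
Qed.

Lemma gsq_intg c : 0 < c -> intg (leb2 R) (gsq c).
Proof. by move=> c0; rewrite gsqE//; apply: intg_gauss2; rewrite invr_eq0 gt_eqF// sqrtr_gt0. Qed.

Lemma gauss2_gsq dl a z : gauss2 dl a z = gsq (dl ^- 2) (z.1 - a.1, z.2 - a.2).
Proof.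
by rewrite /gauss2 /gauss_fun /gsq -expRD; congr expR; rewrite /= !exprMn exprVn -opprD -mulrDl mulrC.
Qed.

Lemma gauss2_stdE v : gauss2_std v = gsq 1 v.
Proof. by rewrite /gauss2_std /gauss_fun /gsq -expRD mul1r opprD. Qed.

(* A Gaussian centred anywhere within a bounded set is dominated by a wider
   one centred at 0. *)
Lemma gsq_shift c k (z w : plane R) : 0 <= c -> w.1 ^+ 2 + w.2 ^+ 2 <= k ->
  gsq c (z.1 - w.1, z.2 - w.2) <= expR (c * k) * gsq (c / 2) z.
Proof.
move=> c0 wk; rewrite /gsq -expRD ler_expR /=.
have := sqr_ge0 (z.1 - 2 * w.1); have := sqr_ge0 (z.2 - 2 * w.2) => h1 h2.
rewrite -lerBlDl -subr_ge0.
rewrite (_ : _ - _ = c * ((k - (w.1 ^+ 2 + w.2 ^+ 2)) + ((z.1 - 2 * w.1) ^+ 2 + (z.2 - 2 * w.2) ^+ 2) / 2)).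
  by rewrite mulr_ge0// addr_ge0 ?subr_ge0// divr_ge0// addr_ge0.
by field.
Qed.

Lemma gsq_out c k (w : plane R) : 0 <= c -> w.1 ^+ 2 + w.2 ^+ 2 <= k -> 1 <= expR (c * k) * gsq c w.
Proof. by move=> c0 wk; rewrite /gsq -expRD -[leLHS]expR0 ler_expR -mulrBr mulr_ge0// subr_ge0. Qed.

End GaussWeight.

Section SpectralGauss.
Variables (R : realType) (f : plane R -> R) (mu : {sigma_finite_measure set (plane R) -> \bar R}).
Hypothesis mu_spec : spectral_measure f mu.
Hypothesis mu_int : (\int[mu]_xi (1 / (1 + enorm xi `^ (2 / 3)))%:E < +oo)%E.

Lemma spectral_schwartz g : schwartz g ->
  intg (leb2 R) (fun z => f z * g z) /\ \int[leb2 R]_z (f z * g z) = \int[mu]_xi fc g xi.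
Proof.
move=> sg; have [_ /(_ _ (cschwartz_real sg))[[i1 _] e]] := mu_spec.
have e1 : (fun z => complex.Re ((f z)%:C%C * (g z)%:C%C)) = (fun z => f z * g z).
  by apply/funext => z /=; rewrite mulr0 subr0.
split; first by rewrite -e1.
have := congr1 (@complex.Re R) e; rewrite /cintegral /= -e1 => ->.
apply: eq_Rintegral => xi _; rewrite /fourier /cintegral /= /fc; apply: eq_Rintegral => y _.
by rewrite /= mulr0 subr0 cosN.
Qed.

Lemma intg_f_gsq c : 0 < c -> intg (leb2 R) (fun z => f z * gsq c z).
Proof.
move=> c0; rewrite gsqE//; apply: (spectral_schwartz _).1; apply: schwartz_gauss2.
by rewrite invr_eq0 gt_eqF// sqrtr_gt0.
Qed.

(** f times a Gaussian is integrable, hence measurable, and a Gaussian never vanishes. *)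
Lemma mf_f : mfun f.
Proof.
have h := intg_measurable (intg_f_gsq ltr01).
have -> : f = (fun z => (f z * gsq 1 z) * (gsq 1 z)^-1).
  by apply/funext => z; rewrite mulfK// gt_eqF// expR_gt0.
by apply: mfM => //; apply: mfV; exact: mf_gsq.
Qed.

(** A Gaussian is bounded below on the box. *)
Lemma intg_f_box K : intg (leb2 R) (fun z => f z * (oo (- K) K z.1 * oo (- K) K z.2)).
Proof.
apply: (@intg_le _ _ _ (leb2 R) _ (fun z => expR (1 * (2 * K ^+ 2)) * `|f z * gsq 1 z|)).
- by apply: mfunE; apply: mfM; [exact: mf_f|meas].
- by apply: intgZl; exact/intg_norm/intg_f_gsq.
move=> z; rewrite !normrM !normr_oo (ger0_norm (gsq_ge0 _ _)) [leRHS]mulrCA ler_wpM2l//.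
have [h1|h1] := boolP (- K < z.1 < K); last by rewrite /oo (negbTE h1) mul0r mulr_ge0 ?expR_ge0.
have [h2|h2] := boolP (- K < z.2 < K); last by rewrite {2}/oo (negbTE h2) mulr0 mulr_ge0 ?expR_ge0.
rewrite /oo h1 h2 mulr1; apply: gsq_out => //.
have := ltr_norml; rewrite -!ltr_norml in h1 h2 => _.
rewrite -[z.1 ^+ 2]real_normK ?num_real// -[z.2 ^+ 2]real_normK ?num_real//.
have := normr_ge0 z.1; have := normr_ge0 z.2; nra.
Qed.

(* exp(- dl^2 |xi|^2 / 4) decays faster than 1 / (1 + |xi|^(2/3)). *)
Lemma intg_mu_gsq c : 0 < c -> intg mu (gsq c).
Proof.
move=> c0; have h := intg_wmu mu_int.
apply: (@intg_le _ _ _ mu _ (fun xi => (2 + c^-1) * (1 / (1 + enorm xi `^ (2 / 3))))).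
- exact: mf_gsq.
- exact: intgZl.
move=> xi; rewrite ger0_norm ?gsq_ge0//.
have p0 : 0 < 1 + enorm xi `^ (2 / 3) by rewrite ltr_pwDl// powR_ge0.
rewrite mulrA mulr1 ler_pdivlMr//.
have e2 : (enorm xi `^ (2 / 3)) ^+ 3 = enorm xi ^+ 2.
  by rewrite -powR_mulrn ?powR_ge0// -powRrM -powR_mulrn ?sqrtr_ge0//; congr (_ `^ _); field.
have := powR_ge0 (enorm xi) (2 / 3); move: e2; set p := _ `^ _ => e2 pp.
have e3 : xi.1 ^+ 2 + xi.2 ^+ 2 = p ^+ 3 by rewrite e2 sqr_sqrtr// addr_ge0 ?sqr_ge0.
rewrite /gsq e3; have c3 : 0 <= c * p ^+ 3 by rewrite mulr_ge0 ?exprn_ge0// ltW.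
rewrite expRN mulrC ler_pdivrMr ?expR_gt0//.
(* exp(c p^3) >= 1 + c p^3, and (2 + 1/c) (1 + c p^3) >= 2 + p^3 >= 1 + p. *)
apply: (@le_trans _ _ ((2 + c^-1) * (1 + c * p ^+ 3))); last first.
  by rewrite ler_wpM2l ?expR_ge1Dx// addr_ge0// invr_ge0 ltW.
rewrite mulrDr mulr1 mulrDl mulKf ?gt_eqF//.
have : 0 <= c^-1 by rewrite invr_ge0 ltW.
have : p <= 1 + p ^+ 3 by case: (lerP p 1) => p1; nra.
have := mulr_ge0 (ler0n R 2) c3; lra.
Qed.

(** The right-hand side is f mollified at scale dl by a Gaussian of mass 1: damping on the side of
    mu corresponds to smoothing on the side of f. *)
Lemma mu_gsq_phase (dl : R) (w : plane R) : 0 < dl ->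
  \int[mu]_xi (gsq (dl ^+ 2 / 4) xi * cos (xi.1 * w.1 + xi.2 * w.2)) =
  (pi * dl ^+ 2)^-1 * \int[leb2 R]_z (f z * gauss2 dl w z).
Proof.
move=> d0; have dn : dl != 0 by rewrite gt_eqF.
have [_ ->] := spectral_schwartz (schwartz_gauss2 w dn).
have pd : pi * dl ^+ 2 != 0 by rewrite mulf_neq0 ?expf_neq0// gt_eqF// pi_gt0.
have i1 : intg mu (fun xi => gsq (dl ^+ 2 / 4) xi * cos (xi.1 * w.1 + xi.2 * w.2)).
  apply: intg_bounded; first by apply: intg_mu_gsq; rewrite divr_gt0// exprn_gt0.
    by apply: mfunE; meas.
  by exists 1 => xi; exact: norm_cos_le1.
apply: (mulfI pd); rewrite [RHS]mulrA mulfV// mul1r -RintegralZl//.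
apply: eq_Rintegral => xi _; rewrite fc_gauss2//; congr (_ * _); rewrite mulrC; congr (_ * _).
by rewrite /gsq; congr expR; field.
Qed.

End SpectralGauss.

(** * Autocorrelation of a bounded function with bounded support *)

Section Autocorrelation.
Variable R : realType.
Local Notation lb := (leb2 R).
Implicit Types (x y z w : plane R).

Definition pdiff x w : plane R := (x.1 - w.1, x.2 - w.2).

Lemma pdiffK x w : pdiff x (pdiff x w) = w.
Proof. by rewrite /pdiff /= !subKr; case: w. Qed.

Lemma mf_pdiff d (T : measurableType d) (g : plane R -> R) (a b : T -> plane R) : mfun g ->
  measurable_fun setT a -> measurable_fun setT b -> mfun (fun p => g (pdiff (a p) (b p))).
Proof.
move=> mg ma mb; apply: (measurableT_comp mg); rewrite /pdiff.
by apply: mm_pairRR; apply: mfD; try apply: mfN; [apply: mf_fst|apply: mf_fst|apply: mf_snd|apply: mf_snd].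
Qed.

Lemma Rint_reflect x (g : plane R -> R) : intg lb g ->
  intg lb (fun w => g (pdiff x w)) /\ \int[lb]_z g z = \int[lb]_w g (pdiff x w).
Proof.
move=> ig; have n1 : -1 != 0 :> R by rewrite oppr_eq0 oner_eq0.
have e : (fun v : plane R => g (-1 * v.1 + x.1, -1 * v.2 + x.2)) = (fun w => g (pdiff x w)).
  by apply/funext => w; rewrite /pdiff !mulN1r ![- _ + _]addrC.
split; first by rewrite -e; exact: (intg_plane_affine x.1 x.2 n1 ig).
by rewrite (Rint_plane_affine x.1 x.2 n1 ig) e sqrrN expr1n mul1r.
Qed.

Variables (h : plane R -> R) (M K : R).
Hypothesis mh : mfun h.
Hypothesis hM : forall x, `|h x| <= M.
Hypothesis hK : forall x, h x != 0 -> `|x.1| <= K /\ `|x.2| <= K.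

Let M0 : 0 <= M. Proof. by apply: le_trans (hM 0). Qed.

Definition box (r : R) z : R := oo (- r) r z.1 * oo (- r) r z.2.

Lemma box_ge0 r z : 0 <= box r z. Proof. by rewrite mulr_ge0 ?oo_ge0. Qed.

Lemma box_le1 r z : box r z <= 1. Proof. by rewrite mulr_ile1 ?oo_ge0 ?oo_le1. Qed.

Lemma mf_box r : mfun (box r). Proof. by rewrite /box; meas. Qed.

Lemma box1 r z : `|z.1| < r -> `|z.2| < r -> box r z = 1.
Proof. by rewrite /box /oo !ltr_norml => -> ->; rewrite mulr1. Qed.

Lemma intg_box r : intg lb (box r).
Proof. by apply: intg_prod; exact: intg_oo1. Qed.

Let h_box x : `|h x| <= M * box (K + 1) x.
Proof.
have [->|/hK[h1 h2]] := eqVneq (h x) 0; first by rewrite normr0 mulr_ge0// box_ge0.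
by rewrite box1 ?mulr1//; lra.
Qed.

Lemma intg_h : intg lb h.
Proof. by apply: (intg_le mh _ h_box); apply: intgZl; exact: intg_box. Qed.

Lemma intg_h2 : intg lb (fun x => h x ^+ 2).
Proof.
apply: (@intg_ext _ _ _ lb (fun x => h x * h x)); first by move=> x; rewrite expr2.
by apply: intg_bounded; [exact: intg_h|exact: mh|exists M].
Qed.

Let hh_box x w : `|h x * h (pdiff x w)| <= `|h x| * (M * box (2 * K + 1) w).
Proof.
rewrite normrM; have [->|/hK[h1 h2]] := eqVneq (h x) 0; first by rewrite normr0 !mul0r.
rewrite ler_wpM2l//; have [->|/hK[h3 h4]] := eqVneq (h (pdiff x w)) 0.
  by rewrite normr0 mulr_ge0// box_ge0.
have e (a b : R) : `|a| <= K -> `|a - b| <= K -> `|b| < 2 * K + 1.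
  move=> k1 k2; have : `|a - (a - b)| <= `|a| + `|a - b| by exact: ler_normB.
  by rewrite subKr; lra.
by rewrite box1 ?mulr1//; [exact: e h1 h3|exact: e h2 h4].
Qed.

(** Its cosine transform is [fourier2 h], so the frequency enters through one phase linear in xi and
    the spectral identity can be applied at each w. *)
Definition autocorr w : R := \int[lb]_x (h x * h (pdiff x w)).

Section Weighted.
Variable u : plane R -> R.
Hypothesis mu : mfun u.
Hypothesis iu : intg lb (fun w => u w * box (2 * K + 1) w).

Let hhu_le x w : `|h x * h (pdiff x w) * u w| <= `|h x| * (M * `|u w * box (2 * K + 1) w|).
Proof.
rewrite [in leRHS]normrM (ger0_norm (box_ge0 _ _)) normrM.
apply: le_trans (ler_wpM2r (normr_ge0 (u w)) (hh_box x w)) _.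
by rewrite le_eqVlt; apply/orP; left; apply/eqP; ring.
Qed.

Let mhh : mfun (fun p : plane R * plane R => h p.1 * h (pdiff p.1 p.2)).
Proof.
apply: mfM; first exact: measurableT_comp mh measurable_fst.
exact: mf_pdiff mh measurable_fst measurable_snd.
Qed.

Let ihhu : intg (lb \x lb)%E (fun p : plane R * plane R => h p.1 * h (pdiff p.1 p.2) * u p.2).
Proof.
apply: (intg_le _ (@intg_prod _ _ _ _ _ lb lb _ _ (intg_norm intg_h)
  (intgZl M (intg_norm iu)))).
  by apply: mfunE; apply: mfM; [exact: mhh|exact: measurableT_comp mu measurable_snd].
by move=> p; exact: hhu_le.
Qed.

(** The substitution w = x - y at fixed x, then an exchange of integrals. The box contains every
    difference of two points of the support of h, so local integrability of u is enough. *)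
Lemma autocorr_fubini : intg lb (fun w => autocorr w * u w) /\
  \int[lb]_x \int[lb]_y (h x * (h y * u (pdiff x y))) = \int[lb]_w (autocorr w * u w).
Proof.
have [i1 e1] := Rfubini2 ihhu.
have e w : \int[lb]_x (h x * h (pdiff x w) * u w) = autocorr w * u w.
  rewrite RintegralZr//; apply: (intg_le _ (intgZl (M) (intg_norm intg_h))).
    exact: (@measurable_slice2 _ _ _ _ _ _ _ mhh w).
  move=> x; apply: (le_trans (hh_box x w)); rewrite [leRHS]mulrC ler_wpM2l//.
  by rewrite ler_piMr// box_le1.
split; first by apply: (intg_ext _ i1) => w; rewrite -e.
rewrite -(Rint_ext lb e) /= e1; apply: eq_Rintegral => x _.
have ix : intg lb (fun w => h x * h (pdiff x w) * u w).
  apply: (intg_le _ (intgZl `|h x| (intgZl M (intg_norm iu)))); last exact: hhu_le.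
  exact: (@measurable_slice1 _ _ _ _ _ _ _ (intg_measurable ihhu) x).
have [_ ->] := Rint_reflect x ix.
by apply: eq_Rintegral => y _; rewrite pdiffK mulrA.
Qed.

End Weighted.

Lemma intg_autocorr : intg lb autocorr.
Proof.
have i1 : intg lb (fun w => (fun=> 1) w * box (2 * K + 1) w).
  by apply: (intg_ext _ (intg_box (2 * K + 1))) => w; rewrite mul1r.
have [h1 _] := autocorr_fubini (@mf_cst _ (plane R) R 1) i1.
by apply: (intg_ext _ h1) => w; rewrite mulr1.
Qed.

(** From a b <= (a^2 + b^2) / 2 and translation invariance. *)
Lemma autocorr_le w : `|autocorr w| <= \int[lb]_x h x ^+ 2.
Proof.
have i2 : intg lb (fun x => h (pdiff x w) ^+ 2).
  have := intg_plane_affine (- w.1) (- w.2) (oner_neq0 R) intg_h2.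
  by apply: intg_ext => x; rewrite /pdiff !mul1r.
have e2 : \int[lb]_x h (pdiff x w) ^+ 2 = \int[lb]_x h x ^+ 2.
  rewrite (Rint_plane_affine (- w.1) (- w.2) (oner_neq0 R) intg_h2) expr1n mul1r.
  by apply: Rint_ext => x; rewrite /pdiff !mul1r.
have -> : \int[lb]_x h x ^+ 2 = \int[lb]_x (2^-1 * (h x ^+ 2 + h (pdiff x w) ^+ 2)).
  rewrite RintegralZl//; last by apply: intgD; [exact: intg_h2|exact: i2].
  rewrite RintegralD//; last exact: intg_h2.
  by rewrite e2; field.
apply: normr_Rint_le.
- by apply: intgZl; apply: intgD; [exact: intg_h2|exact: i2].
- by apply: mfunE; apply: mfM => //; apply: mf_pdiff => //; exact: measurable_cst.
move=> x; rewrite normrM -[h x ^+ 2]real_normK ?num_real// -[h _ ^+ 2]real_normK ?num_real//.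
by have := sqr_ge0 (`|h x| - `|h (pdiff x w)|); move: `|h x| `|h _| => a b; nra.
Qed.

(** Each coordinate of a difference of two points of the support is at most 2 K, so its squared
    length is at most 8 K^2. *)
Lemma autocorr_out w : 8 * K ^+ 2 < w.1 ^+ 2 + w.2 ^+ 2 -> autocorr w = 0.
Proof.
move=> hw; rewrite /autocorr -[RHS](Rint0 lb); apply: eq_Rintegral => x _.
have [->|/hK[h1 h2]] := eqVneq (h x) 0; first by rewrite mul0r.
have [->|/hK[h3 h4]] := eqVneq (h (pdiff x w)) 0; first by rewrite mulr0.
have e (a b : R) : `|a| <= K -> `|a - b| <= K -> b ^+ 2 <= 4 * K ^+ 2.
  move=> k1 k2; have : `|a - (a - b)| <= `|a| + `|a - b| by exact: ler_normB.
  rewrite subKr => k3; rewrite -[b ^+ 2]real_normK ?num_real//.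
  have -> : 4 * K ^+ 2 = (2 * K) ^+ 2 by ring.
  have K0 : 0 <= K by exact: le_trans k1.
  by rewrite lerXn2r ?nnegrE ?mulr_ge0//; lra.
by have := e _ _ h1 h3; have := e _ _ h2 h4; move: hw; lra.
Qed.

(** Expands cos(p - q) = cos p cos q + sin p sin q at the phases p and q of x and y. *)
Lemma fourier2_autocorr xi :
  fourier2 h xi = \int[lb]_w (autocorr w * cos (xi.1 * w.1 + xi.2 * w.2)).
Proof.
have mc : mfun (fun w : plane R => cos (xi.1 * w.1 + xi.2 * w.2)) by meas.
have iu : intg lb (fun w => cos (xi.1 * w.1 + xi.2 * w.2) * box (2 * K + 1) w).
  exact/intg_fc/intg_box.
have [_ <-] := autocorr_fubini mc iu.
rewrite /fourier2 !expr2 {1}/fc {1}/fs -!RintegralZr//; [|exact/intg_fs/intg_h|exact/intg_fc/intg_h].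
have ih := intg_h.
rewrite -RintegralD//; last 2 first.
- apply: (@intg_ext _ _ _ lb (fun x => fc h xi * (cos (xi.1 * x.1 + xi.2 * x.2) * h x))).
    by move=> x; rewrite mulrC.
  by apply: intgZl; exact: intg_fc.
- apply: (@intg_ext _ _ _ lb (fun x => fs h xi * (sin (- (xi.1 * x.1 + xi.2 * x.2)) * h x))).
    by move=> x; rewrite mulrC.
  by apply: intgZl; exact: intg_fs.
apply: eq_Rintegral => x _; set cx := cos _; set sx := sin _.
transitivity (\int[lb]_y ((cx * h x) * (cos (xi.1 * y.1 + xi.2 * y.2) * h y) +
    (sx * h x) * (sin (- (xi.1 * y.1 + xi.2 * y.2)) * h y))).
  by rewrite RintegralD ?RintegralZl//; try apply: intgZl; try exact: intg_fc; exact: intg_fs.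
apply: Rint_ext => y.
have -> : xi.1 * (pdiff x y).1 + xi.2 * (pdiff x y).2 = (xi.1 * x.1 + xi.2 * x.2) - (xi.1 * y.1 + xi.2 * y.2).
  by rewrite /=; ring.
by rewrite cosB /cx /sx !sinN; ring.
Qed.

End Autocorrelation.

(** * The energy inequality and the bound of the noise norm by the L^2 norm *)

Lemma cvg_plane (R : realType) (a b : nat -> R) (p : plane R) :
  a n @[n --> \oo] --> (p.1 : R) -> b n @[n --> \oo] --> (p.2 : R) ->
  ((a n, b n) : plane R) @[n --> \oo] --> p.
Proof.
case: p => p1 p2 ha hb.
exact: (@cvg_pair _ _ _ \oo (nbhs (p1 : R)) (nbhs (p2 : R)) _ _ _ a b ha hb).
Qed.

Lemma RintZl d (T : measurableType d) (R : realType) (m : {measure set T -> \bar R}) (c : R)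
  (f : T -> R) : intg m f -> \int[m]_x (c * f x) = c * \int[m]_x f x.
Proof. by move=> fi; rewrite RintegralZl. Qed.

Section Energy.
Variables (R : realType) (f : plane R -> R) (mu : {sigma_finite_measure set (plane R) -> \bar R}).
Hypothesis mu_spec : spectral_measure f mu.
Hypothesis mu_int : (\int[mu]_xi (1 / (1 + enorm xi `^ (2 / 3)))%:E < +oo)%E.
Local Notation lb := (leb2 R).
Implicit Types (x y z w v : plane R).
Variables (h : plane R -> R) (M K : R).
Hypothesis mh : mfun h.
Hypothesis hM : forall x, `|h x| <= M.
Hypothesis hK : forall x, h x != 0 -> `|x.1| <= K /\ `|x.2| <= K.
Local Notation k := (autocorr h).

Let S : R := \int[lb]_x h x ^+ 2.

Let ik : intg lb k. Proof. exact: intg_autocorr mh hM hK. Qed.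

Let mk : mfun k. Proof. exact: intg_measurable ik. Qed.

Let mf : mfun f. Proof. exact: mf_f mu_spec. Qed.

Let kS w : `|k w| <= S. Proof. exact: autocorr_le mh hM hK w. Qed.

Let S0 : 0 <= S. Proof. exact: le_trans (kS 0). Qed.

Let k8 w : k w != 0 -> w.1 ^+ 2 + w.2 ^+ 2 <= 8 * K ^+ 2.
Proof. by move=> kw; rewrite leNgt; apply: contra kw => ?; apply/eqP; exact: (autocorr_out hK). Qed.

(** The Gaussian factor makes this integral finite before [fourier2 h] is known to be mu-integrable;
    it tends to 1 with dl -> 0. *)
Let heat (dl : R) : R := \int[mu]_xi (gsq (dl ^+ 2 / 4) xi * fourier2 h xi).

(** The integrand of f against the mollified autocorrelation, after the substitution w = z - dl v;
    dividing the standard Gaussian by pi gives it mass 1. *)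
Let mollified (dl : R) (p : plane R * plane R) : R :=
  f p.1 * (gauss2_std p.2 / pi * k (- dl * p.2.1 + p.1.1, - dl * p.2.2 + p.1.2)).

Let heat1 (dl : R) : 0 < dl ->
  heat dl = \int[lb]_w (k w * ((pi * dl ^+ 2)^-1 * \int[lb]_z (f z * gauss2 dl w z))).
Proof.
move=> d0; pose G (p : plane R * plane R) := gsq (dl ^+ 2 / 4) p.1 * cos (p.1.1 * p.2.1 + p.1.2 * p.2.2) * k p.2.
have c0 : 0 < dl ^+ 2 / 4 by rewrite divr_gt0// exprn_gt0.
have mG : mfun G.
  apply: mfM; last exact: measurableT_comp mk measurable_snd.
  by apply: mfM; [exact: measurableT_comp (mf_gsq _) measurable_fst|meas].
have iG : intg (mu \x lb)%E G.
  apply: (intg_le mG (@intg_prod _ _ _ _ _ mu lb _ _ (intg_mu_gsq mu_int c0) (intg_norm ik))).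
  move=> p; rewrite /G !normrM (ger0_norm (gsq_ge0 _ _)) ler_wpM2r//.
  by rewrite ler_piMr ?gsq_ge0// norm_cos_le1.
have [_ e] := Rfubini2 iG.
transitivity (\int[mu]_xi \int[lb]_w G (xi, w)).
  apply: eq_Rintegral => xi _; rewrite (fourier2_autocorr mh hM hK) -RintegralZl//.
    by apply: Rint_ext => w; rewrite /G/= -mulrA [in RHS](mulrC (cos _)).
  apply: intg_bounded => //; first by apply: mfunE; meas.
  by exists 1 => w; exact: norm_cos_le1.
apply: (etrans (esym e)); apply: Rint_ext => w; rewrite -(mu_gsq_phase mu_spec mu_int w d0) mulrC -RintegralZr//.
apply: intg_bounded; first exact: intg_mu_gsq.
  by apply: mfunE; meas.
by exists 1 => xi; exact: norm_cos_le1.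
Qed.

Let heat2 (dl : R) : 0 < dl -> heat dl = \int[lb]_z \int[lb]_v mollified dl (z, v).
Proof.
move=> d0; rewrite heat1//; have dn : dl != 0 by rewrite gt_eqF.
set c := (_ * _)^-1.
pose G (p : plane R * plane R) := k p.1 * (c * (f p.2 * gauss2 dl p.1 p.2)).
have mg : mfun (fun p : plane R * plane R => gauss2 dl p.1 p.2).
  by rewrite /gauss2 /gauss_fun; meas.
have mG : mfun G.
  apply: mfM; first exact: measurableT_comp mk measurable_fst.
  apply: mfM; first exact: mf_cst.
  by apply: mfM => //; exact: measurableT_comp mf measurable_snd.
have d2 : 0 < dl ^- 2 by rewrite invr_gt0 exprn_gt0.
pose B z := expR (dl ^- 2 * (8 * K ^+ 2)) * `|f z * gsq (dl ^- 2 / 2) z|.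
have iB : intg lb B.
  by apply: intgZl; apply: intg_norm; apply: (intg_f_gsq mu_spec); rewrite divr_gt0.
have GB p : `|G p| <= `|k p.1| * (`|c| * B p.2).
  rewrite /G normrM; have [->|/k8 kp] := eqVneq (k p.1) 0; first by rewrite normr0 !mul0r.
  rewrite ler_wpM2l// normrM ler_wpM2l// /B !normrM [leRHS]mulrCA ler_wpM2l//.
  rewrite -[X in X <= _]normrM -/(gauss2 dl p.1 p.2) gauss2_gsq !ger0_norm ?gsq_ge0//.
  exact: gsq_shift (ltW d2) kp.
have iG : intg (lb \x lb)%E G.
  exact: (intg_le mG (@intg_prod _ _ _ _ _ lb lb _ _ (intg_norm ik) (intgZl `|c| iB)) GB).
have [_ e] := Rfubini2 iG.
transitivity (\int[lb]_w \int[lb]_z G (w, z)).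
  have ig w : intg lb (fun z => f z * gauss2 dl w z).
    exact: (spectral_schwartz mu_spec (schwartz_gauss2 w dn)).1.
  apply: Rint_ext => w.
  exact: esym (etrans (RintZl (k w) (intgZl c (ig w))) (congr1 _ (RintZl c (ig w)))).
apply: (etrans (esym e)); apply: Rint_ext => z.
have iz : intg lb (fun w => G (w, z)).
  apply: (intg_le _ (intgZl (`|c| * B z) (intg_norm ik))).
    exact: (@measurable_slice2 _ _ _ _ _ _ _ mG z).
  by move=> w; rewrite [leRHS]mulrC; exact: GB.
have nd : - dl != 0 by rewrite oppr_eq0.
have iz' := intg_plane_affine z.1 z.2 nd iz.
apply: (etrans (Rint_plane_affine z.1 z.2 nd iz)); apply: (etrans (esym (RintZl _ iz'))).
apply: Rint_ext => v; rewrite /G/= /mollified/=.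
have -> : gauss2 dl (- dl * v.1 + z.1, - dl * v.2 + z.2) z = gauss2_std v.
  rewrite -(gauss2_shift z v dn); rewrite /gauss2 /gauss_fun /=; congr (expR (- (_ ^+ 2)) * expR (- (_ ^+ 2)));
    by field.
rewrite /c invfM sqrrN.
have d2n : dl ^+ 2 != 0 by rewrite expf_neq0.
have cancel (D a b e' p' : R) : D != 0 -> D * (a * (p' / D * (e' * b))) = e' * (b * p' * a) by move=> ?; field.
exact: cancel.
Qed.

Let dom (p : plane R * plane R) : R := `|f p.1 * gsq 2^-1 p.1| * gsq 2^-1 p.2.

Let C0 : R := expR (8 * K ^+ 2) / pi.

Let C0_ge0 : 0 <= C0. Proof. by rewrite divr_ge0 ?expR_ge0// pi_ge0. Qed.

Let idom : intg (lb \x lb)%E dom.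
Proof.
apply: (@intg_prod _ _ _ _ _ lb lb (fun z => `|f z * gsq 2^-1 z|)).
  by apply: intg_norm; apply: (intg_f_gsq mu_spec); rewrite invr_gt0.
by apply: gsq_intg; rewrite invr_gt0.
Qed.

Let mmol dl : mfun (mollified dl).
Proof.
apply: mfM; first exact: measurableT_comp mf measurable_fst.
apply: mfM.
  apply: mfM; last exact: mf_cst.
  exact: measurableT_comp (@mf_gauss2_std R) measurable_snd.
apply: (measurableT_comp mk); meas.
Qed.

(** The standard Gaussian exp(- |v|^2) is split into two halves. On the support of k, |z - dl v|^2
    <= 8 K^2 with dl <= 1/2, so |z|^2 / 2 <= 8 K^2 + |v|^2 / 4, and one half is traded for exp(8
    K^2) exp(- |z|^2 / 2), which makes f integrable. The majorant does not depend on dl. *)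
Let mol_le (dl : R) p : 0 <= dl <= 2^-1 -> `|mollified dl p| <= C0 * S * dom p.
Proof.
move=> /andP[d0 d1]; rewrite /mollified; set w := (_, _).
have [->|/k8 kw] := eqVneq (k w) 0.
  rewrite !mulr0 normr0; apply: mulr_ge0; first exact: mulr_ge0 C0_ge0 S0.
  by apply: mulr_ge0; [exact: normr_ge0|exact: gsq_ge0].
rewrite /dom gauss2_stdE !normrM !(ger0_norm (gsq_ge0 _ _)) normfV (ger0_norm (pi_ge0 R)).
have e1 : gsq 1 p.2 = gsq 2^-1 p.2 * gsq 2^-1 p.2 by rewrite /gsq -expRD; congr expR; field.
have e2 : gsq 2^-1 p.2 <= expR (8 * K ^+ 2) * gsq 2^-1 p.1.
  rewrite /gsq -expRD ler_expR.
  move: kw; rewrite /w /= => kw.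
  have q0 := sqr_ge0 (p.1.1 - 2 * dl * p.2.1); have q1 := sqr_ge0 (p.1.2 - 2 * dl * p.2.2).
  have q2 : dl ^+ 2 * p.2.1 ^+ 2 <= 4^-1 * p.2.1 ^+ 2 by rewrite ler_wpM2r ?sqr_ge0//; nra.
  have q3 : dl ^+ 2 * p.2.2 ^+ 2 <= 4^-1 * p.2.2 ^+ 2 by rewrite ler_wpM2r ?sqr_ge0//; nra.
  have := sqr_ge0 p.2.1; have := sqr_ge0 p.2.2; nra.
rewrite e1 /C0.
have := kS w; have f0 := normr_ge0 (f p.1); have g0 := gsq_ge0 2^-1 p.2; have g1 := gsq_ge0 2^-1 p.1.
have p0 : 0 <= (pi : R)^-1 by rewrite invr_ge0 pi_ge0.
move: (`|k w|) (`|f p.1|) (gsq _ p.2) (gsq _ p.1) (expR _) (pi^-1) f0 g0 g1 p0 e2 (normr_ge0 (k w)).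
move=> a b g1 g2 e q b0 g10 g20 q0 eg a0 aS.
have -> : b * (g1 * g1 * q * a) = (b * q * g1) * (g1 * a) by ring.
have -> : e * q * S * (b * g2 * g1) = (b * q * g1) * ((e * g2) * S) by ring.
by rewrite ler_wpM2l ?mulr_ge0// ler_pM.
Qed.

Let imol dl : 0 <= dl <= 2^-1 -> intg (lb \x lb)%E (mollified dl).
Proof.
move=> d01; apply: (intg_le (mmol dl) (intgZl (C0 * S) idom)) => p; exact: mol_le.
Qed.

Let heat3 dl : 0 < dl <= 2^-1 -> heat dl = \int[(lb \x lb)%E]_p mollified dl p.
Proof.
move=> /andP[d0 d1]; rewrite heat2//.
have d01 : 0 <= dl <= 2^-1 by rewrite ltW.
by have [_ ->] := Rfubini1 (imol d01).
Qed.

Let dl_ (n : nat) : R := n.+2%:R^-1.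

Let dl0 n : 0 < dl_ n <= 2^-1.
Proof. by rewrite invr_gt0 ltr0n/= lef_pV2 ?posrE ?ltr0n// ler_nat. Qed.

Let dl_cvg : dl_ n @[n --> \oo] --> (0 : R).
Proof.
by have H := @cvg_harmonic R; rewrite -cvg_shiftS in H; exact: H.
Qed.

Let mF : mfun (fourier2 h).
Proof.
pose g (p : R * plane R) := h p.2.
have mg : mfun (fun p : spacetime R => h p.2) by exact: measurableT_comp mh measurable_snd.
exact: (@measurable_slice1 _ _ _ _ _ _ _ (mf_fourier2 mg) (0 : R)).
Qed.

Let heat_cvg xi : gsq (dl_ n ^+ 2 / 4) xi * fourier2 h xi @[n --> \oo] --> fourier2 h xi.
Proof.
rewrite -[X in _ --> X]mul1r; apply: cvgM; last exact: cvg_cst.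
have c0 : {for (0 : R), continuous (fun d : R => gsq (d ^+ 2 / 4) xi)}.
  have e : isder (0 : R) (fun d : R => - (d ^+ 2 / 4 * (xi.1 ^+ 2 + xi.2 ^+ 2))) 0 by isd_tac; field.
  exact: isd_cont (isd_comp (is_derive_expR _) e).
have e1 : gsq (0 ^+ 2 / 4) xi = 1 by rewrite /gsq expr0n/= !mul0r oppr0 expR0.
have H := cvg_comp dl_ (fun d : R => gsq (d ^+ 2 / 4) xi) dl_cvg c0.
by rewrite e1 in H; exact: H.
Qed.

Let iheat dl : 0 < dl -> intg mu (fun xi => gsq (dl ^+ 2 / 4) xi * fourier2 h xi).
Proof.
move=> d0; apply: intg_bounded => //.
  by apply: intg_mu_gsq => //; rewrite divr_gt0// exprn_gt0.
exists (2 * (\int[lb]_y `|h y|) ^+ 2) => xi.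
by rewrite ger0_norm ?fourier2_ge0//; apply: fourier2_le1; exact: intg_h mh hM hK.
Qed.

(** Depends on f and the support radius K only: h enters [fourier2_L2] through K and its L^2
    norm. *)
Definition energy_cst : R := expR (8 * K ^+ 2) / pi *
  \int[(lb \x lb)%E]_p (`|f p.1 * gsq 2^-1 p.1| * gsq 2^-1 p.2).

(** Fatou as dl -> 0: each damped integral equals the integral of [mollified], bounded through
    [mol_le] by the constant times the L^2 norm of h, which dominates k. *)
Lemma fourier2_L2 : (\int[mu]_xi (fourier2 h xi)%:E <= (energy_cst * \int[lb]_x h x ^+ 2)%:E)%E.
Proof.
apply: (@fatou_le _ _ _ mu (fun n xi => gsq (dl_ n ^+ 2 / 4) xi * fourier2 h xi)) => //.
- by move=> n; apply: mfunE; apply: mfM => //; exact: mf_gsq.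
- by move=> n xi; rewrite mulr_ge0 ?gsq_ge0 ?fourier2_ge0.
move=> n; have /andP[d0 d1] := dl0 n.
rewrite -Rint_intgE; last exact: iheat.
rewrite lee_fin [leLHS](heat3 (dl0 n)) /energy_cst -/C0 mulrAC -(RintZl _ idom).
apply: (le_trans (ler_norm _)); apply: normr_Rint_le.
- by apply: intgZl; exact: idom.
- exact: mmol.
- by move=> p; apply: mol_le; rewrite ltW.
Qed.

(** The damped integrals are at most the right-hand side and converge to the left-hand side as dl ->
    0. Continuity of h makes its autocorrelation continuous, so that the mollified integrands
    converge pointwise. *)
Lemma energy_le : continuous h ->
  ((\int[lb]_x \int[lb]_y (h x * (h y * f (pdiff x y))))%:E <= \int[mu]_xi (fourier2 h xi)%:E)%E.
Proof.
move=> ch; have [_ ->] := autocorr_fubini mh hM hK mf (intg_f_box mu_spec (2 * K + 1)).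
have iF : intg mu (fourier2 h).
  apply: intgP => //; under eq_integral do rewrite (ger0_norm (fourier2_ge0 _ _)).
  exact: le_lt_trans fourier2_L2 (ltry _).
rewrite -Rint_intgE// lee_fin.
have k_cvg z v : k (- dl_ n * v.1 + z.1, - dl_ n * v.2 + z.2) @[n --> \oo] --> k z.
  pose wn n : plane R := (- dl_ n * v.1 + z.1, - dl_ n * v.2 + z.2).
  have a (b c : R) : - dl_ n * b + c @[n --> \oo] --> c.
    have : - dl_ n * b + c @[n --> \oo] --> - 0 * b + c.
      by apply: cvgD; [apply: cvgM; [exact: cvgN|exact: cvg_cst]|exact: cvg_cst].
    by rewrite oppr0 mul0r add0r.
  have m1 n : measurable_fun setT (fun x => h x * h (pdiff x (wn n))).
    by apply: mfunE; apply: mfM => //; apply: mf_pdiff => //; exact: measurable_cst.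
  have c1 x : h x * h (pdiff x (wn n)) @[n --> \oo] --> h x * h (pdiff x z).
    apply: cvgM; first exact: cvg_cst.
    apply: continuous_cvg; first exact: ch.
    by apply: (@cvg_plane _ _ _ (pdiff x z)); apply: cvgB; [exact: cvg_cst|exact: a|exact: cvg_cst|exact: a].
  have b1 n x : `|h x * h (pdiff x (wn n))| <= M * `|h x| by rewrite normrM mulrC ler_wpM2r.
  by have [] := dct_Rint m1 c1 (intgZl M (intg_norm (intg_h mh hM hK))) b1.
have dlr n : 0 <= dl_ n <= 2^-1 by have /andP[/ltW -> ->] := dl0 n.
have c2 p : mollified (dl_ n) p @[n --> \oo] --> f p.1 * (gauss2_std p.2 / pi * k p.1).
  by apply: cvgM; [exact: cvg_cst|apply: cvgM; [exact: cvg_cst|exact: k_cvg]].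
have [i0 hc] := dct_Rint (fun n => mmol (dl_ n)) c2 (intgZl (C0 * S) idom) (fun n p => mol_le p (dlr n)).
have e0 : \int[(lb \x lb)%E]_p (f p.1 * (gauss2_std p.2 / pi * k p.1)) = \int[lb]_w (k w * f w).
  have [_ e] := Rfubini1 i0; apply: (etrans (esym e)); apply: Rint_ext => z.
  transitivity (\int[lb]_v ((f z * k z / pi) * gauss2_std v)).
    by apply: Rint_ext => v /=; move: (gauss2_std v) (pi^-1) => a b; ring.
  rewrite RintZl; last exact: intg_gauss2_std.
  by rewrite Rint_gauss2_std mulrVK ?unitfE ?gt_eqF ?pi_gt0// mulrC.
rewrite -e0 -(cvg_lim (@norm_hausdorff _ _) hc); apply: limr_le; first exact: cvgP hc.
apply: nearW => n; rewrite -[leLHS](heat3 (dl0 n)); apply: le_Rint => // [|xi].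
  by apply: iheat; have /andP[] := dl0 n.
rewrite ler_piMl ?fourier2_ge0// /gsq -[leRHS]expR0 ler_expR oppr_le0.
apply: mulr_ge0; first by rewrite divr_ge0// sqr_ge0.
by apply: addr_ge0; exact: sqr_ge0.
Qed.

End Energy.

(** * Compactly supported integrands and the covariance of the noise *)

Lemma RintZD d (T : measurableType d) (R : realType) (m : {measure set T -> \bar R}) (D : set T) (c : R)
  (u v w : T -> R) : measurable D -> m.-integrable D (EFin \o u) -> m.-integrable D (EFin \o v) ->
  (forall t, w t = c * u t + v t) ->
  \int[m]_(t in D) w t = c * \int[m]_(t in D) u t + \int[m]_(t in D) v t.
Proof.
move=> mD iu iv e; rewrite -RintegralZl// -RintegralD//; first by apply: eq_Rintegral => t _; exact: e.
by have := integrableZl mD c iu; apply: eq_integrable.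
Qed.

Section CompactSupport.
Variable R : realType.
Local Notation leb := (@lebesgue_measure R).
Local Notation lb := (leb2 R).
Implicit Types (phi psi : spacetime R -> R).

(** A class that contains the test functions, is stable under linear combinations, and has explicit
    bounds for the value and the support. *)
Definition ccfun phi := continuous phi /\
  exists M K, [/\ 0 <= M, 0 <= K, forall p, `|phi p| <= M
    & forall p, phi p != 0 -> [/\ `|p.1| <= K, `|p.2.1| <= K & `|p.2.2| <= K]].

Lemma norm_spacetime (p : spacetime R) (K : R) : `|p| <= K ->
  [/\ `|p.1| <= K, `|p.2.1| <= K & `|p.2.2| <= K].
Proof.
rewrite prod_normE ge_max => /andP[h1]; rewrite prod_normE ge_max => /andP[h2 h3].
by split.
Qed.

Lemma test_function_cc phi : test_function phi -> ccfun phi.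
Proof.
move=> [sphi cphi]; have [cont _] := sphi [::]; split; first exact: cont.
have /compact_bounded[K1 [_ hK]] := cphi.
have cim : compact (phi @` closure [set x | phi x != 0]).
  by apply: continuous_compact => //; apply: continuous_subspaceT; exact: cont.
have /compact_bounded[M1 [_ hM]] := cim.
have ltmax (a : R) : a < Num.max a 0 + 1 by rewrite (@le_lt_trans _ _ (Num.max a 0))// ?le_max ?lexx// ltrDl.
have max0 (a : R) : 0 <= Num.max a 0 + 1 by rewrite addr_ge0// le_max lexx orbT.
exists (Num.max M1 0 + 1), (Num.max K1 0 + 1); split; [exact: max0|exact: max0| |].
  move=> p; have [->|p0] := eqVneq (phi p) 0; first by rewrite normr0.
  apply: (hM _ (ltmax _)); exists p => //; exact: subset_closure.
move=> p p0; apply: norm_spacetime; apply: (hK _ (ltmax _)); exact: subset_closure.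
Qed.

Lemma cc_measurable phi : ccfun phi -> mfun phi.
Proof. by move=> [c _]; exact: measurable_continuous_spacetime. Qed.

Lemma cc_slice phi (s : R) : ccfun phi -> continuous (fun y : plane R => phi (s, y)).
Proof. by move=> [/(@continuous_slices R (R * R)%type R)[_ c] _]; exact: c. Qed.

Lemma cc0 : ccfun (fun=> 0).
Proof.
split; first by move=> p; exact: cst_continuous.
by exists 0, 0; split=> // p; rewrite ?normr0// eqxx.
Qed.

Lemma ccZD c phi psi : ccfun phi -> ccfun psi -> ccfun (fun p => c * phi p + psi p).
Proof.
move=> [c1 [M1 [K1 [M10 K10 h1 k1]]]] [c2 [M2 [K2 [M20 K20 h2 k2]]]]; split.
  move=> p; apply: cvgD; last exact: c2.
  by apply: cvgM; [exact: cvg_cst|exact: c1].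
exists (`|c| * M1 + M2), (K1 + K2); split.
- by rewrite addr_ge0// mulr_ge0.
- exact: addr_ge0.
- move=> p; apply: (le_trans (ler_normD _ _)); rewrite normrM; apply: lerD => //.
  by rewrite ler_wpM2l.
- move=> p; have [e1|/k1[a1 a2 a3]] := eqVneq (phi p) 0; last by split; lra.
  have [e2|/k2[a1 a2 a3]] := eqVneq (psi p) 0; last by split; lra.
  by rewrite e1 e2 mulr0 addr0 eqxx.
Qed.

Lemma cc_sum (r : seq (R * (spacetime R -> R))) : (forall x, List.In x r -> ccfun x.2) ->
  ccfun (fun p => \sum_(x <- r) x.1 * x.2 p).
Proof.
elim: r => [_|x r ih h].
  by under eq_fun do rewrite big_nil; exact: cc0.
under eq_fun do rewrite big_cons; apply: ccZD; first by apply: h; left.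
by apply: ih => y hy; apply: h; right.
Qed.

Lemma cc_slice_box phi : ccfun phi -> exists M K, 0 <= K /\ forall s : R,
  [/\ mfun (fun y : plane R => phi (s, y)), forall y, `|phi (s, y)| <= M
    & forall y, phi (s, y) != 0 -> `|y.1| <= K /\ `|y.2| <= K].
Proof.
move=> cp; have [_ [M [K [M0 K0 h k]]]] := cp; exists M, K; split=> // s; split=> [|y|y /k[]//].
  exact: (@measurable_slice1 _ _ _ _ _ _ _ (cc_measurable cp) s).
exact: h.
Qed.

Lemma cc_good phi : ccfun phi -> good_integrand phi.
Proof.
move=> cp; split; first exact: cc_measurable.
have [M [K [K0 h]]] := cc_slice_box cp.
by move=> s; have [h1 h2 h3] := h s; exact: intg_h h1 h2 h3.
Qed.

End CompactSupport.

Section Covariance.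
Variables (R : realType) (f : plane R -> R) (mu : {sigma_finite_measure set (plane R) -> \bar R}).
Hypothesis mu_spec : spectral_measure f mu.
Hypothesis mu_int : (\int[mu]_xi (1 / (1 + enorm xi `^ (2 / 3)))%:E < +oo)%E.
Local Notation leb := (@lebesgue_measure R).
Local Notation lb := (leb2 R).
Implicit Types (phi psi : spacetime R -> R).

Definition covt phi psi (t : R) : R :=
  \int[lb]_x \int[lb]_y (phi (t, x) * f (x - y) * psi (t, y)).

Definition cov phi psi : R := \int[leb]_(t in `[0, +oo[) covt phi psi t.

Let integrand phi psi (q : spacetime R * plane R) : R :=
  phi q.1 * f (pdiff q.1.2 q.2) * psi (q.1.1, q.2).

Let mint phi psi : ccfun phi -> ccfun psi -> mfun (integrand phi psi).
Proof.
move=> /cc_measurable h1 /cc_measurable h2; apply: mfM.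
  apply: mfM; first exact: measurableT_comp h1 measurable_fst.
  by apply: mf_pdiff; [exact: mf_f mu_spec|meas|meas].
by apply: (measurableT_comp h2); meas.
Qed.

(** On the supports x - y stays in a fixed box, so the cutoff fb of f to that box dominates every
    slice after a reflection, and f needs to be integrable only locally. *)
Lemma covt_intg phi psi : ccfun phi -> ccfun psi ->
  [/\ forall t x, intg lb (fun y => phi (t, x) * f (x - y) * psi (t, y)),
      forall t, intg lb (fun x => \int[lb]_y (phi (t, x) * f (x - y) * psi (t, y)))
    & intg leb (covt phi psi)].
Proof.
move=> c1 c2; have m := mint c1 c2.
have [_ [M1 [K1 [M10 K10 h1 k1]]]] := c1; have [_ [M2 [K2 [M20 K20 h2 k2]]]] := c2.
pose r := K1 + K2 + 1; pose fb w := `|f w * box r w|.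
have ifb : intg lb fb by apply: intg_norm; exact: (intg_f_box mu_spec).
have ifx x : intg lb (fun y => fb (pdiff x y)) by have [] := Rint_reflect x ifb.
have efx x : \int[lb]_y fb (pdiff x y) = \int[lb]_w fb w by have [_ ->] := Rint_reflect x ifb.
pose B (t : R) x := oo (- (K1 + 1)) (K1 + 1) t * box (K1 + 1) x.
have B0 t x : 0 <= B t x by rewrite mulr_ge0 ?oo_ge0 ?box_ge0.
have bnd t x y : `|phi (t, x) * f (x - y) * psi (t, y)| <= (M1 * M2 * B t x) * fb (pdiff x y).
  have r0 : 0 <= (M1 * M2 * B t x) * fb (pdiff x y).
    by apply: mulr_ge0; [apply: mulr_ge0 => //; exact: mulr_ge0|exact: normr_ge0].
  rewrite !normrM; have [->|/k1[/= a0 a1 a2]] := eqVneq (phi (t, x)) 0.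
    by rewrite normr0 !mul0r.
  have [->|/k2[/= b0 b1 b2]] := eqVneq (psi (t, y)) 0; first by rewrite normr0 mulr0.
  have lt (a b K : R) : `|a| <= b -> b < K -> - K < a < K by move=> q1 q2; rewrite -ltr_norml; lra.
  rewrite /B /box /oo (lt _ _ _ a0) ?(lt _ _ _ a1) ?(lt _ _ _ a2) ?ltrDl// !mulr1.
  rewrite /fb box1 ?mulr1.
  - rewrite mulrAC ler_wpM2r// ler_pM//.
  - by apply: (le_lt_trans (ler_normB _ _)); rewrite /r; lra.
  - by apply: (le_lt_trans (ler_normB _ _)); rewrite /r; lra.
pose C := M1 * M2 * \int[lb]_w fb w.
have i1 t x : intg lb (fun y => phi (t, x) * f (x - y) * psi (t, y)).
  apply: (intg_le _ (intgZl (M1 * M2 * B t x) (ifx x))); last exact: bnd.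
  exact: (@measurable_slice1 _ _ _ _ _ _ _ m (t, x)).
have bnd1 t x : `|\int[lb]_y (phi (t, x) * f (x - y) * psi (t, y))| <= C * B t x.
  have -> : C * B t x = \int[lb]_y ((M1 * M2 * B t x) * fb (pdiff x y)).
    by rewrite (RintZl _ (ifx x)) efx /C mulrAC.
  by apply: normr_Rint_le; [exact: intgZl|exact: intg_measurable (i1 t x)|exact: bnd].
have m1 : mfun (fun p : spacetime R => \int[lb]_y (phi p * f (p.2 - y) * psi (p.1, y))).
  exact: (measurable_Rint lb m).
have iB t : intg lb (B t) by apply: intgZl; exact: intg_box.
have i2 t : intg lb (fun x => \int[lb]_y (phi (t, x) * f (x - y) * psi (t, y))).
  apply: (intg_le _ (intgZl C (iB t))); last exact: bnd1.
  exact: (@measurable_slice1 _ _ _ _ _ _ _ m1 t).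
split => //.
apply: (intg_le _ (intgZl (C * \int[lb]_x box (K1 + 1) x) (intg_oo1 (- (K1 + 1)) (K1 + 1)))).
  exact: (measurable_Rint lb m1).
move=> t; have -> : C * \int[lb]_x box (K1 + 1) x * oo (- (K1 + 1)) (K1 + 1) t = \int[lb]_x (C * B t x).
  by rewrite (RintZl _ (iB t)) (RintZl _ (intg_box _)) mulrA mulrAC.
by apply: normr_Rint_le; [exact: intgZl|exact: intg_measurable (i2 t)|exact: bnd1].
Qed.

Let intD phi psi : ccfun phi -> ccfun psi -> leb.-integrable `[0, +oo[ (EFin \o covt phi psi).
Proof.
move=> c1 c2; have [_ _ i] := covt_intg c1 c2.
exact: integrableS measurableT _ (subsetT _) i.
Qed.

Lemma covDl c phi1 phi2 psi : ccfun phi1 -> ccfun phi2 -> ccfun psi ->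
  cov (fun p => c * phi1 p + phi2 p) psi = c * cov phi1 psi + cov phi2 psi.
Proof.
move=> c1 c2 c3; apply: (@RintZD _ _ R leb `[0, +oo[%classic c _ _ _ (measurable_itv _) (intD c1 c3) (intD c2 c3)).
have [a1 a2 _] := covt_intg c1 c3; have [b1 b2 _] := covt_intg c2 c3.
move=> t; apply: (RintZD measurableT (a2 t) (b2 t)) => x.
apply: (RintZD measurableT (a1 t x) (b1 t x)) => y.
by rewrite mulrDl mulrDl !mulrA.
Qed.

Lemma covDr c phi psi1 psi2 : ccfun phi -> ccfun psi1 -> ccfun psi2 ->
  cov phi (fun p => c * psi1 p + psi2 p) = c * cov phi psi1 + cov phi psi2.
Proof.
move=> c1 c2 c3; apply: (@RintZD _ _ R leb `[0, +oo[%classic c _ _ _ (measurable_itv _) (intD c1 c2) (intD c1 c3)).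
have [a1 a2 _] := covt_intg c1 c2; have [b1 b2 _] := covt_intg c1 c3.
move=> t; apply: (RintZD measurableT (a2 t) (b2 t)) => x.
apply: (RintZD measurableT (a1 t x) (b1 t x)) => y.
by rewrite mulrDr mulrCA.
Qed.

Lemma cov0 psi : cov (fun=> 0) psi = 0.
Proof.
transitivity (\int[leb]_(t in `[0%R, +oo[) (0 : R)); last by rewrite /Rintegral integral0.
apply: eq_Rintegral => t _.
rewrite /covt -[RHS](Rint0 lb); apply: eq_Rintegral => x _; rewrite -[RHS](Rint0 lb).
by apply: eq_Rintegral => y _; rewrite !mul0r.
Qed.

(** The inequality [energy_le] at each time. The positive part u of the covariance at time t is
    inserted so as to compare nonnegative integrals, the right-hand side possibly being infinite. *)
Lemma cov_le phi : ccfun phi -> ((cov phi phi)%:E <= noise_norm2 mu `[0%R, +oo[ phi)%E.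
Proof.
move=> c1; have [_ _ i] := covt_intg c1 c1; rewrite noise_norm2E.
have e t : ((covt phi phi t)%:E <= fnorm2 mu phi t)%E.
  have [M [K [K0 /(_ t)[h1 h2 h3]]]] := cc_slice_box c1.
  have := energy_le mu_spec mu_int h1 h2 h3 (@cc_slice _ _ t c1).
  rewrite (_ : \int[_]_x _ = covt phi phi t)//; apply: Rint_ext => x; apply: Rint_ext => y.
  by rewrite [phi (t, y) * _]mulrC mulrA.
pose u t := 2^-1 * (covt phi phi t + `|covt phi phi t|).
have iu : intg leb u by apply: intgZl; apply: intgD => //; exact: intg_norm.
have iuD : leb.-integrable `[0, +oo[ (EFin \o u).
  exact: integrableS measurableT _ (subsetT _) iu.
have u0 t : 0 <= u t by rewrite mulr_ge0// -lerBlDl sub0r -normrN ler_norm.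
apply: (@le_trans _ _ (\int[leb]_(t in `[0%R, +oo[) u t)%:E).
  rewrite lee_fin; apply: le_Rintegral => //; first exact: intD.
  by move=> t _; rewrite /u; have := ler_norm (covt phi phi t); lra.
rewrite /Rintegral fineK; last by apply: integrable_fin_num.
apply: ge0_le_integral => //.
- by move=> t _; rewrite lee_fin.
- exact: measurable_int iuD.
- by apply: measurable_funTS; apply: measurable_fnorm2; exact: cc_measurable.
move=> t _; rewrite /u; case: (leP 0 (covt phi phi t)) => h.
  by rewrite ger0_norm// (_ : 2^-1 * _ = covt phi phi t) ?e//; field.
by rewrite ltr0_norm// subrr mulr0 fnorm2_ge0.
Qed.

End Covariance.

(** * Second moments of the noise on test functions and on indicators *)

Section SecondMoment.
Context d (Omega : measurableType d) (R : realType) (P : probability Omega R).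
Implicit Types X Y : Omega -> R.

Definition moment2 X : \bar R := (\int[P]_w (X w ^+ 2)%:E)%E.

Lemma moment2E X : ('E_P[fun w => (X w ^+ 2)%R])%E = moment2 X.
Proof. by rewrite unlock. Qed.

Lemma moment2_ge0 X : (0 <= moment2 X)%E.
Proof. by apply: integral_ge0 => w _; rewrite lee_fin sqr_ge0. Qed.

Lemma moment2D X Y : mfun X -> mfun Y ->
  (moment2 (fun w => (X w + Y w)%R) <= 2%:E * moment2 X + 2%:E * moment2 Y)%E.
Proof.
move=> mX mY; apply: ge0_integral_le2D => //.
- by apply/measurable_EFinP; apply: mfunE; apply: mfX; exact: mfD.
- by apply/measurable_EFinP; apply: mfunE; exact: mfX.
- by apply/measurable_EFinP; apply: mfunE; exact: mfX.
- by move=> w; rewrite lee_fin sqr_ge0.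
- by move=> w; rewrite lee_fin sqr_ge0.
- by move=> w; rewrite lee_fin sqr_ge0.
move=> w; rewrite -!EFinM -EFinD lee_fin.
by have := sqr_ge0 (X w - Y w); move: (X w) (Y w) => a b; nra.
Qed.

Lemma moment2Z c X : mfun X -> (moment2 (fun w => (c * X w)%R) = (c ^+ 2)%:E * moment2 X)%E.
Proof.
move=> mX; rewrite /moment2 -ge0_integralZl//.
- by apply: eq_integral => w _; rewrite -EFinM exprMn.
- by apply/measurable_EFinP; apply: mfunE; exact: mfX.
- by move=> w _; rewrite lee_fin sqr_ge0.
- by rewrite lee_fin sqr_ge0.
Qed.

Lemma moment2N X : moment2 (fun w => - X w) = moment2 X.
Proof. by apply: eq_integral => w _; rewrite sqrrN. Qed.

Lemma intg_sqr_mul X Y : mfun X -> mfun Y -> intg P (fun w => X w ^+ 2) ->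
  intg P (fun w => Y w ^+ 2) -> intg P (fun w => X w * Y w).
Proof.
move=> mX mY iX iY; apply: (intg_le _ (intgD iX iY)); first by apply: mfunE; exact: mfM.
move=> w; rewrite normrM -[X w ^+ 2]real_normK ?num_real// -[Y w ^+ 2]real_normK ?num_real//.
have := sqr_ge0 (`|X w| - `|Y w|); have := normr_ge0 (X w); have := normr_ge0 (Y w).
by move: `|X w| `|Y w| => a b; nra.
Qed.

End SecondMoment.

Lemma ecvg0_lt (R : realType) (u : nat -> \bar R) (e : R) : (0 < e)%R ->
  (u n @[n --> \oo] --> 0)%E -> \forall n \near \oo, (u n < e%:E)%E.
Proof.
move=> e0 /fine_cvgP[fin /cvgrPdist_lt/(_ _ e0) h].
near=> n; have fn : u n \is a fin_num by near: n; exact: fin.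
have : `|0 - fine (u n)| < e by near: n; exact: h.
rewrite sub0r normrN -lte_fin => h1; rewrite -(fineK fn); apply: le_lt_trans h1.
by rewrite lee_fin ler_norm.
Unshelve. all: by end_near. Qed.

Section NoiseMoments.
Context d (Omega : measurableType d) (R : realType) (P : probability Omega R).
Variables (f : plane R -> R) (mu : {sigma_finite_measure set (plane R) -> \bar R}).
Hypothesis mu_spec : spectral_measure f mu.
Hypothesis mu_int : (\int[mu]_xi (1 / (1 + enorm xi `^ (2 / 3)))%:E < +oo)%E.
Variable F : (spacetime R -> R) -> {RV P >-> R}.
Hypothesis F_noise : noise f F.
Local Notation leb := (@lebesgue_measure R).
Local Notation test_list := (seq (R * (spacetime R -> R))).
Implicit Types (phi psi : spacetime R -> R) (l : test_list).

(** Combinations of the F(phi) are formed by hand and their second moments found by bilinear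
    expansion of the covariance; linearity of F in phi is not presupposed. *)
Definition comb l (p : spacetime R) : R := \sum_(x <- l) x.1 * x.2 p.

Definition ncomb l (w : Omega) : R := \sum_(x <- l) x.1 * F x.2 w.

Definition all_test l := forall x, List.In x l -> test_function x.2.

Lemma comb_cc l : all_test l -> ccfun (comb l).
Proof. by move=> h; apply: cc_sum => x /h; exact: test_function_cc. Qed.

Let mF phi : mfun (F phi). Proof. exact: measurable_funPT. Qed.

Lemma mf_ncomb l : mfun (ncomb l).
Proof.
rewrite /ncomb; elim: l => [|x l ih].
  by under eq_fun do rewrite big_nil; exact: mf_cst.
under eq_fun do rewrite big_cons; apply: mfD => //; apply: mfM => //; exact: mf_cst.
Qed.

Let F_sqr phi : test_function phi -> intg P (fun w => F phi w ^+ 2).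
Proof.
move=> tp; have [_ _ /(_ phi phi tp tp)] := F_noise; rewrite unlock => e.
apply: intgP; first by apply: mfunE; exact: mfX.
under eq_integral do rewrite ger0_norm ?sqr_ge0// expr2.
by rewrite e ltry.
Qed.

Let F_cov phi psi : test_function phi -> test_function psi ->
  intg P (fun w => F phi w * F psi w) /\ \int[P]_w (F phi w * F psi w) = cov f phi psi.
Proof.
move=> t1 t2; have i : intg P (fun w => F phi w * F psi w) by apply: intg_sqr_mul => //; exact: F_sqr.
split=> //; apply: EFin_inj; rewrite Rint_intgE//.
by have [_ _ /(_ phi psi t1 t2)] := F_noise; rewrite unlock.
Qed.

Let ncomb_cov1 l psi : all_test l -> test_function psi ->
  intg P (fun w => ncomb l w * F psi w) /\ \int[P]_w (ncomb l w * F psi w) = cov f (comb l) psi.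
Proof.
move=> al tp; have cp := test_function_cc tp; elim: l al => [|x l ih] al.
  have -> : (fun w => ncomb [::] w * F psi w) = fun=> 0.
    by apply/funext => w; rewrite /ncomb big_nil mul0r.
  have -> : comb [::] = fun=> 0 by apply/funext => p; rewrite /comb big_nil.
  by rewrite cov0 Rint0; split => //; exact: intg0.
have tx : test_function x.2 by apply: al; left.
have al' : all_test l by move=> y hy; apply: al; right.
have [i1 e1] := ih al'; have [i2 e2] := F_cov tx tp.
have ew w : ncomb (x :: l) w * F psi w = x.1 * (F x.2 w * F psi w) + ncomb l w * F psi w.
  by rewrite /ncomb big_cons mulrDl mulrA.
split; first by apply: intg_ext (intgD (intgZl x.1 i2) i1) => w; rewrite ew.
have ec : comb (x :: l) = (fun p => x.1 * x.2 p + comb l p) by apply/funext => p; rewrite /comb big_cons.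
rewrite ec (covDl mu_spec x.1 (test_function_cc tx) (comb_cc al') cp) -e1 -e2.
exact: (RintZD measurableT i2 i1 ew).
Qed.

Let ncomb_cov l l' : all_test l -> all_test l' ->
  intg P (fun w => ncomb l w * ncomb l' w) /\ \int[P]_w (ncomb l w * ncomb l' w) = cov f (comb l) (comb l').
Proof.
move=> al; have cl := comb_cc al; elim: l' => [|x l' ih] al'.
  have -> : (fun w => ncomb l w * ncomb [::] w) = fun=> 0.
    by apply/funext => w; rewrite /ncomb [X in _ * X]big_nil mulr0.
  have -> : cov f (comb l) (comb [::]) = 0.
    have e : comb l = (fun p => 1 * comb l p + comb [::] p).
      by apply/funext => p; rewrite mul1r /comb big_nil addr0.
    have -> : comb [::] = (fun p => (-1) * comb l p + comb l p).
      by apply/funext => p; rewrite mulN1r addNr /comb big_nil.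
    by rewrite (covDr mu_spec)// mulN1r addNr.
  by rewrite Rint0; split => //; exact: intg0.
have tx : test_function x.2 by apply: al'; left.
have all' : all_test l' by move=> y hy; apply: al'; right.
have [i1 e1] := ih all'; have [i2 e2] := ncomb_cov1 al tx.
have ew w : ncomb l w * ncomb (x :: l') w = x.1 * (ncomb l w * F x.2 w) + ncomb l w * ncomb l' w.
  by rewrite {2}/ncomb big_cons mulrDr mulrCA.
split; first by apply: intg_ext (intgD (intgZl x.1 i2) i1) => w; rewrite ew.
have ec : comb (x :: l') = (fun p => x.1 * x.2 p + comb l' p) by apply/funext => p; rewrite /comb big_cons.
rewrite ec (covDr mu_spec x.1 cl (test_function_cc tx) (comb_cc all')) -e1 -e2.
exact: (RintZD measurableT i2 i1 ew).
Qed.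

Lemma ncomb_moment2 l : all_test l ->
  (moment2 P (ncomb l) <= noise_norm2 mu `[0%R, +oo[ (comb l))%E.
Proof.
move=> al; have [i e] := ncomb_cov al al.
have -> : moment2 P (ncomb l) = (\int[P]_w (ncomb l w * ncomb l w))%:E.
  by rewrite Rint_intgE//; apply: eq_integral => w _; rewrite expr2.
by rewrite e; apply: cov_le mu_spec mu_int _ (comb_cc al).
Qed.

Lemma noise_norm2Z D (c : R) (g : spacetime R -> R) : good_integrand g -> measurable D ->
  (noise_norm2 mu D (fun p => (c * g p)%R) = (c ^+ 2)%:E * noise_norm2 mu D g)%E.
Proof.
move=> gg mD; rewrite !noise_norm2E -ge0_integralZl//; last 3 first.
- by apply: measurable_funTS; apply: measurable_fnorm2; exact: gg.1.
- by move=> s _; exact: fnorm2_ge0.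
- by rewrite lee_fin sqr_ge0.
apply: eq_integral => s _; rewrite /fnorm2 -ge0_integralZl//; last 3 first.
- by apply/measurable_EFinP; exact: good_slice.
- by move=> xi _; rewrite lee_fin fourier2_ge0.
- by rewrite lee_fin sqr_ge0.
apply: eq_integral => xi _; rewrite -EFinM; congr EFin; have ig := good_intg s gg.
rewrite /fourier2 mulrDr -!exprMn; congr (_ ^+ 2 + _ ^+ 2).
  rewrite -(RintZl _ (intg_fc xi ig)); apply: Rint_ext => y; by rewrite mulrCA.
by rewrite -(RintZl _ (intg_fs xi ig)); apply: Rint_ext => y; rewrite mulrCA.
Qed.

Lemma good_indic (A : set (spacetime R)) : measurable A -> bounded_set A -> good_integrand (\1_A : _ -> R).
Proof.
move=> mA [K0 [_ bA]]; have mi : mfun (\1_A : spacetime R -> R) by exact: measurable_indic.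
split=> // s; have K0' : K0 < Num.max K0 0 + 1.
  by rewrite (@le_lt_trans _ _ (Num.max K0 0))// ?le_max ?lexx// ltrDl.
apply: (intg_le _ (intg_box (Num.max K0 0 + 2))); first exact: (@measurable_slice1 _ _ _ _ _ _ _ mi s).
move=> y; rewrite ger0_norm//; have [h|h] := pselect (A (s, y)); last first.
  by rewrite indicE memNset// box_ge0.
have [/= _ h1 h2] := norm_spacetime (bA _ K0' _ h).
by rewrite indicE mem_set// box1//; [apply: le_lt_trans h1 _|apply: le_lt_trans h2 _]; rewrite ltrD2l ltr1n.
Qed.

Variable FA : set (spacetime R) -> {RV P >-> R}.
Hypothesis FA_ext : indicator_extension mu F FA.

Local Notation set_list := (seq (R * set (spacetime R))).

Definition admissible (A : set (spacetime R)) :=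
  [/\ measurable A, bounded_set A & A `<=` `[0, +oo[ `*` setT].

Definition scomb (r : set_list) (p : spacetime R) : R := \sum_(x <- r) x.1 * \1_(x.2) p.

Definition nscomb (r : set_list) (w : Omega) : R := \sum_(x <- r) x.1 * FA x.2 w.

Definition all_adm (r : set_list) := forall x, List.In x r -> admissible x.2.

Lemma scomb_good r : all_adm r -> good_integrand (scomb r).
Proof.
rewrite /scomb; elim: r => [_|x r ih ar].
  by under eq_fun do rewrite big_nil; exact: good0.
under eq_fun do rewrite big_cons; apply: goodD.
  by apply: goodZ; have [h1 h2 _] := ar x (or_introl erefl); exact: good_indic.
by apply: ih => y hy; apply: ar; right.
Qed.

Lemma mf_nscomb r : mfun (nscomb r).
Proof.
rewrite /nscomb; elim: r => [|x r ih].
  by under eq_fun do rewrite big_nil; exact: mf_cst.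
under eq_fun do rewrite big_cons; apply: mfD => //; apply: mfM; first exact: mf_cst.
exact: measurable_funPT.
Qed.

(** Induction on the list. The head is approximated to precision e / 4 / (1 + c^2), so that c^2
    times it is at most e / 4 for every c, and twice e / 4 for the head plus twice e / 4 for the
    tail is e. *)
Let approx r (e : R) : all_adm r -> 0 < e -> exists2 l, all_test l &
  (noise_norm2 mu `[0%R, +oo[ (fun p => (comb l p - scomb r p)%R) <= e%:E)%E /\
  (moment2 P (fun w => (ncomb l w - nscomb r w)%R) <= e%:E)%E.
Proof.
elim: r e => [|[c A] r ih] e ar e0.
  exists [::] => //; have -> : (fun p => comb [::] p - scomb [::] p) = fun p => 0 * 0.
    by apply/funext => p; rewrite /comb /scomb !big_nil subrr mul0r.
  rewrite (noise_norm2Z 0 (good0 R) (measurable_itv _)); have -> : (fun w => ncomb [::] w - nscomb [::] w) = fun w => 0 * 0.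
    by apply/funext => p; rewrite /ncomb /nscomb !big_nil subrr mul0r.
  rewrite (@moment2Z _ _ _ P 0 (fun=> 0) (mf_cst _)).
  by rewrite expr0n/= !mul0e lee_fin ltW.
have [l al [n1 n2]] : exists2 l, all_test l &
  (noise_norm2 mu `[0%R, +oo[ (fun p => (comb l p - scomb r p)%R) <= (e / 4)%:E)%E /\
  (moment2 P (fun w => (ncomb l w - nscomb r w)%R) <= (e / 4)%:E)%E.
  by apply: ih; [move=> y hy; apply: ar; right|rewrite divr_gt0].
have [mA bA sA] := ar (c, A) (or_introl erefl).
have [phi [tphi c1 c2]] := FA_ext mA bA sA.
have c0 : 0 < 1 + c ^+ 2 by rewrite ltr_pwDl// sqr_ge0.
have e1 : 0 < e / 4 / (1 + c ^+ 2) by rewrite !divr_gt0.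
have [n _ /(_ n (leqnn n))[m1 m2]] : \forall n \near \oo,
    (noise_norm2 mu `[0%R, +oo[ (fun p => (phi n p - \1_A p)%R) < (e / 4 / (1 + c ^+ 2))%:E)%E /\
    (moment2 P (fun w => (F (phi n) w - FA A w)%R) < (e / 4 / (1 + c ^+ 2))%:E)%E.
  near=> n; split; near: n; first exact: ecvg0_lt.
  by apply: ecvg0_lt => //; under eq_fun do rewrite -moment2E.
have ec (x : \bar R) : (x < (e / 4 / (1 + c ^+ 2))%:E)%E -> ((c ^+ 2)%:E * x <= (e / 4)%:E)%E.
  move=> /ltW/(lee_wpmul2l (_ : 0 <= (c ^+ 2)%:E)%E)/le_trans; rewrite lee_fin sqr_ge0; apply=> //.
  rewrite -EFinM lee_fin mulrA ler_pdivrMr// mulrC ler_pM2l ?divr_gt0//; lra.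
have e4 (x y : \bar R) : (x <= (e / 4)%:E -> y <= (e / 4)%:E -> 2%:E * x + 2%:E * y <= e%:E)%E.
  move=> hx hy; have -> : e%:E = (2%:E * (e / 4)%:E + 2%:E * (e / 4)%:E)%E.
    by rewrite -!EFinM -EFinD; congr EFin; field.
  by apply: leeD; rewrite lee_pmul2l//.
have gA := good_indic mA bA.
have gphi := cc_good (test_function_cc (tphi n)).
have ar' : all_adm r by move=> y hy; apply: ar; right.
exists ((c, phi n) :: l); first by move=> y [<-|]; [exact: tphi|exact: al].
split.
  have -> : (fun p => comb ((c, phi n) :: l) p - scomb ((c, A) :: r) p) =
      (fun p => c * (phi n p - \1_A p) + (comb l p - scomb r p)).
    by apply/funext => p; rewrite /comb /scomb !big_cons/=; ring.
  have g1 := goodB gphi gA; have g2 := goodB (cc_good (comb_cc al)) (scomb_good ar').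
  apply: le_trans (noise_norm2D mu (measurable_itv _) (goodZ c g1) g2) _.
  apply: e4; last exact: n1.
  by rewrite (noise_norm2Z c g1 (measurable_itv _)); exact: ec m1.
have -> : (fun w => ncomb ((c, phi n) :: l) w - nscomb ((c, A) :: r) w) =
    (fun w => c * (F (phi n) w - FA A w) + (ncomb l w - nscomb r w)).
  by apply/funext => p; rewrite /ncomb /nscomb !big_cons/=; ring.
have k1 : mfun (fun w => F (phi n) w - FA A w).
  by apply: mfD => //; apply: mfN; exact: measurable_funPT.
have k2 : mfun (fun w => ncomb l w - nscomb r w).
  by apply: mfD; [exact: mf_ncomb|apply: mfN; exact: mf_nscomb].
apply: le_trans (moment2D P (mfM (@mf_cst _ _ _ c) k1) k2) _.
apply: e4; last exact: n2.
by rewrite (moment2Z P c k1); exact: ec m2.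
Unshelve. all: by end_near. Qed.

(** The inequality for test functions is transferred through [approx]; 4 = 2 * 2 comes from one
    quasi-triangle inequality for the moments and one for the noise norms. *)
Lemma nscomb_moment2 r : all_adm r ->
  (moment2 P (nscomb r) <= 4%:E * noise_norm2 mu `[0%R, +oo[ (scomb r))%E.
Proof.
move=> ar; apply/lee_addgt0Pr => e e0.
(* 2 (e / 6) + 2 (2 (e / 6)) = e. *)
have e6 : 0 < e / 6 by rewrite divr_gt0.
have [l al [h1 h2]] := approx ar e6.
have gs := scomb_good ar; have gc := cc_good (comb_cc al).
have m1 : mfun (fun w => nscomb r w - ncomb l w).
  by apply: mfD; [exact: mf_nscomb|apply: mfN; exact: mf_ncomb].
have a1 : (moment2 P (nscomb r) <= 2%:E * (e / 6)%:E + 2%:E * moment2 P (ncomb l))%E.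
  rewrite (_ : nscomb r = (fun w => (nscomb r w - ncomb l w) + ncomb l w)); last first.
    by apply/funext => w; rewrite subrK.
  apply: (le_trans (moment2D P m1 (mf_ncomb l))); rewrite leeD2r// lee_pmul2l//.
  rewrite -moment2N (_ : (fun w => _) = (fun w => ncomb l w - nscomb r w))//.
  by apply/funext => w; rewrite opprB.
have a2 : (noise_norm2 mu `[0%R, +oo[ (comb l) <= 2%:E * (e / 6)%:E + 2%:E * noise_norm2 mu `[0%R, +oo[ (scomb r))%E.
  rewrite (_ : comb l = (fun p => (comb l p - scomb r p) + scomb r p)); last first.
    by apply/funext => p; rewrite subrK.
  apply: (le_trans (noise_norm2D mu (measurable_itv _) (goodB gc gs) gs)); rewrite leeD2r// lee_pmul2l//.
apply: (le_trans a1); have := le_trans (ncomb_moment2 al) a2.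
have := noise_norm2_ge0 mu `[0%R, +oo[ (scomb r).
case: (noise_norm2 _ _ _) => [q| |] //; last first.
  by move=> _ _; rewrite (gt0_muley (_ : 0 < 4%:E)%E) ?lte_fin// addye// leey.
move=> q0; have := moment2_ge0 P (ncomb l); case: (moment2 _ _) => [m| |]//.
rewrite -!EFinM -!EFinD !lee_fin => m0 hm; lra.
Qed.

End NoiseMoments.

(** * Step functions with rational data *)

Section RationalSteps.
Variable R : realType.

(* A step with rational data: coefficient, time interval, spatial rectangle. *)
Definition raw : Type := (rat * ((rat * rat) * ((rat * rat) * (rat * rat))))%type.

Definition rco (r : raw) : R := ratr r.1.
(** The maxima here and in [rhi] turn arbitrary rational data into a legal interval with 0 <= lo <=
    hi, so that no side condition has to be enumerated. *)
Definition rlo (r : raw) : R := Num.max 0 (ratr r.2.1.1).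
Definition rhi (r : raw) : R := Num.max (rlo r) (ratr r.2.1.2).
Definition rbase (r : raw) : set (plane R) :=
  `]ratr r.2.2.1.1, ratr r.2.2.1.2]%classic `*` `]ratr r.2.2.2.1, ratr r.2.2.2.2]%classic.

Lemma rlo_ge0 r : 0 <= rlo r. Proof. by rewrite le_max lexx. Qed.

Lemma rlo_hi r : rlo r <= rhi r. Proof. by rewrite le_max lexx. Qed.

Lemma bounded_itv_oc (a b x : R) : a < x <= b -> `|x| <= `|a| + `|b|.
Proof.
move=> /andP[h1 h2]; have := ler_norm b; have := normr_ge0 a; have := normr_ge0 b.
have := ler_norm (- a); rewrite normrN => h3 h4 h5 h6.
by rewrite ler_norml; apply/andP; split; lra.
Qed.

Lemma measurable_rbase r : measurable (rbase r).
Proof. by apply: measurableX; exact: measurable_itv. Qed.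

Lemma bounded_rbase r : bounded_set (rbase r).
Proof.
set a := ratr r.2.2.1.1 : R; set b := ratr r.2.2.1.2 : R; set c := ratr r.2.2.2.1 : R; set e := ratr r.2.2.2.2 : R.
exists (Num.max (`|a| + `|b|) (`|c| + `|e|)); split; first exact: num_real.
move=> M hM [y1 y2] [/=]; rewrite !in_itv/= => h1 h2; apply: le_trans (ltW hM).
rewrite prod_normE ge_max !le_max /=.
by rewrite (bounded_itv_oc h1) (bounded_itv_oc h2) orbT.
Qed.

Lemma bounded_rslab (I : set R) (h : R) r : (forall s, I s -> 0 <= s <= h) -> bounded_set (I `*` rbase r).
Proof.
move=> Ih; have [N [_ hN]] := bounded_rbase r.
exists (Num.max `|h| (N + 1)); split; first exact: num_real.
move=> K hK [s y] [/= /Ih/andP[s0 sh] hy].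
have := hK; rewrite gt_max => /andP[hK1 hK2].
rewrite prod_normE ge_max /= hN ?andbT//; last by rewrite (lt_trans _ hK2)// ltrDl.
by rewrite ger0_norm// (le_trans sh)// (le_trans (ler_norm h))// ltW.
Qed.

Definition rawfun (l : seq raw) (p : spacetime R) : R :=
  \sum_(r <- l) rco r * \1_(`]rlo r, rhi r] `*` rbase r) p.

Definition rawok (t : R) (l : seq raw) : bool := all (fun r => rhi r <= t) l.

Definition rawopp (l : seq raw) : seq raw := [seq (- r.1, r.2) | r <- l].

Lemma good_rawfun l : good_integrand (rawfun l).
Proof.
apply: good_sum => r; apply: goodZ; apply: good_indic.
  by apply: measurableX; [exact: measurable_itv|exact: measurable_rbase].
apply: (@bounded_rslab _ (rhi r)) => s; rewrite /= in_itv/= => /andP[h1 ->].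
by rewrite (le_trans (rlo_ge0 r))// ltW.
Qed.

Lemma rawfunB l l' p : rawfun (l ++ rawopp l') p = rawfun l p - rawfun l' p.
Proof.
rewrite /rawfun big_cat big_map /= -sumrN; congr (_ + _); apply: eq_bigr => r _.
by rewrite /rco /= rmorphN mulNr.
Qed.

Lemma rawokB t l l' : rawok t l -> rawok t l' -> rawok t (l ++ rawopp l').
Proof. by rewrite /rawok all_cat all_map => -> h; rewrite /= (eq_all (a2 := fun r => rhi r <= t)). Qed.

Lemma rawfun_out t l s (y : plane R) : rawok t l -> ~~ (0 < s <= t) -> rawfun l (s, y) = 0.
Proof.
move=> /allP ok st; rewrite /rawfun big_seq big1// => r /ok rt.
rewrite indicE memNset ?mulr0// => -[/=]; rewrite in_itv/= => /andP[h1 h2] _.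
by move/negP: st; apply; rewrite (le_lt_trans (rlo_ge0 r) h1) (le_trans h2 rt).
Qed.

Section Noise.
Context d (Omega : measurableType d) (P : probability Omega R).
Variables (f : plane R -> R) (mu : {sigma_finite_measure set (plane R) -> \bar R}).
Hypothesis mu_spec : spectral_measure f mu.
Hypothesis mu_int : (\int[mu]_xi (1 / (1 + enorm xi `^ (2 / 3)))%:E < +oo)%E.
Variable F : (spacetime R -> R) -> {RV P >-> R}.
Hypothesis F_noise : noise f F.
Variable FA : set (spacetime R) -> {RV P >-> R}.
Hypothesis FA_ext : indicator_extension mu F FA.
Local Notation M := (martingale_measure FA).

Definition rawint (l : seq raw) (w : Omega) : R :=
  \sum_(r <- l) rco r * (M (rhi r) (rbase r) w - M (rlo r) (rbase r) w).

Lemma rawintB l l' w : rawint (l ++ rawopp l') w = rawint l w - rawint l' w.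
Proof.
rewrite /rawint big_cat big_map /= -sumrN; congr (_ + _); apply: eq_bigr => r _.
by rewrite /rco /= rmorphN mulNr.
Qed.

Lemma raw_step t l : rawok t l ->
  exists e : seq (step t), step_fun e = rawfun l /\ step_integral M e = rawint l.
Proof.
elim: l => [_|r l ih /= /andP[rt /ih[e [e1 e2]]]].
  exists [::]; split; first by apply/funext => p; rewrite /step_fun /rawfun !big_nil.
  by apply/funext => p; rewrite /step_integral /rawint !big_nil.
exists (Step (rco r) (rlo_ge0 r) (rlo_hi r) rt (measurable_rbase r) (bounded_rbase r) :: e); split.
  by apply/funext => p; rewrite /step_fun big_cons /= -/(step_fun e p) e1 /rawfun big_cons.
by apply/funext => w; rewrite /step_integral big_cons /= -/(step_integral M e w) e2 /rawint big_cons.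
Qed.

(** The increment M(hi) - M(lo) is the noise of [0, hi] x B minus that of [0, lo] x B, matching the
    indicator of ]lo, hi] x B. *)
Let tosets (l : seq raw) : seq (R * set (spacetime R)) :=
  flatten [seq [:: (rco r, `[0, rhi r]%classic `*` rbase r); (- rco r, `[0, rlo r]%classic `*` rbase r)] | r <- l].

Let tosets_adm l : all_adm (tosets l).
Proof.
have adm (h : R) r : admissible (`[0, h]%classic `*` rbase r).
  split.
  - by apply: measurableX; [exact: measurable_itv|exact: measurable_rbase].
  - by apply: (@bounded_rslab _ h) => s; rewrite /= in_itv.
  - by move=> [s y] [/=]; rewrite !in_itv/= => /andP[-> _].
elim: l => [//|r l ih] x /= [<-/=|[<-/=|hx]]; [exact: adm|exact: adm|exact: ih].
Qed.

Lemma rawint_moment2 l :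
  (moment2 P (rawint l) <= 4%:E * noise_norm2 mu `[0%R, +oo[ (rawfun l))%E.
Proof.
have := nscomb_moment2 mu_spec mu_int F_noise FA_ext (@tosets_adm l).
rewrite (_ : nscomb FA (tosets l) = rawint l); last first.
  apply/funext => w; rewrite /nscomb /rawint big_flatten big_map; apply: eq_bigr => r _.
  by rewrite !big_cons big_nil /= addr0 mulNr mulrBr.
rewrite (_ : scomb (tosets l) = rawfun l)//.
apply/funext => -[s y]; rewrite /scomb /rawfun big_flatten big_map; apply: eq_bigr => r _.
rewrite !big_cons big_nil /= addr0 mulNr -mulrBr; congr (_ * _).
rewrite !indicE; have [yr|yr] := pselect (rbase r y); last first.
  by rewrite !memNset ?subrr// => -[].
have e (A : set R) : ((s, y) \in A `*` rbase r) = (s \in A).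
  by apply/idP/idP => [/set_mem[]/=|/set_mem h]; rewrite inE.
rewrite !e !mem_setE !in_itv /=; have := rlo_ge0 r; have := rlo_hi r.
by case: (leP 0 s) => h1; case: (leP s (rhi r)) => h2; case: (leP s (rlo r)) => h3 //= h4 h5;
  rewrite ?subrr ?subr0//; lra.
Qed.

Lemma rawint_noise_norm2 t l : rawok t l -> 0 <= t ->
  (moment2 P (rawint l) <= 4%:E * noise_norm2 mu `[0%R, t] (rawfun l))%E.
Proof.
move=> ok t0; apply: (le_trans (rawint_moment2 l)).
rewrite (@noise_norm2_supp _ mu `[0%R, t]%classic `[0%R, +oo[%classic)//.
- by move=> s; rewrite /= !in_itv/= => /andP[-> _].
- exact: (good_rawfun l).1.
move=> s y; rewrite /= !in_itv/= andbT => s0 /negP st; apply: rawfun_out ok _.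
by apply: contra st => /andP[_ ->]; rewrite s0.
Qed.

End Noise.

End RationalSteps.

(** * Convergence in noise norm of bounded integrands *)

Section NoiseL2.
Variables (R : realType) (f : plane R -> R) (mu : {sigma_finite_measure set (plane R) -> \bar R}).
Hypothesis mu_spec : spectral_measure f mu.
Hypothesis mu_int : (\int[mu]_xi (1 / (1 + enorm xi `^ (2 / 3)))%:E < +oo)%E.
Local Notation leb := (@lebesgue_measure R).
Local Notation lb := (leb2 R).

(** At each time the noise norm is at most [energy_cst] times the squared L^2 norm of the slice, and
    dominated convergence applies in space and then in time. Time 0 is excluded from the hypotheses
    because steps ]lo, hi] vanish there; it is a null set. *)
Lemma noise_L2_cvg (t M K : R) (g : nat -> spacetime R -> R) : 0 <= t ->
  (forall n, mfun (g n)) ->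
  (forall n p, 0 < p.1 <= t -> `|g n p| <= M) ->
  (forall n p, 0 < p.1 <= t -> g n p != 0 -> `|p.2.1| <= K /\ `|p.2.2| <= K) ->
  (forall p, 0 < p.1 <= t -> g n p @[n --> \oo] --> (0 : R)) ->
  noise_norm2 mu `[0%R, t] (g n) @[n --> \oo] --> 0%E.
Proof.
move=> t0 mg gM gK g0.
pose S n (s : R) := \int[lb]_y (g n (s, y) ^+ 2).
pose D := energy_cst f K.
have ms n s : mfun (fun y : plane R => g n (s, y)).
  exact: (@measurable_slice1 _ _ _ _ _ _ _ (mg n) s).
have sqb n s (y : plane R) : 0 < s <= t -> `|g n (s, y) ^+ 2| <= M ^+ 2 * box (K + 1) y.
  move=> st; have M0 : 0 <= M by exact: le_trans (gM n (s, y) st).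
  have [->|/(gK n (s, y) st)[h1 h2]] := eqVneq (g n (s, y)) 0.
    by rewrite expr0n normr0 mulr_ge0 ?sqr_ge0 ?box_ge0.
  rewrite box1 ?mulr1; [|by apply: le_lt_trans h1 _; rewrite ltrDl|by apply: le_lt_trans h2 _; rewrite ltrDl].
  by rewrite normrX lerXn2r ?nnegrE//; exact: gM.
have iM : intg lb (fun y => M ^+ 2 * box (K + 1) y) by apply: intgZl; exact: intg_box.
have msq n s : mfun (fun y : plane R => g n (s, y) ^+ 2) by apply: mfX.
have S0 s : 0 < s <= t -> S n s @[n --> \oo] --> (0 : R).
  move=> st.
  have c y : g n (s, y) ^+ 2 @[n --> \oo] --> (0 : R).
    have h : g n (s, y) * g n (s, y) @[n --> \oo] --> (0 * 0 : R) by apply: cvgM; exact: g0.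
    by rewrite mulr0 in h; under eq_fun do rewrite expr2.
  have [_] := dct_Rint (m := lb) (fun n => msq n s) c iM (fun n y => sqb n s y st).
  by rewrite Rint0.
pose B := \int[lb]_y (M ^+ 2 * box (K + 1) y).
have D0 : 0 <= D.
  rewrite /D /energy_cst mulr_ge0 ?divr_ge0 ?expR_ge0 ?pi_ge0//.
  by apply: Rintegral_ge0 => p _; rewrite mulr_ge0 ?gsq_ge0.
have fS n s : 0 < s <= t -> (fnorm2 mu (g n) s <= (D * S n s)%:E)%E.
  move=> st; apply: (fourier2_L2 mu_spec mu_int (ms n s)).
    by move=> y; exact: (gM n (s, y)).
  by move=> y; exact: (gK n (s, y)).
have SB n s : 0 < s <= t -> S n s <= B.
  move=> st; apply: (le_trans (ler_norm _)); apply: normr_Rint_le => //; first exact: msq.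
  by move=> y; exact: sqb.
under eq_fun do rewrite noise_norm2E.
have mf n := measurable_fnorm2 mu (mg n).
under eq_fun => n do rewrite -(integral_itv_obnd_cbnd (measurable_funTS (mf n))).
rewrite -[0%E](@integral0 _ _ R leb `]0%R, t]).
apply: (@dominated_cvg _ _ _ leb `]0%R, t]%classic _ (fun n => fnorm2 mu (g n)) (cst 0%E) (fun=> (D * B)%:E)) => //.
- by move=> n; apply: measurable_funTS; exact: mf.
- move=> s; rewrite /= in_itv/= => st.
  have h : (D * S n s)%:E @[n --> \oo] --> (D * 0)%:E.
    apply: cvg_EFin; first exact: nearW.
    by apply: cvgM; [exact: cvg_cst|exact: S0].
  rewrite mulr0 in h; apply: squeeze_cvge (cvg_cst _) h.
  by apply: nearW => n; rewrite fnorm2_ge0 fS.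
- apply: (@measurable_bounded_integrable _ _ _ leb (cst (D * B))) => //.
  + rewrite /= lebesgue_measure_itv/=; case: ifP => _ //; by rewrite -EFinB ltry.
  + exact: bounded_cst.
- move=> n s; rewrite /= in_itv/= => st; rewrite gee0_abs ?fnorm2_ge0//.
  by apply: (le_trans (fS n s st)); rewrite lee_fin ler_wpM2l// SB.
Qed.

End NoiseL2.

(** * Rational grids *)

Section Grid.
Variable R : realType.

Definition knot (a L : rat) (m i : nat) : rat := a + L * (i%:R / m.+1%:R).

Lemma ratr_knot a L m i : ratr (knot a L m i) = ratr a + ratr L * (i%:R / m.+1%:R) :> R.
Proof. by rewrite /knot rmorphD !rmorphM /= fmorphV /= !ratr_nat. Qed.

Definition in_cell (a L : rat) (m i : nat) (s : R) : bool :=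
  ratr (knot a L m i) < s <= ratr (knot a L m i.+1).

Lemma in_cell_uniq a L m i j (s : R) : 0 < L -> in_cell a L m i s -> in_cell a L m j s -> i = j.
Proof.
move=> L0; have L0' : 0 < ratr L :> R by rewrite ltr0q.
suff h k l : in_cell a L m k s -> in_cell a L m l s -> (k <= l)%N.
  by move=> h1 h2; apply/eqP; rewrite eqn_leq !h.
move=> /andP[h1 _] /andP[_ h2]; have := lt_le_trans h1 h2.
by rewrite !ratr_knot ltrD2l ltr_pM2l// ltr_pM2r ?invr_gt0// ltr_nat ltnS.
Qed.

Lemma in_cell_ex a L m (s : R) : 0 < L -> ratr a < s <= ratr a + ratr L ->
  exists i : 'I_m.+1, in_cell a L m i s.
Proof.
move=> L0 /andP[h1 h2]; have L0' : 0 < ratr L :> R by rewrite ltr0q.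
have exi : exists i, s <= ratr (knot a L m i.+1).
  by exists m; rewrite ratr_knot divff ?mulr1 ?pnatr_eq0.
case: (ex_minnP exi) => i hi mini.
have im : (i < m.+1)%N by rewrite ltnS mini// ratr_knot divff ?mulr1 ?pnatr_eq0.
exists (Ordinal im); rewrite /in_cell /= hi andbT ltNge; apply/negP => h3.
case: i hi mini im h3 => [|i] hi mini im h3.
  by move: h3; rewrite ratr_knot mul0r mulr0 addr0 leNgt h1.
by have := mini i h3; rewrite ltnn.
Qed.

Lemma in_cell_dist a L m i (s : R) : in_cell a L m i s ->
  `|s - ratr (knot a L m i.+1)| <= ratr L / m.+1%:R.
Proof.
rewrite /in_cell; have -> : ratr (knot a L m i.+1) = ratr (knot a L m i) + ratr L / m.+1%:R :> R.
  by rewrite !ratr_knot -addrA; congr (_ + _); rewrite -[i.+1%:R]natr1 mulrDl mulrDr mul1r.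
move: (ratr (knot _ _ _ _) : R) (ratr L / _ : R) => c e /andP[h1 h2].
by rewrite ler_norml; apply/andP; split; lra.
Qed.

Lemma in_cell_in a L m (i : 'I_m.+1) (s : R) : 0 < L -> in_cell a L m i s -> ratr a < s <= ratr a + ratr L.
Proof.
move=> L0 /andP[h1 h2]; have L0' : 0 < ratr L :> R by rewrite ltr0q.
apply/andP; split.
  apply: le_lt_trans h1; rewrite ratr_knot lerDl.
  by apply: mulr_ge0; [exact: ltW|exact: divr_ge0].
apply: (le_trans h2); rewrite ratr_knot lerD2l ger_pMr// ler_pdivrMr ?ltr0n// mul1r ler_nat.
exact: ltn_ord.
Qed.

Variables (tau K : rat) (h : spacetime R -> R).
Hypotheses (tau0 : 0 < tau) (K0 : 0 < K).

Local Notation index m := ('I_m.+1 * ('I_m.+1 * 'I_m.+1))%type.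

(** Samples are taken at the upper corner, which belongs to its cell as the cells are open below and
    closed above. *)
Let corner m (i : index m) : spacetime R :=
  (ratr (knot 0 tau m i.1.+1), (ratr (knot (- K) (K + K) m i.2.1.+1), ratr (knot (- K) (K + K) m i.2.2.+1))).

Let approx_ex (m : nat) (x : R) : exists q : rat, `|ratr q - x| < m.+1%:R^-1.
Proof.
have : 0 < m.+1%:R^-1 :> R by rewrite invr_gt0.
move: (m.+1%:R^-1 : R) => e e0; have lt : x - e < x + e by lra.
have [q] := rat_in_itvoo lt; rewrite in_itv/= => /andP[h1 h2].
by exists q; rewrite ltr_norml; apply/andP; split; lra.
Qed.

(** Rounds a sampled value to a rational with error below 1/(m+1), so that the grid function has
    rational data. *)
Let rnd m x : rat := projT1 (cid (approx_ex m x)).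

Let cell m (i : index m) : raw :=
  (rnd m (h (corner i)), ((knot 0 tau m i.1, knot 0 tau m i.1.+1),
    ((knot (- K) (K + K) m i.2.1, knot (- K) (K + K) m i.2.1.+1),
     (knot (- K) (K + K) m i.2.2, knot (- K) (K + K) m i.2.2.+1)))).

Definition grid m : seq raw := [seq cell i | i <- enum {: index m}].

Let hit m (i : index m) (p : spacetime R) : bool :=
  [&& in_cell 0 tau m i.1 p.1, in_cell (- K) (K + K) m i.2.1 p.2.1 & in_cell (- K) (K + K) m i.2.2 p.2.2].

Let KK : 0 < K + K. Proof. exact: addr_gt0. Qed.

Let knot_ge0 m i : 0 <= ratr (knot 0 tau m i) :> R.
Proof.
rewrite ratr_knot rmorph0 add0r; apply: mulr_ge0; last exact: divr_ge0.
by rewrite ler0q ltW.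
Qed.

Let knot_le m i : ratr (knot 0 tau m i) <= ratr (knot 0 tau m i.+1) :> R.
Proof.
rewrite !ratr_knot lerD2l; apply: ler_wpM2l; first by rewrite ler0q ltW.
by apply: ler_wpM2r; rewrite ?invr_ge0// ler_nat.
Qed.

Let rlo_cell m (i : index m) : rlo R (cell i) = ratr (knot 0 tau m i.1).
Proof. by rewrite /rlo /= max_r. Qed.

Let rhi_cell m (i : index m) : rhi R (cell i) = ratr (knot 0 tau m i.1.+1).
Proof. by rewrite /rhi rlo_cell /= max_r. Qed.

Lemma gridE m p : rawfun (grid m) p =
  \sum_(i : index m) ratr (rnd m (h (corner i))) * (hit i p)%:R.
Proof.
rewrite /rawfun /grid big_map big_enum /=; apply: eq_bigr => i _.
rewrite rlo_cell rhi_cell /rco /=; congr (_ * _); rewrite indicE; congr (_ %:R); congr nat_of_bool.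
rewrite /hit /in_cell; apply/idP/idP; case: p => [s [y1 y2]].
  by move=> /set_mem[/=]; rewrite !in_itv/= => -> [/=]; rewrite !in_itv/= => -> ->.
by move=> /and3P[h1 h2 h3]; apply/mem_set; split; [|split]; rewrite /= in_itv.
Qed.

Lemma grid_ok (t : R) m : ratr tau <= t -> rawok t (grid m).
Proof.
move=> tt; apply/allP => r /mapP[i _ ->]; rewrite rhi_cell ratr_knot rmorph0 add0r.
apply: le_trans tt; rewrite ger_pMr ?ltr0q// ler_pdivrMr ?ltr0n// mul1r ler_nat.
exact: ltn_ord.
Qed.

Definition gbox (p : spacetime R) : bool := [&& 0 < p.1 <= ratr tau, - ratr K < p.2.1 <= ratr K & - ratr K < p.2.2 <= ratr K].

Lemma grid_out m p : ~~ gbox p -> rawfun (grid m) p = 0.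
Proof.
move=> bp; rewrite gridE big1// => i _; case: (boolP (hit i p)); last by rewrite mulr0.
move=> /and3P[/(in_cell_in tau0) h1 /(in_cell_in KK) h2 /(in_cell_in KK) h3]; case/negP: bp.
have e : ratr (- K) + ratr (K + K) = ratr K :> R by rewrite -rmorphD addKr.
move: h1 h2 h3; rewrite e !rmorphN rmorph0 add0r => h1 h2 h3.
by rewrite /gbox h1 h2 h3.
Qed.

Lemma grid_hit m p : gbox p -> exists c, `|rawfun (grid m) p - h c| < m.+1%:R^-1 /\
  `|p - c| <= (ratr tau + ratr (K + K)) / m.+1%:R.
Proof.
move=> /and3P[b1 b2 b3].
have e : ratr (- K) + ratr (K + K) = ratr K :> R by rewrite -rmorphD addKr.
have [i1 h1] : exists i : 'I_m.+1, in_cell 0 tau m i p.1.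
  by apply: in_cell_ex => //; rewrite rmorph0 add0r.
have [i2 h2] : exists i : 'I_m.+1, in_cell (- K) (K + K) m i p.2.1.
  by apply: in_cell_ex => //; rewrite e rmorphN.
have [i3 h3] : exists i : 'I_m.+1, in_cell (- K) (K + K) m i p.2.2.
  by apply: in_cell_ex => //; rewrite e rmorphN.
exists (corner (i1, (i2, i3))).
have -> : rawfun (grid m) p = ratr (rnd m (h (corner (i1, (i2, i3))))).
  rewrite gridE (bigD1 (i1, (i2, i3)))//= [hit _ _](_ : _ = true); last by rewrite /hit h1 h2 h3.
  rewrite mulr1 big1 ?addr0// => -[j1 [j2 j3]] jn.
  rewrite (_ : hit _ _ = false) ?mulr0//; apply/negbTE; apply: contra jn.
  move=> /and3P[/= k1 k2 k3]; apply/eqP; congr (_, (_, _)); apply: val_inj.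
  - exact: in_cell_uniq k1 h1.
  - exact: in_cell_uniq k2 h2.
  - exact: in_cell_uniq k3 h3.
split; first by rewrite /rnd; case: cid.
have t0 : 0 < ratr tau :> R by rewrite ltr0q.
have k0 : 0 < ratr (K + K) :> R by rewrite ltr0q.
have m0 : 0 < m.+1%:R^-1 :> R by rewrite invr_gt0.
have := in_cell_dist h1; have := in_cell_dist h2; have := in_cell_dist h3.
move=> d3 d2 d1; rewrite prod_normE ge_max /= prod_normE ge_max /= mulrDl.
have t1 := divr_ge0 (ltW t0) (ler0n R m.+1); have k1 := divr_ge0 (ltW k0) (ler0n R m.+1).
apply/and3P; split; [apply: le_trans d1 _|apply: le_trans d2 _|apply: le_trans d3 _].
- by rewrite lerDl.
- by rewrite lerDr.
- by rewrite lerDr.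
Qed.

End Grid.

Lemma lte_quarter (R : realType) (a b : \bar R) (e : R) :
  (a < (e / 4)%:E -> b < (e / 4)%:E -> 2%:E * a + 2%:E * b < e%:E)%E.
Proof.
move=> ha hb; have -> : e%:E = (2%:E * (e / 4)%:E + 2%:E * (e / 4)%:E)%E.
  by rewrite -!EFinM -EFinD; congr EFin; field.
by apply: lteD; rewrite lte_pmul2l.
Qed.

(** * Syntax-directed continuity *)

Section ContinuityKit.
Variables (T : topologicalType) (R : realType).
Implicit Types f g : T -> R.

Lemma ct_cst (c : R) : continuous (fun _ : T => c). Proof. exact: cst_continuous. Qed.

Lemma ctD f g : continuous f -> continuous g -> continuous (fun x => f x + g x).
Proof. by move=> cf cg x; apply: cvgD; [exact: cf|exact: cg]. Qed.

Lemma ctN f : continuous f -> continuous (fun x => - f x).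
Proof. by move=> cf x; apply: cvgN; exact: cf. Qed.

Lemma ctM f g : continuous f -> continuous g -> continuous (fun x => f x * g x).
Proof. by move=> cf cg x; apply: cvgM; [exact: cf|exact: cg]. Qed.

Lemma ctX f n : continuous f -> continuous (fun x => f x ^+ n).
Proof.
move=> cf; elim: n => [|n ih]; first by under eq_fun do rewrite expr0; exact: ct_cst.
by under eq_fun do rewrite exprS; exact: ctM.
Qed.

Lemma ct_comp (h : R -> R) f : continuous h -> continuous f -> continuous (fun x => h (f x)).
Proof. by move=> ch cf x; apply: continuous_comp; [exact: cf|exact: ch]. Qed.

Lemma ct_norm f : continuous f -> continuous (fun x => `|f x|).
Proof. by apply: ct_comp; exact: norm_continuous. Qed.

Lemma ct_sqrt f : continuous f -> continuous (fun x => Num.sqrt (f x)).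
Proof. by apply: ct_comp; exact: sqrt_continuous. Qed.

Lemma ct_exp f : continuous f -> continuous (fun x => expR (f x)).
Proof. by apply: ct_comp; exact: continuous_expR. Qed.

Lemma ctV f : (forall x, f x != 0) -> continuous f -> continuous (fun x => (f x)^-1).
Proof. by move=> f0 cf x; apply: cvgV; [exact: f0|exact: cf]. Qed.

End ContinuityKit.

Lemma ct_fst (R : realType) (V W : topologicalType) : continuous (@fst V W).
Proof. by move=> x; exact: cvg_fst. Qed.

Section SpacetimeCoordinates.
Variable R : realType.

Lemma ct_p1 : continuous (fun p : spacetime R => p.1 : R).
Proof. by move=> x; exact: (@cvg_fst _ _ (nbhs x.1) (nbhs x.2)). Qed.

Lemma ct_p21 : continuous (fun p : spacetime R => p.2.1 : R).
Proof.
move=> x; apply: (@continuous_comp _ _ _ (fun p : spacetime R => p.2) (fun y : plane R => y.1 : R)).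
  exact: (@cvg_snd _ _ (nbhs x.1) (nbhs x.2)).
exact: (@cvg_fst _ _ (nbhs x.2.1) (nbhs x.2.2)).
Qed.

Lemma ct_p22 : continuous (fun p : spacetime R => p.2.2 : R).
Proof.
move=> x; apply: (@continuous_comp _ _ _ (fun p : spacetime R => p.2) (fun y : plane R => y.2 : R)).
  exact: (@cvg_snd _ _ (nbhs x.1) (nbhs x.2)).
exact: (@cvg_snd _ _ (nbhs x.2.1) (nbhs x.2.2)).
Qed.

End SpacetimeCoordinates.

Ltac cont1 := match goal with
  | |- continuous (fun _ => ?c) => apply: ct_cst
  | |- continuous (fun p => p.1) => exact: ct_p1
  | |- continuous (fun p => p.2.1) => exact: ct_p21
  | |- continuous (fun p => p.2.2) => exact: ct_p22
  | |- continuous (fun x => - @?f x) => apply: (@ctN _ _ f)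
  | |- continuous (fun x => @?f x + @?g x) => apply: (@ctD _ _ f g)
  | |- continuous (fun x => @?f x * @?g x) => apply: (@ctM _ _ f g)
  | |- continuous (fun x => (@?f x) ^+ ?n) => apply: (@ctX _ _ f n)
  | |- continuous (fun x => `|@?f x|) => apply: (@ct_norm _ _ f)
  | |- continuous (fun x => Num.sqrt (@?f x)) => apply: (@ct_sqrt _ _ f)
  | |- continuous (fun x => expR (@?f x)) => apply: (@ct_exp _ _ f)
  | |- continuous (fun x => (@?f x)^-1) => apply: (@ctV _ _ f)
  end.
Ltac cont := repeat (cbv beta; cont1).

(** * Density of rational steps around the kernel *)

Section SmoothStep.
Variable R : realType.

(** z + |z| is twice the positive part of z: a continuous cutoff that is 0 for z <= 0 and tends to 1
    at every z > 0. *)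
Definition chi (m : nat) (z : R) : R := 1 - expR (- (m.+1%:R * (z + `|z|))).

Lemma chi_npos m z : z <= 0 -> chi m z = 0.
Proof. by move=> z0; rewrite /chi ler0_norm// subrr mulr0 oppr0 expR0 subrr. Qed.

Lemma chi_01 m z : 0 <= chi m z <= 1.
Proof.
have h : 0 <= m.+1%:R * (z + `|z|) by rewrite mulr_ge0// -lerBlDl sub0r -normrN ler_norm.
rewrite /chi subr_ge0 gerBl expR_ge0 andbT -[leRHS]expR0 ler_expR oppr_le0.
exact: h.
Qed.

Lemma chi_cvg z : 0 < z -> chi m z @[m --> \oo] --> (1 : R).
Proof.
move=> z0; rewrite -[X in _ --> X]subr0; apply: cvgB; first exact: cvg_cst.
apply: (@squeeze_cvgr _ _ _ _ (fun=> 0) (fun m => (2 * z)^-1 * m.+1%:R^-1)).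
- apply: nearW => m; rewrite expR_ge0/= gtr0_norm//.
  have w0 : 0 < 2 * z * m.+1%:R by rewrite !mulr_gt0.
  rewrite -invfM expRN lef_pV2 ?posrE ?expR_gt0//.
  apply: le_trans (expR_ge1Dx _); rewrite (_ : m.+1%:R * (z + z) = 2 * z * m.+1%:R) ?lerDr//.
  by ring.
- exact: cvg_cst.
- rewrite -[X in _ --> X](mulr0 (2 * z)^-1).
  by apply: cvgM; [exact: cvg_cst|exact: cvg_harmonic].
Qed.

End SmoothStep.

Section Density.
Variables (R : realType) (f : plane R -> R) (mu : {sigma_finite_measure set (plane R) -> \bar R}).
Hypothesis mu_spec : spectral_measure f mu.
Hypothesis mu_int : (\int[mu]_xi (1 / (1 + enorm xi `^ (2 / 3)))%:E < +oo)%E.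
Variables (t dl nu : R) (x : plane R).
Hypotheses (t0 : 0 <= t) (dl0 : 0 < dl) (nu0 : 0 < nu) (nu1 : nu < 1).

Let q (p : spacetime R) : R := kA x.1 p.2.1 * kB (t - p.1) x.1 p.2.1.
Let v (p : spacetime R) : R := x.2 - p.2.2.
Let G1 (p : spacetime R) : R := p.2.1 - (x.1 + dl).
Let G2 (p : spacetime R) : R := x.1 + 2 * (t - p.1) - dl - p.2.1.
Let G3 (p : spacetime R) : R := nu ^+ 2 * q p - v p ^+ 2.
(** A positive lower bound for the radicand q - v^2 on the truncated support: v^2 < nu^2 q there,
    and q = A B with A >= dl^3 / 12 and B >= dl. *)
Let c : R := (1 - nu ^+ 2) * (dl ^+ 3 / 12 * dl).

Let c0 : 0 < c.
Proof.
rewrite mulr_gt0 ?subr_gt0 ?mulr_gt0 ?exprn_gt0//.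
by rewrite expr_lt1// ltW.
Qed.

Let cut m p : R := chi m (G1 p) * chi m (G2 p) * chi m (G3 p).

(** The kernel with its radicand s replaced by max(s, c), written as c plus the positive part of s -
    c: continuous and bounded everywhere, and equal to the kernel on the truncated support. *)
Let b (p : spacetime R) : R :=
  (2 * pi * Num.sqrt (c + 2^-1 * ((q p - v p ^+ 2 - c) + `|q p - v p ^+ 2 - c|)))^-1.

Let inside p : 0 < G1 p -> 0 < G2 p -> 0 < G3 p -> gtrk dl nu t x p = b p /\ c <= q p - v p ^+ 2.
Proof.
move=> g1 g2 g3; have dp := dl0; have h1 : x.1 < p.2.1 < x.1 + 2 * (t - p.1).
  by move: g1 g2; rewrite /G1 /G2 => g1 g2; lra.
have [A0 B0] := kAB_gt0 h1.
have q0 : 0 < q p by exact: mulr_gt0.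
have cq : c <= q p - v p ^+ 2.
  apply: (@le_trans _ _ ((1 - nu ^+ 2) * q p)); last first.
    by move: g3; rewrite /G3 mulrBl mul1r => g3; lra.
  rewrite ler_wpM2l//; first by rewrite subr_ge0 expr_le1// ltW.
  rewrite ler_pM//; [by rewrite divr_ge0// exprn_ge0// ltW|exact: ltW| |].
    apply: le_trans (kA_ge (ltW (proj1 (andP h1)))); rewrite ler_pM2r ?invr_gt0//.
    rewrite lerXn2r ?nnegrE ?subr_ge0; [by []|exact: ltW|by lra|].
    by move: g1; rewrite /G1; lra.
  by move: g2; rewrite /kB /G2; lra.
split=> //; have [p1 p2] : x.1 + dl < p.2.1 < x.1 + 2 * (t - p.1) - dl /\
    - (nu * kr (t - p.1) x.1 p.2.1) < x.2 - p.2.2 < nu * kr (t - p.1) x.1 p.2.1.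
  split; first by move: g1 g2; rewrite /G1 /G2 => g1 g2; lra.
  rewrite -ltr_norml -(@ltr_pXn2r _ 2)// ?nnegrE ?mulr_ge0 ?sqrtr_ge0// ?ltW//.
  rewrite real_normK ?num_real// exprMn sqr_sqrtr; last exact: ltW.
  by move: g3; rewrite /G3 subr_gt0.
rewrite /gtrk /gtr /oo p1 p2 !mulr1 GammaE.
have tp : 0 < t - p.1 by lra.
rewrite tp (proj1 (andP h1)) /= -/(q p) -/(v p) (lt_le_trans c0 cq) /b.
rewrite ger0_norm ?subr_ge0//; congr ((_ * Num.sqrt _)^-1).
by field.
Qed.

Let outside p : ~~ [&& 0 < G1 p, 0 < G2 p & 0 < G3 p] -> gtrk dl nu t x p = 0 /\ forall m, cut m p = 0.
Proof.
move=> h; split; last first.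
  move=> m; rewrite /cut; move: h; case: (ltP 0 (G1 p)) => [_|h] /=; last by rewrite chi_npos// !mul0r.
  case: (ltP 0 (G2 p)) => [_|h] /=; last by rewrite (chi_npos _ h) mulr0 mul0r.
  by case: (ltP 0 (G3 p)) => [_|h] //= _; rewrite (chi_npos _ h) mulr0.
have dp := dl0.
rewrite /gtrk /gtr; have [k1|k1] := boolP (x.1 + dl < p.2.1 < x.1 + 2 * (t - p.1) - dl); last first.
  by rewrite {1}/oo (negbTE k1) mulr0 mul0r.
have [k2|k2] := boolP (- (nu * kr (t - p.1) x.1 p.2.1) < x.2 - p.2.2 < nu * kr (t - p.1) x.1 p.2.1); last first.
  by rewrite {2}/oo (negbTE k2) mulr0.
case/negP: h; apply/and3P; split; [by rewrite /G1; lra|by rewrite /G2; lra|].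
have h1 : x.1 < p.2.1 < x.1 + 2 * (t - p.1) by lra.
have [A0 B0] := kAB_gt0 h1; have q0 : 0 < q p by exact: mulr_gt0.
move: k2; rewrite -ltr_norml -(@ltr_pXn2r _ 2)// ?nnegrE ?mulr_ge0 ?sqrtr_ge0// ?ltW//.
rewrite real_normK ?num_real// exprMn sqr_sqrtr; last exact: ltW.
by rewrite /G3 subr_gt0.
Qed.

Let hm m p : R := cut m p * b p.

Let hmE m p : hm m p = cut m p * gtrk dl nu t x p.
Proof.
have [/and3P[h1 h2 h3]|h] := boolP [&& 0 < G1 p, 0 < G2 p & 0 < G3 p].
  by have [-> _] := inside h1 h2 h3.
by have [_ e] := outside h; rewrite /hm e !mul0r.
Qed.

Let b0 p : 0 <= b p.
Proof. by rewrite invr_ge0 mulr_ge0 ?sqrtr_ge0// mulr_ge0// pi_ge0. Qed.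

Let chm m : continuous (hm m).
Proof.
rewrite /hm /cut /chi /G1 /G2 /G3 /b /q /v /kA /kB; cont.
move=> p; rewrite mulf_neq0//; first by rewrite mulf_neq0// gt_eqF// pi_gt0.
rewrite gt_eqF// sqrtr_gt0 ltr_pwDl// mulr_ge0// -lerBlDl sub0r -normrN; exact: ler_norm.
Qed.

Let M : R := (2 * pi * Num.sqrt c)^-1.

Let M0 : 0 <= M. Proof. by rewrite invr_ge0 mulr_ge0 ?sqrtr_ge0// mulr_ge0// pi_ge0. Qed.

Let bM p : b p <= M.
Proof.
have p0 : 0 < 2 * pi :> R by rewrite mulr_gt0// pi_gt0.
have h : 0 <= 2^-1 * ((q p - v p ^+ 2 - c) + `|q p - v p ^+ 2 - c|).
  by rewrite mulr_ge0// -lerBlDl sub0r -normrN; exact: ler_norm.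
rewrite lef_pV2 ?posrE; last 2 first.
- by rewrite mulr_gt0// sqrtr_gt0 ltr_pwDl.
- by rewrite mulr_gt0// sqrtr_gt0.
by rewrite ler_pM2l// ler_wsqrtr// lerDl.
Qed.

Let cut01 m p : 0 <= cut m p <= 1.
Proof.
have /andP[a1 a2] := chi_01 m (G1 p); have /andP[a3 a4] := chi_01 m (G2 p).
have /andP[a5 a6] := chi_01 m (G3 p).
by rewrite /cut !mulr_ge0// mulr_ile1 ?mulr_ge0// mulr_ile1.
Qed.

Let hmM m p : `|hm m p| <= M.
Proof.
have /andP[a1 a2] := cut01 m p; rewrite ger0_norm; last exact: mulr_ge0.
by rewrite -[M]mul1r ler_pM.
Qed.

Let gM p : 0 <= gtrk dl nu t x p <= M.
Proof.
rewrite gtr_ge0 /=; have [/and3P[h1 h2 h3]|h] := boolP [&& 0 < G1 p, 0 < G2 p & 0 < G3 p].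
  by have [-> _] := inside h1 h2 h3; exact: bM.
by have [-> _] := outside h.
Qed.

(** A support radius: y1 lies between x1 and x1 + 2 t, and v^2 < q gives |v| < q + 1, where A <= kA
    x1 (x1 + 2t) and B <= 2 t bound q. *)
Let K : R := `|x.1| + `|x.2| + 2 * t + kA x.1 (x.1 + 2 * t) * (2 * t) + 1.

Let kA0 : 0 <= kA x.1 (x.1 + 2 * t) * (2 * t).
Proof.
have t' := t0; have t2 : 0 <= 2 * t by lra.
apply: mulr_ge0 => //; apply: le_trans (kA_ge (_ : x.1 <= x.1 + 2 * t)); last by lra.
by rewrite divr_ge0// exprn_ge0// addrC addKr.
Qed.

Let K_pos : 0 < K.
Proof.
by have t' := t0; have := kA0; have := normr_ge0 x.1; have := normr_ge0 x.2; rewrite /K; lra.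
Qed.

Let support p : 0 <= p.1 <= t -> gtrk dl nu t x p != 0 ->
  [/\ p.1 < t - dl, `|p.2.1| < K & `|p.2.2| < K].
Proof.
move=> /andP[s0 st] gp.
have /and3P[h1 h2 h3] : [&& 0 < G1 p, 0 < G2 p & 0 < G3 p].
  by apply: contraNT gp => /outside[-> _].
have [_ h4] := inside h1 h2 h3; have c0' := c0; have dp := dl0.
have k0 := kA0.
move: h1 h2; rewrite /G1 /G2 => h1 h2.
have hy : x.1 < p.2.1 < x.1 + 2 * t by lra.
have [A0 B0] : 0 < kA x.1 p.2.1 /\ 0 < kB (t - p.1) x.1 p.2.1 by apply: kAB_gt0; lra.
have n1 := normr_ge0 x.1; have n2 := normr_ge0 x.2.
have n3 := ler_norm x.1; have n4 := ler_norm (- x.1); rewrite normrN in n4.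
split; [by lra| |].
  by rewrite ltr_norml /K; apply/andP; split; lra.
have qK : q p <= kA x.1 (x.1 + 2 * t) * (2 * t).
  rewrite /q ler_pM ?(ltW A0) ?(ltW B0)//; first by apply: kA_le; lra.
  by rewrite /kB; lra.
have vq : `|v p| < q p + 1.
  have : v p ^+ 2 < q p by lra.
  rewrite -[v p ^+ 2]real_normK ?num_real//; have := sqr_ge0 (`|v p| - 2^-1).
  move: (`|v p|) (q p) => a e; rewrite !expr2 => h5 h6; lra.
have : `|x.2 - v p| <= `|x.2| + `|v p| by exact: ler_normB.
by rewrite /v subKr -/(v p) /K; lra.
Qed.

(** The three defining inequalities of the truncated support are smoothed by [chi]. The support in
    time ends before t - dl, which leaves room for a rational final time below t. *)
Lemma gtrk_cut_cvg :
  exists h : nat -> spacetime R -> R, [/\ forall m, continuous (h m), forall m, good_integrand (h m),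
    forall m p, 0 <= p.1 <= t -> h m p != 0 -> [/\ p.1 < t - dl, `|p.2.1| < K & `|p.2.2| < K],
    forall m p, `|h m p| <= M
    & noise_norm2 mu `[0%R, t] (fun p => h m p - gtrk dl nu t x p) @[m --> \oo] --> 0%E].
Proof.
have gg : good_integrand (gtrk dl nu t x) by exact: good_gtrk t x (ltW dl0) nu0 (ltW nu1).
have mh m : mfun (hm m) by exact: measurable_continuous_spacetime.
exists hm; split => //.
- move=> m; split=> // s; apply: (intg_le _ (good_intg s gg)).
    exact: (@measurable_slice1 _ _ _ _ _ _ _ (mh m) s).
  move=> y; have /andP[g0 g1] := gM (s, y); have /andP[a0 a1] := cut01 m (s, y).
  by rewrite ger0_norm; [rewrite hmE ler_piMl|exact: mulr_ge0].
- move=> m p sp hp; apply: support => //; apply: contraNneq hp => e.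
  by rewrite hmE e mulr0.
apply: (@noise_L2_cvg _ _ _ mu_spec mu_int t (2 * M) K) => //.
- by move=> m; apply: mfD => //; apply: mfN; exact: gg.1.
- move=> m p _; apply: (le_trans (ler_normB _ _)).
  by have := hmM m p; have /andP[g0 g1] := gM p; rewrite (ger0_norm g0); lra.
- move=> m p /andP[/ltW s0 st]; rewrite hmE => hp; have /support[] // : gtrk dl nu t x p != 0.
    by apply: contraNneq hp => e; rewrite e mulr0 subrr.
    by rewrite s0.
  by move=> _ /ltW h1 /ltW h2.
move=> p _; have H : hm m p @[m --> \oo] --> gtrk dl nu t x p.
  under eq_fun do rewrite hmE.
  have [/and3P[h1 h2 h3]|h] := boolP [&& 0 < G1 p, 0 < G2 p & 0 < G3 p].
    have C : cut m p * gtrk dl nu t x p @[m --> \oo] --> 1 * 1 * 1 * gtrk dl nu t x p.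
      by apply: cvgM; [apply: cvgM; [apply: cvgM; exact: chi_cvg|exact: chi_cvg]|exact: cvg_cst].
    by rewrite !mul1r in C; exact: C.
  by have [-> _] := outside h; under eq_fun do rewrite mulr0; exact: cvg_cst.
have C : hm m p - gtrk dl nu t x p @[m --> \oo] --> gtrk dl nu t x p - gtrk dl nu t x p.
  by apply: cvgB; [exact: H|exact: cvg_cst].
by rewrite subrr in C.
Qed.

(** Two approximations: the truncated kernel by a continuous function, and that function by its grid
    samples. Continuity at each point and a uniform bound are enough, as [noise_L2_cvg] asks for
    pointwise convergence only. *)
Lemma raw_dense_gtrk (e : R) : 0 < e -> exists2 l, rawok t l &
  (noise_norm2 mu `[0%R, t] (fun p => (rawfun l p - gtrk dl nu t x p)%R) < e%:E)%E.
Proof.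
move=> e0; have [h [ch gh sh hM hc]] := gtrk_cut_cvg.
have gg : good_integrand (gtrk dl nu t x) by exact: good_gtrk t x (ltW dl0) nu0 (ltW nu1).
have e4 : 0 < e / 4 by rewrite divr_gt0.
have [m _ /(_ m (leqnn m)) hm4] := ecvg0_lt e4 hc.
suff [l ok lc] : exists2 l, rawok t l & (noise_norm2 mu `[0%R, t] (fun p => (rawfun l p - h m p)%R) < (e / 4)%:E)%E.
  exists l => //.
  rewrite (_ : (fun p => _) = (fun p => (rawfun l p - h m p) + (h m p - gtrk dl nu t x p))); last first.
    by apply/funext => p; rewrite addrA subrK.
  apply: le_lt_trans (noise_norm2D mu (measurable_itv _) (goodB (good_rawfun R l) (gh m)) (goodB (gh m) gg)) _.
  exact: lte_quarter lc hm4.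
(* For t <= dl nothing of the support lies in [0, t], and the empty list serves. *)
have [tdl|tdl] := leP t dl.
  have mg : mfun (fun p => rawfun [::] p - h m p) := (goodB (good_rawfun R [::]) (gh m)).1.
  have z (s : measurableTypeR R) y : `[0%R, t]%classic s -> ~ set0 s -> rawfun [::] (s, y) - h m (s, y) = 0.
    rewrite /= in_itv/= => st _; rewrite /rawfun big_nil sub0r; apply/eqP; rewrite oppr_eq0.
    apply: contraT => /(sh m (s, y) st)[/= h1 _ _]; case/andP: st => s0 _.
    by have := lt_le_trans h1 (_ : t - dl <= 0); rewrite subr_le0 ltNge s0 => /(_ tdl).
  exists [::]; first by [].
  rewrite (@noise_norm2_supp _ mu set0 `[0%R, t]%classic _ measurable0 (measurable_itv _) (@sub0set _ _) mg z).
  by rewrite noise_norm2E integral_set0 lte_fin.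
have ltt : t - dl < t by rewrite ltrBlDr ltrDl.
(* A rational final time in ]t - dl, t[ covers the support in time and keeps the grid inside
   [0, t]. *)
have [tau] := rat_in_itvoo ltt; rewrite in_itv/= => /andP[tau1 tau2].
have KK1 : K < K + 1 by rewrite ltrDl.
have [Kq] := rat_in_itvoo KK1; rewrite in_itv/= => /andP[Kq1 Kq2].
have tau0 : 0 < tau by rewrite -(ltr0q R) (le_lt_trans _ tau1)// subr_ge0 ltW.
have Kq0 : 0 < Kq by rewrite -(ltr0q R) (lt_trans K_pos Kq1).
have hbox p : 0 < p.1 <= t -> h m p != 0 -> gbox tau Kq p.
  move=> /andP[s0 st] /sh[|h1 h2 h3]; first by rewrite ltW.
  have a (z : R) : `|z| < K -> - ratr Kq < z <= ratr Kq.
    by rewrite ltr_norml => /andP[a1 a2]; apply/andP; split; lra.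
  by rewrite /gbox s0 a// a// (ltW (lt_trans h1 tau1)).
have gc : noise_norm2 mu `[0%R, t] (fun p => rawfun (grid tau Kq (h m) n) p - h m p) @[n --> \oo] --> 0%E.
  apply: (@noise_L2_cvg _ _ _ mu_spec mu_int t (2 * M + 1) (ratr Kq)) => //.
  - move=> n; apply: mfD; first exact: (good_rawfun R _).1.
    by apply: mfN; exact: (gh m).1.
  - move=> n p _; apply: (le_trans (ler_normB _ _)).
    have hp := hM m p; have m0 := M0.
    have [gp|/(grid_out (h m) tau0 Kq0 n) ->] := boolP (gbox tau Kq p); last by rewrite normr0; lra.
    have [c' [c1 _]] := grid_hit (h m) tau0 Kq0 n gp.
    have hc' := hM m c'; have c2 : `|rawfun (grid tau Kq (h m) n) p - h m c'| < 1.
      by apply: (lt_le_trans c1); rewrite invf_le1// ler1n.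
    have := ler_normD (rawfun (grid tau Kq (h m) n) p - h m c') (h m c'); rewrite subrK; lra.
  - move=> n p sp gp; have : gbox tau Kq p.
      apply: contraNT gp => gp; rewrite (grid_out (h m) tau0 Kq0 n gp) sub0r oppr_eq0.
      by apply: contraNT gp; exact: hbox.
    move=> /and3P[_ /andP[a1 a2] /andP[a3 a4]].
    by rewrite !ler_norml a2 a4 !ltW.
  move=> p sp; have [gp|gp] := boolP (gbox tau Kq p); last first.
    have -> : h m p = 0 by apply/eqP; apply: contraNT gp; exact: hbox.
    by under eq_fun do rewrite (grid_out (h m) tau0 Kq0 _ gp) subrr; exact: cvg_cst.
  apply/cvgrPdist_lt => r r0; have r2 : 0 < r / 2 by rewrite divr_gt0.
  have /cvgrPdist_lt/(_ _ r2) := ch m p; rewrite -filter_from_norm_nbhs => -[rho rho0 hrho].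
  pose L : R := ratr tau + ratr (Kq + Kq).
  have cL : L * n.+1%:R^-1 @[n --> \oo] --> (0 : R).
    by rewrite -[X in _ --> X](mulr0 L); apply: cvgM; [exact: cvg_cst|exact: cvg_harmonic].
  near=> n; rewrite sub0r normrN.
  have [c' [c1 c2]] := grid_hit (h m) tau0 Kq0 n gp.
  have c3 : `|h m p - h m c'| < r / 2.
    apply: hrho; rewrite /ball_ /=; apply: (le_lt_trans c2).
    have : `|0 - L * n.+1%:R^-1| < rho by near: n; move/cvgrPdist_lt: cL; exact.
    by rewrite sub0r normrN; apply: le_lt_trans; exact: ler_norm.
  have c4 : n.+1%:R^-1 < r / 2.
    have : `|0 - n.+1%:R^-1| < r / 2 by near: n; have /cvgrPdist_lt := @cvg_harmonic R; exact.
    by rewrite sub0r normrN ger0_norm.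
  have := ler_normD (rawfun (grid tau Kq (h m) n) p - h m c') (h m c' - h m p).
  rewrite addrA subrK distrC [X in _ <= _ + X]distrC => c5.
  by have := lt_trans c1 c4; lra.
have [n _ /(_ n (leqnn n)) hn] := ecvg0_lt e4 gc.
by exists (grid tau Kq (h m) n) => //; apply: grid_ok => //; exact: ltW.
Unshelve. all: by end_near. Qed.

End Density.

(** * Rational steps approximate the full kernel *)

Section RawDense.
Variables (R : realType) (f : plane R -> R) (mu : {sigma_finite_measure set (plane R) -> \bar R}).
Hypothesis mu_spec : spectral_measure f mu.
Hypothesis mu_int : (\int[mu]_xi (1 / (1 + enorm xi `^ (2 / 3)))%:E < +oo)%E.

Lemma raw_dense (t : R) (x : plane R) (e : R) : 0 <= t -> 0 < e -> exists2 l, rawok t l &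
  (noise_norm2 mu `[0%R, t] (fun p => (rawfun l p - gtrk 0 1 t x p)%R) < e%:E)%E.
Proof.
move=> t0 e0; have e4 : 0 < e / 4 by rewrite divr_gt0.
have [n _ /(_ n (leqnn n)) hn] := ecvg0_lt e4 (noise_norm2_gtrk_cvg mu_int t x).
have /andP[n0 n1] := nun_01 R n; have d0 := dln_gt0 R n.
have [l ok hl] := raw_dense_gtrk mu_spec mu_int x t0 d0 n0 n1 e4.
have g1 := good_gtrk t x (ltW d0) n0 (ltW n1).
have g2 : good_integrand (gtrk 0 1 t x) by apply: good_gtrk.
exists l => //; rewrite (_ : (fun p => _) = (fun p => (rawfun l p - gtrk (dln R n) (nun R n) t x p) +
    (gtrk (dln R n) (nun R n) t x p - gtrk 0 1 t x p))); last by apply/funext => p; rewrite addrA subrK.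
apply: le_lt_trans (noise_norm2D mu (measurable_itv _) (goodB (good_rawfun R l) g1) (goodB g1 g2)) _.
exact: lte_quarter hl hn.
Qed.

End RawDense.

(** * Limits of rapidly Cauchy sequences in mean square *)

Section FastCauchy.
Context d (Omega : measurableType d) (R : realType) (P : probability Omega R).
Variables (X : nat -> Omega -> R) (C : R).

Definition pow2 (n : nat) : R := (2 ^ n.+1)%:R.

Lemma pow2_gt0 n : 0 < pow2 n. Proof. by rewrite ltr0n expn_gt0. Qed.

Hypothesis C0 : 0 <= C.
Hypothesis mX : forall n, mfun (X n).
Hypothesis XC : forall n m, (moment2 P (fun w => (X n w - X m w)%R) <= (C / pow2 n ^+ 2 + C / pow2 m ^+ 2)%:E)%E.

(** A limit superior is defined at every w and stays measurable when parameters are added; it is the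
    limit wherever the sequence converges. *)
Definition limX (w : Omega) : R := fine (limn_esup (fun n => (X n w)%:E)).

Lemma mf_limX : mfun limX.
Proof.
apply: measurableT_comp; first exact: fine_measurable.
by apply: measurable_fun_limn_esup => n; apply/measurable_EFinP; exact: mX.
Qed.

Let dX n w : R := `|X n.+1 w - X n w|.

Let dX0 n w : (0 <= (dX n w)%:E)%E. Proof. by rewrite lee_fin; exact: normr_ge0. Qed.

Let mdX n : measurable_fun setT (fun w => (dX n w)%:E).
Proof. by apply/measurable_EFinP; apply: mfunE; apply: mf_norm; apply: mfD => //; exact: mfN. Qed.

(** From x <= (a / 2) x^2 + 1 / (2 a) with a = 2^(n+1), which turns the second-moment bound C / a^2
    into a first-moment bound of order 1 / a, summable in n. *)
Let dX_int n : (\int[P]_w (dX n w)%:E <= ((2 * C + 1) / (2 ^ (n + 1))%:R)%:E)%E.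
Proof.
have a0 := pow2_gt0 n; rewrite addn1 -/(pow2 n).
have m1 : mfun (fun w => X n.+1 w - X n w) by apply: mfD => //; exact: mfN.
apply: (@le_trans _ _ (\int[P]_w ((pow2 n / 2)%:E * ((X n.+1 w - X n w)%R ^+ 2)%:E + ((2 * pow2 n)^-1)%:E)))%E.
  apply: ge0_le_integral => //.
  - apply: emeasurable_funD => //; apply: measurable_funeM; apply/measurable_EFinP.
    by apply: mfunE; exact: mfX.
  move=> w _; rewrite -EFinM -EFinD lee_fin /dX -[_ ^+ 2]real_normK ?num_real//.
  move: `|_| => x; rewrite invfM -subr_ge0.
  have -> : pow2 n / 2 * x ^+ 2 + 2^-1 / pow2 n - x = (pow2 n * x - 1) ^+ 2 / (2 * pow2 n).
    by field; rewrite gt_eqF.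
  by rewrite divr_ge0 ?sqr_ge0// mulr_ge0// ltW.
have b0 : 0 <= pow2 n / 2 by rewrite divr_ge0// ltW.
have c0 : 0 <= (2 * pow2 n)^-1 by rewrite invr_ge0 mulr_ge0// ltW.
rewrite ge0_integralD//; last 2 first.
- by move=> w _; rewrite mule_ge0// lee_fin sqr_ge0.
- by apply: measurable_funeM; apply/measurable_EFinP; apply: mfunE; exact: mfX.
rewrite ge0_integralZl//; last 2 first.
- by apply/measurable_EFinP; apply: mfunE; exact: mfX.
- by move=> w _; rewrite lee_fin sqr_ge0.
rewrite integral_cst// [X in (_ + _ * X)%E]probability_setT mule1.
have h := XC n.+1 n; apply: (@le_trans _ _ ((pow2 n / 2)%:E * (C / pow2 n.+1 ^+ 2 + C / pow2 n ^+ 2)%:E + ((2 * pow2 n)^-1)%:E)%E).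
  by rewrite leeD2r// lee_wpmul2l.
rewrite -EFinM -EFinD lee_fin.
have -> : pow2 n.+1 = 2 * pow2 n by rewrite /pow2 expnS natrM.
move: (pow2 n) a0 C0 => a a0 c00; rewrite -subr_ge0.
have -> : (2 * C + 1) / a - (a / 2 * (C / (2 * a) ^+ 2 + C / a ^+ 2) + (2 * a)^-1) = (11 * C / 8 + 2^-1) / a.
  by field; rewrite gt_eqF.
by rewrite divr_ge0 ?ltW// ltr_wpDl// divr_ge0// mulr_ge0.
Qed.

(** The sum of the absolute increments has finite expectation, hence is finite almost surely, and
    the telescoping series converges absolutely. *)
Let ae_cvg : {ae P, forall w, cvgn (fun n => X n w)}.
Proof.
pose G w := (\sum_(n <oo) (dX n w)%:E)%E.
have mG : measurable_fun setT G.
  by apply: ge0_emeasurable_sum => // n w _ _; exact: dX0.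
have G0 w : (0 <= G w)%E by apply: nneseries_ge0 => n _ _; exact: dX0.
have iG : P.-integrable setT G.
  apply/integrableP; split=> //; under eq_integral do rewrite gee0_abs//.
  rewrite integral_nneseries//.
  apply: (@le_lt_trans _ _ (\sum_(n <oo) ((2 * C + 1) / (2 ^ (n + 1))%:R)%:E)%E).
    by apply: lee_nneseries => n //; move=> _ _; apply: integral_ge0 => w _; exact: dX0.
  have := @cvg_geometric_eseries_half R (2 * C + 1) 0 => /cvg_lim -> //.
  exact: ltry.
have := integrable_ae measurableT iG; apply: filterS => w /(_ I) fG.
have b n : series (fun n => dX n w) n <= fine (G w).
  rewrite -lee_fin fineK// /series /= -sumEFin.
  by apply: nneseries_lim_ge => k _ _; exact: dX0.
have cs : cvgn [normed series (telescope (fun n => X n w))].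
  apply: nondecreasing_is_cvgn.
    by apply: nondecreasing_series => n _ _; exact: normr_ge0.
  by exists (fine (G w)) => _ [n _ <-]; exact: b.
rewrite (_ : (fun n => X n w) = (fun n => X 0%N w + series (telescope (fun n => X n w)) n)).
  apply: is_cvgD; first exact: is_cvg_cst.
  exact: normed_cvg.
by apply/funext => n; exact: (eq_sum_telescope (fun n => X n w) n).
Qed.

Lemma limn_einf_le (u : nat -> \bar R) K : (forall m, (u m <= K)%E) -> (limn_einf u <= K)%E.
Proof.
move=> uK; rewrite limn_einf_lim; apply: lime_le; first exact: is_cvg_einfs.
by apply: nearW => m; apply: le_trans (uK m); apply: ereal_inf_lbound; exists m => /=.
Qed.

(** Fatou in m for the squares of X n - X (m + n), whose almost sure limit is the square of X n -
    limX. *)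
Let moment2_limX n : (moment2 P (fun w => (X n w - limX w)%R) <= ((2 * C) / pow2 n)%:E)%E.
Proof.
pose h m w := (((X n w - X (m + n)%N w) ^+ 2)%:E : \bar R).
have mh m : measurable_fun setT (h m).
  by apply/measurable_EFinP; apply: mfunE; apply: mfX; apply: mfD => //; exact: mfN.
have h0 m w : setT w -> (0 <= h m w)%E by move=> _; rewrite lee_fin sqr_ge0.
have ft := fatou P measurableT mh h0.
have me : measurable_fun setT (fun w => limn_einf (h ^~ w)).
  rewrite (_ : (fun w => _) = (fun w => - limn_esup (fun m => - h m w))%E).
    by apply: measurableT_comp => //; apply: measurable_fun_limn_esup => m; exact: measurableT_comp.
  apply/funext => w; rewrite (_ : (fun m => - h m w)%E = -%E \o (h ^~ w))// limn_esupN oppeK//.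
rewrite /moment2 (@ae_eq_integral _ _ _ P setT (fun w => limn_einf (h ^~ w)) (fun w => ((X n w - limX w) ^+ 2)%:E))//; last 2 first.
- by apply/measurable_EFinP; apply: mfunE; apply: mfX; apply: mfD => //; apply: mfN; exact: mf_limX.
- have := ae_cvg; apply: filterS => w cw _.
  have c1 : (X n w)%:E @[n --> \oo] --> (limn (fun n => X n w))%:E.
    by apply: cvg_EFin; [exact: nearW|exact: cw].
  have lw : limX w = limn (fun n => X n w) by rewrite /limX (cvg_limn_einf_sup c1).2.
  have c2 : h m w @[m --> \oo] --> ((X n w - limX w) ^+ 2)%:E.
    apply: cvg_EFin; first exact: nearW.
    have c3 : X n w - X (m + n)%N w @[m --> \oo] --> X n w - limX w.
      rewrite lw; apply: cvgB; first exact: cvg_cst.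
      by have cw' := cw; rewrite -(cvg_shiftn n) in cw'; exact: cw'.
    have c4 : (X n w - X (m + n)%N w) * (X n w - X (m + n)%N w) @[m --> \oo] --> (X n w - limX w) * (X n w - limX w).
      by apply: cvgM; exact: c3.
    by rewrite expr2; exact: c4.
  by rewrite (cvg_limn_einf_sup c2).1.
apply: (le_trans ft); apply: limn_einf_le => m; apply: (le_trans (XC n (m + n)%N)).
have a0 := pow2_gt0 n; have a1 : 1 <= pow2 n by rewrite ler1n expn_gt0.
have amn : pow2 n <= pow2 (m + n)%N by rewrite ler_nat leq_exp2l// ltnS leq_addl.
have b0 (a : R) : pow2 n <= a -> C / a ^+ 2 <= C / pow2 n.
  move=> ha; rewrite ler_wpM2l// lef_pV2 ?posrE ?exprn_gt0//; last exact: lt_le_trans ha.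
  by apply: (le_trans ha); rewrite ler_eXnr//; exact: le_trans ha.
rewrite lee_fin (_ : 2 * C / pow2 n = C / pow2 n + C / pow2 n).
  by apply: lerD; rewrite b0.
by rewrite -mulrA mulr_natl mulr2n.
Qed.

Lemma limX_cvg : moment2 P (fun w => X n w - limX w) @[n --> \oo] --> 0%E.
Proof.
have c : (2 * C / pow2 n)%:E @[n --> \oo] --> (2 * C * 0)%:E.
  apply: cvg_EFin; first exact: nearW.
  apply: cvgM; first exact: cvg_cst.
  apply: (@squeeze_cvgr _ _ _ _ (fun=> 0) (fun n => n.+1%:R^-1)).
  - apply: nearW => n; rewrite invr_ge0 ltW ?pow2_gt0//= lef_pV2 ?posrE ?pow2_gt0//.
    by rewrite ler_nat ltnW// ltn_expl.
  - exact: cvg_cst.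
  - exact: cvg_harmonic.
rewrite mulr0 in c; apply: squeeze_cvge (cvg_cst _) c.
by apply: nearW => n; rewrite moment2_ge0 moment2_limX.
Qed.

End FastCauchy.

(** * Measurable selection and the jointly measurable process *)

Definition least (c : nat -> bool) : nat :=
  if pselect (exists j, c j) is left e then ex_minn e else 0.

(** Expresses the value through countably many conditions on c, the default 0 included;
    measurability of [pick] is read off from this. *)
Lemma leastP (c : nat -> bool) j : least c = j <->
  (c j /\ forall i, (i < j)%N -> ~ c i) \/ (j = 0%N /\ forall i, ~ c i).
Proof.
rewrite /least; case: pselect => [e|ne].
  case: ex_minnP => i ci mi; split => [<-|[[cj hj]|[_ /(_ i)]]] //.
    by left; split=> // k ki ck; have := mi k ck; rewrite leqNgt ki.
  apply/eqP; rewrite eqn_leq mi//= leqNgt; apply/negP => ij; exact: hj ij ci.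
split=> [<-|[[cj _]|[-> //]]]; first by right; split=> // i ci; apply: ne; exists i.
by case: ne; exists j.
Qed.

Lemma least_sat (c : nat -> bool) : (exists j, c j) -> c (least c).
Proof. by move=> e; case/leastP: (erefl (least c)) => [[]|[_ h]]//; case: e => j /h. Qed.

Section Selection.
Context d (Omega : measurableType d) (R : realType) (P : probability Omega R).
Variables (f : plane R -> R) (mu : {sigma_finite_measure set (plane R) -> \bar R}).
Hypothesis mu_spec : spectral_measure f mu.
Hypothesis mu_int : (\int[mu]_xi (1 / (1 + enorm xi `^ (2 / 3)))%:E < +oo)%E.
Variable F : (spacetime R -> R) -> {RV P >-> R}.
Hypothesis F_noise : noise f F.
Variable FA : set (spacetime R) -> {RV P >-> R}.
Hypothesis FA_ext : indicator_extension mu F FA.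
Local Notation leb := (@lebesgue_measure R).
Local Notation M := (martingale_measure FA).

(** An enumeration of the countable type of rational step lists; numbers that decode to nothing give
    the empty list. *)
Definition raw_of (j : nat) : seq raw := odflt [::] (@unpickle (seq (rat * ((rat * rat) * ((rat * rat) * (rat * rat))))) j).

Lemma raw_of_surj (l : seq raw) : exists j, raw_of j = l.
Proof. by exists (@pickle (seq (rat * ((rat * rat) * ((rat * rat) * (rat * rat))))) l); rewrite /raw_of pickleK. Qed.

Definition kdist (j : nat) (z : spacetime R) : \bar R :=
  noise_norm2 mu `[0, z.1] (fun p => rawfun (raw_of j) p - gtrk 0 1 z.1 z.2 p).

(** The time interval [0, t] of the norm moves with the variable, so it is first absorbed into the
    integrand W1. *)
Lemma measurable_kdist j : measurable_fun [set: spacetime R] (kdist j).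
Proof.
pose g (q : (spacetime R * measurableTypeR R) * plane R) :=
  rawfun (raw_of j) (q.1.2, q.2) - gtr 0 1 (q.1.1.1 - q.1.2) q.1.1.2 q.2.
have mg : mfun g.
  apply: mfD; first by apply: (measurableT_comp (good_rawfun R (raw_of j)).1); meas.
  apply: mfN; apply: (@mf_gtr R _ (spacetime R * measurableTypeR R * plane R)%type (fun=> 0) (fun=> 1)
    (fun q => q.1.1.1 - q.1.2) (fun q => q.1.1.2) snd); meas.
pose W (q : spacetime R * measurableTypeR R) := (\int[mu]_xi (fourier2 (fun y => g (q, y)) xi)%:E)%E.
have mW : measurable_fun setT W.
  apply: (@measurable_ge0_int _ _ _ _ _ mu (fun z : (spacetime R * measurableTypeR R) * plane R => fourier2 (fun y => g (z.1, y)) z.2)).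
    exact: mf_fourier2.
  by move=> z; exact: fourier2_ge0.
pose W1 (q : spacetime R * measurableTypeR R) : \bar R := if (0 <= q.2) && (q.2 <= q.1.1) then W q else 0%E.
have mW1 : measurable_fun setT W1.
  apply: measurable_fun_ifT => //.
  by apply: measurable_and; apply: measurable_fun_ler => //; meas.
have W10 q : (0 <= W1 q)%E.
  by rewrite /W1; case: ifP => // _; apply: integral_ge0 => xi _; rewrite lee_fin fourier2_ge0.
have -> : kdist j = (fun z => \int[leb]_s W1 (z, s))%E.
  apply/funext => z; rewrite /kdist noise_norm2E integral_mkcond; apply: eq_integral => s _.
  by rewrite patchE mem_setE in_itv/= /W1 /=; case: ifP.
by apply: (measurable_fun_fubini_tonelli_F W1).
Qed.

(** The threshold 4^-(n+1) on the squared distance is the rate required by [limX_cvg]. *)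
Definition close (n j : nat) (z : spacetime R) : bool :=
  rawok z.1 (raw_of j) && (kdist j z < (pow2 R n ^- 2)%:E)%E.

Lemma measurable_close n j : measurable [set z | close n j z].
Proof.
have -> : [set z | close n j z] = [set z : spacetime R | rawok z.1 (raw_of j)] `&` [set z | (kdist j z < (pow2 R n ^- 2)%:E)%E].
  by apply/seteqP; split=> z /=; rewrite /close => /andP.
apply: measurableI.
  rewrite /rawok; elim: (raw_of j) => [|r l ih] /=.
    by have -> : [set z : spacetime R | true] = setT by apply/seteqP; split.
  have -> : [set z : spacetime R | (rhi R r <= z.1) && all (fun r => rhi R r <= z.1) l] =
     [set z | rhi R r <= z.1] `&` [set z : spacetime R | all (fun r => rhi R r <= z.1) l].
    by apply/seteqP; split=> z /= => /andP.
  apply: measurableI => //.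
  have := @measurable_fst _ _ (measurableTypeR R) (plane R) measurableT _ (measurable_itv `[rhi R r, +oo[).
  by rewrite setTI; congr measurable; apply/seteqP; split=> z /=; rewrite in_itv/= andbT.
have := measurable_kdist j measurableT (emeasurable_itv `]-oo, (pow2 R n ^- 2)%:E[%E).
by rewrite setTI; congr measurable; apply/seteqP; split=> z /=; rewrite in_itv/=.
Qed.

Lemma close_ex n z : 0 <= z.1 -> exists j, close n j z.
Proof.
move=> z0; have p0 : 0 < pow2 R n ^- 2 by rewrite invr_gt0 exprn_gt0// pow2_gt0.
have [l ok hl] := raw_dense mu_spec mu_int z.2 z0 p0.
by have [j jl] := raw_of_surj l; exists j; rewrite /close /kdist jl ok.
Qed.

Definition pick (n : nat) (z : spacetime R) : nat := least (fun j => close n j z).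

Lemma pick_close n z : 0 <= z.1 -> close n (pick n z) z.
Proof.
by move=> /(close_ex n) e; exact: least_sat e.
Qed.

Lemma measurable_pick n j : measurable [set z | pick n z = j].
Proof.
pose A := [set z | close n j z] `&` \bigcap_(i in [set i | (i < j)%N]) ~` [set z | close n i z].
pose B := \bigcap_(i in [set: nat]) ~` [set z | close n i z].
have mA : measurable A.
  apply: measurableI; first exact: measurable_close.
  by apply: bigcap_measurableType => // i _; apply: measurableC; exact: measurable_close.
have mB : measurable B.
  by apply: bigcap_measurableType => // i _; apply: measurableC; exact: measurable_close.
have -> : [set z | pick n z = j] = A `|` (if j == 0%N then B else set0).
  apply/seteqP; split=> z /=; rewrite /pick.
    move=> /leastP[[h1 h2]|[j0 h]]; [left|right]; first by split; [exact: h1|exact: h2].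
    by rewrite j0 eqxx => k _; exact: h.
  case=> [[h1 h2]|]; first by apply/leastP; left; split; [exact: h1|exact: h2].
  by case: eqP => [j0 h|_ []]; apply/leastP; right; split=> // k; exact: (h k I).
by apply: measurableU => //; case: ifP.
Qed.

Definition approx_process (n : nat) (q : spacetime R * Omega) : R :=
  rawint FA (raw_of (pick n q.1)) q.2.

Lemma mf_rawint l : mfun (rawint FA l).
Proof.
rewrite /rawint; elim: l => [|r l ih].
  by under eq_fun do rewrite big_nil; exact: mf_cst.
under eq_fun do rewrite big_cons; apply: mfD => //; apply: mfM; first exact: mf_cst.
by apply: mfD; [|apply: mfN]; exact: measurable_funPT.
Qed.

(** [pick] takes countably many values; on the set where it equals j the process is a fixed random
    variable, so preimages are countable unions of measurable products. *)
Lemma mf_approx_process n : mfun (approx_process n).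
Proof.
move=> _ B mB; rewrite setTI.
have -> : approx_process n @^-1` B =
    \bigcup_j ([set z | pick n z = j] `*` (rawint FA (raw_of j) @^-1` B)).
  apply/seteqP; split=> [[z w] /= h|[z w] /= [j _ [/= <- h]]] //.
  by exists (pick n z).
apply: bigcup_measurable => j _; apply: measurableX; first exact: measurable_pick.
by have := mf_rawint (raw_of j) measurableT mB; rewrite setTI.
Qed.

Definition process (q : spacetime R * Omega) : R := limX (fun n w => approx_process n (q.1, w)) q.2.

Lemma mf_process : mfun process.
Proof.
apply: measurableT_comp; first exact: fine_measurable.
apply: measurable_fun_limn_esup => n; apply/measurable_EFinP.
rewrite (_ : (fun x => _) = approx_process n); first exact: mf_approx_process.
by apply/funext => -[].
Qed.

(** The selected step functions lie within 4^-(n+1) of the kernel, hence their integrals are rapidly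
    Cauchy in mean square and converge to the limit superior that defines the process. *)
Lemma process_integral (t : R) (x : plane R) : 0 <= t ->
  stochastic_integral mu M t (gtrk 0 1 t x) (fun w => process ((t, x), w)).
Proof.
move=> t0; pose X n w := approx_process n ((t, x), w).
have cl n := @pick_close n (t, x) t0.
pose l n := raw_of (pick n (t, x)).
have ok n : rawok t (l n) by have /andP[] := cl n.
have ds n : (noise_norm2 mu `[0%R, t] (fun p => (rawfun (l n) p - gtrk 0 1 t x p)%R) < (pow2 R n ^- 2)%:E)%E.
  by have /andP[_] := cl n.
have gg : good_integrand (gtrk 0 1 t x) by apply: good_gtrk.
have gr n := good_rawfun R (l n).
have mX n : mfun (X n) by exact: (mf_rawint (l n)).
have p0 n : 0 <= pow2 R n ^- 2 by rewrite invr_ge0 exprn_ge0// ltW// pow2_gt0.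
(* 8 = 4 * 2: the factor of [rawint_noise_norm2] times that of the quasi-triangle inequality. *)
have XC n m : (moment2 P (fun w => (X n w - X m w)%R) <= (8 / pow2 R n ^+ 2 + 8 / pow2 R m ^+ 2)%:E)%E.
  rewrite (_ : (fun w => _) = rawint FA (l n ++ rawopp (l m))); last first.
    by apply/funext => w; rewrite rawintB.
  apply: (le_trans (rawint_noise_norm2 mu_spec mu_int F_noise FA_ext (rawokB (ok n) (ok m)) t0)).
  rewrite (_ : rawfun _ = (fun p => (rawfun (l n) p - gtrk 0 1 t x p) + - (rawfun (l m) p - gtrk 0 1 t x p))); last first.
    by apply/funext => p; rewrite rawfunB; ring.
  have h := noise_norm2D mu (measurable_itv `[0%R, t]) (goodB (gr n) gg) (goodN (goodB (gr m) gg)).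
  rewrite (noise_norm2N _ _ (goodB (gr m) gg)) in h.
  apply: (@le_trans _ _ (4%:E * (2%:E * (pow2 R n ^- 2)%:E + 2%:E * (pow2 R m ^- 2)%:E))%E).
    by rewrite lee_pmul2l//; apply: (le_trans h); apply: leeD; rewrite lee_pmul2l// ltW.
  have e (a b : R) : (4%:E * (2%:E * a%:E + 2%:E * b%:E) = (8 * a + 8 * b)%R%:E)%E.
    by rewrite -EFinM; congr EFin; ring.
  by rewrite e.
split.
  exact: (@measurable_slice1 _ _ _ _ _ _ _ mf_process (t, x)).
pose e n := projT1 (cid (raw_step FA (ok n))).
have eP n : step_fun (e n) = rawfun (l n) /\ step_integral M (e n) = rawint FA (l n).
  by rewrite /e; case: cid.
exists e; split.
  have c : (pow2 R n ^- 2)%:E @[n --> \oo] --> 0%E.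
    apply: cvg_EFin; first exact: nearW.
    apply: (@squeeze_cvgr _ _ _ _ (fun=> 0) (fun n => n.+1%:R^-1)).
    - apply: nearW => n; rewrite p0/= lef_pV2 ?posrE ?exprn_gt0 ?pow2_gt0//.
      apply: (@le_trans _ _ (pow2 R n)); first by rewrite ler_nat ltnW// ltn_expl.
      by rewrite ler_eXnr// ler1n expn_gt0.
    - exact: cvg_cst.
    - exact: cvg_harmonic.
  apply: squeeze_cvge (cvg_cst _) c; apply: nearW => n.
  by rewrite noise_norm2_ge0 /= (eP n).1 ltW.
under eq_fun => n do rewrite moment2E (eP n).2.
exact: (@limX_cvg _ _ _ P X 8 _ mX XC).
Qed.

End Selection.

(** * Admissibility of the kernel and sigma-finiteness of the spectral measure *)

Lemma well_defined_kernel (R : realType) (mu : {sigma_finite_measure set (plane R) -> \bar R})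
  (mu_int : (\int[mu]_xi (1 / (1 + enorm xi `^ (2 / 3)))%:E < +oo)%E) (t : R) (x : plane R) :
  well_defined_integrand mu t (gtrk 0 1 t x).
Proof.
have [mg ig] : good_integrand (gtrk 0 1 t x) by apply: good_gtrk.
split; [exact: measurable_funTS|by move=> s _; exact: ig|exact: noise_norm2_gtrk_lty].
Qed.

(** Temperedness provides a strictly positive integrable weight; by Chebyshev its level sets above
    1/(n+1) have finite measure, and they exhaust the plane. *)
Lemma tempered_sigma_finite (R : realType) (mu : {measure set (plane R) -> \bar R}) :
  tempered_measure mu -> sigma_finite setT mu.
Proof.
move=> [k hk]; pose w (xi : plane R) : R := (1 + enorm xi ^+ 2) ^- k.
have mw : mfun w.
  by rewrite /w /enorm; apply: mfV; apply: mfX; meas.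
have w0 xi : 0 < w xi by rewrite invr_gt0 exprn_gt0// ltr_pwDl// sqr_ge0.
exists (fun n => [set xi | n.+1%:R^-1 < w xi]).
  apply/seteqP; split=> // xi _.
  have [n _ /(_ n (leqnn n)) hn] : \forall n \near \oo, n.+1%:R^-1 < w xi.
    have /cvgrPdist_lt/(_ _ (w0 xi)) := @cvg_harmonic R.
    by apply: filterS => n; rewrite sub0r normrN /harmonic /= ger0_norm ?invr_ge0.
  by exists n.
move=> n; have mE : measurable [set xi | n.+1%:R^-1 < w xi].
  have := mw measurableT _ (measurable_itv `]n.+1%:R^-1, +oo[).
  by rewrite setTI; congr measurable; apply/seteqP; split=> z /=; rewrite in_itv/= andbT.
split=> //; have n0 : 0 < n.+1%:R :> R by [].
apply: (@le_lt_trans _ _ (n.+1%:R%:E * \int[mu]_xi (w xi)%:E)%E); last first.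
  by rewrite lte_mul_pinfty.
rewrite -ge0_integralZl//; last 2 first.
- exact/measurable_EFinP.
- by move=> xi _; rewrite lee_fin ltW.
rewrite -[X in (X <= _)%E]mul1e -(integral_cst _ mE 1%E) integral_mkcond.
apply: ge0_le_integral => //.
- by move=> xi _; rewrite patchE; case: ifP.
- by apply/(measurable_restrictT _ mE); exact: measurable_cst.
- by apply: measurable_funeM; exact/measurable_EFinP.
move=> xi _; rewrite patchE; case: ifPn => [/set_mem/= h|_]; last first.
  by rewrite -EFinM lee_fin mulr_ge0// ltW.
by rewrite -EFinM lee_fin mulrC -ler_pdivrMr// div1r ltW.
Qed.

(** * Directional derivatives: mean values, mixed derivatives, chain rule *)

Section MeanValue.
Variable R : realType.

Lemma isd_shift (f : R -> R) (s d : R) : isder 0 (fun h : R => f (h + s)) d -> isder s f d.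
Proof.
move=> h; have e : isder s (fun x : R => x - s) 1 by isd_tac; ring.
have h' : isder (s - s) (fun h : R => f (h + s)) d by rewrite subrr.
apply: isd_eq (_ : isder s f (d * 1)) (mulr1 d).
have := @isd_comp R (fun h : R => f (h + s)) (fun x : R => x - s) s d 1 h' e; rewrite (_ : (fun y => _) = f)//.
by apply/funext => x; rewrite subrK.
Qed.

Lemma mean_value (f df : R -> R) (h : R) : (forall s, isder s f (df s)) ->
  exists2 th : R, 0 <= th <= 1 & f h - f 0 = h * df (th * h).
Proof.
move=> d; have dh (s : R) : isder s (fun s : R => f (s * h)) (df (s * h) * h).
  by apply: isd_comp (d _) _; isd_tac; ring.
have cf : {within `[0, 1], continuous (fun s : R => f (s * h))}.
  by apply: continuous_subspaceT => s; exact: isd_cont (dh s).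
have [th] := @MVT_segment R (fun s : R => f (s * h)) (fun s => df (s * h) * h) 0 1 ler01 (fun s _ => dh s) cf.
rewrite in_itv/= => th01; rewrite mul1r mul0r subr0 mulr1 => ->.
by exists th => //; rewrite mulrC.
Qed.

Variable V : normedModType R.

Lemma is_derive_along (g dg : V -> R) (v : V) : (forall p, is_derive p v g (dg p)) ->
  forall (p : V) (s : R), isder s (fun s : R => g (s *: v + p)) (dg (s *: v + p)).
Proof.
move=> d p s; apply: isd_shift; have /is_derive_line := d (s *: v + p).
rewrite (_ : (fun h : R => g (h *: v + (s *: v + p))) = (fun h : R => g ((h + s) *: v + p)))//.
by apply/funext => h; rewrite scalerDl addrA.
Qed.

Lemma mean_value_line (g dg : V -> R) (v : V) (p : V) (h : R) : (forall p, is_derive p v g (dg p)) ->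
  exists2 th : R, 0 <= th <= 1 & g (h *: v + p) - g p = h * dg ((th * h) *: v + p).
Proof.
move=> d; have [th th01] := mean_value h (is_derive_along d p).
by rewrite scale0r add0r; exists th.
Qed.

End MeanValue.

Section Schwarz.
Variables (R : realType) (V : normedModType R) (g : V -> R) (v w : V).
Variables (gv gw gvw gwv : V -> R).
Hypotheses (dv : forall p, is_derive p v g (gv p)) (dw : forall p, is_derive p w g (gw p)).
Hypotheses (dvw : forall p, is_derive p w gv (gvw p)) (dwv : forall p, is_derive p v gw (gwv p)).
Hypotheses (cvw : continuous gvw) (cwv : continuous gwv).

Let second (h : R) (p : V) := g (h *: v + (h *: w + p)) - g (h *: v + p) - g (h *: w + p) + g p.

Let near_pt (p : V) (h th th' : R) : 0 <= th <= 1 -> 0 <= th' <= 1 ->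
  `|p - ((th * h) *: v + ((th' * h) *: w + p))| <= `|h| * (`|v| + `|w|).
Proof.
move=> /andP[t0 t1] /andP[s0 s1]; rewrite addrA distrC addrK; apply: (le_trans (ler_normD _ _)).
have b (x : R) (z : V) : 0 <= x -> x <= 1 -> `|(x * h) *: z| <= `|h| * `|z|.
  by move=> x0 x1; rewrite normrZ ler_wpM2r// normrM (ger0_norm x0) ler_piMl.
by rewrite mulrDr; apply: lerD; exact: b.
Qed.

Let sec_v (p : V) (h : R) : exists2 q, second h p = h * h * gvw q & `|p - q| <= `|h| * (`|v| + `|w|).
Proof.
have d (q : V) : is_derive q v (fun q => g (h *: w + q) - g q) (gv (h *: w + q) - gv q).
  apply/is_derive_line; apply: isdD.
    have /is_derive_line := dv (h *: w + q); rewrite (_ : (fun s : R => _) = (fun y => g (h *: w + (y *: v + q))))//.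
    by apply/funext => s; rewrite addrCA.
  by apply: isdN; apply/is_derive_line; exact: dv.
have [th t01 e1] := mean_value_line p h d.
have [th' s01 e2] := mean_value_line ((th * h) *: v + p) h dvw.
exists ((th' * h) *: w + ((th * h) *: v + p)); last first.
  by rewrite addrCA; exact: near_pt.
rewrite -mulrA -e2 -e1 /second [h *: w + (h *: v + p)]addrCA; ring.
Qed.

Let sec_w (p : V) (h : R) : exists2 q, second h p = h * h * gwv q & `|p - q| <= `|h| * (`|v| + `|w|).
Proof.
have d (q : V) : is_derive q w (fun q => g (h *: v + q) - g q) (gw (h *: v + q) - gw q).
  apply/is_derive_line; apply: isdD.
    have /is_derive_line := dw (h *: v + q); rewrite (_ : (fun s : R => _) = (fun y => g (h *: v + (y *: w + q))))//.
    by apply/funext => s; rewrite addrCA.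
  by apply: isdN; apply/is_derive_line; exact: dw.
have [th t01 e1] := mean_value_line p h d.
have [th' s01 e2] := mean_value_line ((th * h) *: w + p) h dwv.
exists ((th' * h) *: v + ((th * h) *: w + p)); first by rewrite -mulrA -e2 -e1 /second; ring.
exact: near_pt.
Qed.

(** The second difference is h^2 times either mixed derivative at some point within |h| (|v| + |w|)
    of p; continuity of both concludes. Test functions are given through directional derivatives,
    hence the argument along lines. *)
Lemma schwarz p : gvw p = gwv p.
Proof.
apply/eqP; rewrite -subr_eq0 -normr_le0; apply/ler_addgt0Pr => e e0; rewrite add0r.
have e2 : 0 < e / 2 by rewrite divr_gt0.
have /cvgrPdist_lt/(_ _ e2) := @cvw p; rewrite -filter_from_norm_nbhs => -[r1 r10 h1].
have /cvgrPdist_lt/(_ _ e2) := @cwv p; rewrite -filter_from_norm_nbhs => -[r2 r20 h2].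
pose c := `|v| + `|w| + 1; have c0 : 0 < c by rewrite ltr_wpDl// addr_ge0.
pose h := Num.min r1 r2 / (2 * c).
have m0 : 0 < Num.min r1 r2 by rewrite lt_min r10.
have h0 : 0 < h by rewrite divr_gt0// mulr_gt0.
have hc : `|h| * (`|v| + `|w|) < Num.min r1 r2.
  rewrite gtr0_norm// /h mulrAC ltr_pdivrMr ?mulr_gt0// ltr_pM2l// /c.
  by have := normr_ge0 v; have := normr_ge0 w; move: `|v| `|w| => a b; lra.
have [q1 q1e q1d] := sec_v p h; have [q2 q2e q2d] := sec_w p h.
have hh : h * h != 0 by rewrite mulf_neq0// gt_eqF.
have e12 : gvw q1 = gwv q2 by apply: (mulfI hh); rewrite -q1e q2e.
have k1 : `|gvw p - gvw q1| < e / 2.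
  by apply: h1; apply: (le_lt_trans q1d); apply: (lt_le_trans hc); rewrite ge_min lexx.
have k2 : `|gwv p - gwv q2| < e / 2.
  by apply: h2; apply: (le_lt_trans q2d); apply: (lt_le_trans hc); rewrite ge_min lexx orbT.
rewrite (_ : gvw p - gwv p = (gvw p - gvw q1) - (gwv p - gwv q2)); last by rewrite e12; ring.
by apply: (le_trans (ler_normB _ _)); lra.
Qed.

End Schwarz.

Section ChainRule.
Variable R : realType.

Local Notation et := ((1, (0, 0)) : spacetime R).
Local Notation e1 := ((0, (1, 0)) : spacetime R).
Local Notation e2 := ((0, (0, 1)) : spacetime R).

Variables (g gt g1 g2 : spacetime R -> R).
Hypotheses (dt : forall p, is_derive p et g (gt p)) (d1 : forall p, is_derive p e1 g (g1 p))
  (d2 : forall p, is_derive p e2 g (g2 p)).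
Hypotheses (ct : continuous gt) (c1 : continuous g1) (c2 : continuous g2).

(** Moves one coordinate at a time; each of the three intermediate points stays within the distance
    from p to q in the maximum norm. *)
Lemma increment (p q : spacetime R) : exists xi : spacetime R * (spacetime R * spacetime R),
  g q - g p = gt xi.1 * (q.1 - p.1) + g1 xi.2.1 * (q.2.1 - p.2.1) + g2 xi.2.2 * (q.2.2 - p.2.2) /\
  [/\ `|p - xi.1| <= `|p - q|, `|p - xi.2.1| <= `|p - q| & `|p - xi.2.2| <= `|p - q|].
Proof.
case: p => [p0 [p1 p2]]; case: q => [q0 [q1 q2]].
have [th0 t0 E0] := mean_value_line ((p0, (q1, q2)) : spacetime R) (q0 - p0) dt.
have [th1 t1 E1] := mean_value_line ((p0, (p1, q2)) : spacetime R) (q1 - p1) d1.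
have [th2 t2 E2] := mean_value_line ((p0, (p1, p2)) : spacetime R) (q2 - p2) d2.
have n (a b c a' b' c' : R) : `|a| <= `|a'| -> `|b| <= `|b'| -> `|c| <= `|c'| ->
    `|(a, (b, c)) : spacetime R| <= `|(a', (b', c')) : spacetime R|.
  have mx (x y z x' y' z' : R) : x <= x' -> y <= y' -> z <= z' ->
      Num.max x (Num.max y z) <= Num.max x' (Num.max y' z').
    by move=> k1 k2 k3; rewrite !ge_max !le_max k1 k2 k3 !orbT.
  exact: mx.
have th (a b s : R) : 0 <= s <= 1 -> `|a - (a + s * (b - a))| <= `|a - b|.
  move=> /andP[s0 s1]; rewrite opprD addrA subrr add0r normrN normrM (ger0_norm s0) distrC.
  by rewrite ler_piMl.
have z (a b c s : R) : s *: et + ((a, (b, c)) : spacetime R) = (a + s, (b, c)) :> spacetime R.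
  by congr (_, (_, _)); rewrite /= /GRing.scale /= ?mulr1 ?mulr0 ?add0r// addrC.
have z1 (a b c s : R) : s *: e1 + ((a, (b, c)) : spacetime R) = (a, (b + s, c)) :> spacetime R.
  by congr (_, (_, _)); rewrite /= /GRing.scale /= ?mulr1 ?mulr0 ?add0r// addrC.
have z2 (a b c s : R) : s *: e2 + ((a, (b, c)) : spacetime R) = (a, (b, c + s)) :> spacetime R.
  by congr (_, (_, _)); rewrite /= /GRing.scale /= ?mulr1 ?mulr0 ?add0r// addrC.
exists ((p0 + th0 * (q0 - p0), (q1, q2)), ((p0, (p1 + th1 * (q1 - p1), q2)), (p0, (p1, p2 + th2 * (q2 - p2))))).
split; last by split; apply: n; rewrite /= ?subrr ?normr0//; exact: th.
move: E0 E1 E2; rewrite !z !z1 !z2 !(addrC _ (_ - _)) !subrK /= => E0 E1 E2.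
by rewrite ![gt _ * _]mulrC ![g1 _ * _]mulrC ![g2 _ * _]mulrC -E0 -E1 -E2; ring.
Qed.

Variables (c0 c1' c2' : R -> R) (s b0 b1 b2 : R).
Hypotheses (D0 : isder s c0 b0) (D1 : isder s c1' b1) (D2 : isder s c2' b2).

Let c (h : R) : spacetime R := (c0 h, (c1' h, c2' h)).

(** The difference quotient is an exact combination of partial derivatives at the intermediate
    points of [increment]; these tend to the base point, where the partial derivatives are
    continuous. *)
Lemma chain_rule : isder s (fun h => g (c0 h, (c1' h, c2' h)))
  (gt (c s) * b0 + g1 (c s) * b1 + g2 (c s) * b2).
Proof.
have ex (h : R) := increment (c s) (c (h + s)).
pose xi h := projT1 (cid (ex h)).
have xiP h := projT2 (cid (ex h)).
have cc (f : R -> R) (b : R) : isder s f b -> f (h + s) @[h --> (0 : R)] --> (f s : R).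
  move=> D; have k : {for s, continuous f} := isd_cont D.
  have hs : h + s @[h --> (0 : R)] --> 0 + s by apply: cvgD; [exact: cvg_id|exact: cvg_cst].
  by rewrite add0r in hs; exact: (cvg_comp _ _ hs k).
have cq : `|c s - c (h + s)| @[h --> (0 : R)] --> (0 : R).
  have e h : `|c s - c (h + s)| <= `|c0 s - c0 (h + s)| + `|c1' s - c1' (h + s)| + `|c2' s - c2' (h + s)|.
    rewrite /c !prod_normE /= ge_max -addrA lerDl addr_ge0//= ge_max.
    by apply/andP; split; rewrite ler_wpDl// ?lerDl// lerDr.
  have n0 (f : R -> R) (b : R) : isder s f b -> `|f s - f (h + s)| @[h --> (0 : R)] --> (0 : R).
    move=> D; have : `|f s - f (h + s)| @[h --> (0 : R)] --> `|f s - f s|.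
      by apply: cvg_norm; apply: cvgB; [exact: cvg_cst|exact: cc D].
    by rewrite subrr normr0.
  apply: (@squeeze_cvgr _ _ _ _ (fun=> 0)
    (fun h => `|c0 s - c0 (h + s)| + `|c1' s - c1' (h + s)| + `|c2' s - c2' (h + s)|)).
  - by apply: nearW => h; rewrite normr_ge0 e.
  - exact: cvg_cst.
  - have : `|c0 s - c0 (h + s)| + `|c1' s - c1' (h + s)| + `|c2' s - c2' (h + s)| @[h --> (0 : R)] --> (0 + 0 + 0 : R).
      by apply: cvgD; [apply: cvgD; [exact: n0 D0|exact: n0 D1]|exact: n0 D2].
    by rewrite !addr0.
have lim (f : spacetime R -> R) (x : R -> spacetime R) : continuous f ->
    (forall h, `|c s - x h| <= `|c s - c (h + s)|) -> f (x h) @[h --> (0 : R)^'] --> f (c s).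
  move=> cf hx; apply/cvgrPdist_lt => e e0.
  have /cvgrPdist_lt/(_ _ e0) := cf (c s); rewrite -filter_from_norm_nbhs => -[r r0 hr].
  move/cvgrPdist_lt: cq => /(_ _ r0) /nbhs_dnbhs; apply: filterS => h.
  by rewrite sub0r normrN normr_id => hh; apply: hr; exact: le_lt_trans (hx h) hh.
have dq (f : R -> R) (b : R) : isder s f b -> h^-1 * (f (h + s) - f s) @[h --> (0 : R)^'] --> b.
  move=> [D <-]; have := D; rewrite /derivable => /cvg_ex[l hl]; rewrite /derive (cvg_lim _ hl)//.
  move: hl; rewrite (_ : (fun h : R => h^-1 *: _) = (fun h : R => h^-1 * (f (h + s) - f s)))//.
  by apply/funext => h; rewrite /GRing.scale /= mulr1.
pose Q h := gt (xi h).1 * (h^-1 * (c0 (h + s) - c0 s)) + g1 (xi h).2.1 * (h^-1 * (c1' (h + s) - c1' s))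
  + g2 (xi h).2.2 * (h^-1 * (c2' (h + s) - c2' s)).
have hQ : Q h @[h --> (0 : R)^'] --> gt (c s) * b0 + g1 (c s) * b1 + g2 (c s) * b2.
  apply: cvgD; first apply: cvgD.
  - by apply: cvgM; [apply: lim => // h; have [_ []] := xiP h|exact: dq].
  - by apply: cvgM; [apply: lim => // h; have [_ []] := xiP h|exact: dq].
  - by apply: cvgM; [apply: lim => // h; have [_ []] := xiP h|exact: dq].
have eQ : (fun h : R => h^-1 *: (((fun h => g (c0 h, (c1' h, c2' h))) \o shift s) (h *: 1) -
    g (c0 s, (c1' s, c2' s)))) = Q.
  apply/funext => h; have [e _] := xiP h; rewrite /GRing.scale /= mulr1 -/(c s) -/(c (h + s)) e /Q.
  by rewrite /=; ring.
split; first by apply/cvg_ex; exists (gt (c s) * b0 + g1 (c s) * b1 + g2 (c s) * b2); rewrite eQ.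
by rewrite /derive eQ; apply: cvg_lim.
Qed.

End ChainRule.

(** * Derivatives of test functions, along directions and along curves *)

Section TestDerivatives.
Variable R : realType.
Implicit Types (phi : spacetime R -> R) (v w : spacetime R).

Lemma test_is_derive phi v : test_function phi -> forall p, is_derive p v phi ('D_v phi p).
Proof. by move=> [sm _] p; have [_ /(_ v p) h] := sm [::]; split. Qed.

Lemma test_cont phi : test_function phi -> continuous phi.
Proof. by move=> [sm _]; have [] := sm [::]. Qed.

(** On the open complement of the closed support the function is locally 0, and so is its
    derivative; the support of the derivative is thus a closed subset of a compact set. *)
Lemma test_derive phi v : test_function phi -> test_function ('D_v phi).
Proof.
move=> [sm cp]; split.
  by move=> vs; have := sm (vs ++ [:: v]); rewrite /iter_derive foldr_cat.
apply: (subclosed_compact _ cp); first exact: closed_closure.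
rewrite [X in _ `<=` X](closure_id _).1; last exact: closed_closure.
apply: closure_subset => p /= dp; apply/not_notP => np; case/eqP: dp.
have op : open (~` closure [set x | phi x != 0]) by apply: closed_openC; exact: closed_closure.
have zp : \forall q \near p, phi q = 0.
  have := open_nbhs_nbhs (conj op np); apply: filterS => q nq.
  by apply/eqP; apply: contra_notT nq => h; exact: subset_closure.
by rewrite (near_eq_derive v zp) derive_cst.
Qed.

Lemma test_schwarz phi v w : test_function phi -> 'D_w ('D_v phi) = 'D_v ('D_w phi).
Proof.
move=> tp; apply/funext => p.
have tv := test_derive v tp; have tw := test_derive w tp.
exact: (schwarz (test_is_derive v tp) (test_is_derive w tp) (test_is_derive w tv) (test_is_derive v tw)
  (test_cont (test_derive w tv)) (test_cont (test_derive v tw))).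
Qed.

End TestDerivatives.

Section CurveCalculus.
Variable R : realType.
Local Notation et := ((1, (0, 0)) : spacetime R).
Local Notation e1 := ((0, (1, 0)) : spacetime R).
Local Notation e2 := ((0, (0, 1)) : spacetime R).

Lemma test_chain (g : spacetime R -> R) (c0 c1 c2 : R -> R) (s b0 b1 b2 : R) : test_function g ->
  isder s c0 b0 -> isder s c1 b1 -> isder s c2 b2 ->
  isder s (fun h => g (c0 h, (c1 h, c2 h)))
    ('D_et g (c0 s, (c1 s, c2 s)) * b0 + 'D_e1 g (c0 s, (c1 s, c2 s)) * b1 + 'D_e2 g (c0 s, (c1 s, c2 s)) * b2).
Proof.
move=> tg; exact: (chain_rule (test_is_derive et tg) (test_is_derive e1 tg) (test_is_derive e2 tg)
  (test_cont (test_derive et tg)) (test_cont (test_derive e1 tg)) (test_cont (test_derive e2 tg))).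
Qed.

Lemma curve_cont (g : spacetime R -> R) (c0 c1 c2 : R -> R) (s : R) : continuous g ->
  {for s, continuous c0} -> {for s, continuous c1} -> {for s, continuous c2} ->
  {for s, continuous (fun h : R => g (c0 h, (c1 h, c2 h)))}.
Proof.
move=> cg k0 k1 k2.
have k12 : ((c1 h, c2 h) : plane R) @[h --> s] --> ((c1 s, c2 s) : plane R).
  exact: (@cvg_pair _ _ _ (nbhs s) (nbhs (c1 s)) (nbhs (c2 s)) _ _ _ c1 c2 k1 k2).
have k : ((c0 h, (c1 h, c2 h)) : spacetime R) @[h --> s] --> ((c0 s, (c1 s, c2 s)) : spacetime R).
  exact: (@cvg_pair _ _ _ (nbhs s) (nbhs (c0 s)) (nbhs ((c1 s, c2 s) : plane R)) _ _ _ c0 (fun h => (c1 h, c2 h)) k0 k12).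
exact: (cvg_comp (fun h => ((c0 h, (c1 h, c2 h)) : spacetime R)) g k (cg _)).
Qed.

Lemma cvg_left (f : R -> R) (b : R) : {for b, continuous f} -> f x @[x --> b^'-] --> f b.
Proof. by move=> cf; exact: cvg_at_left_filter. Qed.

Lemma cvg_right (f : R -> R) (b : R) : {for b, continuous f} -> f x @[x --> b^'+] --> f b.
Proof. by move=> cf; exact: cvg_at_right_filter. Qed.

Lemma test_bound (l : seq (spacetime R -> R)) : (forall g, List.In g l -> test_function g) ->
  exists C N, [/\ 0 <= C, 0 <= N, forall g, List.In g l -> forall p, `|g p| <= C
    & forall g, List.In g l -> forall p, g p != 0 -> [/\ `|p.1| <= N, `|p.2.1| <= N & `|p.2.2| <= N]].
Proof.
elim: l => [_|g l ih tl]; first by exists 0, 0; split.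
have [_ [C1 [N1 [C10 N10 h1 k1]]]] := test_function_cc (tl g (or_introl erefl)).
have [|C2 [N2 [C20 N20 h2 k2]]] := ih; first by move=> g' hg; apply: tl; right.
exists (C1 + C2), (N1 + N2); split; [exact: addr_ge0|exact: addr_ge0| |].
- move=> g' [<-|hg] p; first by apply: (le_trans (h1 p)); rewrite lerDl.
  by apply: (le_trans (h2 g' hg p)); rewrite lerDr.
- by move=> g' [<-|hg] p gp; [have [a1 a2 a3] := k1 p gp|have [a1 a2 a3] := k2 g' hg p gp]; split; lra.
Qed.

(** The mixed derivative is written as an x1-derivative of the time derivative, so that the first
    two terms combine into a derivative of the latter along a curve. *)
Lemma wave_opE (phi : spacetime R -> R) p : test_function phi ->
  wave_op phi p = 'D_et ('D_et phi) p - 2 * 'D_e1 ('D_et phi) p - p.2.1 ^+ 2 * 'D_e2 ('D_e2 phi) p.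
Proof.
move=> tphi; have e := congr1 (fun g => g p) (test_schwarz e1 et tphi).
exact: (congr1 (fun z => 'D_et ('D_et phi) p - 2 * z - p.2.1 ^+ 2 * 'D_e2 ('D_e2 phi) p) e).
Qed.

(* With q = sqrt(A B), the coefficients -a^2 B / (2 q) and A / (2 q) are the
   partial derivatives of q along a and B when A' = -a^2. *)
Lemma wave_algebra (a A B q u xtt x1t x2t xx xxx y : R) : q ^+ 2 = A * B -> A != 0 -> q != 0 ->
  xtt - 2 * x1t - a ^+ 2 * xxx =
  - 2 * (xtt * (- 2^-1) + x1t * 1 + x2t * (- (a ^+ 2 * B) / (2 * q) * u))
  - 2 * a ^+ 2 / A * ((A / (2 * q) * u) * xx + (q * u) * (x2t * 2^-1 + y * 0 + xxx * (A / (2 * q) * u)))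
  - a ^+ 2 * ((1 - u ^+ 2) * xxx - u / q * xx).
Proof.
move=> e An qn; have -> : B = q ^+ 2 / A by rewrite e [A * B]mulrC mulfK.
by field; rewrite qn An.
Qed.

Definition invsqrt (s : R) : R := (Num.sqrt s)^-1.

Lemma intg_invsqrt (L : R) : 0 < L -> intg (@lebesgue_measure R) (fun s => invsqrt s * oo 0 L s).
Proof.
move=> L0; have cF (s : R) : {for s, continuous (fun s : R => 2 * Num.sqrt s)}.
  by apply: contM; [exact: cst_continuous|exact: sqrt_continuous].
apply: (intg_FTC_oo L0 _ _ (cvg_right (cF 0)) (cvg_left (cF L))).
- move=> x /andP[x0 _]; rewrite -/(isder _ _ _); isd_tac => //.
  rewrite /invsqrt; have s0 : Num.sqrt x != 0 by rewrite gt_eqF// sqrtr_gt0.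
  by field.
- move=> x /andP[x0 _]; apply: cvgV; first by rewrite gt_eqF// sqrtr_gt0.
  exact: sqrt_continuous.
- by move=> x _; rewrite invr_ge0 sqrtr_ge0.
Qed.

End CurveCalculus.

(** * Local integrability of the kernel and iterated integrals against it *)

Section KernelWeight.
Variables (R : realType) (y1 : R).
Local Notation leb := (@lebesgue_measure R).

Lemma Gamma_slice (t a : R) (k : R -> R) : measurable_fun [set: measurableTypeR R] k ->
  (exists C, forall x, `|k x| <= C) ->
  intg leb (fun x => Gamma_explicit t a y1 x * k x) /\
  \int[leb]_x (Gamma_explicit t a y1 x * k x) =
  (2 * pi)^-1 * (oo a (a + 2 * t) y1 * \int[leb]_u (warc u * k (kr t a y1 * u))).
Proof.
move=> mk [C hC]; pose k' (x : R) : R := k (- x).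
have mk' : measurable_fun [set: measurableTypeR R] k' by apply: (mf_compR mk); apply: mfN; exact: mf_id.
have bk' : exists C, forall x, `|k' x| <= C by exists C => x; exact: hC.
have [i e] := @kernel_slice R 0 1 t ((a, 0) : plane R) y1 k' (lexx 0) ltr01 (lexx 1) mk' bk'.
have a0 : (-1 : R) != 0 by rewrite oppr_eq0 oner_eq0.
have ex (x : R) : k' (-1 * x + 0) * gtr 0 1 t ((a, 0) : plane R) (y1, -1 * x + 0) = Gamma_explicit t a y1 x * k x.
  have -> : -1 * x + 0 = - x by ring.
  by rewrite gtr01 /k' /= !opprK add0r mulrC.
split; first by apply: (intg_ext _ (intg_affine 0 a0 i)) => x; exact: ex.
apply: (etrans (esym (Rint_ext leb ex))).
have e2 := Rint_affine 0 a0 i; rewrite normrN1 mul1r in e2.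
apply: (etrans (esym e2)); apply: (etrans e).
rewrite /= addr0 subr0; congr (_ * (_ * _)); apply: Rint_ext => u.
by rewrite warc_ooE /k' sub0r opprK mulrC.
Qed.

(** The mass of the kernel in x2 is (2 pi)^-1 pi = 1/2 on its support. *)
Lemma Gamma_slice_le (t a c : R) : 0 <= c -> \int[leb]_x (Gamma_explicit t a y1 x * c) <= c.
Proof.
move=> c0; have bc : exists C, forall x : R, `|c| <= C by exists `|c|.
have [_ ->] := Gamma_slice t a (measurable_cst c) bc.
have -> : \int[leb]_u (warc u * c) = c * pi.
  by rewrite -(Rint_warc R) -(RintZl _ (@intg_warc R)); apply: Rint_ext => u; rewrite mulrC.
have E (o q : R) : q != 0 -> (2 * q)^-1 * (o * (c * q)) = o * (c / 2) by move=> q0; field.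
have p0 : (pi : R) != 0 by rewrite gt_eqF// pi_gt0.
rewrite (E _ _ p0).
have o0 := oo_ge0 a (a + 2 * t) y1; have o1 := oo_le1 a (a + 2 * t) y1.
by apply: (@le_trans _ _ (1 * (c / 2))); [apply: ler_wpM2r => //; lra|lra].
Qed.

Variables (k : spacetime R -> R) (c M : R).
Let b (t : R) : R := oo (- M) M t.
Hypotheses (mk : mfun k) (c0 : 0 <= c).
Hypothesis k_le : forall t a x, `|k (t, (a, x))| <= c * b t * b a.
Let Gk (z : spacetime R) : R := Gamma_explicit z.1 z.2.1 y1 z.2.2 * k z.

Lemma mf_Gamma_weight : mfun Gk.
Proof.
apply: mfM => //; apply: mf_Gamma.
- exact: measurable_fst.
- exact: (mf_fst measurable_snd).
- exact: mf_cst.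
- exact: (mf_snd measurable_snd).
Qed.

Let cb0 t a : 0 <= c * b t * b a.
Proof. by apply: mulr_ge0; [apply: mulr_ge0 => //|]; exact: oo_ge0. Qed.

Let mk2 t a : measurable_fun [set: measurableTypeR R] (fun x => k (t, (a, x))).
Proof. exact: (measurable_slice1 (measurable_slice1 mk t) a). Qed.

Lemma Gamma_weight_slice (t a : R) :
  intg leb (fun x => Gamma_explicit t a y1 x * k (t, (a, x))) /\
  \int[leb]_x `|Gamma_explicit t a y1 x * k (t, (a, x))| <= c * b t * b a.
Proof.
have bk : exists C, forall x, `|k (t, (a, x))| <= C by exists (c * b t * b a) => x; exact: k_le.
have [i _] := Gamma_slice t a (mk2 t a) bk; split => //.
have bc : exists C, forall x : R, `|c * b t * b a| <= C by exists `|c * b t * b a|.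
have [i2 _] := Gamma_slice t a (measurable_cst (c * b t * b a)) bc.
apply: (le_trans _ (Gamma_slice_le t a (cb0 t a))); apply: le_Rint (intg_norm i) i2 _ => x.
by rewrite normrM (ger0_norm (Gamma_ge0 _ _ _ _)); apply: ler_wpM2l; [exact: Gamma_ge0|exact: k_le].
Qed.

Let intg_b (d : R) : intg leb (fun a => d * b a).
Proof. exact: intg_oo_const. Qed.

Lemma intg_Gamma_weight2 (t : R) :
  intg (leb2 R) (fun q => Gk (t, q)) /\ \int[leb2 R]_q `|Gk (t, q)| <= c * b t * \int[leb]_a b a.
Proof.
have m2 : measurable_fun [set: plane R] (fun q => Gk (t, q)) by exact: (measurable_slice1 mf_Gamma_weight t).
have i2 : intg (leb2 R) (fun q => Gk (t, q)).
  exact: (@Rint_prod_crit _ _ _ _ R leb leb (fun q => Gk (t, q)) (fun a => c * b t * b a) m2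
    (fun a => (Gamma_weight_slice t a).1) (intg_b _) (fun a => (Gamma_weight_slice t a).2)).
split=> //; rewrite (Rint_leb2 (intg_norm i2)) -(RintZl _ (intg_oo1 (- M) M)).
apply: le_Rint; [exact: (Rfubini1 (intg_norm i2)).1|exact: intg_b|].
by move=> a; have [] := Gamma_weight_slice t a.
Qed.

Lemma intg_Gamma_weight : intg (leb3 R) Gk.
Proof.
have ib : intg leb (fun t => c * b t * \int[leb]_a b a).
  by apply: (intg_ext _ (intg_b (c * \int[leb]_a b a))) => t; ring.
exact: (@Rint_prod_crit _ _ _ _ R leb (leb2 R) Gk (fun t => c * b t * \int[leb]_a b a) mf_Gamma_weight
  (fun t => (intg_Gamma_weight2 t).1) ib (fun t => (intg_Gamma_weight2 t).2)).
Qed.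

Let S (z : plane R) : R := \int[leb]_x (Gamma_explicit z.1 z.2 y1 x * k (z.1, (z.2, x))).

Let S_le t a : `|S (t, a)| <= c * b t * b a.
Proof.
have [i h] := Gamma_weight_slice t a; apply: le_trans h.
exact: (normr_Rint_le (intg_norm i) (intg_measurable i) (fun x => lexx _)).
Qed.

Let mS : mfun S.
Proof.
have m1 : measurable_fun [set: plane R * measurableTypeR R] (fun w => w.1) by exact: measurable_fst.
have mp : measurable_fun [set: plane R * measurableTypeR R] (fun w => (w.1.1, (w.1.2, w.2)) : spacetime R).
  apply: measurable_fun_pair; first exact: (mf_fst m1).
  by apply: measurable_fun_pair; [exact: (mf_snd m1)|exact: measurable_snd].
have mG := measurableT_comp mf_Gamma_weight mp.
exact: (@measurable_Rint _ _ _ _ R leb _ mG).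
Qed.

(** The order a, then t, then x2 is chosen so that t can be replaced by B at fixed a. *)
Lemma Gamma_weight_fubini :
  \int[leb3 R]_z Gk z = \int[leb]_a \int[leb]_t S (t, a) /\ forall a, intg leb (fun t => S (t, a)).
Proof.
have iS : intg (leb2 R) S.
  have ip : intg (leb2 R) (fun z => c * b z.1 * b z.2) by exact: intg_prod (intg_b c) (intg_oo1 (- M) M).
  by apply: (intg_le mS ip) => -[t a]; exact: S_le.
split; last first.
  move=> a; apply: (intg_le _ (intg_b (c * b a))); first exact: (measurable_slice2 mS a).
  by move=> t; apply: (le_trans (S_le t a)); rewrite mulrAC.
have [_ ->] := Rfubini2 iS.
have [_ e] := Rfubini1 intg_Gamma_weight; apply: (etrans (esym e)).
by apply: Rint_ext => t; rewrite (Rint_leb2 (intg_Gamma_weight2 t).1).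
Qed.

End KernelWeight.

(** * The explicit kernel is a fundamental solution *)

Section FundamentalSolution.
Variables (R : realType) (y1 : R) (phi : spacetime R -> R).
Hypothesis tphi : test_function phi.
Local Notation leb := (@lebesgue_measure R).
Local Notation et := ((1, (0, 0)) : spacetime R).
Local Notation e1 := ((0, (1, 0)) : spacetime R).
Local Notation e2 := ((0, (0, 1)) : spacetime R).

Let ft := 'D_et phi.
Let fx := 'D_e2 phi.
Let ftt := 'D_et ft.
Let f1t := 'D_e1 ft.
Let f2t := 'D_e2 ft.
Let ftx := 'D_et fx.
Let f1x := 'D_e1 fx.
Let fxx := 'D_e2 fx.

Let t_ft : test_function ft. Proof. exact: test_derive. Qed.
Let t_fx : test_function fx. Proof. exact: test_derive. Qed.

Variables C N : R.
Hypotheses (C0 : 0 <= C) (N0 : 0 <= N).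
Hypothesis bd : forall g, List.In g [:: fx; ft; ftt; f1t; f2t; ftx; fxx; phi] -> forall p, `|g p| <= C.
Hypothesis sp : forall g, List.In g [:: fx; ft; ftt; f1t; f2t; ftx; fxx; phi] -> forall p, g p != 0 ->
  [/\ `|p.1| <= N, `|p.2.1| <= N & `|p.2.2| <= N].

Let b_fx p : `|fx p| <= C. Proof. by apply: bd; left. Qed.
Let b_ftt p : `|ftt p| <= C. Proof. by apply: bd; do 2 right; left. Qed.
Let b_f1t p : `|f1t p| <= C. Proof. by apply: bd; do 3 right; left. Qed.
Let b_f2t p : `|f2t p| <= C. Proof. by apply: bd; do 4 right; left. Qed.
Let b_ftx p : `|ftx p| <= C. Proof. by apply: bd; do 5 right; left. Qed.
Let b_fxx p : `|fxx p| <= C. Proof. by apply: bd; do 6 right; left. Qed.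

Let inbox (p : spacetime R) := [/\ `|p.1| <= N, `|p.2.1| <= N & `|p.2.2| <= N].
Let s_fx p : ~ inbox p -> fx p = 0.
Proof. by move=> h; apply/eqP; apply: contra_notT h => gp; apply: sp gp; left. Qed.
Let s_ft p : ~ inbox p -> ft p = 0.
Proof. by move=> h; apply/eqP; apply: contra_notT h => gp; apply: sp gp; right; left. Qed.
Let s_ftt p : ~ inbox p -> ftt p = 0.
Proof. by move=> h; apply/eqP; apply: contra_notT h => gp; apply: sp gp; do 2 right; left. Qed.
Let s_f1t p : ~ inbox p -> f1t p = 0.
Proof. by move=> h; apply/eqP; apply: contra_notT h => gp; apply: sp gp; do 3 right; left. Qed.
Let s_fxx p : ~ inbox p -> fxx p = 0.
Proof. by move=> h; apply/eqP; apply: contra_notT h => gp; apply: sp gp; do 6 right; left. Qed.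

Let s_phi p : ~ inbox p -> phi p = 0.
Proof. by move=> h; apply/eqP; apply: contra_notT h => gp; apply: sp gp; do 7 right; left. Qed.
Let b_ft p : `|ft p| <= C. Proof. by apply: bd; right; left. Qed.

(** Coordinates (a, B, u) with a = x1, B = 2 t + a - y1 and x2 = r u; [ra] and [rB] are the partial
    derivatives of r = sqrt(A B), and [pt] returns to (t, (x1, x2)). *)
Let ra (a B : R) : R := - (a ^+ 2 * B) / (2 * Num.sqrt (kA a y1 * B)).
Let rB (a B : R) : R := kA a y1 / (2 * Num.sqrt (kA a y1 * B)).
Let r (a B : R) : R := Num.sqrt (kA a y1 * B).
Let pt (a B x : R) : spacetime R := ((B + y1 - a) / 2, (a, x)).

Let r_gt0 a B : a < y1 -> 0 < B -> 0 < r a B.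
Proof. by move=> h1 h2; rewrite sqrtr_gt0 mulr_gt0// kA_gt0. Qed.

Let isd_ra a B : a < y1 -> 0 < B -> isder a (fun a => r a B) (ra a B).
Proof.
move=> h1 h2; have AB : 0 < kA a y1 * B by rewrite mulr_gt0// kA_gt0.
have d : isder a (fun a => kA a y1 * B) (- (a ^+ 2 * B)).
  by rewrite /kA; isd_tac; field.
exact: (@isd_sqrt _ (fun a : R => kA a y1 * B) a _ AB d).
Qed.

Let isd_rB a B : a < y1 -> 0 < B -> isder B (fun B => r a B) (rB a B).
Proof.
move=> h1 h2; have AB : 0 < kA a y1 * B by rewrite mulr_gt0// kA_gt0.
have d : isder B (fun B => kA a y1 * B) (kA a y1) by isd_tac; ring.
exact: (@isd_sqrt _ (fun B : R => kA a y1 * B) B _ AB d).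
Qed.

(** The total a-derivative of ft along the coordinate curve; [EB] is the total B-derivative of r u
    fx. The factors -1/2 and 1/2 are those of t = (B + y1 - a) / 2. *)
Let Ea a B u : R := ftt (pt a B (r a B * u)) * (- 2^-1) + f1t (pt a B (r a B * u)) * 1
  + f2t (pt a B (r a B * u)) * (ra a B * u).

Let EB a B u : R := (rB a B * u) * fx (pt a B (r a B * u)) + (r a B * u) *
  (ftx (pt a B (r a B * u)) * 2^-1 + f1x (pt a B (r a B * u)) * 0 + fxx (pt a B (r a B * u)) * (rB a B * u)).

Let isd_Ea a B u : a < y1 -> 0 < B -> isder a (fun a => ft (pt a B (r a B * u))) (Ea a B u).
Proof.
move=> h1 h2; rewrite /Ea /pt; apply: (test_chain t_ft).
- by isd_tac; field.
- exact: isd_id.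
- by apply: isd_eq (isdM (isd_ra h1 h2) (isd_cst u a)) _; ring.
Qed.

Let isd_EB a B u : a < y1 -> 0 < B -> isder B (fun B => (r a B * u) * fx (pt a B (r a B * u))) (EB a B u).
Proof.
move=> h1 h2; have d : isder B (fun B => r a B * u) (rB a B * u).
  by apply: isd_eq (isdM (isd_rB h1 h2) (isd_cst u B)) _; ring.
apply: isdM => //; rewrite /pt; apply: (test_chain t_fx) => //.
  by isd_tac; field.
exact: isd_cst.
Qed.

Let wave_split a B u : a < y1 -> 0 < B ->
  wave_op phi (pt a B (r a B * u)) = - 2 * Ea a B u - 2 * a ^+ 2 / kA a y1 * EB a B u
  - a ^+ 2 * ((1 - u ^+ 2) * fxx (pt a B (r a B * u)) - u / r a B * fx (pt a B (r a B * u))).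
Proof.
move=> h1 h2; have r0 := r_gt0 h1 h2; have A0 := kA_gt0 h1.
have rr : r a B ^+ 2 = kA a y1 * B by rewrite sqr_sqrtr// mulr_ge0// ltW.
have e2t : ftx = f2t := test_schwarz e2 et tphi.
have An : kA a y1 != 0 by rewrite gt_eqF.
have rn : r a B != 0 by rewrite gt_eqF.
apply: (etrans (wave_opE _ tphi)); rewrite /EB e2t.
exact: (wave_algebra a u (ftt (pt a B (r a B * u))) (f1t (pt a B (r a B * u))) (f2t (pt a B (r a B * u)))
  (fx (pt a B (r a B * u))) (fxx (pt a B (r a B * u))) (f1x (pt a B (r a B * u))) rr An rn).
Qed.

Let Pu_cont (g : spacetime R -> R) a B (u : R) : continuous g ->
  {for u, continuous (fun u : R => g (pt a B (r a B * u)))}.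
Proof.
move=> cg; apply: curve_cont => //; [exact: cst_continuous|exact: cst_continuous|].
by apply: contM; [exact: cst_continuous|exact: (isd_cont (isd_id u))].
Qed.

Let cfx : continuous fx. Proof. exact: test_cont. Qed.
Let cft : continuous ft. Proof. exact: test_cont. Qed.
Let cfxx : continuous fxx. Proof. exact: test_cont (test_derive _ t_fx). Qed.
Let cftx : continuous ftx. Proof. exact: test_cont (test_derive _ t_fx). Qed.
Let cf1x : continuous f1x. Proof. exact: test_cont (test_derive _ t_fx). Qed.
Let cftt : continuous ftt. Proof. exact: test_cont (test_derive _ t_ft). Qed.
Let cf1t : continuous f1t. Proof. exact: test_cont (test_derive _ t_ft). Qed.
Let cf2t : continuous f2t. Proof. exact: test_cont (test_derive _ t_ft). Qed.

Let intg_warc_bdd (h : R -> R) : measurable_fun [set: measurableTypeR R] h ->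
  (exists C, forall u, -1 < u < 1 -> `|h u| <= C) -> intg leb (fun u => warc u * h u).
Proof.
move=> mh [c hC]; apply: (intg_le _ (intgZl `|c| (@intg_warc R))).
  apply: mfunE; apply: mfM; [apply: mf_warc; exact: mf_id|exact: mh].
move=> u; rewrite normrM (ger0_norm (warc_ge0 u)) mulrC.
have [hu|/warc_out ->] := boolP (-1 < u < 1); last by rewrite !mulr0.
by rewrite ler_wpM2r ?warc_ge0// (le_trans (hC u hu))// ler_norm.
Qed.

(** Times the arcsine weight this is the u-derivative of sqrt(1 - u^2) fx / r, which vanishes at u =
    -1 and u = 1. *)
Let cancel_u a B : a < y1 -> 0 < B ->
  intg leb (fun u => warc u * ((1 - u ^+ 2) * fxx (pt a B (r a B * u)) - u / r a B * fx (pt a B (r a B * u)))) /\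
  \int[leb]_u (warc u * ((1 - u ^+ 2) * fxx (pt a B (r a B * u)) - u / r a B * fx (pt a B (r a B * u)))) = 0.
Proof.
move=> h1 h2; have r0 := r_gt0 h1 h2; have rn : r a B != 0 by rewrite gt_eqF.
pose h (u : R) : R := (1 - u ^+ 2) * fxx (pt a B (r a B * u)) - u / r a B * fx (pt a B (r a B * u)).
have ch (u : R) : {for u, continuous h}.
  have c1 : {for u, continuous (fun u : R => 1 - u ^+ 2)} by apply: isd_cont; isd.
  have c2 : {for u, continuous (fun u : R => u / r a B)} by apply: isd_cont; isd.
  have c3 : {for u, continuous (fun u : R => (1 - u ^+ 2) * fxx (pt a B (r a B * u)))} by apply: (contM c1); apply: Pu_cont; exact: cfxx.
  have c4 : {for u, continuous (fun u : R => u / r a B * fx (pt a B (r a B * u)))} by apply: (contM c2); apply: Pu_cont; exact: cfx.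
  by apply: (@continuousB R (R : normedModType R) R (fun u : R => (1 - u ^+ 2) * fxx (pt a B (r a B * u))) (fun u : R => u / r a B * fx (pt a B (r a B * u))) u).
have mh : measurable_fun [set: measurableTypeR R] h by apply: continuous_measurable_fun => u; exact: ch.
have iw : intg leb (fun u => warc u * h u).
  apply: intg_warc_bdd => //; exists (C + C / r a B) => u /andP[u1 u2].
  have u3 : `|u| <= 1 by rewrite ler_norml; apply/andP; split; lra.
  apply: (le_trans (ler_normB _ _)); apply: lerD.
    rewrite normrM -[leRHS]mul1r; apply: ler_pM (b_fxx _); [exact: normr_ge0|exact: normr_ge0|].
    by rewrite ger0_norm ?subr_ge0 ?gerBl ?sqr_ge0// -real_normK ?num_real// expr_le1.
  rewrite !normrM normfV (gtr0_norm r0) mulrAC ler_wpM2r ?invr_ge0 ?(ltW r0)//.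
  by rewrite -[leRHS]mul1r; apply: ler_pM (b_fx _); [exact: normr_ge0|exact: normr_ge0|].
split=> //.
pose F (u : R) : R := Num.sqrt (1 - u ^+ 2) * (fx (pt a B (r a B * u)) / r a B).
have cF (u : R) : {for u, continuous F}.
  apply: contM; last by apply: contM; [apply: Pu_cont; exact: cfx|exact: cst_continuous].
  apply: (@continuous_comp _ _ _ (fun u : R => 1 - u ^+ 2) Num.sqrt); last exact: sqrt_continuous.
  by apply: isd_cont; isd.
have F1 (u : R) : u ^+ 2 = 1 -> F u = 0 by move=> e; rewrite /F e subrr sqrtr0 mul0r.
have dF (u : R) : -1 < u < 1 -> isder u F (warc u * h u).
  move=> hu; have s0 := sqr_lt1 hu.
  have d2 : isder u (fun u => fx (pt a B (r a B * u))) (fxx (pt a B (r a B * u)) * r a B).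
    have d0 : isder u (fun u : R => r a B * u) (r a B) by isd_tac; ring.
    have e (x y z w : R) : x * 0 + y * 0 + z * w = z * w by ring.
    exact: isd_eq (test_chain t_fx (isd_cst ((B + y1 - a) / 2) u) (isd_cst a u) d0) (e _ _ _ _).
  have d1 : isder u (fun u : R => 1 - u ^+ 2) (- (2 * u)) by isd_tac; ring.
  have d3 := @isd_sqrt _ (fun u : R => 1 - u ^+ 2) u _ s0 d1.
  have d4 := isdM d2 (isd_cst (r a B)^-1 u).
  have sn : Num.sqrt (1 - u ^+ 2) != 0 by rewrite gt_eqF// sqrtr_gt0.
  have ss : Num.sqrt (1 - u ^+ 2) ^+ 2 = 1 - u ^+ 2 by rewrite sqr_sqrtr// ltW.
  have e (s rr v x1 x2 : R) : s != 0 -> rr != 0 -> - (2 * v) / (2 * s) * (x2 / rr) + s * (x1 * rr * rr^-1 + x2 * 0) =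
      s^-1 * (s ^+ 2 * x1 - v / rr * x2) by move=> s1 s2; field; rewrite s1 s2.
  have e' := e _ _ u (fxx (pt a B (r a B * u))) (fx (pt a B (r a B * u))) sn rn.
  rewrite ss in e'; exact: isd_eq (isdM d3 d4) e'.
have lt11 : -1 < 1 :> R by lra.
rewrite -(Rint_ext leb (f := fun u => (warc u * h u) * oo (-1) 1 u)); last first.
  by move=> u; rewrite mulrAC warc_ooE.
rewrite (FTC_oo lt11 dF _ (cvg_right (cF (-1))) (cvg_left (cF 1))).
- by rewrite !F1 ?subrr// ?sqrrN expr1n.
- move=> u hu; apply: contM; [exact: cont_warc|exact: ch].
- by apply: (intg_ext _ iw) => u; rewrite mulrAC warc_ooE.
Qed.

(** For a <= L or B >= H the point lies outside the support box of phi, which removes the boundary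
    terms at these ends. *)
Let L : R := - (N + `|y1| + 1).
Let H : R := 3 * N + `|y1| + 2.

Let L_lt : L < y1.
Proof. by rewrite /L; have := ler_norm (- y1); rewrite normrN; have n0 := N0; lra. Qed.
Let H_gt0 : 0 < H.
Proof. by rewrite /H; have := normr_ge0 y1; have n0 := N0; lra. Qed.

Let out_a a t x : (a <= L) -> ~ inbox (t, (a, x)).
Proof.
move=> h [_ /= h2 _]; move: h2; rewrite ler_norml => /andP[h2 _]; have := normr_ge0 y1.
by move: h; rewrite /L; have n0 := N0; lra.
Qed.

Let out_B a B x : H <= B -> ~ inbox (pt a B x).
Proof.
move=> h [/= h1 h2 _]; move: h1 h2; rewrite !ler_norml => /andP[_ h1] /andP[_ h2].
have := ler_norm (- y1); rewrite normrN; move: h; rewrite /H => h h3; have n0 := N0.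
by move: h1; rewrite ler_pdivrMr//; lra.
Qed.

Let cont_rB_fun a (B : R) : {for B, continuous (fun B : R => r a B)}.
Proof.
apply: (@continuous_comp _ _ _ (fun B : R => kA a y1 * B) Num.sqrt); last exact: sqrt_continuous.
by apply: isd_cont; isd.
Qed.

Let cont_ra_fun (a : R) B : {for a, continuous (fun a : R => r a B)}.
Proof.
apply: (@continuous_comp _ _ _ (fun a : R => kA a y1 * B) Num.sqrt); last exact: sqrt_continuous.
by rewrite /kA; apply: isd_cont; isd.
Qed.

Let cont_B (g : spacetime R -> R) a (B : R) u : continuous g ->
  {for B, continuous (fun B : R => g (pt a B (r a B * u)))}.
Proof.
move=> cg; apply: curve_cont => //; [by apply: isd_cont; isd|exact: cst_continuous|].
by apply: contM; [exact: cont_rB_fun|exact: cst_continuous].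
Qed.

Let cont_a (g : spacetime R -> R) (a : R) B u : continuous g ->
  {for a, continuous (fun a : R => g (pt a B (r a B * u)))}.
Proof.
move=> cg; apply: curve_cont cg _ _ _; first by apply: isd_cont; isd.
  by apply: isd_cont; isd.
by apply: contM; [exact: cont_ra_fun|exact: cst_continuous].
Qed.

Let cont_rB a (B : R) : a < y1 -> 0 < B -> {for B, continuous (fun B : R => rB a B)}.
Proof.
move=> h1 h2; have c2 : {for B, continuous (fun B : R => 2 * r a B)}.
  by apply: contM; [exact: cst_continuous|exact: cont_rB_fun].
apply: contM; first exact: cst_continuous.
apply: cvgV; first by rewrite mulf_neq0// gt_eqF// r_gt0.
exact: c2.
Qed.

Let cont_ra (a : R) B : a < y1 -> 0 < B -> {for a, continuous (fun a : R => ra a B)}.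
Proof.
move=> h1 h2; have c2 : {for a, continuous (fun a : R => 2 * r a B)}.
  by apply: contM; [exact: cst_continuous|exact: cont_ra_fun].
apply: contM; first by apply: isd_cont; isd.
apply: cvgV; first by rewrite mulf_neq0// gt_eqF// r_gt0.
exact: c2.
Qed.

(** Both boundary terms vanish: r = 0 at B = 0, and fx = 0 at B = H. *)
Let FB a u : a < y1 -> intg leb (fun B => EB a B u * oo 0 H B) ->
  \int[leb]_B (EB a B u * oo 0 H B) = 0.
Proof.
move=> h1 ii; pose F (B : R) : R := (r a B * u) * fx (pt a B (r a B * u)).
have cF (B : R) : {for B, continuous F}.
  apply: contM; last by apply: cont_B; exact: cfx.
  by apply: contM; [exact: cont_rB_fun|exact: cst_continuous].
have dF (B : R) : 0 < B < H -> isder B F (EB a B u) by move=> /andP[B0 _]; exact: isd_EB.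
rewrite (FTC_oo H_gt0 dF _ (cvg_right (cF 0)) (cvg_left (cF H)) ii).
  by rewrite /F s_fx; [rewrite /r !mulr0 sqrtr0 !mul0r subrr|exact: out_B].
move=> B /andP[B0 _]; have c1 := cont_rB h1 B0.
have c2 : {for B, continuous (fun B : R => rB a B * u)} by apply: contM => //; exact: cst_continuous.
apply: contD; first by apply: contM => //; apply: cont_B; exact: cfx.
apply: contM; first by apply: contM; [exact: cont_rB_fun|exact: cst_continuous].
apply: contD; last by apply: contM => //; apply: cont_B; exact: cfxx.
apply: contD; (apply: contM; last exact: cst_continuous); apply: cont_B.
  exact: cftx.
exact: cf1x.
Qed.

(** At a = y1 the radius is 0, so the boundary value no longer depends on u: this is the one
    contribution that survives. *)
Let FA B u : 0 < B -> intg leb (fun a => Ea a B u * oo L y1 a) ->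
  \int[leb]_a (Ea a B u * oo L y1 a) = ft (pt y1 B 0).
Proof.
move=> B0 ii; pose F (a : R) : R := ft (pt a B (r a B * u)).
have cF (a : R) : {for a, continuous F} by apply: cont_a; exact: cft.
have dF (a : R) : L < a < y1 -> isder a F (Ea a B u) by move=> /andP[_ h]; exact: isd_Ea.
rewrite (FTC_oo L_lt dF _ (cvg_right (cF L)) (cvg_left (cF y1)) ii).
  have e0 : F L = 0 by rewrite /F s_ft//; exact: out_a.
  by rewrite e0 subr0 /F /r /kA subrr !mul0r sqrtr0 mul0r.
move=> a /andP[_ h]; have c1 := cont_ra h B0.
apply: contD; last by apply: contM; [apply: cont_a; exact: cf2t|apply: contM => //; exact: cst_continuous].
apply: contD; (apply: contM; last exact: cst_continuous); apply: cont_a.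
  exact: cftt.
exact: cf1t.
Qed.

Let c_pt0 (g : spacetime R -> R) (B : R) : continuous g -> {for B, continuous (fun B : R => g (pt y1 B 0))}.
Proof.
by move=> cg; apply: curve_cont => //; [apply: isd_cont; isd|exact: cst_continuous|exact: cst_continuous].
Qed.

Let intg_ft : intg leb (fun B => ft (pt y1 B 0) * oo 0 H B).
Proof.
apply: (intg_le _ (intg_oo_const 0 H C)).
  by apply: measurable_mul_oo => B _; apply: c_pt0; exact: cft.
by move=> B; rewrite normrM normr_oo; apply: ler_wpM2r; [exact: oo_ge0|exact: b_ft].
Qed.

(** On the line a = y1 one has t = B / 2, so 2 phi is a primitive in B; only its value at B = 0
    remains. *)
Let FT : \int[leb]_B (ft (pt y1 B 0) * oo 0 H B) = - 2 * phi (0, (y1, 0)).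
Proof.
pose F (B : R) : R := 2 * phi (pt y1 B 0).
have cF (B : R) : {for B, continuous F}.
  by apply: contM; [exact: cst_continuous|apply: c_pt0; exact: test_cont].
have dF (B : R) : 0 < B < H -> isder B F (ft (pt y1 B 0)).
  move=> _; have d0 : isder B (fun B : R => (B + y1 - y1) / 2) 2^-1 by isd_tac; field.
  have d := test_chain tphi d0 (isd_cst y1 B) (isd_cst 0 B).
  have e (p x y z : R) : 0 * p + 2 * (x * 2^-1 + y * 0 + z * 0) = x by field.
  exact: isd_eq (isdM (isd_cst 2 B) d) (e _ _ _ _).
rewrite (FTC_oo H_gt0 dF _ (cvg_right (cF 0)) (cvg_left (cF H)) intg_ft).
  have e0 : F H = 0 by rewrite /F s_phi ?mulr0//; exact: out_B.
  by rewrite e0 sub0r /F /pt add0r subrr mul0r mulNr.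
by move=> B _; apply: c_pt0; exact: cft.
Qed.

(** Squaring reduces this to a^2 (y1 - a) <= 4 A, and the difference of the two sides is (y1 - a) (2
    y1 + a)^2 / 3. The singularity at a = y1 is therefore integrable for every y1, including y1 =
    0. *)
Let bound_ra a B : a < y1 -> 0 < B -> `|ra a B| <= `|a| * Num.sqrt B * invsqrt (y1 - a).
Proof.
move=> h1 h2; have A0 := kA_gt0 h1; have ya : 0 < y1 - a by lra.
have AB : 0 < kA a y1 * B by rewrite mulr_gt0.
have s0 : 0 < Num.sqrt (y1 - a) by rewrite sqrtr_gt0.
rewrite /invsqrt ler_pdivlMr// -(@ler_pXn2r _ 2)//; last 2 first.
- by rewrite nnegrE mulr_ge0// sqrtr_ge0.
- by rewrite nnegrE mulr_ge0// sqrtr_ge0.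
rewrite !exprMn (sqr_sqrtr (ltW h2)) (sqr_sqrtr (ltW ya)) !real_normK ?num_real//.
have -> : ra a B ^+ 2 = a ^+ 4 * B / (4 * kA a y1).
  rewrite /ra exprMn exprVn exprMn (sqr_sqrtr (ltW AB)); field; rewrite !gt_eqF//.
have A4 : 0 < 4 * kA a y1 by apply: mulr_gt0.
rewrite mulrAC (ler_pdivrMr _ _ A4).
have k : a ^+ 2 * (y1 - a) <= 4 * kA a y1.
  rewrite /kA -subr_ge0.
  have -> : 4 * ((y1 ^+ 3 - a ^+ 3) / 3) - a ^+ 2 * (y1 - a) = (y1 - a) * (2 * y1 + a) ^+ 2 / 3 by field.
  by apply: divr_ge0 => //; apply: mulr_ge0; [exact: ltW|exact: sqr_ge0].
have -> : a ^+ 4 * B * (y1 - a) = (a ^+ 2 * B) * (a ^+ 2 * (y1 - a)) by ring.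
by apply: ler_wpM2l => //; apply: mulr_ge0; [exact: sqr_ge0|exact: ltW].
Qed.

Let Lm : R := N + `|y1| + 1.
Let gA a : R := 2 * C + C * (Lm * Num.sqrt H * invsqrt (y1 - a)).

Let tri (x y z x' y' z' : R) : `|x| <= x' -> `|y| <= y' -> `|z| <= z' -> `|x + y + z| <= x' + y' + z'.
Proof.
by move=> h1 h2 h3; apply: (le_trans (ler_normD _ _)); apply: lerD h3; apply: (le_trans (ler_normD _ _)); exact: lerD.
Qed.

Let nM (x y x' y' : R) : `|x| <= x' -> `|y| <= y' -> `|x * y| <= x' * y'.
Proof. by move=> h1 h2; rewrite normrM; apply: ler_pM. Qed.

Let bound_Ea a B u : L < a < y1 -> 0 < B < H -> -1 < u < 1 -> `|Ea a B u| <= gA a.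
Proof.
move=> /andP[a1 a2] /andP[B1 B2] hu; have u3 : `|u| <= 1 by rewrite ler_norml; move/andP: hu => [u1 u2]; apply/andP; split; lra.
have aL : `|a| <= Lm.
  rewrite ler_norml; apply/andP; split; first by apply: ltW.
  by have := ler_norm y1; rewrite /Lm; have n0 := N0; lra.
have h : `|ra a B * u| <= Lm * Num.sqrt H * invsqrt (y1 - a).
  rewrite -[leRHS]mulr1; apply: nM => //; apply: (le_trans (bound_ra a2 B1)).
  apply: ler_wpM2r; first by rewrite invr_ge0 sqrtr_ge0.
  by apply: ler_pM => //; apply: ler_wsqrtr; exact: ltW.
have h2 : `|- 2^-1 : R| <= 1 by rewrite normrN ger0_norm; lra.
have h1 : `|1 : R| <= 1 by rewrite normr1.
have := tri (nM (b_ftt (pt a B (r a B * u))) h2) (nM (b_f1t (pt a B (r a B * u))) h1) (nM (b_f2t (pt a B (r a B * u))) h).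
by rewrite /gA; have -> : C * 1 + C * 1 = 2 * C by ring.
Qed.

Let gB a B : R := C * (Num.sqrt (kA a y1) / 2) * invsqrt B + (Num.sqrt (kA a y1 * H) * C + C * kA a y1).

Let bound_EB a B u : a < y1 -> 0 < B < H -> -1 < u < 1 -> `|EB a B u| <= gB a B.
Proof.
move=> a2 /andP[B1 B2] hu; have u3 : `|u| <= 1 by rewrite ler_norml; move/andP: hu => [u1 u2]; apply/andP; split; lra.
have A0 := kA_gt0 a2; have r0 := r_gt0 a2 B1.
have sA : 0 < Num.sqrt (kA a y1) by rewrite sqrtr_gt0.
have sB : 0 < Num.sqrt B by rewrite sqrtr_gt0.
have rBE : rB a B = Num.sqrt (kA a y1) / 2 * invsqrt B.
  rewrite /rB /invsqrt (sqrtrM _ (ltW A0)) -{1}(sqr_sqrtr (ltW A0)); move: (Num.sqrt _) (Num.sqrt _) sA sB => x y x0 y0.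
  by field; rewrite !gt_eqF.
(* [rB] blows up like B^(-1/2), but its square occurs only together with r: the product r [rB] is A
   / 2, which is bounded. *)
have rrB : r a B * rB a B = kA a y1 / 2.
  by rewrite /rB -/(r a B); move: (r a B) r0 => x x0; field; rewrite gt_eqF.
have rB0 : 0 <= rB a B by rewrite rBE mulr_ge0 ?invr_ge0 ?divr_ge0 ?sqrtr_ge0.
have h1 : `|rB a B * u| <= Num.sqrt (kA a y1) / 2 * invsqrt B.
  by rewrite -[leRHS]mulr1; apply: nM => //; rewrite ger0_norm// rBE.
have h2 : `|r a B * u| <= Num.sqrt (kA a y1 * H).
  rewrite -[leRHS]mulr1; apply: nM => //; rewrite (ger0_norm (ltW r0)); apply: ler_wsqrtr.
  by apply: ler_wpM2l; apply: ltW.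
have uu : `|u * u| <= 1 by rewrite -[leRHS]mulr1; exact: nM.
have h3 : `|(r a B * rB a B) * (u * u)| <= kA a y1.
  rewrite rrB -[leRHS]mulr1; apply: nM => //; rewrite ger0_norm; last by lra.
  by lra.
have h4 : `|2^-1 : R| <= 1 by rewrite ger0_norm; lra.
have E0 (p q v x y z w : R) : (q * v) * x + (p * v) * (y * 2^-1 + w * 0 + z * (q * v)) =
  x * (q * v) + (p * v) * (y * 2^-1) + z * ((p * q) * (v * v)) by ring.
have h5 := nM h2 (nM (b_ftx (pt a B (r a B * u))) h4).
have gBe : gB a B = C * (Num.sqrt (kA a y1) / 2 * invsqrt B) + Num.sqrt (kA a y1 * H) * (C * 1) + C * kA a y1.
  by rewrite /gB; ring.
rewrite gBe /EB E0.
exact: (tri (nM (b_fx (pt a B (r a B * u))) h1) h5 (nM (b_fxx (pt a B (r a B * u))) h3)).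
Qed.

Let mf_test d (T : measurableType d) (g : spacetime R -> R) (x y z : T -> R) : continuous g ->
  mfun x -> mfun y -> mfun z -> mfun (fun w => g (x w, (y w, z w))).
Proof.
move=> cg mx my mz; apply: (measurableT_comp (measurable_continuous_spacetime cg)).
by apply: measurable_fun_pair => //; apply: measurable_fun_pair.
Qed.

Let mf_kA d (T : measurableType d) (x y : T -> R) : mfun x -> mfun y -> mfun (fun z => kA (x z) (y z)).
Proof. by move=> mx my; rewrite /kA; apply: mfM; [apply: mfD; [exact: mfX|apply: mfN; exact: mfX]|exact: mf_cst]. Qed.

Let mf_r d (T : measurableType d) (a B : T -> R) : mfun a -> mfun B -> mfun (fun z => r (a z) (B z)).
Proof. by move=> ma mB; apply: mf_sqrt; apply: mfM => //; apply: mf_kA => //; exact: mf_cst. Qed.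

Let mf_pt d (T : measurableType d) (g : spacetime R -> R) (a B u : T -> R) : continuous g ->
  mfun a -> mfun B -> mfun u -> mfun (fun z => g (pt (a z) (B z) (r (a z) (B z) * u z))).
Proof.
move=> cg ma mB mu; apply: mf_test => //; last by apply: mfM => //; exact: mf_r.
apply: mfM; last exact: mf_cst.
by apply: mfD; [apply: mfD => //; exact: mf_cst|exact: mfN].
Qed.

Let mf_Ea d (T : measurableType d) (a B u : T -> R) :
  mfun a -> mfun B -> mfun u -> mfun (fun z => Ea (a z) (B z) (u z)).
Proof.
move=> ma mB mu; rewrite /Ea; apply: mfD.
  apply: mfD; (apply: mfM; last exact: mf_cst).
    by exact: (mf_pt cftt ma mB mu).
  by exact: (mf_pt cf1t ma mB mu).
apply: mfM; first by exact: (mf_pt cf2t ma mB mu).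
apply: mfM => //; apply: mfM; first by apply: mfN; apply: mfM => //; exact: mfX.
by apply: mfV; apply: mfM; [exact: mf_cst|exact: mf_r].
Qed.

Let mf_EB d (T : measurableType d) (a B u : T -> R) :
  mfun a -> mfun B -> mfun u -> mfun (fun z => EB (a z) (B z) (u z)).
Proof.
move=> ma mB mu.
have mrB : mfun (fun z => rB (a z) (B z) * u z).
  apply: mfM => //; apply: mfM; first by apply: mf_kA => //; exact: mf_cst.
  by apply: mfV; apply: mfM; [exact: mf_cst|exact: mf_r].
rewrite /EB; apply: mfD; first by apply: mfM => //; exact: (mf_pt cfx ma mB mu).
apply: mfM; first by apply: mfM => //; exact: mf_r.
apply: mfD; last by apply: mfM => //; exact: (mf_pt cfxx ma mB mu).
apply: mfD; (apply: mfM; last exact: mf_cst).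
  by exact: (mf_pt cftx ma mB mu).
by exact: (mf_pt cf1x ma mB mu).
Qed.

Let intg_gA : intg leb (fun a => gA a * oo L y1 a).
Proof.
have L0 : 0 < y1 - L by rewrite subr_gt0.
have a0 : (-1 : R) != 0 by rewrite oppr_eq0 oner_eq0.
have i1 := intg_affine y1 a0 (intg_invsqrt L0).
apply: (intg_ext _ (intgD (intg_oo_const L y1 (2 * C)) (intgZl (C * (Lm * Num.sqrt H)) i1))) => a.
have -> : oo 0 (y1 - L) (-1 * a + y1) = oo L y1 a.
  rewrite /oo; have -> : (0 < -1 * a + y1 < y1 - L) = (L < a < y1) by apply/idP/idP => /andP[h h']; apply/andP; split; lra.
  by [].
have -> : -1 * a + y1 = y1 - a by ring.
by rewrite /gA; ring.
Qed.

Let intg_gB a : intg leb (fun B => gB a B * oo 0 H B).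
Proof.
apply: (intg_ext _ (intgD (intgZl (C * (Num.sqrt (kA a y1) / 2)) (intg_invsqrt H_gt0))
  (intg_oo_const 0 H (Num.sqrt (kA a y1 * H) * C + C * kA a y1)))) => B.
by rewrite /gB; ring.
Qed.

Let dom u (E g l h x : R) : (-1 < u < 1 -> l < x < h -> `|E| <= g) ->
  `|warc u * (E * oo l h x)| <= g * oo l h x * warc u.
Proof.
move=> k; rewrite normrM (ger0_norm (warc_ge0 u)) normrM normr_oo mulrC.
have [hu|/warc_out ->] := boolP (-1 < u < 1); last by rewrite !mulr0.
apply: ler_wpM2r; first exact: warc_ge0.
by rewrite /oo; case: (boolP (l < x < h)) => hx; rewrite ?mulr0// !mulr1; exact: k.
Qed.

Let EBw a (z : plane R) : R := warc z.2 * (EB a z.1 z.2 * oo 0 H z.1).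

Let mf_EBw a : mfun (EBw a).
Proof.
apply: mfM; first by apply: mf_warc; exact: measurable_snd.
apply: mfM; first by apply: mf_EB; [exact: mf_cst|exact: measurable_fst|exact: measurable_snd].
by apply: mf_oo; [exact: mf_cst|exact: mf_cst|exact: measurable_fst].
Qed.

Let intg_EBw a : a < y1 -> intg (leb2 R) (EBw a).
Proof.
move=> h; have ip : intg (leb2 R) (fun z => gB a z.1 * oo 0 H z.1 * warc z.2) by exact: intg_prod (intg_gB a) (@intg_warc R).
apply: (intg_le (mf_EBw a) ip) => -[B u]; apply: dom => hu hB; exact: bound_EB.
Qed.

Let int_EBw a : a < y1 -> \int[leb]_B \int[leb]_u EBw a (B, u) = 0.
Proof.
move=> h; have [_ e] := Rfubini2 (intg_EBw h).
apply: (etrans (esym e)); apply: (etrans (Rint_ext leb _) (Rint0 leb)) => u.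
have [hu|/warc_out w0] := boolP (-1 < u < 1); last first.
  by apply: (etrans (Rint_ext leb _) (Rint0 leb)) => B; rewrite /EBw w0 mul0r.
have ii : intg leb (fun B => EB a B u * oo 0 H B).
  apply: (intg_le _ (intg_gB a)).
    by apply: mfM; [apply: mf_EB; [exact: mf_cst|exact: mf_id|exact: mf_cst]|exact: measurable_oo].
  move=> B; rewrite normrM normr_oo /oo; case: (boolP (0 < B < H)) => hB; rewrite ?mulr0// !mulr1.
  exact: bound_EB.
by rewrite /EBw /= (RintZl _ ii) (FB h ii) mulr0.
Qed.

Let KA (z : spacetime R) : R := warc z.2.2 * ((Ea z.1 z.2.1 z.2.2 * oo L y1 z.1) * oo 0 H z.2.1).

Let mf_KA d (T : measurableType d) (a B u : T -> R) : mfun a -> mfun B -> mfun u ->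
  mfun (fun z => KA (a z, (B z, u z))).
Proof.
move=> ma mB mu; apply: mfM; first exact: mf_warc.
apply: mfM; last by apply: mf_oo => //; exact: mf_cst.
by apply: mfM; [exact: mf_Ea|apply: mf_oo => //; exact: mf_cst].
Qed.

Let dom_KA a B u : `|KA (a, (B, u))| <= gA a * oo L y1 a * (oo 0 H B * warc u).
Proof.
rewrite mulrA; apply: dom => hu hB; rewrite normrM normr_oo /oo.
by case: (boolP (L < a < y1)) => ha; rewrite ?mulr0// !mulr1; exact: bound_Ea.
Qed.

Let intg_bu : intg (leb2 R) (fun q : plane R => oo 0 H q.1 * warc q.2).
Proof. exact: intg_prod (intg_oo1 0 H) (@intg_warc R). Qed.

Let intg_KA1 a : intg (leb2 R) (fun q => KA (a, q)).
Proof.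
apply: (intg_le _ (intgZl (gA a * oo L y1 a) intg_bu)); last by move=> [B u]; exact: dom_KA.
have := @mf_KA _ (plane R) (fun=> a) fst snd (mf_cst _) measurable_fst measurable_snd.
by rewrite (_ : (fun z => _) = (fun q => KA (a, q)))//; apply/funext => -[].
Qed.

Let intg_KA : intg (leb \x leb2 R)%E KA.
Proof.
have ip : intg (leb \x leb2 R)%E (fun z => gA z.1 * oo L y1 z.1 * (oo 0 H z.2.1 * warc z.2.2)).
  exact: (intg_prod intg_gA intg_bu).
apply: (intg_le _ ip); last by move=> [a [B u]]; exact: dom_KA.
have := @mf_KA _ (spacetime R) (fun z => z.1) (fun z => z.2.1) (fun z => z.2.2) measurable_fst
  (mf_fst measurable_snd) (mf_snd measurable_snd).
by rewrite (_ : (fun z => _) = KA)//; apply/funext => -[? []].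
Qed.

(** The integration in a comes first and gives [FA]; then the weight contributes pi, and [FT]
    contributes -2 phi. *)
Let int_KA : \int[leb]_a \int[leb2 R]_q KA (a, q) = - 2 * pi * phi (0, (y1, 0)).
Proof.
have [i2 e] := Rfubini2 intg_KA; apply: (etrans (esym e)).
have eq1 q : \int[leb]_a KA (a, q) = (ft (pt y1 q.1 0) * oo 0 H q.1) * warc q.2.
  case: q => B u /=; have [hu|/warc_out w0] := boolP (-1 < u < 1); last first.
    by rewrite w0 mulr0; apply: (etrans (Rint_ext leb _) (Rint0 leb)) => a; rewrite /KA /= w0 mul0r.
  have [hB|hB] := boolP (0 < B < H); last first.
    rewrite [oo 0 H B]/oo (negbTE hB) mulr0 mul0r; apply: (etrans (Rint_ext leb _) (Rint0 leb)) => a.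
    by rewrite /KA /= [oo 0 H B]/oo (negbTE hB) !mulr0.
  have ii : intg leb (fun a => Ea a B u * oo L y1 a).
    apply: (intg_le _ intg_gA).
      by apply: mfM; [apply: mf_Ea; [exact: mf_id|exact: mf_cst|exact: mf_cst]|exact: measurable_oo].
    move=> a; rewrite normrM normr_oo /oo; case: (boolP (L < a < y1)) => ha; rewrite ?mulr0// !mulr1.
    exact: bound_Ea.
  have B0 : 0 < B by case/andP: hB.
  apply: (etrans (Rint_ext leb (g := fun a => (warc u * oo 0 H B) * (Ea a B u * oo L y1 a)) _)).
    by move=> a; rewrite /KA /=; ring.
  by rewrite (RintZl _ ii) (FA B0 ii); ring.
rewrite (Rint_ext _ eq1).
have ip : intg (leb2 R) (fun q => ft (pt y1 q.1 0) * oo 0 H q.1 * warc q.2) by exact: intg_prod intg_ft (@intg_warc R).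
rewrite (Rint_leb2 ip).
have eq2 B : \int[leb]_u (ft (pt y1 B 0) * oo 0 H B * warc u) = pi * (ft (pt y1 B 0) * oo 0 H B).
  by rewrite (RintZl _ (@intg_warc R)) Rint_warc mulrC.
apply: (etrans (Rint_ext leb eq2)); rewrite (RintZl _ intg_ft) FT; ring.
Qed.

Let h (p : spacetime R) : R := wave_op phi p.

Let hE p : h p = ftt p - 2 * f1t p - p.2.1 ^+ 2 * fxx p.
Proof. exact: wave_opE. Qed.

Let h_out p : ~ inbox p -> h p = 0.
Proof. by move=> k; rewrite hE (s_ftt k) (s_f1t k) (s_fxx k) !mulr0 !subr0. Qed.

Let CK : R := C + 2 * C + N ^+ 2 * C.

Let CK0 : 0 <= CK.
Proof. by apply: addr_ge0; [apply: addr_ge0 => //; exact: mulr_ge0|apply: mulr_ge0 => //; exact: sqr_ge0]. Qed.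

Let h_le p : `|h p| <= CK.
Proof.
have [ib|/h_out ->] := pselect (inbox p); last by rewrite normr0.
have [_ k2 _] := ib.
have E (x y z w : R) : x - 2 * y - w * z = x + (- 2) * y + (- w) * z by ring.
rewrite hE E.
have n2 : `|- (2 : R)| <= 2 by rewrite normrN ger0_norm.
have n3 : `|- p.2.1 ^+ 2| <= N ^+ 2.
  by rewrite normrN normrX; apply: lerXn2r => //; rewrite nnegrE.
exact: (tri (b_ftt p) (nM n2 (b_f1t p)) (nM n3 (b_fxx p))).
Qed.

Let mf_h d (T : measurableType d) (x y z : T -> R) :
  mfun x -> mfun y -> mfun z -> mfun (fun w => h (x w, (y w, z w))).
Proof.
move=> mx my mz.
have m0 : mfun (fun w => ftt (x w, (y w, z w)) - 2 * f1t (x w, (y w, z w)) - y w ^+ 2 * fxx (x w, (y w, z w))).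
  apply: mfD; first apply: mfD.
  - exact: (mf_test cftt mx my mz).
  - by apply: mfN; apply: mfM; [exact: mf_cst|exact: (mf_test cf1t mx my mz)].
  - by apply: mfN; apply: mfM; [exact: mfX|exact: (mf_test cfxx mx my mz)].
have e : (fun w => h (x w, (y w, z w))) =
    (fun w => ftt (x w, (y w, z w)) - 2 * f1t (x w, (y w, z w)) - y w ^+ 2 * fxx (x w, (y w, z w))).
  by apply/funext => w; exact: hE.
exact: (eq_ind_r (@mfun _ T R) m0 e).
Qed.

Let Wf a B : R := \int[leb]_u (warc u * h (pt a B (r a B * u))).

(** [wave_split] integrated against the weight; its last term drops out by [cancel_u]. *)
Let wave_u a B : L < a < y1 -> 0 < B < H ->
  Wf a B = - 2 * \int[leb]_u (warc u * Ea a B u) + - (2 * a ^+ 2 / kA a y1) * \int[leb]_u (warc u * EB a B u).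
Proof.
move=> ha hB; have [a2 B1] : a < y1 /\ 0 < B by split; [case/andP: ha|case/andP: hB].
have iA : intg leb (fun u => warc u * Ea a B u).
  apply: intg_warc_bdd; last by exists (gA a) => u; exact: bound_Ea.
  by apply: mf_Ea; [exact: mf_cst|exact: mf_cst|exact: mf_id].
have iB : intg leb (fun u => warc u * EB a B u).
  apply: intg_warc_bdd; last by exists (gB a B) => u; exact: bound_EB.
  by apply: mf_EB; [exact: mf_cst|exact: mf_cst|exact: mf_id].
have [iC eC] := cancel_u a2 B1.
have E0 (w x y z c d : R) : w * (- 2 * x - c * y - d * z) = - 2 * (w * x) + (- c * (w * y) + - d * (w * z)) by ring.
set c := 2 * a ^+ 2 / kA a y1.
pose k (u : R) : R := warc u * ((1 - u ^+ 2) * fxx (pt a B (r a B * u)) - u / r a B * fx (pt a B (r a B * u))).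
have iK : intg leb k by exact: iC.
have eK : \int[leb]_u k u = 0 by exact: eC.
have e u : warc u * h (pt a B (r a B * u)) = - 2 * (warc u * Ea a B u) + (- c * (warc u * EB a B u) + - a ^+ 2 * k u).
  by rewrite /h (wave_split u a2 B1); exact: E0.
apply: (etrans (RintZD measurableT iA (intgD (intgZl (- c) iB) (intgZl (- a ^+ 2) iK)) e)).
have e2 u : - c * (warc u * EB a B u) + - a ^+ 2 * k u = - c * (warc u * EB a B u) + (- a ^+ 2 * k u) by [].
have e3 := RintZD measurableT iB (intgZl (- a ^+ 2) iK) e2.
by rewrite (RintZl _ iK) eK mulr0 addr0 in e3; rewrite e3.
Qed.

(** The coefficient 2 a^2 / A depends on neither B nor u, so the [EB] term integrates to 0 in B at
    fixed a. *)
Let wave_a a : intg leb (fun B => oo L y1 a * (oo 0 H B * Wf a B)) /\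
  \int[leb]_B (oo L y1 a * (oo 0 H B * Wf a B)) = - 2 * \int[leb2 R]_q KA (a, q).
Proof.
have [ha|ha] := boolP (L < a < y1); last first.
  have e B : oo L y1 a * (oo 0 H B * Wf a B) = 0 by rewrite [oo L y1 a]/oo (negbTE ha) mul0r.
  split; first by apply: (intg_ext _ (intg0 leb)) => B; rewrite e.
  rewrite (Rint_ext leb e) Rint0 (_ : \int[leb2 R]_q KA (a, q) = 0) ?mulr0//.
  by apply: (etrans (Rint_ext _ _) (Rint0 (leb2 R))) => q; rewrite /KA /= [oo L y1 a]/oo (negbTE ha) mulr0 mul0r mulr0.
have a2 : a < y1 by case/andP: ha.
have oa : oo L y1 a = 1 by rewrite /oo ha.
have [i1 _] := Rfubini1 (intg_KA1 a); have [i2 _] := Rfubini1 (intg_EBw a2).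
have e B : oo L y1 a * (oo 0 H B * Wf a B) =
    - 2 * \int[leb]_u KA (a, (B, u)) + - (2 * a ^+ 2 / kA a y1) * \int[leb]_u EBw a (B, u).
  rewrite oa mul1r; have [hB|hB] := boolP (0 < B < H).
    have oB : oo 0 H B = 1 by rewrite /oo hB.
    rewrite oB mul1r (wave_u ha hB); congr (_ * _ + _ * _); apply: Rint_ext => u.
      by rewrite /KA /= oa oB !mulr1.
    by rewrite /EBw /= oB mulr1.
  have oB : oo 0 H B = 0 by rewrite /oo (negbTE hB).
  have e1 : \int[leb]_u KA (a, (B, u)) = 0.
    by apply: (etrans (Rint_ext _ _) (Rint0 leb)) => u; rewrite /KA /= oB !mulr0.
  have e2 : \int[leb]_u EBw a (B, u) = 0.
    by apply: (etrans (Rint_ext _ _) (Rint0 leb)) => u; rewrite /EBw /= oB !mulr0.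
  by rewrite oB e1 e2 mul0r !mulr0 addr0.
split.
  apply: (intg_ext _ (intgD (intgZl (- 2) i1) (intgZl (- (2 * a ^+ 2 / kA a y1)) i2))) => B.
  exact: esym (e B).
rewrite (RintZD measurableT i1 (intgZl (- (2 * a ^+ 2 / kA a y1)) i2) e).
by rewrite (RintZl _ i2) (int_EBw a2) mulr0 addr0 (Rint_leb2 (intg_KA1 a)).
Qed.

Let S (t a : R) : R := \int[leb]_x (Gamma_explicit t a y1 x * h (t, (a, x))).

(** The support of the kernel is a < y1, B > 0; the further cutoffs at L and H can be inserted
    because phi vanishes beyond them. *)
Let S_eq a B : S (2^-1 * B + (y1 - a) / 2) a = (2 * pi)^-1 * (oo L y1 a * (oo 0 H B * Wf a B)).
Proof.
have -> : 2^-1 * B + (y1 - a) / 2 = (B + y1 - a) / 2 by ring.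
set t := (B + y1 - a) / 2; pose k (x : R) := h (t, (a, x)).
have mk : measurable_fun [set: measurableTypeR R] k.
  by apply: mf_h; [exact: mf_cst|exact: mf_cst|exact: mf_id].
have bk : exists c, forall x, `|k x| <= c by exists CK => x; exact: h_le.
have [_ e] := Gamma_slice y1 t a mk bk.
rewrite /S; apply: (etrans e); congr (_ * _).
have tE : a + 2 * t = B + y1 by rewrite /t; field.
have rE : kr t a y1 = r a B by rewrite /kr /r /kB (_ : 2 * t + a - y1 = B)//; rewrite /t; field.
rewrite rE; have -> : \int[leb]_u (warc u * k (r a B * u)) = Wf a B by [].
have -> : oo a (a + 2 * t) y1 = ((a < y1) && (0 < B))%:R by rewrite /oo tE ltrDr.
have W1 : a <= L -> Wf a B = 0.
  by move=> k1; apply: (etrans (Rint_ext _ _) (Rint0 leb)) => u; rewrite h_out ?mulr0//; exact: out_a.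
have W2 : H <= B -> Wf a B = 0.
  by move=> k1; apply: (etrans (Rint_ext _ _) (Rint0 leb)) => u; rewrite h_out ?mulr0//; exact: out_B.
rewrite /oo; case: (leP a L) => [/W1 ->|_]; first by rewrite !mulr0.
case: (ltP B H) => [_|/W2 ->]; last by rewrite !mulr0.
by rewrite andbT; case: (a < y1); case: (0 < B); rewrite /= ?mul1r ?mul0r.
Qed.

Lemma wave_op_Gamma :
  \int[leb3 R]_p (Gamma_explicit p.1 p.2.1 y1 p.2.2 * wave_op phi p) = phi (0, (y1, 0)).
Proof.
have k_le t a x : `|h (t, (a, x))| <= CK * oo (- (N + 1)) (N + 1) t * oo (- (N + 1)) (N + 1) a.
  have [[/= k1 k2 _]|/h_out ->] := pselect (inbox (t, (a, x))); last first.
    by rewrite normr0; apply: mulr_ge0; [apply: mulr_ge0 => //|]; exact: oo_ge0.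
  have o1 (s : R) : `|s| <= N -> oo (- (N + 1)) (N + 1) s = 1.
    move=> k; have k' : - (N + 1) < s < N + 1 by rewrite -ltr_norml; apply: (le_lt_trans k); rewrite ltrDl.
    by rewrite /oo k'.
  by rewrite (o1 t k1) (o1 a k2) !mulr1; exact: h_le.
have mh : mfun h.
  have m0 := @mf_h _ (spacetime R) (fun z => z.1) (fun z => z.2.1) (fun z => z.2.2) measurable_fst
    (mf_fst measurable_snd) (mf_snd measurable_snd).
  have e0 (z : spacetime R) : z = (z.1, (z.2.1, z.2.2)) by case: z => t [a x].
  have e (z : spacetime R) : h z = h (z.1, (z.2.1, z.2.2)) := congr1 h (e0 z).
  exact: (eq_ind_r (@mfun _ (spacetime R) R) m0 (funext e)).
have [e iS] := @Gamma_weight_fubini R y1 h CK (N + 1) mh CK0 k_le.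
apply: (etrans e).
have p2 : (2^-1 : R) != 0 by rewrite invr_eq0.
(* The factor 1/2 is the Jacobian of t in terms of B; with (2 pi)^-1, the factor -2 and the value -2
   pi phi of [int_KA] the product is exactly phi. *)
have eS a : \int[leb]_t S t a = (2^-1 * ((2 * pi)^-1 * - 2)) * \int[leb2 R]_q KA (a, q).
  apply: (etrans (Rint_affine ((y1 - a) / 2) p2 (iS a))).
  have -> : `|2^-1 : R| = 2^-1 by rewrite ger0_norm.
  have [i1 e1] := wave_a a; rewrite -!mulrA -e1 -(RintZl _ i1); congr (_ * _).
  by apply: Rint_ext => B; exact: S_eq.
apply: (etrans (Rint_ext leb eS)); rewrite (RintZl _ (Rfubini1 intg_KA).1) int_KA.
have p0 : (pi : R) != 0 by rewrite gt_eqF// pi_gt0.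
have E (q w : R) : q != 0 -> 2^-1 * ((2 * q)^-1 * - 2) * (- 2 * q * w) = w by move=> q0; field.
exact: E.
Qed.

End FundamentalSolution.

(** * The fundamental solution for every parameter y1 *)

Section Assembly.
Variable R : realType.

Lemma le_integral_subset d (T : measurableType d) (m : {measure set T -> \bar R}) (D : set T) (f g : T -> \bar R) :
  (forall x, 0 <= f x)%E -> (forall x, 0 <= g x)%E -> (forall x, D x -> f x <= g x)%E ->
  (\int[m]_(x in D) f x <= \int[m]_x g x)%E.
Proof.
move=> f0 g0 fg; rewrite ge0_integralE// ge0_integralTE//; apply: ereal_sup_le => _ [s /= hs <-].
exists s => //= x; apply: (le_trans (hs x)); rewrite /patch; case: ifPn => // /set_mem; exact: fg.
Qed.

Lemma compact_coords (K : set (spacetime R)) : compact K ->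
  exists2 M : R, 0 <= M & forall p, K p -> [/\ `|p.1| <= M, `|p.2.1| <= M & `|p.2.2| <= M].
Proof.
move=> /compact_bounded[M1 [_ hM]]; exists (Num.max M1 0 + 1).
  by rewrite addr_ge0// le_max lexx orbT.
move=> p Kp; apply: norm_spacetime; apply: (hM (Num.max M1 0 + 1)) => //.
by rewrite (@le_lt_trans _ _ (Num.max M1 0))// ?le_max ?lexx// ltrDl.
Qed.

Lemma fundamental_Gamma : fundamental_solution (@Gamma_explicit R).
Proof.
move=> y1; split.
- by move=> p p0; rewrite /Gamma_explicit ltNge p0.
- move=> K /compact_coords[M M0 hM].
  pose k (z : spacetime R) : R := oo (- (M + 1)) (M + 1) z.1 * oo (- (M + 1)) (M + 1) z.2.1.
  have mk : mfun k.
    apply: mfM; apply: mf_oo; try exact: mf_cst; first exact: measurable_fst.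
    exact: (mf_fst measurable_snd).
  have k_le t a x : `|k (t, (a, x))| <= 1 * oo (- (M + 1)) (M + 1) t * oo (- (M + 1)) (M + 1) a.
    by rewrite /k /= mul1r normrM !normr_oo.
  have i := @intg_Gamma_weight R y1 k 1 (M + 1) mk ler01 k_le.
  have mG : mfun (fun z : spacetime R => Gamma_explicit z.1 z.2.1 y1 z.2.2).
    apply: mf_Gamma; [exact: measurable_fst|exact: (mf_fst measurable_snd)|exact: mf_cst|].
    exact: (mf_snd measurable_snd).
  apply/integrableP; split; first by apply: measurable_funTS; exact/measurable_EFinP.
  apply: le_lt_trans (intg_lty i); apply: le_integral_subset => //= z Kz.
  have [k1 k2 _] := hM z Kz.
  have o1 (s : R) : `|s| <= M -> oo (- (M + 1)) (M + 1) s = 1.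
    move=> l; have l' : - (M + 1) < s < M + 1 by rewrite -ltr_norml; apply: (le_lt_trans l); rewrite ltrDl.
    by rewrite /oo l'.
  by rewrite /k (o1 _ k1) (o1 _ k2) !mulr1.
- move=> phi tphi.
  have [|C [N [C0 N0 bd sp]]] := @test_bound R [:: 'D_((0, (0, 1)) : spacetime R) phi;
    'D_((1, (0, 0)) : spacetime R) phi;
    'D_((1, (0, 0)) : spacetime R) ('D_((1, (0, 0)) : spacetime R) phi);
    'D_((0, (1, 0)) : spacetime R) ('D_((1, (0, 0)) : spacetime R) phi);
    'D_((0, (0, 1)) : spacetime R) ('D_((1, (0, 0)) : spacetime R) phi);
    'D_((1, (0, 0)) : spacetime R) ('D_((0, (0, 1)) : spacetime R) phi);
    'D_((0, (0, 1)) : spacetime R) ('D_((0, (0, 1)) : spacetime R) phi); phi].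
    move=> g /= hg.
    by repeat (case: hg => [<-|hg]; first by repeat (first [assumption | apply: test_derive])).
  exact: (wave_op_Gamma y1 tphi C0 N0 bd sp).
Qed.

End Assembly.

(** * Packing the spectral measure and the existence theorem *)

Section SigmaFinitePacking.
Context d (T : measurableType d) (R : realType).
Variables (mu : {measure set T -> \bar R}) (sf : sigma_finite setT mu).

(** A copy of mu indexed by the proof of sigma-finiteness, to which the corresponding structure can
    be attached. *)
Definition sf_measure (_ : sigma_finite setT mu) : set T -> \bar R := mu.

HB.instance Definition _ := Measure.on (sf_measure sf).
HB.instance Definition _ := Measure_isSigmaFinite.Build _ _ _ (sf_measure sf) sf.

End SigmaFinitePacking.

Theorem theorem1p1 (R : realType) (d : measure_display)
    (Omega : measurableType d) (P : probability Omega R)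
    (P_complete : measure_is_complete P)
    (f : plane R -> R)
    (f_cont : forall x : plane R, x != 0 -> {for x, continuous f})
    (f_even : forall x : plane R, f (- x) = f x)
    (F : (spacetime R -> R) -> {RV P >-> R})
    (F_noise : noise f F)
    (mu : {measure set (plane R) -> \bar R})
    (mu_spectral : spectral_measure f mu)
    (FA : set (spacetime R) -> {RV P >-> R})
    (FA_ext : indicator_extension mu F FA)
    (T : R) (T_gt0 : 0 < T)
    (mu_int : (\int[mu]_xi (1 / (1 + enorm xi `^ (2 / 3)))%:E < +oo)%E) :
  exists u : R -> plane R -> Omega -> R,
    random_field_solution mu (martingale_measure FA) T Gamma_explicit u.
Proof.
have sf : sigma_finite setT mu by exact: tempered_sigma_finite mu_spectral.1.
(* [mu'] unfolds to mu, so hypotheses and conclusions pass from one to the other by conversion. *)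
pose mu' : {sigma_finite_measure set (plane R) -> \bar R} := sf_measure sf.
exists (fun t x w => process mu' FA ((t, x), w)); split.
- exact: fundamental_Gamma.
- move=> t x /andP[t0 _]; rewrite shifted_kernelE; split.
    exact: (@well_defined_kernel _ mu' mu_int t x).
  exact: (@process_integral _ _ _ _ f mu' mu_spectral mu_int F F_noise FA FA_ext t x t0).
- rewrite (_ : (fun q => _) = process mu' FA); last by apply/funext => -[[]].
  by apply: measurable_funTS; exact: mf_process.
Qed.
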